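(* Let $X\subset\mathbb{R}^d$ be a complementary regular set and $f:\mathbb{R}^d\to\mathbb{R}$ a $C^2$ function. Let $c\in\mathbb{R}$ and assume $f_{|X}$ has exactly one critical point $x$ in $f^{-1}(c)$, and that $x$ is non-degenerate. Then for every $\varepsilon>0$ small enough, $X_{c+\varepsilon}$ has the homotopy type of $X_{c-\varepsilon}$ with a $\lambda_x$-cell attached, where $\lambda_x$ is the index of the Hessian $H_xf_{|X}$ plus the number of infinite principal curvatures at $(x,n)$, $n=-\nabla f(x)/\|\nabla f(x)\|$, i.e. $\lambda_x=\operatorname{ind}(H_xf_{|X})+(d-1-\dim\pi_0(\operatorname{Tan}(\operatorname{Nor}(X),(x,n))))$.
   Context: $X_t:=X\cap f^{-1}(-\infty,t]$. Notation: $d_A(x)=\inf_{a\in A}\|x-a\|$; Clarke gradient $\partial\phi(x)$ of a locally Lipschitz $\phi$: convex hull of limits $\lim_i\nabla\phi(x_i)$, $x_i\to x$, $\phi$ differentiable at $x_i$; $\Delta(B)=\inf_{b\in B}\|b\|$. Complement set $\mathcal{C}A:=\overline{\mathbb{R}^d\setminus A}$; $\partial A=\overline A\setminus\operatorname{int}A$. Reach of closed $A$: supremum of $t\ge0$ such that every $x$ with $d_A(x)<t$ has a unique nearest point in $A$. For $\mu\in(0,1]$, $\operatorname{reach}_\mu(A)=\sup\{s:\Delta(\partial d_A(x))\ge\mu\text{ for all }x\text{ with }0<d_A(x)\le s\}$. A compact $X$ is complementary regular if $\overline{\operatorname{int}X}=X$, $\operatorname{reach}_\mu(X)>0$ for some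 $\mu\in(0,1]$, and $\operatorname{reach}(\mathcal{C}X)>0$. Tangent cone $\operatorname{Tan}(A,x)$: cone generated by limits of $(x_n-x)/\|x_n-x\|$, $x_n\in A\setminus\{x\}$, $x_n\to x$; polar cone $B^\circ=\{u:\langle u,b\rangle\le0\ \forall b\in B\}$; for closed $A$ of positive reach, $\operatorname{Nor}(A,x)=\operatorname{Tan}(A,x)^\circ$. For complementary regular $X$: $\operatorname{Nor}(X,x):=-\operatorname{Nor}(\mathcal{C}X,x)$ for $x\in\partial X$, $\{0\}$ for interior $x$; $\operatorname{Nor}(X)=\bigcup_{x\in\partial X}\{x\}\times(\operatorname{Nor}(X,x)\cap\mathbb{S}^{d-1})$. $(x,n)\in\operatorname{Nor}(X)$ is regular if $\operatorname{Tan}(\operatorname{Nor}(X),(x,n))$ is a $(d-1)$-dimensional linear subspace; there are then principal curvatures $\kappa_i\in\mathbb{R}\cup\{\infty\}$ and orthonormal $b_i\perp n$ with $(b_i,\kappa_ib_i)/\sqrt{1+\kappa_i^2}$ (read $(0,b_i)$ if $\kappa_i=\infty$) an orthonormal basis; $\pi_0(u,v)=u$; the number of infinite $\kappa_i$ is $d-1-\dim\pi_0(\operatorname{Tan}(\operatorname{Nor}(X),(x,n)))$. $\mathrm{II}_{x,n}(u,u')=\langle u,v'\rangle$ for $(u,v),(u',v')$ in that tangent space. $x\in X$ is a critical point of $f_{|X}$ if $\nabla f(x)\in-\operatorname{Nor}(X,x)$. If $\nabla f(x)\ne0$ and $(x,n)$ regular: $H_xf_{|X}(u,u')=H_xf(u,u')+\|\nabla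 f(x)\|\mathrm{II}_{x,n}(u,u')$ on $\pi_0(\operatorname{Tan}(\operatorname{Nor}(X),(x,n)))$; non-degenerate means $\nabla f(x)\ne0$, $(x,n)$ regular, $H_xf_{|X}$ non-degenerate; $\operatorname{ind}$ is the maximal dimension of a negative definite subspace. *)

(* Defs.v *)
(* Points of R^d are row vectors 'rV[R]_d
   (with their canonical product/normed topology, i.e. the Euclidean topology),
   R : realType.  The Euclidean inner product and norm are defined explicitly. *)
From HB Require Import structures.
From mathcomp Require Import all_boot all_order all_algebra.
From mathcomp Require Import all_classical all_reals all_analysis.
From mathcomp Require Import generic_quotient.
Import numFieldNormedType.Exports.
Set Implicit Arguments.
Unset Strict Implicit.
Unset Printing Implicit Defensive.
Import Order.TTheory GRing.Theory Num.Theory.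
Local Open Scope ring_scope.
Local Open Scope classical_set_scope.

Section Euclid.
Variable R : realType.

Definition dotp (m : nat) (u v : 'rV[R]_m) : R := \sum_(i < m) u 0 i * v 0 i.
Definition enorm (m : nat) (u : 'rV[R]_m) : R := Num.sqrt (dotp u u).

Definition dist_set (m : nat) (A : set 'rV[R]_m) (x : 'rV[R]_m) : R :=
  inf [set enorm (x - a) | a in A].

Definition reach (m : nat) (A : set 'rV[R]_m) : \bar R :=
  ereal_sup [set t%:E | t in [set t : R | 0 <= t /\
     forall x, dist_set A x < t ->
       exists! a, A a /\ enorm (x - a) = dist_set A x]].

Definition evec (m : nat) (i : 'I_m) : 'rV[R]_m := delta_mx 0 i.

Definition pderiv (m : nat) (i : 'I_m) (g : 'rV[R]_m -> R) : 'rV[R]_m -> R :=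
  fun x => 'D_(evec i) g x.
Definition grad (m : nat) (g : 'rV[R]_m -> R) (x : 'rV[R]_m) : 'rV[R]_m :=
  \row_i pderiv i g x.

Definition C1 (m : nat) (g : 'rV[R]_m -> R) : Prop :=
  (forall i x, derivable g x (evec i)) /\ (forall i, continuous (pderiv i g)).
Definition C2 (m : nat) (g : 'rV[R]_m -> R) : Prop :=
  C1 g /\ forall i, C1 (pderiv i g).

Definition hessian (m : nat) (g : 'rV[R]_m -> R) (x u u' : 'rV[R]_m) : R :=
  \sum_(i < m) \sum_(j < m) u 0 i * u' 0 j * pderiv j (pderiv i g) x.

Definition clarke_limits (m : nat) (phi : 'rV[R]_m -> R) (x : 'rV[R]_m) :
  set 'rV[R]_m :=
  [set g | exists xs : nat -> 'rV[R]_m,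
     (forall n, differentiable phi (xs n)) /\
     xs @ \oo --> x /\ (fun n => grad phi (xs n)) @ \oo --> g].
Definition conv_hull (m : nat) (B : set 'rV[R]_m) : set 'rV[R]_m :=
  [set y | exists (k : nat) (w : 'I_k -> R) (p : 'I_k -> 'rV[R]_m),
     (forall i, 0 <= w i) /\ \sum_(i < k) w i = 1 /\
     (forall i, B (p i)) /\ y = \sum_(i < k) w i *: p i].
Definition clarke_grad (m : nat) (phi : 'rV[R]_m -> R) (x : 'rV[R]_m) :=
  conv_hull (clarke_limits phi x).

Definition Delta (m : nat) (B : set 'rV[R]_m) : R := inf [set enorm b | b in B].

Definition reach_mu (m : nat) (mu : R) (A : set 'rV[R]_m) : \bar R :=
  ereal_sup [set s%:E | s in [set s : R | forall x,
     0 < dist_set A x <= s -> mu <= Delta (clarke_grad (dist_set A) x)]].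

Definition compl_set (m : nat) (A : set 'rV[R]_m) := closure (~` A).
Definition bdry (m : nat) (A : set 'rV[R]_m) := closure A `\` interior A.

Definition complementary_regular (m : nat) (X : set 'rV[R]_m) : Prop :=
  compact X /\ closure (interior X) = X /\
  (exists mu : R, 0 < mu <= 1 /\ (0 < reach_mu mu X)%E) /\
  (0 < reach (compl_set X))%E.

Definition tan_dirs (m : nat) (A : set 'rV[R]_m) (x : 'rV[R]_m) : set 'rV[R]_m :=
  [set u | exists xs : nat -> 'rV[R]_m,
     (forall n, A (xs n) /\ xs n != x) /\ xs @ \oo --> x /\
     (fun n => (enorm (xs n - x))^-1 *: (xs n - x)) @ \oo --> u].
Definition Tan (m : nat) (A : set 'rV[R]_m) (x : 'rV[R]_m) : set 'rV[R]_m :=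
  [set 0] `|` [set v | exists t u, 0 <= t /\ tan_dirs A x u /\ v = t *: u].

Definition polar (m : nat) (B : set 'rV[R]_m) : set 'rV[R]_m :=
  [set u | forall b, B b -> dotp u b <= 0].

(* Nor(A, x) = Tan(A, x)° (for A of positive reach) *)
Definition Nor_pr (m : nat) (A : set 'rV[R]_m) (x : 'rV[R]_m) := polar (Tan A x).

Definition NorX (m : nat) (X : set 'rV[R]_m) (x : 'rV[R]_m) : set 'rV[R]_m :=
  if `[< bdry X x >] then [set - v | v in Nor_pr (compl_set X) x]
  else [set 0].

Definition NorBundle (m : nat) (X : set 'rV[R]_m) : set 'rV[R]_(m + m) :=
  [set w | exists x n, bdry X x /\ NorX X x n /\ enorm n = 1 /\ w = row_mx x n].

Definition pi0 (m : nat) (w : 'rV[R]_(m + m)) : 'rV[R]_m := lsubmx w.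

Definition subspace_dim (n : nat) (S : set 'rV[R]_n) (k : nat) : Prop :=
  exists B : 'M[R]_(k, n), row_free B /\ S = [set v | (v <= B)%MS].

Definition regular_pt (m : nat) (X : set 'rV[R]_m) (x n : 'rV[R]_m) : Prop :=
  NorBundle X (row_mx x n) /\
  subspace_dim (Tan (NorBundle X) (row_mx x n)) m.-1.

Definition TanNor (m : nat) (X : set 'rV[R]_m) (x n : 'rV[R]_m) :=
  Tan (NorBundle X) (row_mx x n).

Definition second_ff (m : nat) (X : set 'rV[R]_m) (x n u u' : 'rV[R]_m) : R :=
  dotp u (rsubmx (xget 0 [set w | TanNor X x n w /\ @pi0 m w = u'])).

Definition unit_normal (m : nat) (f : 'rV[R]_m -> R) (x : 'rV[R]_m) :=
  - ((enorm (grad f x))^-1 *: grad f x).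

Definition restr_hessian (m : nat) (X : set 'rV[R]_m) (f : 'rV[R]_m -> R)
  (x u u' : 'rV[R]_m) : R :=
  hessian f x u u' + enorm (grad f x) * second_ff X x (unit_normal f x) u u'.

Definition restr_dom (m : nat) (X : set 'rV[R]_m) (f : 'rV[R]_m -> R)
  (x : 'rV[R]_m) : set 'rV[R]_m :=
  @pi0 m @` TanNor X x (unit_normal f x).

Definition critical (m : nat) (X : set 'rV[R]_m) (f : 'rV[R]_m -> R)
  (x : 'rV[R]_m) : Prop :=
  X x /\ [set - v | v in NorX X x] (grad f x).

Definition nondeg_form (m : nat) (Q : 'rV[R]_m -> 'rV[R]_m -> R)
  (V : set 'rV[R]_m) : Prop :=
  forall u, V u -> (forall u', V u' -> Q u u' = 0) -> u = 0.

Definition nondegenerate_cp (m : nat) (X : set 'rV[R]_m) (f : 'rV[R]_m -> R)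
  (x : 'rV[R]_m) : Prop :=
  grad f x != 0 /\ regular_pt X x (unit_normal f x) /\
  nondeg_form (restr_hessian X f x) (restr_dom X f x).

Definition has_negdef_subspace (m : nat) (Q : 'rV[R]_m -> 'rV[R]_m -> R)
  (V : set 'rV[R]_m) (j : nat) : Prop :=
  exists W : set 'rV[R]_m, subspace_dim W j /\ W `<=` V /\
    forall u, W u -> u != 0 -> Q u u < 0.

Definition is_index (m : nat) (Q : 'rV[R]_m -> 'rV[R]_m -> R)
  (V : set 'rV[R]_m) (k : nat) : Prop :=
  has_negdef_subspace Q V k /\ forall j, has_negdef_subspace Q V j -> (j <= k)%N.

Definition sublevel (m : nat) (X : set 'rV[R]_m) (f : 'rV[R]_m -> R) (t : R) :=
  X `&` [set y | f y <= t].

Definition unit_interval : Type := set_type [set t : R | 0 <= t <= 1].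

Definition homotopic (Y Z : topologicalType) (g h : Y -> Z) : Prop :=
  exists H : (unit_interval * Y)%type -> Z, continuous H /\
    (forall t y, set_val t = 0 -> H (t, y) = g y) /\
    (forall t y, set_val t = 1 -> H (t, y) = h y).

Definition homotopy_equiv (Y Z : topologicalType) : Prop :=
  exists (g : Y -> Z) (h : Z -> Y), continuous g /\ continuous h /\
    homotopic (h \o g) id /\ homotopic (g \o h) id.

Definition disk (l : nat) : set 'rV[R]_l := [set y | enorm y <= 1].
Definition sphere (l : nat) : set 'rV[R]_l := [set y | enorm y = 1].

End Euclid.

Section Adjunction.
Variables (R : realType) (A : topologicalType) (l : nat).
Variable phi : set_type (@sphere R l) -> A.

Definition adj_pieces (b : bool) : topologicalType :=
  if b then A else (set_type (@disk R l) : topologicalType).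

Definition adj_sum : topologicalType := {b : bool & adj_pieces b}.

Definition adj_key (p : adj_sum) : option A :=
  match p with
  | existT true a => Some a
  | existT false y =>
      omap phi (insub (set_val (y : set_type (@disk R l))) : option (set_type (@sphere R l)))
  end.

Definition adj_rel (p q : adj_sum) : bool :=
  (p == q) || (if adj_key p is Some a then
                 if adj_key q is Some b then a == b else false
               else false).

Lemma adj_rel_refl : reflexive adj_rel.
Proof. by move=> p; rewrite /adj_rel eqxx. Qed.

Lemma adj_rel_sym : symmetric adj_rel.
Proof.
move=> p q; rewrite /adj_rel eq_sym; congr (_ || _).
by case: (adj_key p) => [a|]; case: (adj_key q) => [b|] //; rewrite eq_sym.
Qed.

Lemma adj_rel_trans : transitive adj_rel.
Proof.
move=> q p r; rewrite /adj_rel => /orP[/eqP->//|Hpq] /orP[/eqP<-|Hqr].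
  by rewrite Hpq orbT.
apply/orP; right; move: Hpq Hqr.
case: (adj_key p) => [a|] //; case: (adj_key q) => [b|] //.
by case: (adj_key r) => [c|] // /eqP-> /eqP->.
Qed.

Definition adj_equiv := EquivRel adj_rel adj_rel_refl adj_rel_sym adj_rel_trans.

Local Open Scope quotient_scope.
Definition adjunction_space : topologicalType :=
  quotient_topology {eq_quot adj_equiv}.
End Adjunction.

Definition cell_attached (R : realType) (Y A : topologicalType) (l : nat) : Prop :=
  exists phi : set_type (@sphere R l) -> A, continuous phi /\
    homotopy_equiv R Y (adjunction_space phi).

(* Main.v *)
(** No gradient flow is used.  Since the complement of [X] has positive reach, near the critical
    point [X] is the epigraph, in the direction [v] of the inner normal, of a semiconcave function [h];
    [f] restricted to the graph, [F u = f (u, h u)], is then semiconcave as well, and its proximal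
    supergradients correspond to the unit normals of [X].  Hence the tangent spaces of the normal bundle
    and of the graph of the supergradients of [F] determine each other.  The sup-convolution [Fs] of
    [F] has a Lipschitz gradient, and when the tangent space of the normal bundle is a linear
    space [Fs] has a second order expansion at the critical point whose index is the index of the
    restricted Hessian plus the number of infinite principal curvatures.

    A normal of [X] never points against the gradient of [f] elsewhere in the band, and a
    supergradient of [F] at [u <> 0] is never opposite to the gradient of [Fs].  So one can build
    continuous push fields on [X] that decrease at a definite rate both [f] and a given family of
    quadratic perturbations of [Fs]; finitely many small steps along these fields deform [X_(c + eps)]
    into [X_(c - eps)] together with a neighbourhood of the critical point, where everything is compared
    with the quadratic model, whose handle collapses onto a cell. *)

(* When a principal curvature is infinite, [F] has no second order expansion at the critical point,
   and its supergradients are multivalued, so neither a Morse chart nor a gradient field is at hand.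
   Subtracting a multiple of the squared norm makes [F] concave, and the Moreau envelope of a
   concave function has a Lipschitz gradient. The resolvent behind it sends the vertical tangent
   directions [(0, q)], which account for the infinite curvatures, to directions of second
   derivative [K - 1 / s]: this is why they add to the index. The price is that [Fs] only dominates
   [F], so sublevel sets of the two are never identified. The sets followed by the deformation are
   instead mapped into themselves by every small push, essentially because the functions that define
   them decrease. One vector must then decrease several functions at once; by convex separation it
   exists unless a supergradient is opposite to the gradient of [Fs]. Nondegeneracy excludes this
   with a margin proportional to the distance to the critical point, uniformly in small [s], and
   this margin pays for the quadratic perturbations that compensate the gap between [F] and [Fs]. *)
Require Import Defs.
From HB Require Import structures.
From mathcomp Require Import all_boot all_order all_algebra.
From mathcomp Require Import all_classical all_reals all_analysis.
From mathcomp Require Import generic_quotient ring lra zify.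
Import numFieldNormedType.Exports.
Set Implicit Arguments.
Unset Strict Implicit.
Unset Printing Implicit Defensive.
Import Order.TTheory GRing.Theory Num.Theory.
Local Open Scope ring_scope.
Local Open Scope classical_set_scope.

(** * Euclidean space *)

Section EuclideanSpace.
Variable R : realType.
Implicit Types m n : nat.

Lemma dotpE m (u v : 'rV[R]_m) : dotp u v = (u *m v^T) 0 0.
Proof. by rewrite /dotp mxE; apply: eq_bigr => i _; rewrite mxE. Qed.

Lemma dotpC m (u v : 'rV[R]_m) : dotp u v = dotp v u.
Proof. by rewrite /dotp; apply: eq_bigr => i _; rewrite mulrC. Qed.

Lemma dotpDl m (u v w : 'rV[R]_m) : dotp (u + v) w = dotp u w + dotp v w.
Proof. by rewrite !dotpE mulmxDl mxE. Qed.

Lemma dotpDr m (u v w : 'rV[R]_m) : dotp w (u + v) = dotp w u + dotp w v.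
Proof. by rewrite dotpC dotpDl !(dotpC w). Qed.

Lemma dotpZl m a (u w : 'rV[R]_m) : dotp (a *: u) w = a * dotp u w.
Proof. by rewrite !dotpE -scalemxAl mxE. Qed.

Lemma dotpZr m a (u w : 'rV[R]_m) : dotp w (a *: u) = a * dotp w u.
Proof. by rewrite dotpC dotpZl dotpC. Qed.

Lemma dotpNl m (u w : 'rV[R]_m) : dotp (- u) w = - dotp u w.
Proof. by rewrite -scaleN1r dotpZl mulN1r. Qed.

Lemma dotpNr m (u w : 'rV[R]_m) : dotp w (- u) = - dotp w u.
Proof. by rewrite dotpC dotpNl dotpC. Qed.

Lemma dotpBl m (u v w : 'rV[R]_m) : dotp (u - v) w = dotp u w - dotp v w.
Proof. by rewrite dotpDl dotpNl. Qed.

Lemma dotpBr m (u v w : 'rV[R]_m) : dotp w (u - v) = dotp w u - dotp w v.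
Proof. by rewrite dotpDr dotpNr. Qed.

Lemma dotp0l m (w : 'rV[R]_m) : dotp 0 w = 0.
Proof. by rewrite dotpE mul0mx mxE. Qed.

Lemma dotp0r m (w : 'rV[R]_m) : dotp w 0 = 0.
Proof. by rewrite dotpC dotp0l. Qed.

Lemma dotp_mulmxl m n (u : 'rV[R]_m) (M : 'M[R]_(m, n)) v :
  dotp (u *m M) v = dotp u (v *m M^T).
Proof. by rewrite !dotpE trmx_mul trmxK mulmxA. Qed.

Lemma dotp_mulmxr m n (u : 'rV[R]_m) (M : 'M[R]_(m, n)) v :
  dotp v (u *m M) = dotp (v *m M^T) u.
Proof. by rewrite dotpC dotp_mulmxl dotpC. Qed.

Lemma dotp_ge0 m (u : 'rV[R]_m) : 0 <= dotp u u.
Proof. by apply: sumr_ge0 => i _; rewrite -expr2 sqr_ge0. Qed.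

Lemma dotp_eq0 m (u : 'rV[R]_m) : (dotp u u == 0) = (u == 0).
Proof.
apply/eqP/eqP => [u0|->]; last by rewrite dotp0l.
apply/rowP => i; rewrite mxE; apply/eqP; rewrite -sqrf_eq0 expr2.
move/eqP: u0; rewrite psumr_eq0 => [|j _]; last by rewrite -expr2 sqr_ge0.
by move=> /allP/(_ i); rewrite mem_index_enum => /(_ isT).
Qed.

Lemma enorm_ge0 m (u : 'rV[R]_m) : 0 <= enorm u.
Proof. exact: sqrtr_ge0. Qed.
#[local] Hint Resolve enorm_ge0 : core.

Lemma enorm_sqr m (u : 'rV[R]_m) : enorm u ^+ 2 = dotp u u.
Proof. by rewrite sqr_sqrtr// dotp_ge0. Qed.

Lemma enorm_eq0 m (u : 'rV[R]_m) : (enorm u == 0) = (u == 0).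
Proof. by rewrite -dotp_eq0 -enorm_sqr sqrf_eq0. Qed.

Lemma enorm_gt0 m (u : 'rV[R]_m) : (0 < enorm u) = (u != 0).
Proof. by rewrite lt_def enorm_ge0 andbT enorm_eq0. Qed.

Lemma enorm0 m : enorm (0 : 'rV[R]_m) = 0.
Proof. by apply/eqP; rewrite enorm_eq0. Qed.

Lemma enormZ m a (u : 'rV[R]_m) : enorm (a *: u) = `|a| * enorm u.
Proof.
by rewrite /enorm dotpZl dotpZr mulrA -expr2 sqrtrM ?sqr_ge0// sqrtr_sqr.
Qed.

Lemma enormN m (u : 'rV[R]_m) : enorm (- u) = enorm u.
Proof. by rewrite -scaleN1r enormZ normrN1 mul1r. Qed.

Lemma enormB m (u v : 'rV[R]_m) : enorm (u - v) = enorm (v - u).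
Proof. by rewrite -enormN opprB. Qed.

Lemma ler_enorm m (u : 'rV[R]_m) (a : R) : 0 <= a ->
  (enorm u <= a) = (dotp u u <= a ^+ 2).
Proof. by move=> a0; rewrite -enorm_sqr ler_sqr// nnegrE. Qed.

Lemma ger_enorm m (u : 'rV[R]_m) (a : R) : 0 <= a ->
  (a <= enorm u) = (a ^+ 2 <= dotp u u).
Proof. by move=> a0; rewrite -enorm_sqr ler_sqr// nnegrE. Qed.

Lemma dotp_addsq m (u v : 'rV[R]_m) :
  dotp (u + v) (u + v) = dotp u u + 2 * dotp u v + dotp v v.
Proof. by rewrite !dotpDl !dotpDr (dotpC v u); lra. Qed.

Lemma dotp_subsq m (u v : 'rV[R]_m) :
  dotp (u - v) (u - v) = dotp u u - 2 * dotp u v + dotp v v.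
Proof. by rewrite dotp_addsq dotpNr dotpNl dotpNr; lra. Qed.

Lemma dotp_le_enorm m (u v : 'rV[R]_m) : dotp u v <= enorm u * enorm v.
Proof.
have [->|v0] := eqVneq v 0; first by rewrite dotp0r enorm0 mulr0.
have vp : 0 < enorm v by rewrite enorm_gt0.
have := dotp_ge0 (enorm v ^+ 2 *: u - dotp u v *: v).
rewrite dotp_subsq !dotpZl !dotpZr -!enorm_sqr => h.
have {}h : 0 <= enorm v ^+ 2 * ((enorm u * enorm v) ^+ 2 - dotp u v ^+ 2).
  by move: h; congr (_ <= _); ring.
rewrite pmulr_rge0 ?exprn_gt0// subr_ge0 in h.
have [uv0|uv0] := leP (dotp u v) 0; first by rewrite (le_trans uv0)// mulr_ge0.
by rewrite -ler_sqr// nnegrE ?mulr_ge0// ltW.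
Qed.

Lemma dotp_ge_enorm m (u v : 'rV[R]_m) : - (enorm u * enorm v) <= dotp u v.
Proof. by rewrite lerNl -dotpNl (le_trans (dotp_le_enorm _ _))// enormN. Qed.

Lemma normr_dotp m (u v : 'rV[R]_m) : `|dotp u v| <= enorm u * enorm v.
Proof. by rewrite ler_norml dotp_le_enorm dotp_ge_enorm. Qed.

Lemma enormD m (u v : 'rV[R]_m) : enorm (u + v) <= enorm u + enorm v.
Proof.
rewrite ler_enorm ?addr_ge0// dotp_addsq -!enorm_sqr.
by have := dotp_le_enorm u v; lra.
Qed.

Lemma enorm_triangle m (u v w : 'rV[R]_m) :
  enorm (u - w) <= enorm (u - v) + enorm (v - w).
Proof. by rewrite (le_trans _ (enormD _ _))// addrA subrK. Qed.

Lemma enormBD m (u v : 'rV[R]_m) : enorm (u - v) <= enorm u + enorm v.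
Proof. by rewrite (le_trans (enormD _ _))// enormN. Qed.

Lemma enorm_lb m (u v : 'rV[R]_m) : enorm u - enorm v <= enorm (u + v).
Proof.
have := enormD (u + v) (- v).
by rewrite addrK enormN; lra.
Qed.

Lemma enorm_lip m (u v : 'rV[R]_m) : `|enorm u - enorm v| <= enorm (u - v).
Proof.
rewrite ler_norml; have := enorm_lb u (v - u); have := enorm_lb v (u - v).
by rewrite !subrKC (enormB v u); lra.
Qed.

Lemma enorm_unit m (u : 'rV[R]_m) : u != 0 -> enorm ((enorm u)^-1 *: u) = 1.
Proof.
move=> u0; have up : 0 < enorm u by rewrite enorm_gt0.
by rewrite enormZ ger0_norm ?invr_ge0// mulVf// gt_eqF.
Qed.

Lemma unit_dotp m (u : 'rV[R]_m) : enorm u = 1 -> dotp u u = 1.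
Proof. by move=> u1; rewrite -enorm_sqr u1 expr1n. Qed.

Lemma normr_coord m (u : 'rV[R]_m) i : `|u 0 i| <= enorm u.
Proof.
rewrite -ler_sqr ?nnegrE// real_normK ?num_real// enorm_sqr /dotp.
rewrite (bigD1 i)//= expr2 lerDl.
by apply: sumr_ge0 => j _; rewrite -expr2 sqr_ge0.
Qed.

Lemma enorm_le_sum m (u : 'rV[R]_m) : enorm u <= \sum_i `|u 0 i|.
Proof.
have s0 : 0 <= \sum_i `|u 0 i| by exact: sumr_ge0.
rewrite ler_enorm// /dotp expr2 mulr_suml; apply: ler_sum => i _.
rewrite (le_trans (ler_norm _))// normrM ler_wpM2l//.
by rewrite (bigD1 i)//= lerDl sumr_ge0.
Qed.

Lemma enorm_le_norm m (u : 'rV[R]_m) : enorm u <= m%:R * `|u|.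
Proof.
rewrite (le_trans (enorm_le_sum u))// mulr_natl.
rewrite -[X in _ *+ X](card_ord m) -sumr_const; apply: ler_sum => i _.
rewrite [leRHS]/Num.norm/= mx_normrE; apply/bigmax_geP; right => /=.
by exists (ord0, i).
Qed.

Lemma norm_le_enorm m (u : 'rV[R]_m) : `|u| <= enorm u.
Proof.
rewrite [leLHS]/Num.norm/= mx_normrE; apply/bigmax_leP; split => //= -[i j] _ /=.
by rewrite ord1 normr_coord.
Qed.

Lemma mulmx_bound m n (M : 'M[R]_(m, n)) :
  exists2 C : R, 0 < C & forall u, enorm (u *m M) <= C * enorm u.
Proof.
exists (1 + \sum_j enorm (row j M^T)).
  by rewrite ltr_pwDl// sumr_ge0.
move=> u; rewrite (le_trans (enorm_le_sum _))// mulrDl mul1r.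
rewrite (@le_trans _ _ (\sum_j enorm (row j M^T) * enorm u))//; last first.
  by rewrite -mulr_suml lerDr.
apply: ler_sum => j _; rewrite mulrC.
have -> : (u *m M) 0 j = dotp u (row j M^T).
  by rewrite /dotp mxE; apply: eq_bigr => i _; rewrite !mxE.
exact: normr_dotp.
Qed.

(** The topology of row vectors comes from the maximum norm; the two comparisons above make the
    Euclidean balls a basis of neighbourhoods. *)
Lemma nbhs_enormP m (y : 'rV[R]_m) (A : set 'rV[R]_m) :
  nbhs y A <-> exists2 e : R, 0 < e & forall z, enorm (z - y) < e -> A z.
Proof.
split => [/nbhs_ballP[e /= e0 eA]|[e e0 eA]].
  exists e => // z zy; apply: eA; rewrite -ball_normE /=.
  by rewrite distrC (le_lt_trans (norm_le_enorm _)).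
(* [m.+1] instead of [m] keeps the divisor positive in dimension 0. *)
apply/nbhs_ballP; exists (e / m.+1%:R) => /=; first by rewrite divr_gt0.
move=> z; rewrite -ball_normE /= distrC => zy; apply: eA.
rewrite (le_lt_trans (enorm_le_norm _))//.
have : m.+1%:R * `|z - y| < e by rewrite mulrC -ltr_pdivlMr.
by apply: le_lt_trans; rewrite ler_wpM2r// ler_nat.
Qed.

Lemma enorm_continuous m : continuous (@enorm R m).
Proof.
move=> y A /= /nbhs_ballP[e /= e0 eA]; apply/nbhs_enormP; exists e => // z zy.
apply: eA; rewrite -ball_normE /= distrC.
exact: le_lt_trans (enorm_lip _ _) _.
Qed.

Lemma closedP_enorm m (A : set 'rV[R]_m) :
  closed A <-> forall y, (forall e, 0 < e -> exists2 z, A z & enorm (z - y) < e) -> A y.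
Proof.
split=> [cA y h|h y cy].
  apply: cA => B /nbhs_enormP[e e0 eB].
  by have [z Az zy] := h _ e0; exists z; split => //; exact: eB.
apply: h => e e0; have [|z [Az zy]] := cy [set z | enorm (z - y) < e].
  by apply/nbhs_enormP; exists e.
by exists z.
Qed.

Lemma closureP_enorm m (A : set 'rV[R]_m) y :
  closure A y <-> (forall e, 0 < e -> exists2 z, A z & enorm (z - y) < e).
Proof.
split=> [cy e e0|h B /nbhs_enormP[e e0 eB]].
  have [|z [Az zy]] := cy [set z | enorm (z - y) < e].
    by apply/nbhs_enormP; exists e.
  by exists z.
by have [z Az zy] := h _ e0; exists z; split => //; exact: eB.
Qed.

Lemma interiorP_enorm m (A : set 'rV[R]_m) y :
  interior A y <-> exists2 e : R, 0 < e & forall z, enorm (z - y) < e -> A z.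
Proof. exact: nbhs_enormP. Qed.

Lemma closed_enorm_le m (y : 'rV[R]_m) r : closed [set z | enorm (z - y) <= r].
Proof.
apply/closedP_enorm => z h /=; rewrite leNgt; apply/negP => rz.
have [|w /= wr wz] := h (enorm (z - y) - r); first by rewrite subr_gt0.
by have := enorm_triangle z w y; rewrite (enormB z w); lra.
Qed.

Lemma compact_enorm m (A : set 'rV[R]_m) (M : R) :
  closed A -> (forall y, A y -> enorm y <= M) -> compact A.
Proof.
move=> cA AM; apply: bounded_closed_compact => //.
exists M; split; first exact: num_real.
move=> N MN y /AM yM; apply: le_trans (norm_le_enorm _) _.
exact: le_trans yM (ltW MN).
Qed.

Lemma compact_enorm_le m (y : 'rV[R]_m) r : compact [set z | enorm (z - y) <= r].
Proof.
apply: (@compact_enorm _ _ (r + enorm y)); first exact: closed_enorm_le.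
by move=> z /= zy; have := enorm_lb z (- y); rewrite enormN; lra.
Qed.

Lemma compact_closed_enorm m (K : set 'rV[R]_m) : compact K -> closed K.
Proof. by apply: compact_closed; exact: norm_hausdorff. Qed.

Lemma compact_enorm_bound m (K : set 'rV[R]_m) : compact K ->
  exists2 M : R, 0 < M & forall y, K y -> enorm y <= M.
Proof.
move=> /compact_bounded[M [_ KM]]; exists (m.+1%:R * (`|M| + 1)).
  by rewrite mulr_gt0// ltr_wpDl.
move=> y Ky; rewrite (le_trans (enorm_le_norm _))//.
apply: ler_pM => //; first by rewrite ler_nat.
by apply: KM => //; rewrite (le_lt_trans (ler_norm _))// ltrDl.
Qed.

Lemma compact_closedI_enorm m (K B : set 'rV[R]_m) :
  compact K -> closed B -> compact (K `&` B).
Proof.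
move=> cK cB; apply: (subclosed_compact _ cK) => [|y []//].
by apply: closedI => //; exact: compact_closed_enorm.
Qed.

(* Lebesgue-number form of compactness: a property of points and scales that
   holds locally at some scale holds uniformly at a common scale. *)
Lemma compact_unif m (K : set 'rV[R]_m) (Q : 'rV[R]_m -> R -> Prop) :
  compact K ->
  (forall y r r', Q y r -> 0 < r' <= r -> Q y r') ->
  (forall y, K y -> exists2 r : R, 0 < r &
     forall y', K y' -> enorm (y' - y) < r -> Q y' r) ->
  exists2 r : R, 0 < r & forall y, K y -> Q y r.
Proof.
move=> cK Qle Qloc.
have /(_ R (at_right 0) (fun r y => K y -> Q y r) _)[] :=
  (@compact_near_coveringP _ K).1 cK.
  move=> y Ky; have [r r0 Qr] := Qloc y Ky.
  exists ([set z | enorm (z - y) < r], [set s | 0 < s <= r]) => /=.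
    split; first by apply/nbhs_enormP; exists r.
    near=> s; apply/andP; split => //; near: s; exact: nbhs_right_le.
  by move=> [z s] /= [zy sr] Kz; apply: Qle sr; exact: Qr.
move=> e /= e0 he; exists (e / 2); first by rewrite divr_gt0.
move=> y Ky; apply: (he (e/2)) => //=.
  by rewrite sub0r normrN gtr0_norm ?divr_gt0// ltr_pdivrMr// ltr_pMr// ltr1n.
by rewrite divr_gt0.
Unshelve. all: by end_near.
Qed.

(** Relative to [K] on both sides, because [F] is controlled only on a closed ball. *)
Definition rcontinuous_on m (K : set 'rV[R]_m) (g : 'rV[R]_m -> R) :=
  forall y, K y -> forall e : R, 0 < e -> exists2 r : R, 0 < r &
    forall y', K y' -> enorm (y' - y) < r -> `|g y' - g y| < e.

Lemma continuous_rcontinuous_on m (K : set 'rV[R]_m) (g : 'rV[R]_m -> R) :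
  continuous g -> rcontinuous_on K g.
Proof.
move=> cg y Ky e e0.
have /nbhs_enormP[r r0 h] : nbhs y [set z | `|g z - g y| < e].
  have /nbhs_enormP[r r0 h] := cg y _ (nbhsx_ballx (g y) e e0).
  by apply/nbhs_enormP; exists r => // z /h; rewrite /= -ball_normE /= distrC.
by exists r => // y' _ /h.
Qed.

Lemma rcontinuous_on_within m (K : set 'rV[R]_m) (g : 'rV[R]_m -> R) :
  rcontinuous_on K g -> {within K, continuous g}.
Proof.
move=> cg; rewrite continuous_subspace_in => y /[!inE] Ky A /= /nbhs_ballP[e /= e0 eA].
have [r r0 h] := cg _ Ky _ e0.
rewrite /nbhs/= -nbhs_subspace_in// /within/=.
apply/nbhs_enormP; exists r => // z zy Kz; apply: eA.
by rewrite -ball_normE /= distrC; exact: h.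
Qed.

Lemma compact_min m (K : set 'rV[R]_m) (g : 'rV[R]_m -> R) :
  compact K -> K !=set0 -> rcontinuous_on K g ->
  exists2 y, K y & forall z, K z -> g y <= g z.
Proof.
move=> cK K0 /rcontinuous_on_within cg.
have [y] := compact_EVT_min K0 cK cg; rewrite inE => Ky h.
by exists y => // z Kz; apply: h; rewrite inE.
Qed.

Lemma rcontinuous_onN m (K : set 'rV[R]_m) (g : 'rV[R]_m -> R) :
  rcontinuous_on K g -> rcontinuous_on K (fun y => - g y).
Proof.
move=> cg y Ky e e0; have [r r0 h] := cg y Ky e e0; exists r => // y' Ky' yy'.
by rewrite -opprD normrN h.
Qed.

Lemma rcontinuous_onD m (K : set 'rV[R]_m) (g g' : 'rV[R]_m -> R) :
  rcontinuous_on K g -> rcontinuous_on K g' ->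
  rcontinuous_on K (fun y => g y + g' y).
Proof.
move=> cg cg' y Ky e e0; have e20 : 0 < e / 2 by rewrite divr_gt0.
have [r r0 h] := cg y Ky _ e20; have [r' r'0 h'] := cg' y Ky _ e20.
exists (Num.min r r'); first by rewrite lt_min r0.
move=> y' Ky'; rewrite lt_min => /andP[/h{}h /h'{}h'].
have {h h'} := conj (h Ky') (h' Ky'); rewrite !ltr_norml => -[].
by move=> /andP[? ?] /andP[? ?]; apply/andP; split; lra.
Qed.

Lemma compact_max m (K : set 'rV[R]_m) (g : 'rV[R]_m -> R) :
  compact K -> K !=set0 -> rcontinuous_on K g ->
  exists2 y, K y & forall z, K z -> g z <= g y.
Proof.
move=> cK K0 /rcontinuous_onN cg.
have [y Ky h] := compact_min cK K0 cg.
by exists y => // z Kz; rewrite -lerN2 h.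
Qed.

Lemma lipschitz_rcontinuous_on m (K : set 'rV[R]_m) (g : 'rV[R]_m -> R) C :
  (forall y z, K y -> K z -> `|g z - g y| <= C * enorm (z - y)) ->
  rcontinuous_on K g.
Proof.
move=> h y Ky e e0; exists (e / (1 + `|C|)); first by rewrite divr_gt0// ltr_pwDl.
move=> z Kz zy; rewrite (le_lt_trans (h _ _ Ky Kz))//.
rewrite ltr_pdivlMr ?ltr_pwDl// in zy.
by have := ler_norm C; have := enorm_ge0 (z - y); nra.
Qed.

End EuclideanSpace.
#[global] Hint Extern 0 (is_true (@Order.le _ _ _ (enorm _))) =>
  solve [apply: enorm_ge0] : core.

(* [lra] reifies the whole context, and fails when a section hypothesis has been cleared: these come
   back as [True], from the list [section_facts] when there is one. *)
Ltac section_facts := idtac.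
Ltac clear_facts := repeat match goal with
  H : ?T |- _ => lazymatch type of T with Prop => clear H end end.
Ltac forget_facts := match goal with
  | H : ?T |- _ => lazymatch type of T with Prop => clear H end; forget_facts; assert (H := I)
  | _ => idtac end.
Tactic Notation "lra_with" constr_list(hs) :=
  generalize hs; first [clear_facts; section_facts; lra | forget_facts; lra].
Ltac rowring := apply/rowP => ?; rewrite !mxE; ring.

(** * Continuity on subsets and the clamp to the unit interval *)

Lemma set_val_continuous (T : topologicalType) (B : set T) :
  continuous (set_val : set_type B -> T).
Proof. exact: initial_continuous. Qed.

Lemma continuous_set_type (S T : topologicalType) (B : set T) (g : S -> set_type B) :
  continuous (fun x => set_val (g x)) -> continuous g.
Proof. by move=> h; apply: (@continuous_comp_initial _ _ _ set_val g). Qed.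

Definition corestr (S T : Type) (B : set T) (g : S -> T) (gB : forall x, B (g x))
  : S -> set_type B := fun x => exist _ (g x) (mem_set (gB x)).

Lemma corestr_continuous (S T : topologicalType) (B : set T) (g : S -> T)
  (gB : forall x, B (g x)) : continuous g -> continuous (corestr gB).
Proof. by move=> cg; exact: continuous_set_type. Qed.

Lemma set_typeP (T : Type) (B : set T) (x : set_type B) : B (set_val x).
Proof. exact/set_mem/(valP x). Qed.

Lemma set_val_inj (T : Type) (B : set T) : injective (set_val : set_type B -> T).
Proof. exact: val_inj. Qed.

Lemma corestrE (S T : Type) (B : set T) (g : S -> T) (gB : forall x, B (g x)) x :
  set_val (corestr gB x) = g x.
Proof. by []. Qed.

Lemma continuous_comp_fst (S T U : topologicalType) (g : S -> U) :
  continuous g -> continuous (fun p : (S * T)%type => g p.1).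
Proof. by move=> cg p; apply: (@continuous_comp _ _ _ fst g); [exact: cvg_fst|exact: cg]. Qed.

Lemma continuous_comp_snd (S T U : topologicalType) (g : T -> U) :
  continuous g -> continuous (fun p : (S * T)%type => g p.2).
Proof. by move=> cg p; apply: (@continuous_comp _ _ _ snd g); [exact: cvg_snd|exact: cg]. Qed.

Lemma within_set_type (S T : topologicalType) (B : set T) (g : T -> S) :
  {within B, continuous g} -> continuous (fun x : set_type B => g (set_val x)).
Proof. by move=> /subspace_sigL_continuousP. Qed.

Lemma within_comp (S T U : topologicalType) (B : set T) (C : set U)
    (g : T -> U) (h : U -> S) :
  (forall x, B x -> C (g x)) -> {within B, continuous g} ->
  {within C, continuous h} -> {within B, continuous (h \o g)}.
Proof.
move=> gC /within_set_type cg /within_set_type ch; apply/subspace_sigL_continuousP.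
have gC' (x : set_type B) : C (g (set_val x)).
  exact: gC _ (set_typeP x).
have -> : sigL B (h \o g) = (fun x : set_type C => h (set_val x)) \o corestr gC'.
  by [].
move=> x; apply: continuous_comp; last exact: ch.
exact: corestr_continuous.
Qed.

Lemma eq_within (S T : topologicalType) (B : set T) (g h : T -> S) :
  (forall x, B x -> g x = h x) -> {within B, continuous g} -> {within B, continuous h}.
Proof.
move=> gh /subspace_sigL_continuousP cg; apply/subspace_sigL_continuousP.
rewrite (_ : sigL B h = sigL B g)//.
by apply/funext => x; rewrite /sigL /= gh//; exact: set_typeP.
Qed.

Definition clamp01 (R : realType) (t : R) : R := Num.max 0 (Num.min 1 t).

Lemma clamp01P (R : realType) (t : R) : 0 <= clamp01 t <= 1.
Proof. by rewrite /clamp01 le_max lexx /= ge_max ler01 ge_min lexx. Qed.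

Lemma clamp01_le0 (R : realType) (t : R) : t <= 0 -> clamp01 t = 0.
Proof. by move=> t0; rewrite /clamp01 min_r ?max_l//; lra. Qed.

Lemma clamp01_ge1 (R : realType) (t : R) : 1 <= t -> clamp01 t = 1.
Proof. by move=> t1; rewrite /clamp01 min_l// max_r. Qed.

Lemma clamp01_id (R : realType) (t : R) : 0 <= t <= 1 -> clamp01 t = t.
Proof. by move=> /andP[t0 t1]; rewrite /clamp01 min_r// max_r. Qed.

Lemma clamp01_cases (R : realType) (t : R) :
  [\/ clamp01 t = 0 /\ t <= 0, clamp01 t = 1 /\ 1 <= t | clamp01 t = t /\ 0 <= t <= 1].
Proof.
have [t0|t0] := leP t 0; first by constructor 1; rewrite clamp01_le0.
have [t1|t1] := leP 1 t; first by constructor 2; rewrite clamp01_ge1.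
have t01 : 0 <= t <= 1 by apply/andP; split; exact: ltW.
by constructor 3; rewrite clamp01_id.
Qed.

Lemma clamp01_lip (R : realType) (s t : R) : `|clamp01 s - clamp01 t| <= `|s - t|.
Proof.
have := ler_norm (s - t); have := ler_norm (t - s); rewrite (distrC t s) ler_norml.
have [[-> s0]|[-> s0]|[-> /andP[s0 s1]]] := clamp01_cases s;
have [[-> t0]|[-> t0]|[-> /andP[t0 t1]]] := clamp01_cases t;
by move=> h1 h2; apply/andP; split; lra.
Qed.

Lemma pair_continuous (S T U : topologicalType) (g : S -> T) (h : S -> U) :
  continuous g -> continuous h -> continuous (fun x => (g x, h x)).
Proof.
move=> cg ch x B [[U1 U2] /= [h1 h2] hB].
apply: (filterS (P := g @^-1` U1 `&` h @^-1` U2)) => [y [? ?]|]; first exact: hB.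
by apply: filterI; [exact: cg|exact: ch].
Qed.

Lemma clamp01_continuous (R : realType) : continuous (@clamp01 R).
Proof.
move=> t A /nbhs_ballP[e /= e0 eA]; apply/nbhs_ballP; exists e => //= s.
by rewrite /ball/= => st; apply: eA; rewrite /ball/=; exact: le_lt_trans (clamp01_lip _ _) _.
Qed.

(** * Attaching a cell up to homotopy *)

Section AdjunctionSpace.
Variables (R : realType) (A : topologicalType) (l : nat).
Variable phi : set_type (@sphere R l) -> A.
Local Open Scope quotient_scope.
Local Notation D := (set_type (@disk R l)).
Local Notation adj := (adjunction_space phi).
Local Notation I := (unit_interval R).

Definition adjA (a : A) : adj := \pi_adj (existT (adj_pieces R A l) true a).
Definition adjD (y : D) : adj := \pi_adj (existT (adj_pieces R A l) false y).

Lemma adjA_continuous : continuous adjA.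
Proof.
move=> a; apply: (@continuous_comp _ _ _ (existT (adj_pieces R A l) true)).
  exact: existT_continuous.
exact: pi_continuous.
Qed.

Lemma adjD_continuous : continuous adjD.
Proof.
move=> a; apply: (@continuous_comp _ _ _ (existT (adj_pieces R A l) false)).
  exact: existT_continuous.
exact: pi_continuous.
Qed.

Lemma adj_glue (x : set_type (@sphere R l)) (y : D) :
  set_val x = set_val y -> adjD y = adjA (phi x).
Proof.
move=> xy; apply/eqmodP => /=; rewrite /adj_rel /= -xy valK /= eqxx ?orbT; done.
Qed.

Lemma adj_ind (q : adj) : (exists a, q = adjA a) \/ (exists y, q = adjD y).
Proof.
rewrite -(reprK q); case: (repr q) => -[] z; first by left; exists z.
by right; exists z.
Qed.

(* Maps out of I x adj are given by maps on the two pieces, because the product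
   of a quotient map with the compact interval is a quotient map. *)
Lemma adj_lift_homotopy (Z : topologicalType) (KA : (I * A)%type -> Z)
    (KD : (I * D)%type -> Z) :
  continuous KA -> continuous KD ->
  (forall t (x : set_type (@sphere R l)) (y : D), set_val x = set_val y ->
     KD (t, y) = KA (t, phi x)) ->
  exists2 K : (I * adj)%type -> Z, continuous K &
    (forall t a, K (t, adjA a) = KA (t, a)) /\
    (forall t y, K (t, adjD y) = KD (t, y)).
Proof.
move=> cKA cKD agree.
pose Ks (t : I) (p : adj_sum R A l) : Z :=
  match p with
  | existT true a => KA (t, a)
  | existT false y => KD (t, y)
  end.
have Ks_key t p a : adj_key phi p = Some a -> Ks t p = KA (t, a).
  case: p => -[] z /=; first by move=> [->].
  by case: insubP => //= u _ uz [<-]; exact: agree.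
have Ks_rel t p q : adj_rel phi p q -> Ks t p = Ks t q.
  move=> /orP[/eqP-> //|].
  case Ep : (adj_key phi p) => [a|//]; case Eq : (adj_key phi q) => [b|//].
  by move=> /eqP ab; rewrite (Ks_key _ _ _ Ep) (Ks_key _ _ _ Eq) ab.
have Ks_pi t p : Ks t (repr (\pi_adj p)) = Ks t p.
  have /eqmodP : repr (\pi_({eq_quot (adj_equiv phi)}) p) = p %[mod {eq_quot (adj_equiv phi)}].
    by rewrite reprK.
  exact: Ks_rel.
have cKs (O : set Z) t p : nbhs (Ks t p) O ->
    exists2 U : set I * set (adj_sum R A l), nbhs t U.1 /\ nbhs p U.2 &
      forall t' p', U.1 t' -> U.2 p' -> O (Ks t' p').
  case: p => -[] z /= Oz.
    have [[U1 U2] /= [tU1 zU2] h] := cKA _ _ Oz.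
    exists (U1, [set existT (adj_pieces R A l) true z | z in U2]) => /=.
      by split => //; exact: existT_nbhs.
    by move=> t' _ U1t' [z' U2z' <-]; exact: (h (t', z')).
  have [[U1 U2] /= [tU1 zU2] h] := cKD _ _ Oz.
  exists (U1, [set existT (adj_pieces R A l) false z | z in U2]) => /=.
    by split => //; exact: existT_nbhs.
  by move=> t' _ U1t' [z' U2z' <-]; exact: (h (t', z')).
exists (fun tq => Ks tq.1 (repr tq.2)); last first.
  by split=> t z /=; rewrite Ks_pi.
move=> [t0 q0] B /=; rewrite nbhsE => -[ O [ oO Oz ] OB ].
have [[U1 U2] /= [tU1 pU2] h] := cKs O t0 (repr q0) (open_nbhs_nbhs (conj oO Oz)).
have [e e0 eU1] : exists2 e : R, 0 < e & forall t : I, `|set_val t - set_val t0| <= e -> U1 t.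
  case: tU1 => W [[W' oW' WW'] Wt0] WU1.
  have : nbhs (set_val t0) W'.
    by apply: open_nbhs_nbhs; split => //; rewrite -WW' in Wt0.
  move=> /nbhs_ballP[e /= e0 eW']; exists (e / 2); first by rewrite divr_gt0.
  move=> t tt0; apply: WU1; rewrite -WW' /=; apply: eW'.
  rewrite -ball_normE /= distrC (le_lt_trans tt0)// ltr_pdivrMr// ltr_pMr//.
  by rewrite ltr1n.
pose Kc := `[0, 1]%classic `&` [set t : R | `|t - set_val t0| <= e].
have cKc : compact Kc.
  rewrite /Kc setIC; apply: subclosed_compact (@segment_compact R 0 1) _; last first.
    by move=> t [].
  apply: closedI; last exact: interval_closed.
  have -> : [set t : R | `|t - set_val t0| <= e] = closed_ball (set_val t0) e.
    by rewrite closed_ballE// /closed_ball_; apply/seteqP; split => t /=; rewrite distrC.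
  exact: closed_ball_closed.
(* Tube lemma: compactness of [Kc] makes [Om] open, and since [Ks] respects the gluing relation [Om]
   is saturated, so its image in the quotient is open. *)
pose Om := [set p | forall t : I, Kc (set_val t) -> O (Ks t p)].
have oOm : open Om.
  rewrite openE => p Omp; rewrite /interior.
  suff : \forall p' \near p, Kc `<=` (fun t : R =>
      forall h : t \in [set t : R | 0 <= t <= 1], O (Ks (exist _ t h) p')).
    apply: filterS => p' hp' t Kt; have := hp' _ Kt (valP t).
    by congr (O (Ks _ _)); apply: val_inj.
  apply: ((@compact_near_coveringP _ Kc).1 cKc _ (nbhs p)
    (fun p' (t : R) => forall h : t \in [set t : R | 0 <= t <= 1], O (Ks (exist _ t h) p'))).
        move=> t Kt; have t01 : t \in [set t : R | 0 <= t <= 1].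
      by rewrite inE /=; case: Kt; rewrite /= in_itv.
    have Op : O (Ks (exist _ t t01) p) by exact: Omp.
    have [[V1 V2] /= [tV1 pV2] hV] := cKs O _ _ (open_nbhs_nbhs (conj oO Op)).
    case: tV1 => W [[W' oW' WW'] Wt] WV1.
    exists (W', V2).
      split => //=; apply: open_nbhs_nbhs; split => //.
      by rewrite -WW' in Wt.
    move=> [t' p'] /= [W't' V2p'] h'; apply: hV => //; apply: WV1.
    by rewrite -WW' /=.
have Omq0 : Om (repr q0).
  by move=> t [_ Kt]; apply: h; [exact: eU1|exact: nbhs_singleton].
have Ompi p : Om (repr (\pi_adj p)) <-> Om p.
  by split=> hp t Kt; have := hp t Kt; rewrite Ks_pi.
exists ([set t : I | `|set_val t - set_val t0| < e], [set q : adj | Om (repr q)]) => /=.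
  split.
    have : nbhs t0 (set_val @^-1` ball (set_val t0) e).
      exact: (@set_val_continuous _ _ t0 _ (nbhsx_ballx (set_val t0) e e0)).
    by apply: filterS => t; rewrite /= -ball_normE/= distrC.
  apply: (@open_nbhs_nbhs adj q0); split; last exact: Omq0.
  rewrite /open/= /quotient_open (_ : _ @^-1` _ = Om)//.
  by apply/seteqP; split => p /=; rewrite Ompi.
move=> [t q] /= [te Omq]; apply: OB; apply: Omq; split; last exact: ltW.
by have := valP t; rewrite inE /= in_itv.
Qed.

Lemma adj_lift (Z : topologicalType) (hA : A -> Z) (hD : D -> Z) :
  continuous hA -> continuous hD ->
  (forall (x : set_type (@sphere R l)) (y : D), set_val x = set_val y ->
     hD y = hA (phi x)) ->
  exists2 h : adj -> Z, continuous h &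
    (forall a, h (adjA a) = hA a) /\ (forall y, h (adjD y) = hD y).
Proof.
move=> cA cD agree.
have t0in : (0 : R) \in [set t : R | 0 <= t <= 1] by rewrite inE /= lexx ler01.
pose t0 : I := exist _ 0 t0in.
have [|||K cK [KA KD]] := @adj_lift_homotopy Z (hA \o snd) (hD \o snd).
- by move=> p; apply: continuous_comp; [exact: cvg_snd|exact: cA].
- by move=> p; apply: continuous_comp; [exact: cvg_snd|exact: cD].
- by move=> t x y; exact: agree.
exists (fun q => K (t0, q)); last by split=> z; [exact: KA|exact: KD].
move=> q; apply: (@continuous_comp _ _ _ (fun q => (t0, q)) K); last exact: cK.
move=> B [[U1 U2] /= [tU1 qU2] h]; apply: filterS qU2 => z U2z.
by apply: h; split => //; exact: nbhs_singleton.
Qed.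

End AdjunctionSpace.

Section Homotopies.
Variable R : realType.
Local Notation I := (unit_interval R).

Lemma within_unit_interval (T Z : topologicalType) (S : set T) (F : (R * T)%type -> Z) :
  {within [set t : R | 0 <= t <= 1] `*` S, continuous F} ->
  continuous (fun p : (I * set_type S)%type => F (set_val p.1, set_val p.2)).
Proof.
move=> /within_set_type cF p.
exact: (@continuous_comp _ _ _ (@sigT_of_setX _ _ [set t : R | 0 <= t <= 1] S)
  (fun q => F (set_val q)) p (@sigT_of_setX_continuous _ _ _ _ p) (cF _)).
Qed.

Lemma homotopic_trans (Y Z : topologicalType) (g1 g2 g3 : Y -> Z) :
  homotopic R g1 g2 -> homotopic R g2 g3 -> homotopic R g1 g3.
Proof.
move=> [H [cH [H0 H1]]] [H' [cH' [H'0 H'1]]].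
have c1P (t : R) : [set s : R | 0 <= s <= 1] (clamp01 (2 * t)) by exact: clamp01P.
have c2P (t : R) : [set s : R | 0 <= s <= 1] (clamp01 (2 * t - 1)) by exact: clamp01P.
pose c1 : R -> I := corestr c1P; pose c2 : R -> I := corestr c2P.
have cc1 : continuous c1.
  apply: corestr_continuous => t.
  apply: (@continuous_comp _ _ _ (fun t : R => 2 * t) (@clamp01 R)).
    exact: mulrl_continuous.
  exact: clamp01_continuous.
have cc2 : continuous c2.
  apply: corestr_continuous => t.
  apply: (@continuous_comp _ _ _ (fun t : R => 2 * t - 1) (@clamp01 R)).
    by apply: continuousB; [exact: mulrl_continuous|exact: cst_continuous].
  exact: clamp01_continuous.
pose K (p : (I * Y)%type) : Z :=
  if set_val p.1 <= 1 / 2 then H (c1 (set_val p.1), p.2)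
  else H' (c2 (set_val p.1), p.2).
exists K; split; last first.
  split => t y t01; rewrite /K /= t01.
    by rewrite divr_ge0 ?ler01 ?ler0n// H0//= /set_val/= mulr0 clamp01_le0.
  rewrite ifF; last by apply/negbTE; rewrite -ltNge ltr_pdivrMr// mul1r ltr1n.
  by rewrite H'1//= /set_val/= mulr1 clamp01_ge1//; lra.
have cv : continuous (fun p : (I * Y)%type => set_val p.1 : R).
  move=> p; apply: (@continuous_comp _ _ _ fst); first exact: cvg_fst.
  exact: set_val_continuous.
pose B1 := [set p : (I * Y)%type | set_val p.1 <= 1 / 2].
pose B2 := [set p : (I * Y)%type | 1 / 2 <= set_val p.1].
have cB1 : closed B1.
  by apply: (@closed_comp _ _ _ [set t : R | t <= 1 / 2]); [move=> p _; exact: cv|exact: closed_le].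
have cB2 : closed B2.
  by apply: (@closed_comp _ _ _ [set t : R | 1 / 2 <= t]); [move=> p _; exact: cv|exact: closed_ge].
have cF1 : continuous (fun p : (I * Y)%type => H (c1 (set_val p.1), p.2)).
  move=> p; apply: (@continuous_comp _ _ _ (fun p => (c1 (set_val p.1), p.2)) H); last exact: cH.
  apply: pair_continuous => q; last exact: cvg_snd.
  exact: (continuous_comp (cv q) (cc1 _)).
have cF2 : continuous (fun p : (I * Y)%type => H' (c2 (set_val p.1), p.2)).
  move=> p; apply: (@continuous_comp _ _ _ (fun p => (c2 (set_val p.1), p.2)) H'); last exact: cH'.
  apply: pair_continuous => q; last exact: cvg_snd.
  exact: (continuous_comp (cv q) (cc2 _)).
have : {within B1 `|` B2, continuous K}.
  apply: withinU_continuous => //.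
    apply: (@eq_within _ _ _ (fun p => H (c1 (set_val p.1), p.2))).
      by move=> p; rewrite /B1 /K /= => ->.
    exact: continuous_subspaceT.
  apply: (@eq_within _ _ _ (fun p => H' (c2 (set_val p.1), p.2))); last first.
    exact: continuous_subspaceT.
  move=> p; rewrite /B2 /K /= => p1; case: ifPn => // p2.
  have p12 : set_val p.1 = 1 / 2 :> R by apply/eqP; rewrite eq_le p1 p2.
  rewrite H1; last by rewrite /c1 /corestr /= {1}/set_val /= p12 mulrC divfK// clamp01_ge1.
  by rewrite H'0// /c2 /corestr /= {1}/set_val /= p12 mulrC divfK// subrr clamp01_le0.
have -> : B1 `|` B2 = setT.
  by apply/seteqP; split => // p _; rewrite /B1 /B2 /=; have [|/ltW] := leP (set_val p.1) (1 / 2); [left|right].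
by move=> h; apply/continuous_subspace_setT; exact: h.
Qed.

Lemma homotopic_eq0 (Y Z : topologicalType) (H : (I * Y)%type -> Z) (g1 g2 : Y -> Z) :
  continuous H -> (forall t y, set_val t = 0 -> H (t, y) = g1 y) ->
  (forall t y, set_val t = 1 -> H (t, y) = g2 y) -> homotopic R g1 g2.
Proof. by move=> cH H0 H1; exists H. Qed.

Lemma homotopic_sym (Y Z : topologicalType) (g1 g2 : Y -> Z) :
  homotopic R g1 g2 -> homotopic R g2 g1.
Proof.
move=> [H [cH [H0 H1]]].
have sP (t : I) : [set s : R | 0 <= s <= 1] (1 - set_val t).
  have /andP[t0 t1] := set_typeP t.
  by apply/andP; split; lra.
exists (fun p => H (corestr sP p.1, p.2)); split.
  move=> p; apply: (@continuous_comp _ _ _ (fun p : (I * Y)%type => (corestr sP p.1, p.2)) H); last exact: cH.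
  apply: pair_continuous => q; last exact: cvg_snd.
  apply: (@continuous_comp _ _ _ fst); first exact: cvg_fst.
  apply: corestr_continuous => t; apply: continuousB; first exact: cst_continuous.
  exact: set_val_continuous.
split=> t y t01.
  rewrite H1//= (_ : set_val (corestr sP t) = 1 - set_val t)//.
  by rewrite t01 subr0.
rewrite H0//= (_ : set_val (corestr sP t) = 1 - set_val t)//.
by rewrite t01 subrr.
Qed.

End Homotopies.

(** * A homotopy criterion for attaching a cell *)

Section Criterion.
Variables (R : realType) (V : topologicalType) (l : nat).
Local Notation I := (unit_interval R).
Local Notation I01 := [set t : R | 0 <= t <= 1].

(* Y retracts by deformation (De, then Co, then Re) onto J together with the
   cell E; A is only known to deform inside itself into J, so that the inverse
   of (inclusion, E) : A u_phi D -> Y is homotopic to the identity through maps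
   which agree along the attaching sphere. *)
Lemma cell_attached_criterion (Y A J T P P2 : set V)
    (De Co Re : R * V -> V) (E : 'rV[R]_l -> V) (xi : V -> 'rV[R]_l) :
  A `<=` Y -> J `<=` A -> T `<=` Y -> J `<=` P2 -> T `<=` P `|` P2 ->
  {within I01 `*` Y, continuous De} -> {within I01 `*` Y, continuous Co} ->
  {within I01 `*` T, continuous Re} ->
  (forall y, Y y -> De (0, y) = y) -> (forall y, Y y -> Co (0, y) = y) ->
  (forall y, T y -> Re (0, y) = Co (1, y)) ->
  (forall t y, 0 <= t <= 1 -> Y y -> Y (De (t, y))) ->
  (forall t y, 0 <= t <= 1 -> A y -> A (De (t, y))) ->
  (forall t y, 0 <= t <= 1 -> T y -> T (De (t, y))) ->
  (forall t y, 0 <= t <= 1 -> J y -> J (De (t, y))) ->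
  (forall y, Y y -> T (De (1, y))) -> (forall y, A y -> J (De (1, y))) ->
  (forall t y, 0 <= t <= 1 -> Y y -> Y (Co (t, y))) ->
  (forall t y, 0 <= t <= 1 -> A y -> A (Co (t, y))) ->
  (forall t y, 0 <= t <= 1 -> T y -> Y (Re (t, y))) ->
  (forall y, J y -> Re (1, y) = Co (1, y)) ->
  (forall y, P2 y -> J (Re (1, y))) -> P2 `<=` T ->
  closed P -> closed P2 -> {within P, continuous xi} ->
  (forall y, P y -> disk (xi y)) -> (forall y, P y -> E (xi y) = Re (1, y)) ->
  (forall y, P y -> P2 y -> sphere (xi y)) ->
  {within @disk R l, continuous E} ->
  (forall x, disk x -> T (E x)) -> (forall x, disk x -> P (E x)) ->
  (forall x, disk x -> xi (E x) = x) -> (forall x, sphere x -> J (E x)) ->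
  (forall t x, 0 <= t <= 1 -> sphere x -> Co (t, E x) = E x) ->
  cell_attached R (set_type Y) (set_type A) l.
Proof.
move=> AY JA TY JP2 TPP2 cDe cCo cRe De0 Co0 Re0 DeY DeA DeT DeJ De1T De1J
  CoY CoA ReY ReJ ReP2 P2T cP cP2 cxi xid xiE xis cE ET EP xiEx EJ CoE.
have I0 : I01 0 by rewrite /= lexx ler01.
have I1 : I01 1 by rewrite /= lexx ler01.
have sphere_disk (x : 'rV[R]_l) : sphere x -> disk x by rewrite /sphere /disk /= => ->.
have phiP (x : set_type (@sphere R l)) : A (E (set_val x)).
  exact: JA _ (EJ _ (set_typeP x)).
pose phi : set_type (@sphere R l) -> set_type A := corestr phiP.
have cphi : continuous phi.
  apply: corestr_continuous; apply: within_set_type.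
  exact: continuous_subspaceW cE.
exists phi; split => //.
pose adj := adjunction_space phi.
have d0P : disk (0 : 'rV[R]_l) by rewrite /disk /= enorm0.
pose d0 : set_type (@disk R l) := exist _ 0 (mem_set d0P).
(* Extensions of the two canonical maps to the ambient types; the value at [d0] outside the disk or
   outside [A] is a placeholder. *)
pose inD (x : 'rV[R]_l) : adj := if pselect (disk x) is left h
  then adjD phi (exist _ x (mem_set h)) else adjD phi d0.
pose inA (y : V) : adj := if pselect (A y) is left h
  then adjA phi (exist _ y (mem_set h)) else adjD phi d0.
have inDE (x : set_type (@disk R l)) : inD (set_val x) = adjD phi x.
  rewrite /inD; case: pselect => [h|[]]; last exact: set_typeP.
  by congr (adjD phi _); exact: val_inj.
have inAE (x : set_type A) : inA (set_val x) = adjA phi x.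
  rewrite /inA; case: pselect => [h|[]]; last exact: set_typeP.
  by congr (adjA phi _); exact: val_inj.
have cinD : {within @disk R l, continuous inD}.
  apply/subspace_sigL_continuousP.
  rewrite (_ : sigL _ _ = adjD phi); first exact: adjD_continuous.
  by apply/funext => x; rewrite -inDE.
have cinA : {within A, continuous inA}.
  apply/subspace_sigL_continuousP.
  rewrite (_ : sigL _ _ = adjA phi); first exact: adjA_continuous.
  by apply/funext => x; rewrite -inAE.
have glue (x : 'rV[R]_l) : sphere x -> inD x = inA (E x).
  move=> sx.
  pose xs : set_type (@sphere R l) := exist _ x (mem_set sx).
  pose xd : set_type (@disk R l) := exist _ x (mem_set (sphere_disk _ sx)).
  have -> : inD x = adjD phi xd by rewrite -inDE.
  rewrite (@adj_glue _ _ _ phi xs xd)//.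
  by rewrite -inAE.
(* On the overlap of [P] and [P2] the coordinate [xi] lies on the sphere, where [glue] identifies
   the two branches. *)
pose g1 (y : V) : adj := if pselect (P y) then inD (xi y) else inA (Re (1, y)).
have cRe1 : {within T, continuous (fun y => Re (1, y))}.
  apply: (@within_comp _ _ _ _ (I01 `*` T) (fun y => (1 : R, y)) Re) => //.
  apply: continuous_subspaceT; apply: pair_continuous; first exact: cst_continuous.
  by move=> ?; exact: cvg_id.
have cg1 : {within T, continuous g1}.
  have : {within P `|` P2, continuous g1}.
    apply: withinU_continuous => //.
      apply: (@eq_within _ _ _ (inD \o xi)).
        by move=> y Py; rewrite /g1; case: pselect.
      exact: within_comp xid cxi cinD.
    apply: (@eq_within _ _ _ (inA \o (fun y => Re (1, y)))).
      move=> y P2y; rewrite /g1; case: pselect => //= Py.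
      by rewrite glue ?xiE//; exact: xis.
    apply: within_comp cinA => [y P2y|]; first exact: JA _ (ReP2 _ P2y).
    exact: continuous_subspaceW cRe1.
  exact: continuous_subspaceW.
have De1YT (y : set_type Y) : T (De (1, set_val y)) by exact: De1T _ (set_typeP y).
have cDe1 : {within Y, continuous (fun y => De (1, y))}.
  apply: (@within_comp _ _ _ _ (I01 `*` Y) (fun y => (1 : R, y)) De) => //.
  apply: continuous_subspaceT; apply: pair_continuous; first exact: cst_continuous.
  by move=> ?; exact: cvg_id.
pose g (y : set_type Y) : adj := g1 (De (1, set_val y)).
have cg : continuous g.
  apply: (@within_set_type _ _ Y (fun y => g1 (De (1, y)))).
  exact: (within_comp De1T cDe1 cg1).
have hAP (a : set_type A) : Y (set_val a) by exact: AY _ (set_typeP a).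
have hDP (x : set_type (@disk R l)) : Y (E (set_val x)) by exact: TY _ (ET _ (set_typeP x)).
have [||x y xy|h ch [hA hD]] := @adj_lift R (set_type A) l phi (set_type Y) (corestr hAP) (corestr hDP).
- by apply: corestr_continuous; exact: set_val_continuous.
- by apply: corestr_continuous; exact: within_set_type.
- by apply: set_val_inj; rewrite ?corestrE /= -xy.
have hg1 y : T y -> set_val (h (g1 y)) = Re (1, y).
  move=> Ty; rewrite /g1; case: pselect => Py.
    have dx := xid _ Py; rewrite (_ : inD _ = adjD phi (exist _ (xi y) (mem_set dx))).
      by rewrite hD; exact: xiE.
    by rewrite -inDE.
  have P2y : P2 y by case: (TPP2 _ Ty).
  have Ay : A (Re (1, y)) by exact: JA _ (ReP2 _ P2y).
  rewrite (_ : inA _ = adjA phi (exist _ (Re (1, y)) (mem_set Ay))); first by rewrite hA.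
  by rewrite -inAE.
(* The composite on [Y] is [Re (1, De (1, y))]; it is joined to the identity by running [Re], [Co]
   and [De] backwards in turn. *)
exists g, h; do 2 split => //; split.
  pose De1 : set_type Y -> set_type Y := corestr (fun y => TY _ (De1YT y)).
  have CoDe1P (y : set_type Y) : Y (Co (1, De (1, set_val y))).
    by apply: CoY => //; exact: TY _ (De1YT y).
  have ReDe1P (y : set_type Y) : Y (Re (1, De (1, set_val y))).
    by apply: ReY.
  have -> : h \o g = corestr ReDe1P.
    by apply/funext => y; apply: set_val_inj; exact: hg1 _ (De1YT y).
  have cDe1' : continuous (fun y : set_type Y => De (1, set_val y)).
    exact: within_set_type cDe1.
  have cId1 : continuous (fun p : (I * set_type Y)%type => (set_val p.1, De (1, set_val p.2))).
    apply: pair_continuous => p.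
      by apply: (@continuous_comp_fst _ _ _ set_val); exact: set_val_continuous.
    by apply: (@continuous_comp_snd _ _ _ (fun y : set_type Y => De (1, set_val y))); exact: cDe1'.
  apply: (@homotopic_trans _ _ _ _ (corestr CoDe1P)).
    apply: homotopic_sym.
    have KP (p : (I * set_type Y)%type) : Y (Re (set_val p.1, De (1, set_val p.2))).
      by apply: ReY => //; exact: set_typeP p.1.
    apply: (@homotopic_eq0 R _ _ (corestr KP)).
    - apply: corestr_continuous.
      have pP (p : (I * set_type Y)%type) : (I01 `*` T) (set_val p.1, De (1, set_val p.2)).
        by split => //=; exact: set_typeP p.1.
      move=> p; apply: (@continuous_comp _ _ _ (corestr pP) (fun q => Re (set_val q))).
        exact: corestr_continuous cId1 _.
      exact: within_set_type.
    - by move=> t y t0; apply: set_val_inj; rewrite ?corestrE /= t0 Re0.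
    - by move=> t y t0; apply: set_val_inj; rewrite ?corestrE /= t0.
  apply: homotopic_sym; apply: (@homotopic_trans _ _ _ _ De1).
    have KP (p : (I * set_type Y)%type) : Y (De (set_val p.1, set_val p.2)).
      by exact: DeY _ _ (set_typeP p.1) (set_typeP p.2).
    apply: (@homotopic_eq0 R _ _ (corestr KP)).
    - by apply: corestr_continuous; exact: within_unit_interval.
    - by move=> t y t0; apply: set_val_inj; rewrite ?corestrE /= t0 De0//; exact: set_typeP y.
    - by move=> t y t0; apply: set_val_inj; rewrite ?corestrE /= t0.
  have KP (p : (I * set_type Y)%type) : Y (Co (set_val p.1, De (1, set_val p.2))).
    by apply: CoY; [exact: set_typeP p.1|exact: TY _ (De1YT p.2)].
  apply: (@homotopic_eq0 R _ _ (corestr KP)).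
  - apply: corestr_continuous.
    have pP (p : (I * set_type Y)%type) : (I01 `*` Y) (set_val p.1, De (1, set_val p.2)).
      by split => //=; [exact: set_typeP p.1|exact: TY _ (De1YT p.2)].
    move=> p; apply: (@continuous_comp _ _ _ (corestr pP) (fun q => Co (set_val q))).
      exact: corestr_continuous cId1 _.
    exact: within_set_type.
  - by move=> t y t0; apply: set_val_inj; rewrite ?corestrE /= t0 Co0//; exact: TY _ (De1YT y).
  - by move=> t y t0; apply: set_val_inj; rewrite ?corestrE /= t0.
have g1J y : J y -> g1 y = inA (Co (1, y)).
  move=> Jy; rewrite /g1; case: pselect => Py; last by rewrite ReJ.
  by rewrite glue ?xiE ?ReJ//; apply: xis => //; exact: JP2.
have g1E x : disk x -> g1 (E x) = inD x.
  by move=> dx; rewrite /g1; case: pselect => [?|[]]; [rewrite xiEx|exact: EP].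
have Co1A (a : set_type A) : A (Co (1, set_val a)).
  by exact: CoA _ _ I1 (set_typeP a).
have cCoA : {within I01 `*` A, continuous Co}.
  by apply: continuous_subspaceW cCo => -[t y] [t01 Ay]; split => //; exact: AY.
have cDeA : {within I01 `*` A, continuous De}.
  by apply: continuous_subspaceW cDe => -[t y] [t01 Ay]; split => //; exact: AY.
have cDeT : {within I01 `*` T, continuous De}.
  by apply: continuous_subspaceW cDe => -[t y] [t01 Ay]; split => //; exact: TY.
have CoP (p : (I * set_type A)%type) : A (Co (set_val p.1, set_val p.2)).
  by exact: CoA _ _ (set_typeP p.1) (set_typeP p.2).
(* First half on the adjunction space: [Co] moves [A] while the disk stands still. The pieces match
   because [Co] fixes the attaching sphere. *)
have [||t x y xy|K1 cK1 [K1A K1D]] := @adj_lift_homotopy R (set_type A) l phi adj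
  (fun p => adjA phi (corestr CoP p)) (fun p => adjD phi p.2).
- move=> p; apply: continuous_comp; last exact: adjA_continuous.
  by apply: corestr_continuous; exact: within_unit_interval.
- by apply: continuous_comp_snd; exact: adjD_continuous.
- rewrite (@adj_glue _ _ _ phi x y)//; congr (adjA phi _); apply: set_val_inj.
  by symmetry; exact: CoE _ _ (set_typeP t) (set_typeP x).
have DeP (p : (I * set_type A)%type) : A (Co (1, De (set_val p.1, set_val p.2))).
  by exact: CoA _ _ I1 (DeA _ _ (set_typeP p.1) (set_typeP p.2)).
(* Second half: [De] is run on both pieces, read through [Co (1, _)] on [A] and through [g1] on the
   disk. Along the sphere [De] stays in [J], where the two readings agree by [g1J]. *)
have [||t x y xy|K2 cK2 [K2A K2D]] := @adj_lift_homotopy R (set_type A) l phi adj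
  (fun p => adjA phi (corestr DeP p)) (fun p => g1 (De (set_val p.1, E (set_val p.2)))).
- move=> p; apply: continuous_comp; last exact: adjA_continuous.
  apply: corestr_continuous.
  apply: (@within_unit_interval _ _ _ _ (fun q => Co (1, De q))).
  apply: (@within_comp _ _ _ _ (I01 `*` A) (fun q => (1 : R, De q)) Co) => //.
    by move=> [t y] [t01 Ay]; split => //=; exact: DeA.
  apply/subspace_sigL_continuousP; apply: pair_continuous; first exact: cst_continuous.
  exact: within_set_type.
- apply: (@within_unit_interval _ _ _ _ (fun q => g1 (De (q.1, E q.2)))).
  apply: (@within_comp _ _ _ _ T (fun q => De (q.1, E q.2)) g1) => //.
    by move=> [t y] [t01 dy]; apply: DeT => //; exact: ET.
  apply: (@within_comp _ _ _ _ (I01 `*` T) (fun q => (q.1, E q.2)) De) => //.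
    by move=> [t y] [t01 dy]; split => //; exact: ET.
  apply/subspace_sigL_continuousP.
  apply: pair_continuous => p.
    by apply: (@continuous_comp _ _ _ set_val fst); [exact: set_val_continuous|exact: cvg_fst].
  have p2P (q : set_type (I01 `*` @disk R l)) : disk (set_val q).2 by have [] := set_typeP q.
  apply: (@continuous_comp _ _ _ (corestr p2P) (fun x => E (set_val x))).
    apply: corestr_continuous => q.
    by apply: (@continuous_comp _ _ _ set_val snd); [exact: set_val_continuous|exact: cvg_snd].
  exact: within_set_type.
- have sx : sphere (set_val x) by exact: set_typeP x.
  rewrite /= g1J; last by apply: DeJ; [exact: set_typeP t|rewrite -xy; exact: EJ].
  by rewrite -xy -(inAE (corestr DeP (t, phi x))).
apply: homotopic_sym.
apply: (@homotopic_trans _ _ _ _ (fun q => K1 (exist _ 1 (mem_set I1), q))).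
  apply: (@homotopic_eq0 R _ _ K1) => //.
  - move=> t q t0; have [[a ->]|[x ->]] := adj_ind q; last by rewrite K1D.
    rewrite K1A; congr (adjA phi _); apply: set_val_inj.
    by rewrite corestrE -[LHS]/(Co (set_val t, set_val a)) t0 Co0//; exact: AY _ (set_typeP a).
  - move=> t q t1; congr (K1 (_, _)); exact: val_inj.
apply: (@homotopic_eq0 R _ _ K2) => //.
  move=> t q t0; have [[a ->]|[x ->]] := adj_ind q.
    rewrite K2A K1A; congr (adjA phi _); apply: set_val_inj.
    rewrite !corestrE -[LHS]/(Co (1, De (set_val t, set_val a))) t0 De0//.
  rewrite K2D K1D -[LHS]/(g1 (De (set_val t, E (set_val x)))) t0 De0; last exact: TY _ (ET _ (set_typeP x)).
  by rewrite g1E; [rewrite inDE|exact: set_typeP x].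
move=> t q t1; have [[a ->]|[x ->]] := adj_ind q; rewrite -[RHS]/(g (h _)) ?hA ?hD.
  rewrite K2A -[RHS]/(g1 (De (1, set_val a))) (g1J _ (De1J _ (set_typeP a))).
  by rewrite -(inAE (corestr DeP (t, a))) corestrE -[LHS]/(inA (Co (1, De (set_val t, set_val a)))) t1.
by rewrite K2D -[LHS]/(g1 (De (set_val t, E (set_val x)))) t1.
Qed.

End Criterion.

Section Differentiability.
Variable R : realType.

Definition dotl m (g : 'rV[R]_m) (h : 'rV[R]_m) : R^o := dotp g h.

Lemma dotl_is_linear m (g : 'rV[R]_m) : linear (dotl g).
Proof. by move=> a u v; rewrite /dotl dotpDr dotpZr. Qed.

HB.instance Definition _ m (g : 'rV[R]_m) :=
  GRing.isLinear.Build R 'rV[R]_m R^o _ (dotl g) (dotl_is_linear g).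

Lemma differentiable_grad m (phi : 'rV[R]_m -> R) (y g : 'rV[R]_m) :
  (forall e : R, 0 < e -> exists2 r : R, 0 < r & forall h, enorm h < r ->
    `|phi (y + h) - phi y - dotp g h| <= e * enorm h) ->
  differentiable phi y /\ grad phi y = g.
Proof.
move=> phig.
have cdf : continuous (dotl g).
  move=> z A /nbhs_ballP[e /= e0 eA].
  apply/nbhs_enormP; exists (e / (enorm g + 1)).
    by apply: divr_gt0 => //; apply: ltr_wpDl.
  move=> z' zz'; apply: eA; rewrite -ball_normE/= distrC /dotl -dotpBr.
  rewrite (le_lt_trans (normr_dotp _ _))//.
  rewrite ltr_pdivlMr ?ltr_wpDl// in zz'.
  by apply: le_lt_trans zz'; rewrite mulrC ler_wpM2l// lerDl.
have phio : phi \o shift y = cst (phi y : R^o) + dotl g +o_ (0 : 'rV[R]_m) id.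
  apply/eqaddoP => e e0.
  have m0 : 0 < m.+1%:R :> R by [].
  have [r r0 h] := phig (e / m.+1%:R) (divr_gt0 e0 m0).
  apply/nbhs_enormP; exists r => // z; rewrite subr0 => /h /=.
  rewrite !fctE /= => hz.
  rewrite (_ : phi (z + y) - (phi y + dotl g z) = phi (y + z) - phi y - dotp g z); last first.
    by rewrite /dotl (addrC z y); ring.
  rewrite (le_trans hz)// -mulrA ler_wpM2l ?(ltW e0)//.
  rewrite ler_pdivrMl// (le_trans (enorm_le_norm _))//.
  by rewrite ler_wpM2r// ler_nat.
have dE := diff_unique cdf phio.
have dy : differentiable phi y by apply/diff_locallyP; rewrite dE.
split => //; apply/rowP => i; rewrite mxE /pderiv deriveE// dE /dotl.
rewrite [LHS]/(dotp g _) /dotp (bigD1 i)//= big1 ?addr0 ?mxE ?eqxx ?mulr1//.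
by move=> j ji; rewrite /evec mxE (negPf ji) andbF mulr0.
Qed.

(** After squaring, the slack is a perfect square. The upper bound alone serves both sides of a
    distance function, since a lower bound on the distance to a set is an upper bound on the
    distance to an outer centre. *)
Lemma enorm_expand m (u h : 'rV[R]_m) : u != 0 ->
  enorm (u + h) <= enorm u + dotp u h / enorm u + enorm h ^+ 2 / (2 * enorm u).
Proof.
move=> u0; have up : 0 < enorm u by rewrite enorm_gt0.
have := dotp_ge_enorm u h.
set p := enorm u in up *; set q := enorm h => cs.
have q0 : 0 <= q by exact: enorm_ge0.
have c0 : - q <= dotp u h / p by rewrite ler_pdivlMr// mulNr mulrC.
have e0 : p + - q + q ^+ 2 / (2 * p) >= 0.
  have : 0 <= (p - q) ^+ 2 + p ^+ 2 by rewrite addr_ge0// sqr_ge0.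
  rewrite (_ : (p - q) ^+ 2 + p ^+ 2 = (p + - q + q ^+ 2 / (2 * p)) * (2 * p)).
    by rewrite pmulr_lge0// mulr_gt0.
  by field; rewrite gt_eqF.
set t := dotp u h / p in c0 *.
have t0 : 0 <= p + t + q ^+ 2 / (2 * p) by lra.
rewrite ler_enorm// dotp_addsq -!enorm_sqr -/p -/q.
have -> : dotp u h = t * p by rewrite /t divfK// gt_eqF.
have -> : (p + t + q ^+ 2 / (2 * p)) ^+ 2 =
   p ^+ 2 + 2 * (t * p) + q ^+ 2 + (t + q ^+ 2 / (2 * p)) ^+ 2.
  by field; rewrite gt_eqF.
by rewrite lerDl sqr_ge0.
Qed.

End Differentiability.

(** * Distance functions and proximal normals *)

Section Distance.
Variables (R : realType) (m : nat).
Implicit Types (A : set 'rV[R]_m) (x y z a b : 'rV[R]_m).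

Lemma dist_set_le A x a : A a -> dist_set A x <= enorm (x - a).
Proof.
move=> Aa; apply: ge_inf; last by exists a.
by exists 0 => _ [b _ <-]; exact: enorm_ge0.
Qed.

Lemma dist_set_ge A x (c : R) : A !=set0 ->
  (forall a, A a -> c <= enorm (x - a)) -> c <= dist_set A x.
Proof.
move=> [a Aa] h; apply: lb_le_inf; first by exists (enorm (x - a)); exists a.
by move=> _ [b Ab <-]; exact: h.
Qed.

Lemma dist_set_ge0 A x : 0 <= dist_set A x.
Proof.
have [->|/set0P A0] := eqVneq A set0; last first.
    by apply: dist_set_ge => // a _; exact: enorm_ge0.
by rewrite /dist_set image_set0 inf0.
Qed.

Lemma dist_set_mem A x : A x -> dist_set A x = 0.
Proof.
move=> Ax; apply/eqP; rewrite eq_le dist_set_ge0 andbT.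
by rewrite (le_trans (dist_set_le x Ax))// subrr enorm0.
Qed.

Lemma dist_setD A x y : A !=set0 -> dist_set A y <= dist_set A x + enorm (y - x).
Proof.
move=> A0; rewrite -lerBlDr; apply: dist_set_ge => // a Aa.
by have := dist_set_le y Aa; have := enorm_triangle y x a; lra.
Qed.

Lemma dist_set_lip A x y : A !=set0 ->
  `|dist_set A y - dist_set A x| <= 1 * enorm (y - x).
Proof.
move=> A0; rewrite mul1r ler_norml.
by have := dist_setD x y A0; have := dist_setD y x A0; rewrite (enormB x); lra.
Qed.

Lemma dist_set_attained A x : closed A -> A !=set0 ->
  exists2 a, A a & enorm (x - a) = dist_set A x.
Proof.
move=> cA A0; have [a0 Aa0] := A0.
pose K := A `&` [set z | enorm (z - x) <= enorm (a0 - x)].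
have cK : compact K.
  rewrite /K setIC; apply: compact_closedI_enorm => //.
  exact: compact_enorm_le.
have [||a [Aa aa0] ha] := @compact_min _ _ K (fun z => enorm (x - z)) cK.
- by exists a0; split => //=.
- apply: (@lipschitz_rcontinuous_on _ _ _ _ 1) => y z _ _; rewrite mul1r.
  by rewrite (le_trans (enorm_lip _ _))// opprB addrC addrA subrK enormB.
exists a => //; apply/eqP; rewrite eq_le dist_set_le// andbT.
apply: dist_set_ge => // b Ab.
have [bx|/ltW bx] := leP (enorm (b - x)) (enorm (a0 - x)); first exact: ha.
by rewrite (enormB x a) (enormB x b) (le_trans aa0).
Qed.

Lemma dist_set_gt0 A x : closed A -> A !=set0 -> ~ A x -> 0 < dist_set A x.
Proof.
move=> cA A0 Ax; rewrite lt_def dist_set_ge0 andbT; apply/eqP => d0.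
have [a Aa] := dist_set_attained x cA A0; rewrite d0 => /eqP.
by rewrite enorm_eq0 subr_eq0 => /eqP xa; apply: Ax; rewrite xa.
Qed.

(** By compactness the almost nearest points of [A] still see [e] at nearly the rate [th]; the
    remaining points are too far away to matter for a small step. Half of the gap between [th] and
    [th'] pays for each loss. *)
Lemma dist_set_step A z e (th th' : R) : closed A -> A !=set0 ->
  0 < dist_set A z -> enorm e <= 1 -> 0 <= th' < th ->
  (forall a, A a -> enorm (z - a) = dist_set A z ->
     th * dist_set A z <= dotp (z - a) e) ->
  exists2 s0 : R, 0 < s0 & forall s, 0 < s < s0 ->
    dist_set A z + th' * s <= dist_set A (z + s *: e).
Proof.
move=> cA A0; set d := dist_set A z => d0 e1 /andP[th'0 thth] hnear.
pose t := (th - th') / 2; have t0 : 0 < t by rewrite /t; lra.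
have [rho rho0 hrho] : exists2 rho : R, 0 < rho & forall b,
    (A `&` [set b | enorm (b - z) <= d + 1]) b ->
    enorm (z - b) <= d + rho -> (th - t) * d <= dotp (z - b) e.
  apply: (@compact_unif _ _ _ (fun b r => enorm (z - b) <= d + r -> _)).
  - rewrite setIC; apply: compact_closedI_enorm => //.
    exact: compact_enorm_le.
  - by move=> b r r' h /andP[_ rr'] h'; apply: h; lra.
  move=> b [Ab _]; have := dist_set_le z Ab; rewrite -/d le_eqVlt => /predU1P[db|db].
    exists (t * d); first by rewrite mulr_gt0.
    move=> b' _ bb' _; have := hnear _ Ab (esym db).
    have := dotp_ge_enorm (b - b') e; rewrite (enormB b b') => cs.
    have -> : z - b' = (z - b) + (b - b') by rewrite addrA subrK.
    have : enorm (b' - b) * enorm e <= enorm (b' - b) by rewrite ler_piMr.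
    by rewrite (dotpDl (z - b)) mulrBl; lra.
  exists ((enorm (z - b) - d) / 2); first by lra.
  move=> b' _ bb' h; have := enorm_triangle z b' b; lra.
pose r1 := Num.min rho 1.
have r10 : 0 < r1 by rewrite lt_min rho0 ltr01.
pose c := th' ^+ 2 + 1; have c0 : 0 < c by rewrite /c ltr_wpDl// sqr_ge0.
pose s0 := Num.min (r1 / (1 + th')) (2 * t * d / c).
exists s0 => [|s /andP[sp]].
  by rewrite lt_min !divr_gt0 ?mulr_gt0//; lra.
rewrite lt_min ltr_pdivlMr ?ltr_wpDr// ltr_pdivlMr// => /andP[s1 s2].
apply: dist_set_ge => // b Ab.
have [zb|zb] := leP (enorm (z - b)) (d + r1); last first.
  have := enorm_lb (z - b) (s *: e); rewrite enormZ gtr0_norm// addrAC => h.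
  by have := enorm_ge0 e; nra.
have r1rho : r1 <= rho by rewrite /r1 ge_min lexx.
have r11 : r1 <= 1 by rewrite /r1 ge_min lexx orbT.
have := hrho b; rewrite /= (enormB b z) => /(_ _ _)/wrap[||].
- by split => //; lra.
- by lra.
move=> hb; rewrite ger_enorm; last by rewrite addr_ge0// ?mulr_ge0// ltW.
rewrite addrAC dotp_addsq dotpZr dotpZl dotpZr.
have := dist_set_le z Ab; rewrite -/d => dzb.
have dd : d ^+ 2 <= dotp (z - b) (z - b).
  by rewrite -enorm_sqr ler_sqr ?nnegrE// ltW.
have := dotp_ge0 e => ee.
have h2 : s * ((th - t) * d) <= s * dotp (z - b) e by rewrite ler_wpM2l// ltW.
have h3 : 0 <= s * (s * dotp e e) by rewrite !mulr_ge0// ltW.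
have h4 : th' ^+ 2 * s <= 2 * t * d by rewrite (le_trans _ (ltW s2))// mulrC ler_wpM2l ?ltW// /c; lra_with.
have h5 : s * (th' ^+ 2 * s) <= s * (2 * t * d) by rewrite ler_wpM2l// ltW.
have -> : (d + th' * s) ^+ 2 = d ^+ 2 + 2 * (s * (th' * d)) + s * (th' ^+ 2 * s) by ring.
have e3 : s * ((th - t) * d) = s * (th' * d) + s * (t * d) by rewrite /t; field.
have e4 : s * (2 * t * d) = 2 * (s * (t * d)) by ring.
by lra_with dd h2 h3 h5 e3.
Qed.

(* Ekeland's principle for the distance function: if the distance can be
   increased at rate more than k everywhere near y, the maximum of
   dist - k |. - y| over a ball is attained on its boundary. *)
Lemma dist_set_ascent A y (rho k : R) : A !=set0 -> 0 < rho -> 0 < k ->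
  (forall z, enorm (z - y) < rho ->
     dist_set A y + k * enorm (z - y) <= dist_set A z ->
     exists e (k' s0 : R), [/\ enorm e <= 1, k < k', 0 < s0 &
       forall s, 0 < s < s0 -> dist_set A z + k' * s <= dist_set A (z + s *: e)]) ->
  exists2 z, enorm (z - y) = rho & dist_set A y + k * rho <= dist_set A z.
Proof.
move=> A0 rho0 k0 hstep.
pose phi z := dist_set A z - k * enorm (z - y).
have [|||z /= zrho hz] := @compact_max _ _ [set z | enorm (z - y) <= rho] phi.
- exact: compact_enorm_le.
- by exists y; rewrite /= subrr enorm0 ltW.
- apply: (@lipschitz_rcontinuous_on _ _ _ _ (1 + k)) => z z' _ _.
  have := dist_set_lip z z' A0; have := enorm_lip (z' - y) (z - y).
  rewrite opprB addrA subrK !ler_norml /phi => /andP[h1 h2] /andP[h3 h4].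
  by apply/andP; split; nra.
have hyz : dist_set A y + k * enorm (z - y) <= dist_set A z.
  have := hz y; rewrite /phi/= subrr enorm0 => /(_ (ltW rho0)); lra.
move: zrho; rewrite le_eqVlt => /predU1P[zrho|zrho]; first by exists z; rewrite -?zrho.
have [e [k' [s0 [e1 kk' s00 hs]]]] := hstep _ zrho hyz.
pose s := Num.min (s0 / 2) (rho - enorm (z - y)).
have sp : 0 < s by rewrite lt_min; apply/andP; split; lra.
have ss0 : s < s0 by rewrite (@le_lt_trans _ _ (s0 / 2)) ?ge_min ?lexx//; lra.
have srho : s <= rho - enorm (z - y) by rewrite ge_min lexx orbT.
have := hs s; rewrite sp ss0 => /(_ isT) h1.
have h2 : enorm (z + s *: e - y) <= enorm (z - y) + s.
  rewrite addrAC (le_trans (enormD _ _))// lerD2l enormZ gtr0_norm//.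
  by have := enorm_ge0 e; nra.
have := hz (z + s *: e); rewrite /phi/= => /(_ _)/wrap[|h3]; first by lra.
have h4 : 0 < (k' - k) * s by rewrite mulr_gt0 ?subr_gt0.
have h5 : k * enorm (z + s *: e - y) <= k * (enorm (z - y) + s) by rewrite ler_wpM2l// ltW.
exfalso; lra_with h1 h3 h4 h5.
Qed.

End Distance.

(** * Tangent balls from positive reach *)

Section ProximalNormals.
Variables (R : realType) (m : nat).
Implicit Types (A X : set 'rV[R]_m) (x y z a b n : 'rV[R]_m) (r : R).

(* For a unit vector n: the open ball of radius r tangent to A at a in the
   direction n does not meet A. *)
Definition proxnor r A a n :=
  forall b, A b -> 2 * r * dotp n (b - a) <= dotp (b - a) (b - a).

Lemma not_proxnor_near r A a n : 0 < r -> ~ proxnor r A a n ->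
  exists2 s : R, 0 < s & forall a' n', enorm (a' - a) < s -> enorm (n' - n) < s ->
    ~ proxnor r A a' n'.
Proof.
move=> r0 /existsNP[b /not_implyP[Ab /negP]]; rewrite -ltNge => hb.
set D := 2 * r * dotp n (b - a) - dotp (b - a) (b - a).
have D0 : 0 < D by rewrite subr_gt0.
pose B := enorm (b - a) + 1.
have B1 : 1 <= B by rewrite /B; have := enorm_ge0 (b - a); lra.
pose C := 2 * r * (B + enorm n) + 2 * B.
have C0 : 0 < C.
  have : 0 <= r * enorm n by rewrite mulr_ge0// ltW.
  have : 0 < r * B by rewrite mulr_gt0//; lra.
  by rewrite /C; lra.
exists (Num.min 1 (D / (4 * C))).
  by rewrite lt_min ltr01 divr_gt0// mulr_gt0.
move=> a' n'; rewrite !lt_min !ltr_pdivlMr ?mulr_gt0//.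
move=> /andP[a1 a2] /andP[n1 n2] /(_ _ Ab); apply/negP; rewrite -ltNge.
have -> : b - a' = (b - a) - (a' - a) by rewrite opprB addrA subrK.
set u := b - a; set v := a' - a in a1 a2 *.
have -> : n' = n + (n' - n) by rewrite addrC subrK.
set w := n' - n in n1 n2 *.
rewrite dotp_subsq dotpDl !(dotpBr u v).
have uB : enorm u <= B by rewrite /B lerDl.
have h1 := dotp_le_enorm n v; have h2 := dotp_ge_enorm w u.
have h3 := dotp_le_enorm w v; have h4 := dotp_ge_enorm u v.
have h5 : enorm w * enorm u <= enorm w * B by rewrite ler_wpM2l.
have h6 : enorm w * enorm v <= enorm w * 1 by rewrite ler_wpM2l// ltW.
have h7 : enorm u * enorm v <= B * enorm v by rewrite ler_wpM2r.
have h8 : dotp v v <= enorm v.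
  by rewrite -enorm_sqr expr2 ler_piMl// ltW.
have hD : dotp u u = 2 * r * dotp n u - D by rewrite /D -/u; lra_with.
rewrite hD.
have e1 : r * dotp n v <= r * (enorm n * enorm v) by rewrite ler_wpM2l// ltW.
have e2 : r * dotp w v <= r * (enorm w * B).
  rewrite ler_wpM2l ?(ltW r0)// (le_trans h3)// ler_wpM2l//; lra_with B1 a1.
have e3 : r * (- (enorm w * B)) <= r * dotp w u.
  by rewrite ler_wpM2l ?(ltW r0)//; lra_with h2 h5.
have e5 : enorm v <= B * enorm v by rewrite ler_peMl.
have a3 : r * (enorm n * enorm v) * 2 + 3 * (B * enorm v) <= enorm v * C * (3/2).
  rewrite /C; have : 0 <= r * (B * enorm v) by rewrite !mulr_ge0//; lra_with B1 r0.
  have : 0 <= r * (enorm n * enorm v) by rewrite !mulr_ge0//; lra_with r0.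
  by lra_with.
have n3 : r * (enorm w * B) * 4 <= enorm w * C * 2.
  rewrite /C; have : 0 <= B * enorm w by rewrite mulr_ge0//; lra_with B1.
  have : 0 <= r * (enorm n * enorm w) by rewrite !mulr_ge0//; lra_with r0.
  by lra_with.
by lra_with D0 a2 n2 h4 h7 h8 e1 e2 e3 e5 a3 n3.
Qed.

Lemma closed_compl_set X : closed (compl_set X).
Proof. exact: closed_closure. Qed.

Lemma notin_compl_set X y : ~ compl_set X y -> X y.
Proof. by move=> h; apply: contrapT => Xy; apply: h; exact: subset_closure. Qed.

Lemma interior_notin_compl_set X y : interior X y -> ~ compl_set X y.
Proof.
move=> /interiorP_enorm[e e0 h] /closureP_enorm/(_ _ e0)[z Xz zy].
exact/Xz/h.
Qed.

Definition unique_proj (Rr : R) A :=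
  forall x, dist_set A x < Rr -> exists! a, A a /\ enorm (x - a) = dist_set A x.

Lemma reach_unique_proj A : (0 < reach A)%E -> exists2 Rr, 0 < Rr & unique_proj Rr A.
Proof.
by move=> /ereal_sup_gt[_ [t [t0 ht] <-]]; rewrite lte_fin => tp; exists t.
Qed.

Lemma proxnor_ball r A a n b : 0 < r -> enorm n = 1 -> proxnor r A a n -> A b ->
  r <= enorm (a + r *: n - b).
Proof.
move=> r0 n1 h Ab; rewrite ger_enorm ?(ltW r0)//.
have -> : a + r *: n - b = r *: n - (b - a) by rowring.
rewrite dotp_subsq !dotpZl !dotpZr unit_dotp// mulr1 expr2.
by have := h _ Ab; lra.
Qed.

(* Uniqueness of projections extends the segment from a to y up to length r:
   maximize the distance to A on the sphere of radius r - |y - a| around y;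
   the equality case of the triangle inequality locates the maximum. *)
Lemma proxnor_of_proj (Rr r : R) A y a : closed A -> unique_proj Rr A ->
  0 < dist_set A y <= r -> r < Rr -> A a -> enorm (y - a) = dist_set A y ->
  proxnor r A a ((dist_set A y)^-1 *: (y - a)).
Proof.
move=> cA uA; set d := dist_set A y => /andP[d0 dr] rRr Aa yad.
have A0 : A !=set0 by exists a.
have r0 : 0 < r by lra.
suff [z [zy dz]] : exists z, enorm (z - y) = r - d /\ r <= dist_set A z.
  have za : r <= enorm (z - a) by rewrite (le_trans dz)// dist_set_le.
  have zE : d *: (z - y) = (r - d) *: (y - a).
    apply/eqP; rewrite -subr_eq0 -enorm_eq0 -sqrf_eq0 enorm_sqr dotp_subsq.
    rewrite !dotpZl !dotpZr -!enorm_sqr zy yad eq_le -[X in _ && X]/(0 <= _).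
    apply/andP; split; last first.
      have := dotp_ge0 (d *: (z - y) - (r - d) *: (y - a)).
      by rewrite dotp_subsq !dotpZl !dotpZr -!enorm_sqr zy yad.
    move: za; rewrite ger_enorm ?(ltW r0)//.
    have -> : z - a = (z - y) + (y - a) by rewrite addrA subrK.
    rewrite dotp_addsq -!enorm_sqr zy yad => h.
    have h1 : d * (r - d) <= dotp (z - y) (y - a) by nra.
    have h2 : 0 <= d * (r - d) by rewrite mulr_ge0 ?subr_ge0// ltW.
    by nra.
  have zn : z = a + r *: (d^-1 *: (y - a)).
    have -> : z = y + (z - y) by rewrite addrC subrK.
    rewrite -[z - y]scale1r -(@mulVf _ d) ?gt_eqF// -scalerA zE.
    by apply/rowP => i; rewrite !mxE; field; rewrite gt_eqF.
  have n1 : enorm (d^-1 *: (y - a)) = 1.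
    by rewrite enormZ gtr0_norm ?invr_gt0// yad mulVf// gt_eqF.
  move=> b Ab; have := le_trans dz (dist_set_le z Ab).
  rewrite zn ger_enorm ?(ltW r0)//.
  have -> : a + r *: (d^-1 *: (y - a)) - b = r *: (d^-1 *: (y - a)) - (b - a).
    by rowring.
  move: n1; set n := d^-1 *: _ => n1.
  by rewrite (dotp_subsq (r *: n)) !(dotpZl r n) (dotpZr r n n) unit_dotp// mulr1; lra.
move: dr; rewrite le_eqVlt => /predU1P[dr|dr].
  by exists y; rewrite subrr enorm0 -dr subrr.
pose S := [set z | enorm (z - y) = r - d].
(* Moving straight away from the unique nearest point increases the distance at rate 1, hence at
   every rate below 1. *)
have asc k : 0 < k < 1 -> exists2 z, S z & d + k * (r - d) <= dist_set A z.
  move=> /andP[k0 k1]; apply: dist_set_ascent => // [|z zy dz].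
    by rewrite subr_gt0.
  have dz0 : 0 < dist_set A z.
    by rewrite (lt_le_trans _ dz)// ltr_pwDl// mulr_ge0// ltW.
  have dzR : dist_set A z < Rr.
    by rewrite (le_lt_trans (dist_setD y z A0))// -/d; lra.
  have [b [[Ab zb] ub]] := uA _ dzR.
  have [|||s0 s00 hs] := @dist_set_step _ _ A z ((dist_set A z)^-1 *: (z - b)) 1 ((1 + k) / 2) cA A0 dz0.
  - by rewrite enormZ gtr0_norm ?invr_gt0// zb mulVf// gt_eqF.
  - by apply/andP; split; lra_with k0 k1.
  - move=> b' Ab' zb'; have -> : b' = b by apply/esym/ub.
    rewrite mul1r dotpZr -enorm_sqr zb expr2 mulrA mulVf ?gt_eqF//.
    by rewrite mul1r.
  exists ((dist_set A z)^-1 *: (z - b)), ((1 + k) / 2), s0; split => //.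
    by rewrite enormZ gtr0_norm ?invr_gt0// zb mulVf// gt_eqF.
  by lra.
have S0 : S !=set0.
  by have [|z Sz _] := asc (1/2); [apply/andP; split; lra|exists z].
have cS : compact S.
  have -> : S = [set z | enorm (z - y) <= r - d] `&` S.
    by apply/seteqP; split => z /= => [h|[]//]; split => //; rewrite h.
  apply: compact_closedI_enorm; first exact: compact_enorm_le.
  apply/closedP_enorm => z h; apply/eqP; rewrite -subr_eq0 -normr_le0.
  rewrite leNgt; apply/negP => h0.
  have [w Sw] := h _ h0; rewrite -Sw distrC ltNge; apply/negP/negPn.
  rewrite (le_trans (enorm_lip _ _))//.
  by rewrite opprB addrA subrK.
have [z Sz hz] := @compact_max _ _ _ (dist_set A) cS S0
  (lipschitz_rcontinuous_on (fun x y _ _ => dist_set_lip x y A0)).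
exists z; split => //; rewrite leNgt; apply/negP => hlt.
(* With this slope the ascent recovers at least half of the supposed defect [r - dist_set A z],
   beating the maximum; [1/2] keeps the slope positive. *)
pose k := Num.max (1/2) (1 - (r - dist_set A z) / (2 * (r - d))).
have rd : 0 < r - d by rewrite subr_gt0.
have k1 : 0 < k < 1.
  rewrite lt_max gt_max; apply/andP; split; first by rewrite divr_gt0.
  by rewrite gtrBl divr_gt0 ?subr_gt0 ?mulr_gt0// andbT; lra.
have [w Sw] := asc _ k1; apply/negP; rewrite -ltNge.
rewrite (le_lt_trans (hz _ Sw))//.
have : (1 - (r - dist_set A z) / (2 * (r - d))) * (r - d) <= k * (r - d).
  by rewrite ler_wpM2r ?(ltW rd)// /k le_max lexx orbT.
rewrite mulrBl mul1r.
have -> : (r - dist_set A z) / (2 * (r - d)) * (r - d) = (r - dist_set A z) / 2.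
  by field; rewrite subr_eq0 gt_eqF.
by lra.
Qed.

(** Off the complement the normal comes from a nearest point. For [y] in the complement it is a
    limit: if no unit vector were a proximal normal at [y], compactness of the sphere would exclude
    all of them at nearby points too, whereas interior points close to [y] provide some. *)
Lemma inner_proxnor (Rr r : R) X y : closure (interior X) = X ->
  compl_set X !=set0 -> unique_proj Rr (compl_set X) -> 0 < r < Rr ->
  X y -> dist_set (compl_set X) y <= r ->
  exists n, [/\ enorm n = 1, compl_set X (y - dist_set (compl_set X) y *: n) &
    proxnor r (compl_set X) (y - dist_set (compl_set X) y *: n) n].
Proof.
set A := compl_set X => cX A0 uA /andP[r0 rR] Xy dr.
have cA : closed A by exact: closed_compl_set.
have inn z : 0 < dist_set A z <= r -> exists n, [/\ enorm n = 1,
    A (z - dist_set A z *: n) & proxnor r A (z - dist_set A z *: n) n].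
  move=> /[dup] dz /andP[d0 _]; have [a Aa za] := dist_set_attained z cA A0.
  exists ((dist_set A z)^-1 *: (z - a)).
  rewrite scalerA divff ?gt_eqF// scale1r subKr; split => //.
    by rewrite enormZ gtr0_norm ?invr_gt0// za mulVf// gt_eqF.
  exact: proxnor_of_proj uA dz rR Aa za.
have := dist_set_ge0 A y; rewrite le_eqVlt => /predU1P[d0|d0]; last first.
  by apply: inn; rewrite d0.
have Ay : A y by apply: contrapT => /(dist_set_gt0 cA A0); rewrite -d0 ltxx.
rewrite -d0; apply: contrapT => hno.
have {}hno n : enorm n = 1 -> ~ proxnor r A y n.
  by move=> n1 hn; apply: hno; exists n; rewrite scale0r subr0.
have [s s0 hs] : exists2 s : R, 0 < s & forall n, [set n | enorm (n : 'rV[R]_m) = 1] n ->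
    forall a, enorm (a - y) < s -> ~ proxnor r A a n.
  apply: (@compact_unif _ _ _ (fun n s => forall a, enorm (a - y) < s -> ~ proxnor r A a n)).
  - apply: (@compact_enorm _ _ _ 1) => [|n -> //].
    apply/closedP_enorm => n h; apply/eqP; rewrite -subr_eq0 -normr_le0.
    rewrite leNgt; apply/negP => h0.
    have [w Sw] := h _ h0; rewrite -Sw distrC ltNge; apply/negP/negPn.
    exact: enorm_lip.
  - by move=> n s s' h /andP[_ ss'] a ay; apply: h; exact: lt_le_trans ss'.
  move=> n n1; have [s s0 hs] := not_proxnor_near r0 (hno _ n1).
  by exists s => // n' _ nn' a ay; exact: hs.
have := Xy; rewrite -cX => /closureP_enorm/(_ (Num.min (s / 2) r)).
rewrite lt_min r0 divr_gt0// => /(_ isT)[z /interior_notin_compl_set Az].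
rewrite lt_min => /andP[zs zr].
have dz : dist_set A z <= enorm (z - y) by exact: dist_set_le.
have [|n [n1 _ hn]] := inn z.
  by rewrite dist_set_gt0//= (le_trans dz)// ltW.
apply: (hs _ n1 _ _ hn); rewrite addrAC (le_lt_trans (enormBD _ _))//.
by rewrite enormZ n1 mulr1 ger0_norm ?dist_set_ge0//; lra.
Qed.

End ProximalNormals.

(** * Clarke gradients of the distance and pointedness of the normals *)

Section ReachMu.
Variables (R : realType) (m : nat).
Implicit Types (A X : set 'rV[R]_m) (x y z a b n : 'rV[R]_m) (r : R).

(** Strictly between [a] and [z] the distance is squeezed between the distance to [a] and
    [dist_set X z] minus the distance to [z]; both are smooth there and have the same value and
    gradient. *)
Lemma dist_set_grad X z a (c : R) : X a -> enorm (z - a) = dist_set X z ->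
  0 < dist_set X z -> 0 < c < 1 ->
  differentiable (dist_set X) (a + c *: (z - a)) /\
  grad (dist_set X) (a + c *: (z - a)) = (dist_set X z)^-1 *: (z - a).
Proof.
move=> Xa; set d := dist_set X z => za d0 /andP[c0 c1].
have X0 : X !=set0 by exists a.
have d'0 : d != 0 by rewrite gt_eqF.
have z0 : z - a != 0 by rewrite -enorm_gt0 za.
have c1' : 0 < 1 - c by rewrite subr_gt0.
pose C := (2 * (c * d))^-1 + (2 * ((1 - c) * d))^-1.
have C0 : 0 < C by rewrite addr_gt0// invr_gt0 !mulr_gt0.
set w := a + c *: (z - a).
have zw : z - w = (1 - c) *: (z - a) by rewrite /w; rowring.
have dw : dist_set X w = c * d.
  apply/eqP; rewrite eq_le; apply/andP; split.
    rewrite (le_trans (dist_set_le w Xa))// /w addrAC subrr add0r.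
    by rewrite enormZ za gtr0_norm.
  have := dist_setD w z X0; rewrite -/d zw enormZ za gtr0_norm//; lra.
apply: differentiable_grad => e e0; exists (e / C); first by rewrite divr_gt0.
move=> h; rewrite ltr_pdivlMr// => he.
have ub : dist_set X (w + h) <= c * d + dotp (d^-1 *: (z - a)) h + enorm h ^+ 2 / (2 * (c * d)).
  rewrite (le_trans (dist_set_le _ Xa))//.
  have -> : w + h - a = c *: (z - a) + h by rewrite /w; rowring.
  have := @enorm_expand _ _ (c *: (z - a)) h.
  rewrite scaler_eq0 negb_or z0 andbT gt_eqF// => /(_ isT).
  rewrite enormZ za gtr0_norm// !dotpZl.
  have -> : c * dotp (z - a) h / (c * d) = d^-1 * dotp (z - a) h.
    by field; rewrite d'0 gt_eqF.
  by [].
have lb : c * d + dotp (d^-1 *: (z - a)) h - enorm h ^+ 2 / (2 * ((1 - c) * d)) <= dist_set X (w + h).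
  have := dist_setD (w + h) z X0; rewrite -/d.
  have -> : z - (w + h) = (1 - c) *: (z - a) + - h by rewrite /w; rowring.
  have := @enorm_expand _ _ ((1 - c) *: (z - a)) (- h).
  rewrite scaler_eq0 negb_or z0 andbT gt_eqF// => /(_ isT).
  rewrite enormZ za gtr0_norm// enormN !dotpZl dotpNr.
  have -> : (1 - c) * - dotp (z - a) h / ((1 - c) * d) = - (d^-1 * dotp (z - a) h).
    by field; rewrite d'0 gt_eqF.
  by lra_with.
rewrite dw.
have hC : enorm h ^+ 2 / (2 * (c * d)) + enorm h ^+ 2 / (2 * ((1 - c) * d)) <= e * enorm h.
  by rewrite -mulrDr -/C expr2 -mulrA mulrC -mulrA [C * _]mulrC mulrC ler_wpM2r// ltW.
have h1 : 0 <= enorm h ^+ 2 / (2 * (c * d)).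
  by rewrite divr_ge0 ?sqr_ge0// !mulr_ge0// ltW.
have h2 : 0 <= enorm h ^+ 2 / (2 * ((1 - c) * d)).
  by rewrite divr_ge0 ?sqr_ge0// !mulr_ge0// ltW.
by rewrite ler_norml; apply/andP; split; lra_with ub lb hC h1 h2.
Qed.

(** At [z] the distance need not be differentiable, but on the segment towards [a] it is, with
    constant gradient. *)
Lemma clarke_limits_proj X z a : X a -> enorm (z - a) = dist_set X z ->
  0 < dist_set X z ->
  clarke_limits (dist_set X) z ((dist_set X z)^-1 *: (z - a)).
Proof.
move=> Xa za d0.
pose c k : R := 1 - k.+1%:R^-1 / 2.
have c01 k : 0 < c k < 1.
  have : 0 < k.+1%:R^-1 :> R by rewrite invr_gt0.
  have : k.+1%:R^-1 <= 1 :> R by rewrite invf_le1// ler1n.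
  by rewrite /c; move: (_^-1) => q h1 h2; apply/andP; split; lra.
exists (fun k => a + c k *: (z - a)); split.
  by move=> k; have [] := dist_set_grad Xa za d0 (c01 k).
split.
  move=> A /nbhs_enormP[e e0 eA].
  have ed0 : 0 < e / dist_set X z by rewrite divr_gt0.
  apply: (filterS _ (near_infty_natSinv_lt (PosNum ed0))) => k /= hk.
  apply: eA.
  have -> : a + c k *: (z - a) - z = (- (k.+1%:R^-1 / 2)) *: (z - a).
    by rewrite /c; rowring.
  rewrite enormZ za normrN gtr0_norm ?divr_gt0 ?invr_gt0//.
  rewrite -ltr_pdivlMr// (@le_lt_trans _ _ k.+1%:R^-1)//.
    by rewrite ler_pdivrMr// ler_peMr ?invr_ge0// ler1n.
rewrite (_ : (fun k => _) = cst ((dist_set X z)^-1 *: (z - a))).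
  exact: cvg_cst.
by apply/funext => k /=; have [_ ->] := dist_set_grad Xa za d0 (c01 k).
Qed.

Lemma conv_hull_segment (B : set 'rV[R]_m) (u v : 'rV[R]_m) s :
  conv_hull B u -> B v -> 0 <= s <= 1 -> conv_hull B (u + s *: (v - u)).
Proof.
move=> [k [w [p [w0 [w1 [Bp ->]]]]]] Bv /andP[s0 s1].
exists k.+1, (fun i => if unlift ord0 i is Some j then (1 - s) * w j else s),
  (fun i => if unlift ord0 i is Some j then p j else v).
split; first by move=> i; case: unliftP => [j _|_] //; rewrite mulr_ge0// subr_ge0.
split.
  rewrite big_ord_recl unlift_none.
  under eq_bigr do rewrite liftK.
  by rewrite -mulr_sumr w1 mulr1 addrC subrK.
split; first by move=> i; case: unliftP => [j _|_].
rewrite big_ord_recl unlift_none.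
under [X in _ = _ + X]eq_bigr do rewrite liftK -scalerA.
by rewrite -scaler_sumr scalerBl scale1r scalerBr addrCA.
Qed.

(** An element [e0] of almost minimal norm gives the direction: by convexity, moving from [e0]
    towards the unit vector of any nearest point cannot shorten it much, so that vector has inner
    product about [mu] or more with the direction of [e0]. *)
Lemma clarke_grad_step X z (mu k : R) : closed X -> X !=set0 ->
  0 < dist_set X z -> mu <= Delta (clarke_grad (dist_set X) z) -> 0 < k < mu ->
  exists e (k' s0 : R), [/\ enorm e <= 1, k < k', 0 < s0 &
    forall s, 0 < s < s0 -> dist_set X z + k' * s <= dist_set X (z + s *: e)].
Proof.
move=> cX X0 d0 muD /andP[k0 kmu]; set d := dist_set X z in d0 *.
pose D := clarke_grad (dist_set X) z.
have hlb b : D b -> mu <= enorm b.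
  move=> Db; apply: (le_trans muD); apply: ge_inf; last by exists b.
  by exists 0 => _ [b' _ <-].
have lD a : X a -> enorm (z - a) = d -> clarke_limits (dist_set X) z (d^-1 *: (z - a)).
  by move=> Xa za; exact: clarke_limits_proj.
have limD b : clarke_limits (dist_set X) z b -> D b.
  move=> lb; exists 1%N, (fun=> 1), (fun=> b); split => //.
  by rewrite !big_ord1 scale1r.
have [a Xa za] := dist_set_attained z cX X0.
have n1 b : enorm (z - b) = d -> enorm (d^-1 *: (z - b)) = 1.
  by move=> zb; rewrite enormZ gtr0_norm ?invr_gt0// zb mulVf// gt_eqF.
have D0 : has_inf [set enorm b | b in D].
  split; first by exists (enorm (d^-1 *: (z - a))); exists (d^-1 *: (z - a)) => //; apply/limD/lD.
  by exists 0 => _ [b' _ <-].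
set m0 := Delta D in muD.
have m0D b : D b -> m0 <= enorm b.
  by move=> Db; apply: ge_inf; [case: D0|exists b].
have m01 : m0 <= 1 by rewrite -(n1 _ za) m0D//; exact/limD/lD.
(* The weight of the convex combination is [s] and the allowed defect of [e0] from the infimum is
   [s ^+ 2]: after division by [s] the defect is again of order [s]. *)
pose s := Num.min 1 (mu * (mu - k) / 24).
have s0 : 0 < s by rewrite lt_min ltr01 divr_gt0// mulr_gt0; lra.
have s1 : s <= 1 by rewrite ge_min lexx.
have s2 : 24 * s <= mu * (mu - k).
  by rewrite mulrC -ler_pdivlMr// ge_min lexx orbT.
have [_ [e0 De0 <-] e0m] := inf_adherent (exprn_gt0 2 s0) D0.
rewrite -/(Delta D) -/m0 in e0m.
have m0e := m0D _ De0.
have e0p : 0 < enorm e0 by lra.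
have key b : X b -> enorm (z - b) = d -> (mu - (mu - k) / 4) * d <= dotp (z - b) ((enorm e0)^-1 *: e0).
  move=> Xb zb; have lb := lD _ Xb zb; have nb := n1 _ zb.
  have -> : z - b = d *: (d^-1 *: (z - b)).
    by rewrite scalerA divff ?gt_eqF// scale1r.
  move: lb nb; set g := d^-1 *: (z - b) => lb nb.
  have /m0D : D (e0 + s *: (g - e0)).
    by apply: conv_hull_segment => //; rewrite s1 ltW.
  rewrite ger_enorm; last by lra.
  rewrite dotp_addsq !dotpZr dotpZl dotpBr -!enorm_sqr => h.
  have g3 : enorm (g - e0) <= 3.
    have := enormBD g e0; rewrite nb; have : s ^+ 2 <= 1 by rewrite expr_le1// ltW.
    by lra_with m01 e0m.
  have g9 : enorm (g - e0) ^+ 2 <= 9.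
    by have := enorm_ge0 (g - e0); nra.
  have ss : s ^+ 2 <= 1 by rewrite expr_le1// ltW.
  have sp : 0 <= s ^+ 2 by rewrite sqr_ge0.
  have e2 : enorm e0 ^+ 2 <= m0 ^+ 2 + 3 * s ^+ 2.
    have : enorm e0 ^+ 2 <= (m0 + s ^+ 2) ^+ 2.
      by rewrite ler_sqr ?nnegrE ?ltW//; lra_with e0m e0p.
    have : m0 * s ^+ 2 <= 1 * s ^+ 2 by rewrite ler_wpM2r.
    have : s ^+ 2 * s ^+ 2 <= 1 * s ^+ 2 by rewrite ler_wpM2r.
    by lra_with.
  have h1 : - (12 * s) <= 2 * (dotp e0 g - enorm e0 ^+ 2).
    rewrite -(ler_pM2l s0); have : s * (s * enorm (g - e0) ^+ 2) <= s * (s * 9).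
      by rewrite !ler_wpM2l// ltW.
    by nra.
  rewrite (dotpZl d) mulrCA mulrC ler_wpM2l ?(ltW d0)//.
  rewrite -(ler_pM2l e0p) mulrA divff ?gt_eqF// mul1r (dotpC g).
  have h2 : enorm e0 * ((mu - k) / 4) >= 6 * s.
    have : mu * (mu - k) <= enorm e0 * (mu - k) by rewrite ler_wpM2r//; lra_with kmu muD m0e.
    by lra_with s2.
  have h3 : enorm e0 * mu <= enorm e0 ^+ 2 by rewrite expr2 ler_wpM2l ?(ltW e0p)//; lra_with muD m0e.
  by lra_with h1 h2 h3.
have [||s0' s0'0 hs] := dist_set_step cX X0 d0 _ _ key (th' := (mu + k) / 2).
- by rewrite enormZ gtr0_norm ?invr_gt0// mulVf// gt_eqF.
- by apply/andP; split; lra_with k0 kmu.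
exists ((enorm e0)^-1 *: e0), ((mu + k) / 2), s0'; split => //.
  by rewrite enormZ gtr0_norm ?invr_gt0// mulVf// gt_eqF.
by lra.
Qed.

(* A positive mu-reach forces the unit normals at a boundary point to lie in an
   open half space: near y there is z at distance at least mu |z - y| / 2 from
   X, whereas X contains the tangent balls carried by the normals at y. *)
Lemma pointed_proxnor X y (mu s r : R) : closed X -> X y -> compl_set X y ->
  0 < s -> 0 < mu <= 1 -> 0 < r ->
  (forall x, 0 < dist_set X x <= s -> mu <= Delta (clarke_grad (dist_set X) x)) ->
  exists v, enorm v <= 1 /\ forall n, enorm n = 1 ->
    proxnor r (compl_set X) y n -> mu / 8 <= dotp v n.
Proof.
move=> cX Xy Ay s0 /andP[mu0 mu1] r0 hmu.
have X0 : X !=set0 by exists y.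
pose k := mu / 2; have k0 : 0 < k by rewrite /k; lra.
pose rho := Num.min (s / 2) (k * r / 4).
have rho0 : 0 < rho by rewrite lt_min !divr_gt0// mulr_gt0.
have rhos : rho <= s / 2 by rewrite ge_min lexx.
have rhor : rho <= k * r / 4 by rewrite ge_min lexx orbT.
have /closureP_enorm/(_ _ rho0)[y0 Xy0 y0y] := Ay.
have dy0 : 0 < dist_set X y0 by exact: dist_set_gt0.
have dy0' : dist_set X y0 < rho.
  by rewrite (le_lt_trans (dist_set_le y0 Xy)).
have [z zy0 dz] : exists2 z, enorm (z - y0) = rho & dist_set X y0 + k * rho <= dist_set X z.
  apply: dist_set_ascent => // z zy hz.
  have kz : 0 <= k * enorm (z - y0) by rewrite mulr_ge0// ltW.
  apply: (@clarke_grad_step _ _ mu) => //; first by lra.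
  - by apply: hmu; have := dist_setD y0 z X0 => dt; apply/andP; split; lra_with dy0 hz kz rhos dy0' zy dt.
  - by rewrite k0 /k; lra.
have zy : enorm (z - y) < 2 * rho.
  by have := enorm_triangle z y0 y; lra.
exists (- ((2 * rho)^-1 *: (z - y))); split.
  rewrite enormN enormZ gtr0_norm ?invr_gt0 ?mulr_gt0//.
  by rewrite ler_pdivrMl ?mulr_gt0// mulr1 ltW.
move=> n n1 hn.
have kr : k * rho <= r / 16.
  have : k * rho <= k * (k * r / 4) by rewrite ler_wpM2l ?(ltW k0).
  have : k * k * r <= 1 / 4 * r by rewrite ler_wpM2r ?(ltW r0)// /k; nra.
  by lra.
(* [X] contains the open ball of radius [r] about this centre, while [z] is at distance at least
   [k * rho] from [X]. *)
have zc : r + k * rho <= enorm (z - (y + r *: n)).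
  rewrite leNgt; apply/negP => hlt.
  set c := y + r *: n in hlt.
  have inX b : enorm (c - b) < r -> X b.
    move=> cb; apply: notin_compl_set => Ab.
    by have := proxnor_ball r0 n1 hn Ab; rewrite -/c; lra_with cb.
  have krho0 : 0 < k * rho by rewrite mulr_gt0.
  have [zr|zr] := ltP (enorm (z - c)) r.
    have /inX/dist_set_mem : enorm (c - z) < r by rewrite enormB.
    by lra_with dy0 dz krho0.
  pose q := enorm (z - c); pose t := (q - k * rho + r) / 2.
  have q0 : 0 < q by rewrite /q; lra.
  have t0 : 0 < t by rewrite /t /q; lra_with kr krho0 zr.
  have tq : t < q by rewrite /t -/q in zr hlt *; lra_with zr hlt.
  pose b := c + (t / q) *: (z - c).
  have /inX Xb : enorm (c - b) < r.
    rewrite /b opprD addrA subrr add0r enormN enormZ gtr0_norm ?(divr_gt0 t0 q0)//.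
    by rewrite -/q divfK ?gt_eqF// /t; rewrite -/q in hlt; lra_with hlt.
  have := dist_set_le z Xb.
  have -> : z - b = (1 - t / q) *: (z - c) by rewrite /b; rowring.
  rewrite enormZ ger0_norm; last by rewrite subr_ge0 ler_pdivrMr// mul1r ltW.
  rewrite -/q mulrBl divfK ?gt_eqF// mul1r.
  by rewrite -/q in hlt zr; rewrite /t; lra_with dy0 dz hlt.
have : z - (y + r *: n) = (z - y) - r *: n by rewrite opprD addrA.
move: zc => /[swap] ->; rewrite ger_enorm; last by rewrite addr_ge0 ?mulr_ge0// ltW.
rewrite (dotp_subsq (z - y)) !dotpZr dotpZl (unit_dotp n1) -enorm_sqr => h.
have zy2 : enorm (z - y) ^+ 2 <= 4 * rho ^+ 2.
  by have := enorm_ge0 (z - y); nra.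
have rr : rho ^+ 2 <= rho * (k * r / 4) by rewrite expr2 ler_wpM2l// ltW.
have kk : 0 <= (k * rho) ^+ 2 by rewrite sqr_ge0.
have h2 : 2 * r * dotp (z - y) n <= - (r * (k * rho)) by nra.
have h3 : dotp (z - y) n <= - (k * rho) / 2 by rewrite -(ler_pM2l r0); lra_with h2.
rewrite dotpNl dotpZl lerNr.
rewrite ler_pdivrMl ?mulr_gt0// (le_trans h3)// /k; lra_with.
Qed.

End ReachMu.

(** * Semiconcave functions and their sup-convolution *)

Section Moreau.
Variables (R : realType) (m : nat) (F : 'rV[R]_m -> R) (K rho : R).

(** The functional whose supremum over [v] is the Moreau envelope of the concave function obtained
    from [F] by subtracting [K / 2] times the squared norm; [supconv] adds that term back. *)
Definition moreau (s : R) (u v : 'rV[R]_m) :=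
  F v - K / 2 * dotp v v - (2 * s)^-1 * dotp (u - v) (u - v).

End Moreau.

(** Maximises over the closed ball on which [F] is controlled; under the hypotheses of [proxP] the
    default 0 is never a fallback. *)
HB.lock Definition prox (R : realType) (m : nat) (F : 'rV[R]_m -> R) (K rho s : R)
    (u : 'rV[R]_m) : 'rV[R]_m :=
  xget 0 [set v | enorm v <= rho /\ forall w, enorm w <= rho -> moreau F K s u w <= moreau F K s u v].

HB.lock Definition supconv (R : realType) (m : nat) (F : 'rV[R]_m -> R) (K rho s : R)
    (u : 'rV[R]_m) : R :=
  moreau F K s u (prox F K rho s u) + K / 2 * dotp u u.

HB.lock Definition resid (R : realType) (m : nat) (F : 'rV[R]_m -> R) (K rho s : R)
    (u : 'rV[R]_m) : 'rV[R]_m := s^-1 *: (u - prox F K rho s u).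

HB.lock Definition supgrad (R : realType) (m : nat) (F : 'rV[R]_m -> R) (K rho s : R)
    (u : 'rV[R]_m) : 'rV[R]_m := K *: u - resid F K rho s u.

Section SemiConcave.
Variables (R : realType) (m : nat).
Implicit Types (u v q : 'rV[R]_m).

Definition sgrad (F : 'rV[R]_m -> R) (K rho : R) u q :=
  forall u1, enorm u1 <= rho ->
    F u1 <= F u + dotp q (u1 - u) + K / 2 * dotp (u1 - u) (u1 - u).

Lemma enorm_segment u v (s rho : R) : enorm u <= rho -> enorm v <= rho ->
  0 <= s <= 1 -> enorm (u + s *: (v - u)) <= rho.
Proof.
move=> ur vr /andP[s0 s1].
have -> : u + s *: (v - u) = (1 - s) *: u + s *: v by rowring.
rewrite (le_trans (enormD _ _))// !enormZ !ger0_norm ?subr_ge0//.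
have : s * enorm v <= s * rho by rewrite ler_wpM2l.
have : (1 - s) * enorm u <= (1 - s) * rho by rewrite ler_wpM2l// subr_ge0.
by lra.
Qed.

Lemma ler_small_slope (a b C : R) : 0 <= C ->
  (forall s, 0 < s <= 1 -> a <= b + C * s) -> a <= b.
Proof.
move=> C0 h; rewrite leNgt; apply/negP => ba.
pose s := Num.min 1 ((a - b) / (2 * (C + 1))).
have C1 : 0 < 2 * (C + 1) by lra.
have s0 : 0 < s by rewrite lt_min ltr01 divr_gt0// subr_gt0.
have s1 : s <= 1 by rewrite ge_min lexx.
have sC : s * (2 * (C + 1)) <= a - b.
  by rewrite -ler_pdivlMr// ge_min lexx orbT.
have := h s; rewrite s0 s1 => /(_ isT) h1.
by move: sC; rewrite mulrCA mulrDr mulr1 (mulrC s C); lra.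
Qed.

Variables (F : 'rV[R]_m -> R) (K rho : R).
Hypothesis rho0 : 0 < rho.
Hypothesis K0 : 0 <= K.
Hypothesis neF : forall u, enorm u <= rho -> exists q, sgrad F K rho u q.

(* F - K|.|^2/2 is concave, being everywhere superdifferentiable; so a
   supergradient with any quadratic error is one with error K. *)
Lemma sgrad_weak u q C : 0 <= C -> enorm u <= rho ->
  (forall u1, enorm u1 <= rho -> F u1 <= F u + dotp q (u1 - u) + C * dotp (u1 - u) (u1 - u)) ->
  sgrad F K rho u q.
Proof.
move=> C0 ur h u1 u1r; set D := u1 - u.
apply: (@ler_small_slope _ _ (C * dotp D D)); first by rewrite mulr_ge0// dotp_ge0.
move=> s /andP[s0 s1]; pose us := u + s *: D.
have usr : enorm us <= rho by apply: enorm_segment => //; rewrite (ltW s0).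
have [qs hs] := neF usr.
have h1 := hs _ ur; have h2 := hs _ u1r; have h3 := h _ usr.
have e1 : u - us = - s *: D by rewrite /us /D; rowring.
have e2 : u1 - us = (1 - s) *: D by rewrite /us /D; rowring.
have e3 : us - u = s *: D by rewrite /us /D; rowring.
rewrite e1 !(dotpZl, dotpZr) in h1; rewrite e2 !(dotpZl, dotpZr) in h2.
rewrite e3 !(dotpZl, dotpZr) in h3.
move: h1 h2 h3; set Fs := F us; set dd := dotp D D; set qd := dotp q D; set qsd := dotp qs D.
move=> h1 h2 h3.
have hs1 : 0 <= 1 - s by rewrite subr_ge0.
have g1 := ler_wpM2l hs1 h1; have g2 := ler_wpM2l (ltW s0) h2.
rewrite -(ler_pM2l s0).
have E : s * (F u + qd + K / 2 * dd + C * dd * s) =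
  s * F u + s * qd + (K / 2) * (s * dd) + C * (s * (s * dd)) by ring.
have E1 : (1 - s) * (Fs + - s * qsd + K / 2 * (- s * (- s * dd))) +
  s * (Fs + (1 - s) * qsd + K / 2 * ((1 - s) * ((1 - s) * dd))) =
  Fs + K / 2 * (s * dd) - K / 2 * (s * (s * dd)) by ring.
have E2 : 0 <= K / 2 * (s * (s * dd)).
  by rewrite !mulr_ge0 ?dotp_ge0 ?(ltW s0)// invr_ge0.
rewrite E; move: g1 g2 E1 E2; move: ((1 - s) * (_ + _)) (s * (_ + _)) => x1 x2.
by lra.
Qed.

Hypothesis cF : rcontinuous_on [set u | enorm u <= rho] F.

Local Notation mor := (moreau F K).
Local Notation px := (prox F K rho).
Local Notation rs := (resid F K rho).
Local Notation sc := (supconv F K rho).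
Local Notation sgs := (supgrad F K rho).

Let ball := [set u : 'rV[R]_m | enorm u <= rho].

Let cball : compact ball.
Proof.
have -> : ball = [set z | enorm (z - 0) <= rho].
  by apply/seteqP; split => z /=; rewrite subr0.
exact: compact_enorm_le.
Qed.

Lemma dotp_lip_ball u v w : enorm v <= rho -> enorm w <= rho ->
  `|dotp (u - w) (u - w) - dotp (u - v) (u - v)| <= 2 * (enorm u + rho) * enorm (w - v).
Proof.
move=> vr wr.
have -> : dotp (u - w) (u - w) - dotp (u - v) (u - v) = dotp ((w - u) + (v - u)) (w - v).
  rewrite !(dotpBl, dotpBr, dotpDl, dotpDr) (dotpC w u) (dotpC v u) (dotpC v w); ring.
rewrite (le_trans (normr_dotp _ _))// ler_wpM2r//.
have := enormD (w - u) (v - u); have := enormBD w u; have := enormBD v u; lra.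
Qed.

Lemma proxP s u : enorm (px s u) <= rho /\
  forall w, enorm w <= rho -> mor s u w <= mor s u (px s u).
Proof.
have cm : rcontinuous_on ball (mor s u).
  apply: rcontinuous_onD; first apply: rcontinuous_onD => //.
    apply: rcontinuous_onN.
    apply: (@lipschitz_rcontinuous_on _ _ _ _ (`|K / 2| * (2 * (enorm (0 : 'rV[R]_m) + rho)))).
    move=> v w /= vr wr; rewrite -mulrBr normrM -mulrA ler_wpM2l//.
    have := dotp_lip_ball 0 vr wr.
    by rewrite !sub0r !(dotpNl, dotpNr) !opprK.
  apply: rcontinuous_onN.
  apply: (@lipschitz_rcontinuous_on _ _ _ _ (`|(2 * s)^-1| * (2 * (enorm u + rho)))).
  move=> v w /= vr wr; rewrite -mulrBr normrM -mulrA ler_wpM2l//.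
  exact: dotp_lip_ball.
have b0 : ball !=set0 by exists 0; rewrite /ball /= enorm0 ltW.
have [v vr vm] := compact_max cball b0 cm.
rewrite prox.unlock; case: xgetP => [x _ []//|/(_ v)[]].
by split.
Qed.

Lemma enorm_prox s u : enorm (px s u) <= rho.
Proof. by have [] := proxP s u. Qed.

Lemma prox_resid s u : 0 < s -> u - px s u = s *: rs s u.
Proof. by move=> s0; rewrite resid.unlock scalerA mulfV ?gt_eqF// scale1r. Qed.

(** Maximality of the proximal point is a supergradient inequality with the larger quadratic
    constant [K / 2 + (2 * s)^-1], which [sgrad_weak] improves. *)
Lemma sgrad_prox s u : 0 < s ->
  sgrad F K rho (px s u) (K *: px s u - rs s u).
Proof.
move=> s0; have [pr pm] := proxP s u.
have s20 : 0 < (2 * s)^-1 by rewrite invr_gt0 mulr_gt0.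
apply: (@sgrad_weak _ _ (K / 2 + (2 * s)^-1)) => //.
  by rewrite addr_ge0 ?divr_ge0// ltW.
move=> v vr; have := pm _ vr; rewrite /moreau.
set p := px s u; set z := rs s u.
have up : u = p + s *: z by rewrite -prox_resid// addrC subrK.
have vD : v = p + (v - p) by rewrite addrC subrK.
set D := v - p in vD *.
have -> : u - v = s *: z - D by rewrite up vD; rowring.
have -> : u - p = s *: z by rewrite prox_resid.
have -> : dotp v v = dotp (p + D) (p + D) by rewrite -vD.
move: p z D {up vD pm pr} => p z D.
rewrite !(dotpBl, dotpBr, dotpDl, dotpDr, dotpZl, dotpZr) (dotpC D p) (dotpC D z).
move: (F v) (F p) (dotp D D) (dotp p p) (dotp p D) (dotp z z) (dotp z D) => a b dd pp pd zz zd.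
have s1 : s * (2 * s)^-1 = 1 / 2 by rewrite invfM mulrCA mulfV ?mulr1 ?gt_eqF// mul1r.
have E : (2 * s)^-1 * (s * (s * zz) - s * zd - (s * zd - dd)) =
  s * (2 * s)^-1 * (s * zz - 2 * zd) + (2 * s)^-1 * dd by ring.
have E2 : (2 * s)^-1 * (s * (s * zz)) = s * (2 * s)^-1 * (s * zz) by ring.
by rewrite E E2 s1; lra.
Qed.

Lemma sgrad_mono u v q q' : enorm u <= rho -> enorm v <= rho ->
  sgrad F K rho u q -> sgrad F K rho v q' ->
  dotp (q - q') (u - v) <= K * dotp (u - v) (u - v).
Proof.
move=> ur vr h h'; have := h _ vr; have := h' _ ur.
have -> : v - u = - (u - v) by rewrite opprB.
rewrite !(dotpNr, dotpNl) [dotp (q - q') _]dotpBl.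
by move: (dotp (u - v) (u - v)) (F u) (F v) (dotp q _) (dotp q' _) => *; lra.
Qed.

(** With [u = p + s *: z] and [v = p' + s *: z'], monotonicity of supergradients makes the cross
    term between [p - p'] and [z - z'] nonnegative. *)
Lemma prox_nonexp s u v : 0 < s -> enorm (px s u - px s v) <= enorm (u - v).
Proof.
move=> s0; rewrite ler_enorm// enorm_sqr.
have := sgrad_mono (enorm_prox s u) (enorm_prox s v) (sgrad_prox u s0) (sgrad_prox v s0).
set p := px s u; set p' := px s v; set z := rs s u; set z' := rs s v.
have -> : K *: p - z - (K *: p' - z') = K *: (p - p') - (z - z') by rowring.
have -> : u - v = (p - p') + s *: (z - z').
  have -> : u = p + s *: z by rewrite -prox_resid// addrC subrK.
  have -> : v = p' + s *: z' by rewrite -prox_resid// addrC subrK.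
  by move: p p' z z' => p p' z z'; rowring.
move: p p' z z' => p p' z z'.
rewrite (dotpBl (K *: (p - p'))) dotpZl (dotp_addsq (p - p')) dotpZl !dotpZr (dotpC (p - p')).
have := dotp_ge0 (z - z'); move: (dotp _ _) (dotp _ _) (dotp _ _) => a b c c0 h.
have : 0 <= s * a by rewrite mulr_ge0 ?(ltW s0)//; lra.
have : 0 <= s * (s * c) by rewrite !mulr_ge0 ?(ltW s0).
lra.
Qed.

Lemma supconv_ge s u : enorm u <= rho -> F u <= sc s u.
Proof.
move=> ur; have := (proxP s u).2 _ ur.
rewrite {1}/moreau subrr dotp0l supconv.unlock; lra.
Qed.

(** The supergradient is tested at the proximal point and a square is completed. With [supconv_ge]
    it shows that the gap to [F] is of order [s] wherever supergradients are bounded. *)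
Lemma supconv_le s u q : 0 < s -> sgrad F K rho u q ->
  sc s u <= F u + s / 2 * dotp (q - K *: u) (q - K *: u).
Proof.
move=> s0 h; have := h _ (enorm_prox s u); rewrite supconv.unlock /moreau.
have := prox_resid u s0; move: (px s u) (rs s u) => p z upz.
have pE : p = u - s *: z by rewrite -upz opprB addrC subrK.
have -> : p - u = - (s *: z) by rewrite -upz opprB.
rewrite upz; have -> : dotp p p = dotp (u - s *: z) (u - s *: z) by rewrite pE.
have := dotp_ge0 (q - K *: u + z).
rewrite !(dotpNl, dotpNr, dotpBl, dotpBr, dotpDl, dotpDr, dotpZl, dotpZr).
rewrite (dotpC z u) (dotpC u q) (dotpC z q).
move: (F p) (F u) (dotp q q) (dotp u u) (dotp q u) (dotp z z) (dotp u z) (dotp q z).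
move=> a b qq uu qu zz uz qz h0 h1.
have := mulr_ge0 (ltW s0) h0.
have s1 : s * (2 * s)^-1 = 1 / 2 by rewrite invfM mulrCA mulfV ?mulr1 ?gt_eqF// mul1r.
have -> : (2 * s)^-1 * (s * (s * zz)) = s * (2 * s)^-1 * (s * zz) by ring.
rewrite s1; lra.
Qed.

(* G - |u - .|^2/2s at the two proximal points, using 2 z.z' <= |z|^2 + |z'|^2 *)
Lemma supconv_sgrad s u v : 0 < s ->
  sc s v <= sc s u + dotp (sgs s u) (v - u) + K / 2 * dotp (v - u) (v - u).
Proof.
move=> s0; have := sgrad_prox u s0 (enorm_prox s v); rewrite supconv.unlock /moreau supgrad.unlock.
have := prox_resid u s0; have := prox_resid v s0.
move: (px s u) (rs s u) (px s v) (rs s v) => p z p' z' vE uE.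
rewrite uE vE.
have {}uE : u = p + s *: z by rewrite -uE addrC subrK.
have {}vE : v = p' + s *: z' by rewrite -vE addrC subrK.
rewrite {}uE {}vE.
have := dotp_ge0 (z - z').
rewrite !(dotpNl, dotpNr, dotpBl, dotpBr, dotpDl, dotpDr, dotpZl, dotpZr).
rewrite (dotpC z p) (dotpC z p') (dotpC z' p) (dotpC z' p') (dotpC z' z) (dotpC p' p).
move: (F p) (F p') (dotp p p) (dotp p' p') (dotp z z) (dotp z' z') (dotp z z').
move: (dotp p p') (dotp p z) (dotp p z') (dotp p' z) (dotp p' z').
move=> pp' pz pz' p'z p'z' a a' pp p'p' zz z'z' zz' h0 h1.
have := mulr_ge0 (ltW s0) h0.
have s1 : s * (2 * s)^-1 = 1 / 2 by rewrite invfM mulrCA mulfV ?mulr1 ?gt_eqF// mul1r.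
have -> : (2 * s)^-1 * (s * (s * zz)) = s * (2 * s)^-1 * (s * zz) by ring.
have -> : (2 * s)^-1 * (s * (s * z'z')) = s * (2 * s)^-1 * (s * z'z') by ring.
rewrite s1; lra.
Qed.

Lemma supgrad_lip s u v : 0 < s ->
  enorm (sgs s u - sgs s v) <= (K + 2 / s) * enorm (u - v).
Proof.
move=> s0; rewrite supgrad.unlock resid.unlock.
have -> : K *: u - s^-1 *: (u - px s u) - (K *: v - s^-1 *: (v - px s v)) =
  K *: (u - v) + s^-1 *: ((px s u - px s v) - (u - v)) by rowring.
have si : 0 < s^-1 by rewrite invr_gt0.
rewrite (le_trans (enormD _ _))// !enormZ (ger0_norm K0) (ger0_norm (ltW si)).
rewrite mulrDl lerD2l -mulrA mulrCA ler_wpM2l ?(ltW si)//.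
by have := prox_nonexp u v s0; have := enormBD (px s u - px s v) (u - v); lra.
Qed.

Lemma supconv_continuous s : 0 < s -> continuous (sc s).
Proof.
move=> s0 u A /= /nbhs_ballP[e /= e0 eA].
pose C := enorm (sgs s u) + (K + 2 / s) + K + 1.
have K2 : 0 <= K + 2 / s by rewrite addr_ge0// divr_ge0// ltW.
have C0 : 0 < C by rewrite /C; have := enorm_ge0 (sgs s u); move: K2; move: (K + 2 / s) (enorm _) => *; move: K0; lra.
apply/nbhs_enormP; exists (Num.min 1 (e / C)).
  by rewrite lt_min ltr01 divr_gt0.
move=> v; rewrite lt_min ltr_pdivlMr// => /andP[v1 ve].
apply: eA; rewrite -ball_normE /=; set d := v - u in v1 ve.
have dE : u - v = - d by rewrite opprB.
have h1 := supconv_sgrad u v s0; have h2 := supconv_sgrad v u s0.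
have h3 := supgrad_lip v u s0.
rewrite -/d in h1 h3; rewrite dE !dotpNr dotpNl opprK in h2.
rewrite /C in ve; clear C0 dE; clear C; move: v1 ve h1 h2 h3 K2.
move: (sc s u) (sc s v) (sgs s u) (sgs s v) d (K + 2 / s).
move=> su sv gu gv d c v1 ve h1 h2 h3 c0.
have c1 := dotp_le_enorm gu d; have c2 := dotp_ge_enorm gv d.
have c3 : enorm gv <= enorm gu + c * enorm d.
  by have := enorm_lb gv (gu - gv); have := enorm_triangle gv gu 0; rewrite !subr0; lra.
rewrite -enorm_sqr in h1 h2.
have dd0 : 0 <= enorm d by []. 
have k0 : enorm d ^+ 2 <= enorm d by rewrite expr2 ler_piMl// ltW.
have k1 : K * enorm d ^+ 2 <= K * enorm d by rewrite ler_wpM2l.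
have k2 : c * enorm d * enorm d <= c * enorm d by rewrite -mulrA -expr2 ler_wpM2l.
have k3 : enorm gv * enorm d <= (enorm gu + c * enorm d) * enorm d by rewrite ler_wpM2r.
have k4 : 0 <= K * enorm d by rewrite mulr_ge0.
have k5 : 0 <= c * enorm d by rewrite mulr_ge0.
have k6 : 0 <= K * enorm d ^+ 2 by rewrite mulr_ge0// sqr_ge0.
have k7 : 0 <= enorm gu * enorm d by rewrite mulr_ge0.
rewrite mulrDl in k3; rewrite !mulrDr mulr1 in ve.
rewrite ltr_norml; apply/andP; split; lra_with c1 c2 h1 h2 dd0 k1 k2 k3 k4 k5 ve.
Qed.

Hypothesis sg0 : sgrad F K rho 0 0.

Lemma prox0 s : 0 < s -> px s 0 = 0.
Proof.
move=> s0; have n0 : enorm (0 : 'rV[R]_m) <= rho by rewrite enorm0 ltW.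
have := sgrad_mono (enorm_prox s 0) n0 (sgrad_prox 0 s0) sg0.
have pE : px s 0 = - (s *: rs s 0) by rewrite -prox_resid// sub0r opprK.
rewrite subr0 (subr0 (px s 0)) (dotpBl (K *: _)) dotpZl => h.
have {h} : dotp (rs s 0) (px s 0) >= 0 by lra.
rewrite pE dotpNr dotpZr; have z0 := dotp_ge0 (rs s 0) => h.
have : dotp (rs s 0) (rs s 0) == 0.
  by rewrite eq_le z0 andbT -(ler_pM2l s0) mulr0; lra.
by rewrite dotp_eq0 => /eqP r0; rewrite r0 scaler0 oppr0.
Qed.

Lemma supconv0 s : 0 < s -> sc s 0 = F 0.
Proof.
by move=> s0; rewrite supconv.unlock /moreau prox0// subr0 dotp0l !mulr0 !subr0 addr0.
Qed.

Lemma enorm_prox_le s u : 0 < s -> enorm (px s u) <= enorm u.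
Proof. by move=> s0; have := prox_nonexp u 0 s0; rewrite prox0// !subr0. Qed.

End SemiConcave.

(** Over [n] equal pieces the quadratic errors add up to [C / n]. This plays the part of integrating
    along a segment. *)
Lemma telescope_le (R : realType) (g : R -> R) (C : R) : 0 <= C ->
  (forall t t1, 0 <= t <= 1 -> 0 <= t1 <= 1 -> t <= t1 ->
     g t1 <= g t + C * (t1 - t) ^+ 2) -> g 1 <= g 0.
Proof.
move=> C0 h.
have step n i : (i <= n.+1)%N -> g (i%:R / n.+1%:R) <= g 0 + i%:R * (C / n.+1%:R ^+ 2).
  elim: i => [|i IH] ni; first by rewrite !mul0r addr0.
  have n0 : 0 < n.+1%:R :> R by [].
  have in01 j : (j <= n.+1)%N -> 0 <= (j%:R / n.+1%:R : R) <= 1.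
    by move=> jn; rewrite divr_ge0// ler_pdivrMr// mul1r ler_nat.
  have := h (i%:R / n.+1%:R) (i.+1%:R / n.+1%:R) (in01 _ (ltnW ni)) (in01 _ ni).
  rewrite ler_pM2r ?invr_gt0// ler_nat leqnSn => /(_ isT).
  rewrite -mulrBl -natrB// subSnn mul1r exprVn.
  have -> : i.+1%:R * (C / n.+1%:R ^+ 2) = i%:R * (C / n.+1%:R ^+ 2) + C / n.+1%:R ^+ 2.
    by rewrite -[i.+1%:R]natr1 mulrDl mul1r.
  by move=> h1; apply: (le_trans h1); rewrite addrA lerD2r; exact: IH (ltnW ni).
apply: (@ler_small_slope _ _ _ (2 * C)); first by rewrite mulr_ge0.
move=> s /andP[s0 s1].
have [n ns] : exists n : nat, s^-1 <= n.+1%:R.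
  exists (Num.truncn s^-1); apply/ltW; apply: truncnS_gt.
have n0 : 0 < n.+1%:R :> R by [].
have := step n n.+1 (leqnn _); rewrite divff ?gt_eqF//.
have -> : n.+1%:R * (C / n.+1%:R ^+ 2) = C / n.+1%:R :> R by field; rewrite gt_eqF.
have : n.+1%:R^-1 <= s by rewrite -[s]invrK lef_pV2 ?posrE ?invr_gt0.
move=> /(ler_wpM2l C0) h1 h2.
have Cs : 0 <= C * s by rewrite mulr_ge0// ltW.
by apply: (le_trans h2); rewrite lerD2l (le_trans h1)// -mulrA mulr_natl mulr2n lerDl.
Qed.

(** * Second order expansion of the sup-convolution *)

Section TangentAnalysis.
Variables (R : realType) (m : nat).
Implicit Types (u v q : 'rV[R]_m).
Variables (F : 'rV[R]_m -> R) (K rho : R).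
Hypothesis rho0 : 0 < rho.
Hypothesis K0 : 0 <= K.
Hypothesis neF : forall u, enorm u <= rho -> exists q, sgrad F K rho u q.
Hypothesis cF : rcontinuous_on [set u | enorm u <= rho] F.
Hypothesis sg0 : sgrad F K rho 0 0.
Ltac section_facts ::= assert (rho0 := I); assert (K0 := I); assert (neF := I); assert (cF := I);
  assert (sg0 := I); assert (cball := I).
Local Notation sg := (sgrad F K rho).
Local Ltac slra := have := rho0; have := K0; lra.

Let cball : compact [set u : 'rV[R]_m | enorm u <= rho].
Proof.
have -> : [set u : 'rV[R]_m | enorm u <= rho] = [set z | enorm (z - 0) <= rho].
  by apply/seteqP; split => z /=; rewrite subr0.
exact: compact_enorm_le.
Qed.

(** A long supergradient would make [F] drop below its minimum after a step of length [rho / 2]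
    against it. *)
Lemma sgrad_bound : exists2 L : R, 0 < L &
  forall u q, enorm u <= rho / 2 -> sg u q -> enorm q <= L.
Proof.
have b0 : [set u : 'rV[R]_m | enorm u <= rho] !=set0 by exists 0; rewrite /= enorm0 ltW.
have [uM _ hM] := compact_max cball b0 cF.
have [um _ hm] := compact_min cball b0 cF.
pose L := (`|F uM - F um| + K * rho ^+ 2 / 8) * (2 / rho) + 1.
have r2 : 0 < 2 / rho by rewrite divr_gt0.
have L0 : 0 <= (`|F uM - F um| + K * rho ^+ 2 / 8) * (2 / rho).
  by rewrite mulr_ge0 ?(ltW r2)// addr_ge0// divr_ge0// mulr_ge0// sqr_ge0.
exists L; first by rewrite /L ltr_wpDl.
move=> u q ur sq; have [->|q0] := eqVneq q 0; first by rewrite enorm0 /L; slra.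
have q1 := enorm_unit q0; set n := _ *: q in q1.
pose u1 := u - (rho / 2) *: n.
have r20 : 0 < rho / 2 by slra.
have u1r : enorm u1 <= rho.
  by rewrite (le_trans (enormBD _ _))// enormZ q1 mulr1 gtr0_norm//; slra.
have e1 : u1 - u = - ((rho / 2) *: n) by rewrite /u1; rowring.
have := sq _ u1r; rewrite e1.
rewrite !(dotpNl, dotpNr) opprK !(dotpZl, dotpZr) -!enorm_sqr.
have -> : (enorm q)^-1 * enorm q ^+ 2 = enorm q.
  by rewrite expr2 mulKf// gt_eqF// enorm_gt0.
have -> : (enorm q)^-1 * enorm q = 1 by rewrite mulVf// gt_eqF// enorm_gt0.
rewrite !mulr1 => h.
have h1 : F um <= F u1 by exact: hm.
have h2 : F u <= F uM by apply: hM => /=; slra.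
have h3 : rho / 2 * enorm q <= F uM - F um + K * rho ^+ 2 / 8.
  have -> : K * rho ^+ 2 / 8 = K / 2 * (rho / 2 * (rho / 2)) by field.
  by slra.
have h4 : enorm q <= (F uM - F um + K * rho ^+ 2 / 8) * (2 / rho).
  have -> : enorm q = (rho / 2 * enorm q) * (2 / rho) by field; rewrite gt_eqF.
  by rewrite ler_wpM2r// ltW.
have : (F uM - F um + K * rho ^+ 2 / 8) * (2 / rho) <=
  (`|F uM - F um| + K * rho ^+ 2 / 8) * (2 / rho).
  by rewrite ler_wpM2r ?(ltW r2)// lerD2r ler_norm.
by rewrite /L; lra_with h4.
Qed.

Lemma not_sgrad_near u q : enorm u <= rho -> ~ sg u q ->
  exists2 s : R, 0 < s & forall u' q', enorm u' <= rho ->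
    enorm (u' - u) < s -> enorm (q' - q) < s -> ~ sg u' q'.
Proof.
move=> ur /existsNP[u1 /not_implyP[u1r /negP]]; rewrite -ltNge => hu.
set D := F u1 - (F u + dotp q (u1 - u) + K / 2 * dotp (u1 - u) (u1 - u)).
have D0 : 0 < D by rewrite subr_gt0.
have [r1 r10 hr1] := cF ur (divr_gt0 D0 (ltr0n R 2)).
pose C := 2 * rho + enorm q + 2 * K * rho + 1.
have C0 : 0 < C.
  have : 0 <= K * rho by rewrite mulr_ge0// ltW.
  by have := enorm_ge0 q; rewrite /C; slra.
pose s := Num.min r1 (D / (2 * C)).
exists s; first by rewrite lt_min r10 divr_gt0// mulr_gt0.
move=> u' q' u'r u's q's /(_ _ u1r); rewrite leNgt; apply/negP; rewrite negbK.
have us1 : enorm (u' - u) < r1 by rewrite (lt_le_trans u's)// ge_min lexx.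
have sD : s * C <= D / 2.
  have : s <= D / (2 * C) by rewrite ge_min lexx orbT.
  move=> /(ler_wpM2r (ltW C0)); rewrite (_ : D / (2 * C) * C = D / 2)//.
  by field; rewrite gt_eqF.
have := hr1 _ u'r us1; rewrite ltr_norml => /andP[_ f1].
have e1 : dotp q' (u1 - u') - dotp q (u1 - u) = dotp (q' - q) (u1 - u') - dotp q (u' - u).
  by rewrite !(dotpBl, dotpBr); ring.
have e2 : dotp (u1 - u') (u1 - u') - dotp (u1 - u) (u1 - u) =
  - dotp ((u1 - u') + (u1 - u)) (u' - u).
  rewrite !(dotpBl, dotpBr, dotpDl, dotpDr) (dotpC u u1) (dotpC u' u1) (dotpC u u'); ring.
have s0 : 0 <= s by rewrite (le_trans _ (ltW u's)).
have n1 : enorm (u1 - u') <= 2 * rho by rewrite (le_trans (enormBD _ _))//; slra.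
have n2 : enorm ((u1 - u') + (u1 - u)) <= 4 * rho.
  by rewrite (le_trans (enormD _ _))//; have := enormBD u1 u; lra_with ur u1r n1.
have c1 : dotp (q' - q) (u1 - u') <= s * (2 * rho).
  by rewrite (le_trans (dotp_le_enorm _ _))// ler_pM// ltW.
have c2 : - dotp q (u' - u) <= enorm q * s.
  rewrite -dotpNr (le_trans (dotp_le_enorm _ _))// enormN ler_wpM2l// ltW//.
have c3 : - dotp ((u1 - u') + (u1 - u)) (u' - u) <= 4 * rho * s.
  by rewrite -dotpNr (le_trans (dotp_le_enorm _ _))// enormN ler_pM// ltW.
have c4 : K / 2 * (- dotp ((u1 - u') + (u1 - u)) (u' - u)) <= K / 2 * (4 * rho * s).
  by rewrite ler_wpM2l// divr_ge0.
rewrite -e2 in c4; rewrite /C in sD; rewrite /D in sD f1.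
move: sD; rewrite !mulrDr mulr1 => sD; lra_with e1 s0 c1 c2 c4 f1 sD.
Qed.

(** The pairs [(x *m A0, x *m B0)] form a linear space which, to first order, contains the graph of
    the supergradients at the origin. [A0] is singular when the graph has vertical tangents. *)
Variables A0 B0 : 'M[R]_m.
Hypothesis tang : forall tau : R, 0 < tau -> exists2 eta : R, 0 < eta &
  forall u q, enorm u <= eta -> enorm q <= eta -> sg u q ->
    exists x : 'rV[R]_m, enorm (u - x *m A0) + enorm (q - x *m B0) <= tau * (enorm u + enorm q).

(* Superdifferentials at 0 being convex, each of their elements is itself a
   tangent direction, whence no smallness of q is needed. *)
Lemma tangent_uniform tau : 0 < tau -> exists2 eta : R, 0 < eta <= rho / 2 &
  forall u q, enorm u <= eta -> sg u q ->
    exists x : 'rV[R]_m, enorm (u - x *m A0) + enorm (q - x *m B0) <= tau * (enorm u + enorm q).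
Proof.
move=> tau0; have [L L0 hL] := sgrad_bound.
have r20 : 0 < rho / 2 by slra.
have n0 : enorm (0 : 'rV[R]_m) <= rho by rewrite enorm0 ltW.
pose Q q r := forall u, enorm u <= rho -> enorm u <= r -> sg u q ->
  exists x : 'rV[R]_m, enorm (u - x *m A0) + enorm (q - x *m B0) <= tau * (enorm u + enorm q).
have [|q r r' h /andP[r'0 rr'] u ur ur'|q0 _|r rr0 hr] :=
  @compact_unif _ _ [set z : 'rV[R]_m | enorm (z - 0) <= L] Q.
- exact: compact_enorm_le.
- by apply: h => //; slra.
- have [->|q00] := eqVneq q0 0.
    have [eta eta0 he] := tang tau0; exists eta => // q' _.
    by rewrite subr0 => q'e u _ ur; apply: he => //; exact: ltW.
  have [s0|ns0] := pselect (sg 0 q0); last first.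
    have [s s0 hs] := not_sgrad_near n0 ns0.
    exists (s / 2); first by slra.
    move=> q' _ q's u ur us suq; exfalso; apply: (hs u q') => //; last by slra.
    by rewrite subr0; slra.
  have nq : 0 < enorm q0 by rewrite enorm_gt0.
  have [|eta eta0 he] := tang (_ : 0 < tau / 4); first by slra.
  pose t := Num.min 1 (eta / enorm q0).
  have t0 : 0 < t by rewrite lt_min ltr01 divr_gt0.
  have t1 : t <= 1 by rewrite ge_min lexx.
  have tq : t * enorm q0 <= eta by rewrite -ler_pdivlMr// ge_min lexx orbT.
  have [|||x hx] := he 0 (t *: q0).
  - by rewrite enorm0 ltW.
  - by rewrite enormZ gtr0_norm.
  - move=> u1 u1r; have := ler_wpM2l (ltW t0) (s0 _ u1r).
    have t1' : 0 <= 1 - t by slra.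
    have := ler_wpM2l t1' (sg0 u1r).
    rewrite subr0 dotp0l dotpZl !mulrDr; move: (dotp _ _) (dotp _ _) => a b.
    by rewrite !mulrBl !mul1r; slra.
  pose x0 := t^-1 *: x.
  have ti : 0 < t^-1 by rewrite invr_gt0.
  have hx0 : enorm (x0 *m A0) + enorm (q0 - x0 *m B0) <= tau / 4 * enorm q0.
    move: hx; rewrite sub0r enormN enorm0 add0r enormZ gtr0_norm// => hx.
    have -> : x0 *m A0 = t^-1 *: (x *m A0) by rewrite -scalemxAl.
    have -> : q0 - x0 *m B0 = t^-1 *: (t *: q0 - x *m B0).
      by rewrite scalerBr scalerA mulVf ?gt_eqF// scale1r -scalemxAl.
    rewrite !enormZ gtr0_norm// -mulrDr mulrC ler_pdivrMr// (le_trans hx)//.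
    by rewrite mulrCA mulrC.
  pose r := Num.min (tau * enorm q0 / 8) (enorm q0 / 4).
  have r1 : r <= tau * enorm q0 / 8 by rewrite ge_min lexx.
  have r2 : r <= enorm q0 / 4 by rewrite ge_min lexx orbT.
  exists r; first by rewrite lt_min !divr_gt0// mulr_gt0.
  move=> q' _ q'r u _ ur _; exists x0.
  have h1 := enormBD u (x0 *m A0); have h2 := enorm_triangle q' q0 (x0 *m B0).
  have h3 : tau * (3 / 4 * enorm q0) <= tau * (enorm u + enorm q').
    rewrite ler_wpM2l ?(ltW tau0)//.
    by have := enorm_triangle q0 q' 0; rewrite !subr0 (enormB q0); have := enorm_ge0 u; lra_with r2 q'r.
  have : 0 < tau * enorm q0 by rewrite mulr_gt0.
  by rewrite mulrCA in h3; lra_with hx0 r1 q'r ur h1 h2 h3.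
exists (Num.min r (rho / 2)).
  by rewrite lt_min rr0 r20 ge_min lexx orbT.
move=> u q; rewrite le_min => /andP[ur ur2] suq.
apply: (hr q) => //; first by rewrite /= subr0; exact: hL suq.
by slra.
Qed.

Local Notation px := (prox F K rho).
Local Notation rs := (resid F K rho).
Local Notation sgs := (supgrad F K rho).

(** If [(p, q)] is a proximal point with its supergradient, the residual is [z = K *: p - q], the
    base point [p + s *: z] and the gradient there [q + (K * s) *: z]. [resM] and [resN] are these
    two expressions on the tangent space. *)
Definition resM s : 'M[R]_m := (1 + s * K) *: A0 - s *: B0.
Definition resN s : 'M[R]_m := B0 + (K * s) *: (K *: A0 - B0).

Lemma resid_bound s u : 0 < s -> enorm (rs s u) <= 2 / s * enorm u.
Proof.
move=> s0; rewrite resid.unlock enormZ gtr0_norm ?invr_gt0// mulrAC mulrC ler_pM2r ?invr_gt0//.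
by have := enormBD u (px s u); have := enorm_prox_le rho0 K0 neF cF sg0 u s0; slra.
Qed.

Lemma resolvent_tangent s tau : 0 < s -> 0 < tau -> exists2 eta : R, 0 < eta &
  forall u, enorm u <= eta -> exists x,
    enorm (u - x *m resM s) <= tau * enorm u /\
    enorm (sgs s u - x *m resN s) <= tau * enorm u.
Proof.
(* The first factor bounds [enorm p + enorm q] by multiples of [enorm u]; the second dominates all
   coefficients of the errors [a] and [b]. *)
move=> s0 tau0; pose C := (1 + (K + 2 / s)) * (1 + s * K + s + (K * s * K + 1 + K * s)).
have Ks : 0 <= K * s by rewrite mulr_ge0// ltW.
have KsK : 0 <= K * s * K by rewrite mulr_ge0.
have s2 : 0 < 2 / s by rewrite divr_gt0.
have c1 : 1 <= 1 + (K + 2 / s) by rewrite lerDl addr_ge0// ltW.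
have c2 : 1 <= 1 + s * K + s + (K * s * K + 1 + K * s) by rewrite (mulrC s); slra.
have C0 : 0 < C by rewrite mulr_gt0// (lt_le_trans ltr01).
have [|eta /andP[eta0 er] he] := tangent_uniform (_ : 0 < tau / C); first by rewrite divr_gt0.
exists eta => // u ue.
have pu := enorm_prox_le rho0 K0 neF cF sg0 u s0.
have ru := resid_bound u s0.
have [|x] := he _ _ _ (sgrad_prox rho0 K0 neF cF u s0); first by slra.
have uE := prox_resid F K rho u s0; rewrite supgrad.unlock.
move: pu ru uE; move: (px s u) (rs s u) => p z pu zu uE.
have {}uE : u = p + s *: z by rewrite -uE addrC subrK.
set q := K *: p - z => hx.
have qu : enorm q <= (K + 2 / s) * enorm u.
  rewrite (le_trans (enormBD _ _))// enormZ ger0_norm// mulrDl lerD// ler_wpM2l//.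
have hx' : enorm (p - x *m A0) + enorm (q - x *m B0) <= tau / C * ((1 + (K + 2 / s)) * enorm u).
  apply: le_trans hx _; rewrite ler_wpM2l ?divr_ge0 ?(ltW tau0) ?(ltW C0)//.
  by rewrite mulrDl mul1r lerD.
set a := p - x *m A0 in hx'; set b := q - x *m B0 in hx'.
have a0 := enorm_ge0 a; have b0 := enorm_ge0 b.
have zE : z = K *: p - q by rewrite /q; rowring.
have e1 : u - x *m resM s = (1 + s * K) *: a - s *: b.
  rewrite uE zE /resM /a /b mulmxBr -!scalemxAr.
  by move: (x *m A0) (x *m B0) => xa xb; rowring.
have e2 : K *: u - z - x *m resN s = (K * s * K) *: a + (1 - K * s) *: b.
  rewrite uE zE /resN /a /b mulmxDr -!scalemxAr mulmxBr -!scalemxAr.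
  by move: (x *m A0) (x *m B0) => xa xb; rowring.
have hC : tau / C * ((1 + (K + 2 / s)) * enorm u) =
  tau * enorm u / (1 + s * K + s + (K * s * K + 1 + K * s)).
  by rewrite /C; field; rewrite !gt_eqF//; lra_with s0 Ks KsK.
rewrite hC ler_pdivlMr in hx'; last by lra_with s0 Ks KsK.
have key x1 x2 : 0 <= x1 -> 0 <= x2 ->
  x1 + x2 <= 1 + s * K + s + (K * s * K + 1 + K * s) ->
  x1 * enorm a + x2 * enorm b <= tau * enorm u.
  move=> x10 x20 x12; apply: le_trans hx'.
  have : (x1 + x2) * (enorm a + enorm b) <=
    (1 + s * K + s + (K * s * K + 1 + K * s)) * (enorm a + enorm b).
    by rewrite ler_wpM2r// addr_ge0.
  have : 0 <= x1 * enorm b by rewrite mulr_ge0.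
  have : 0 <= x2 * enorm a by rewrite mulr_ge0.
  by rewrite (mulrC (enorm a + _)) (mulrDl x1) !(mulrDr _ (enorm a) (enorm b)); lra_with.
exists x; split.
  rewrite e1 (le_trans (enormBD _ _))// !enormZ gtr0_norm ?(gtr0_norm s0); last by rewrite (mulrC s); lra_with Ks.
  by apply: key; rewrite ?(mulrC s); lra_with s0 Ks KsK.
rewrite e2 (le_trans (enormD _ _))// !enormZ ger0_norm//.
apply: le_trans (_ : (K * s * K) * enorm a + (1 + K * s) * enorm b <= _).
  rewrite lerD2l ler_wpM2r// (le_trans (ler_normB _ _))// normr1 ger0_norm//.
by apply: key; rewrite ?(mulrC s K); lra_with s0 Ks KsK.
Qed.

(** Every small [u] lies within half its norm of the row space of [resM s], to which a kernel vector
    of the transpose is orthogonal. *)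
Lemma resM_unit s : 0 < s -> resM s \in unitmx.
Proof.
move=> s0; rewrite -unitmx_tr -row_free_unit -kermx_eq0; apply/eqP.
apply/row_matrixP => i; rewrite row0; set y := row i _.
have yM : y *m (resM s)^T = 0.
  by apply/sub_kermxP; rewrite row_sub.
have [|eta eta0 he] := @resolvent_tangent s (1 / 2) s0; first by slra.
apply/eqP; rewrite -enorm_eq0; apply/negPn/negP => y0.
have yp : 0 < enorm y by rewrite lt_def y0 enorm_ge0.
pose u := (eta / enorm y) *: y.
have ue : enorm u = eta by rewrite enormZ gtr0_norm ?divr_gt0// divfK ?gt_eqF.
have [|x [hx _]] := he u; first by rewrite ue.
have : dotp u u = dotp (u - x *m resM s) u.
  by rewrite dotpBl [dotp (x *m _) u]dotp_mulmxl /u -scalemxAl yM scaler0 dotp0r subr0.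
rewrite -enorm_sqr => uu; have := dotp_le_enorm (u - x *m resM s) u.
rewrite -uu ue expr2 ler_pM2r// => h.
by move: hx; rewrite ue; slra.
Qed.

Definition supS s : 'M[R]_m := invmx (resM s) *m resN s.

Lemma supgrad_expand s tau : 0 < s -> 0 < tau -> exists2 eta : R, 0 < eta &
  forall u, enorm u <= eta -> enorm (sgs s u - u *m supS s) <= tau * enorm u.
Proof.
move=> s0 tau0; have [C C0 hC] := mulmx_bound (supS s).
have [|eta eta0 he] := @resolvent_tangent s (tau / (1 + C)) s0.
  by rewrite divr_gt0// addr_gt0.
exists eta => // u /he[x [h1 h2]].
have -> : sgs s u - u *m supS s = (sgs s u - x *m resN s) - (u - x *m resM s) *m supS s.
  rewrite mulmxBl -[x *m resM s *m _]mulmxA {3}/supS (mulmxA (resM s)) mulmxV ?resM_unit// mul1mx.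
  by move: (sgs s u) (u *m _) (x *m _) => a b c; rowring.
rewrite (le_trans (enormBD _ _))// (le_trans (lerD h2 (hC _)))//.
have := ler_wpM2l (ltW C0) h1.
have E : tau / (1 + C) * enorm u + C * (tau / (1 + C) * enorm u) = tau * enorm u.
  by field; rewrite gt_eqF// addr_gt0.
by lra_with E.
Qed.

Local Notation Fs := (supconv F K rho).

(** The sign [b] treats both bounds at once. The supergradient inequality at either end of a short
    piece bounds the increment from above and below up to a quadratic error, which [telescope_le]
    sums out. *)
Lemma supconv_expand_le s tau (b : R) : 0 < s -> 0 < tau -> `|b| = 1 ->
  exists2 eta : R, 0 < eta &
  forall u, enorm u <= eta ->
    b * (Fs s u - F 0 - dotp (u *m supS s) u / 2) <= tau * dotp u u.
Proof.
move=> s0 tau0 b1; have [eta eta0 he] := supgrad_expand s0 tau0.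
exists eta => // u ue.
set Q := dotp (u *m supS s) u.
pose C := K / 2 * dotp u u + `|Q| + tau * dotp u u.
have uu := dotp_ge0 u.
have tuu : 0 <= tau * dotp u u by rewrite mulr_ge0// ltW.
have Kuu : 0 <= K / 2 * dotp u u by rewrite !mulr_ge0// invr_ge0.
have C0 : 0 <= C by rewrite !addr_ge0.
have gt t : 0 <= t <= 1 -> `|dotp (sgs s (t *: u)) u - t * Q| <= t * (tau * dotp u u).
  move=> /andP[t0 t1].
  have tu : enorm (t *: u) <= eta.
    rewrite enormZ ger0_norm// (le_trans _ ue)// ler_piMl//.
  have := he _ tu; rewrite -scalemxAl => h.
  have -> : dotp (sgs s (t *: u)) u - t * Q = dotp (sgs s (t *: u) - t *: (u *m supS s)) u.
    by rewrite (dotpBl _ (t *: _)) (dotpZl t).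
  rewrite (le_trans (normr_dotp _ _))// (le_trans (ler_wpM2r (enorm_ge0 u) h))//.
  by rewrite enormZ ger0_norm// -enorm_sqr expr2; slra.
pose g t := b * (Fs s (t *: u) - t ^+ 2 * (Q / 2)) - t ^+ 2 * (tau * dotp u u / 2).
suff : g 1 <= g 0.
  rewrite /g !scale1r scale0r !expr1n expr0n /= !mul0r !mul1r !subr0 supconv0//.
  by slra.
apply: (telescope_le C0) => t t1 t01 t11 tt1.
have d0 : 0 <= t1 - t by rewrite subr_ge0.
have e1 : t1 *: u - t *: u = (t1 - t) *: u by rewrite -scalerBl.
have e2 : t *: u - t1 *: u = - ((t1 - t) *: u) by rewrite -e1 opprB.
have h1 := supconv_sgrad rho0 K0 neF cF (t *: u) (t1 *: u) s0.
have h2 := supconv_sgrad rho0 K0 neF cF (t1 *: u) (t *: u) s0.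
rewrite e1 !(dotpZl, dotpZr) in h1; rewrite e2 !(dotpNl, dotpNr, dotpZl, dotpZr) in h2.
have := gt _ t01; have := gt _ t11; rewrite !ler_norml.
have := ler_norm Q; have := ler_norm (- Q); rewrite normrN.
rewrite /g; move: h1 h2; rewrite /C.
move: (Fs s (t1 *: u)) (Fs s (t *: u)) (dotp (sgs s (t *: u)) u) (dotp (sgs s (t1 *: u)) u) => fa fb ga gb.
clear gt C0; clear C g; clearbody Q.
move: (tau * dotp u u) tuu Q (`|Q|) => T T0 q nQ.
have -> : K / 2 * ((t1 - t) * ((t1 - t) * dotp u u)) = (t1 - t) ^+ 2 * (K / 2 * dotp u u) by ring.
have -> : K / 2 * - - ((t1 - t) * ((t1 - t) * dotp u u)) = (t1 - t) ^+ 2 * (K / 2 * dotp u u) by ring.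
move: (K / 2 * dotp u u) Kuu => k k0 h1 h2 q1 q2 /andP[g1 g2] /andP[g3 g4].
have m1 := ler_wpM2l d0 g1; have m2 := ler_wpM2l d0 g2.
have m3 := ler_wpM2l d0 g3; have m4 := ler_wpM2l d0 g4.
have dd : 0 <= (t1 - t) ^+ 2 by exact: sqr_ge0.
have m5 := ler_wpM2l dd q1; have m6 := ler_wpM2l dd q2; have m7 := mulr_ge0 dd T0.
have m8 := mulr_ge0 dd k0.
have {b1} [->|->] : b = 1 \/ b = -1.
  by case: (leP 0 b) b1 => b0; [rewrite ger0_norm//; left|rewrite ltr0_norm// => b1'; right; lra_with b1'].
  by lra_with h1 m4 m5 m6 m7.
by lra_with h2 m1 m5 m6 m7.
Qed.

Lemma supconv_expand s tau : 0 < s -> 0 < tau ->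
  exists2 eta : R, 0 < eta &
  forall u, enorm u <= eta ->
    `|Fs s u - F 0 - dotp (u *m supS s) u / 2| <= tau * dotp u u.
Proof.
move=> s0 t0.
have [e1 e10 h1] := @supconv_expand_le s tau 1 s0 t0 (normr1 _).
have [e2 e20 h2] := @supconv_expand_le s tau (-1) s0 t0 (normrN1 _).
exists (Num.min e1 e2); first by rewrite lt_min e10.
move=> u; rewrite le_min => /andP[/h1 + /h2]; rewrite ler_norml; slra.
Qed.

Lemma supS_sym s : 0 < s -> (supS s)^T = supS s.
Proof.
move=> s0; set S := supS s.
have key u w : dotp (u *m S) w <= dotp (w *m S) u.
  pose B a b := dotp (a *m S) b.
  have BZ a t b t' : B (t *: a) (t' *: b) = t * t' * B a b.
    by rewrite /B -scalemxAl dotpZl dotpZr mulrA.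
  have BD a a' b b' : B (a + a') (b + b') = B a b + B a b' + B a' b + B a' b'.
    by rewrite /B mulmxDl !(dotpDl, dotpDr); ring.
  have BN a b : B a (- b) = - B a b by rewrite /B dotpNr.
  suff : (B u w + B w u) / 2 >= B u w by rewrite /B; slra.
  (* expand Fs (t u - t r w) <= Fs (t u) + ... to second order in t, then r -> 0 *)
  apply: (@ler_small_slope _ _ _ (`|B w w| / 2 + K / 2 * dotp w w)).
    by rewrite addr_ge0 ?divr_ge0// !mulr_ge0 ?dotp_ge0// invr_ge0.
  move=> r /andP[r0 r1].
  pose N := dotp u u + dotp (u - r *: w) (u - r *: w) + enorm u * enorm w.
  have N0 : 0 <= N by rewrite !addr_ge0 ?dotp_ge0// mulr_ge0.
  apply: (@ler_small_slope _ _ _ (N / r)); first by rewrite divr_ge0// ltW.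
  move=> tau /andP[tau0 _].
  have [e1 e10 h1] := supconv_expand s0 tau0.
  have [e2 e20 h2] := supgrad_expand s0 tau0.
  pose M := 1 + enorm u + enorm (u - r *: w).
  have M0 : 0 < M by rewrite /M; have := enorm_ge0 u; have := enorm_ge0 (u - r *: w); slra.
  pose t := Num.min e1 e2 / M.
  have t0 : 0 < t by rewrite divr_gt0// lt_min e10.
  have tM : t * M = Num.min e1 e2 by rewrite /t divfK// gt_eqF.
  have tb v : enorm v <= M -> enorm (t *: v) <= e1 /\ enorm (t *: v) <= e2.
    move=> vM; have : enorm (t *: v) <= Num.min e1 e2.
      by rewrite enormZ gtr0_norm// -tM ler_wpM2l// ltW.
    by rewrite le_min => /andP.
  have uM : enorm u <= M by rewrite /M; have := enorm_ge0 (u - r *: w); slra.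
  have vM : enorm (u - r *: w) <= M by rewrite /M; have := enorm_ge0 u; slra.
  have [u1 u2] := tb _ uM; have [v1 v2] := tb _ vM.
  have k1 := h1 _ u1; have k2 := h1 _ v1; have k3 := h2 _ u2.
  have := supconv_sgrad rho0 K0 neF cF (t *: u) (t *: (u - r *: w)) s0.
  have -> : t *: (u - r *: w) - t *: u = - ((t * r) *: w) by rowring.
  have k4 : - (tau * enorm (t *: u) * enorm w) <= dotp (sgs s (t *: u) - t *: u *m S) w.
    rewrite (le_trans _ (dotp_ge_enorm _ _))// lerN2 ler_wpM2r//.
  rewrite dotpBl in k4.
  move: k1 k2 k4; rewrite -![dotp (_ *m S) _]/(B _ _).
  rewrite !BZ -![- (r *: w)]scaleNr BD !BZ.
  have Bu1 a t' b : B a (t' *: b) = t' * B a b by rewrite /B dotpZr.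
  have Bu2 a t' b : B (t' *: a) b = t' * B a b by rewrite /B -scalemxAl dotpZl.
  rewrite !Bu1 !Bu2 enormZ (gtr0_norm t0).
  rewrite scaleNr !(dotpNl, dotpNr) !(dotpZl, dotpZr) !ler_norml.
  move: (Fs s _) (Fs s _) (dotp (sgs s _) _) (B u w) (B w u) (B u u) (B w w) => fa fb g buw bwu buu bww.
  move=> /andP[_ k1] /andP[k2 _] k4 k5.
  rewrite -(ler_pM2l r0) -(ler_pM2l t0) -(ler_pM2l t0).
  have -> : t * (t * (r * ((buw + bwu) / 2 + (`|bww| / 2 + K / 2 * dotp w w) * r + N / r * tau))) =
    t * (t * (r * ((buw + bwu) / 2))) + t * t * r * r * `|bww| / 2 + t * t * r * r * (K / 2 * dotp w w) + t * t * N * tau.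
    by field; rewrite gt_eqF.
  clearbody t; have t00 := ltW t0; have r00 := ltW r0.
  have tr0 : 0 <= t * t * r * r by rewrite !mulr_ge0.
  have n1 := ler_wpM2l tr0 (ler_norm (- bww)); rewrite normrN in n1.
  have tr : 0 <= t * r by rewrite mulr_ge0.
  have n2 := ler_wpM2l tr k4.
  have n3 : 0 <= tau * (t * (t * (1 - r))) * (enorm u * enorm w).
    by have tau00 := ltW tau0; rewrite !mulr_ge0//; lra_with r1.
  rewrite /N; lra_with k1 k2 k5 n1 n2 n3.
apply/matrixP => i j.
have E u w : dotp (u *m S) w = dotp (w *m S) u by apply/eqP; rewrite eq_le !key.
have := E (evec R i) (evec R j).
have ev (v : 'rV[R]_m) k : dotp v (evec R k) = v 0 k.
  rewrite /dotp (bigD1 k)//= big1 ?addr0 => [|l lk]; rewrite mxE eqxx ?eqxx ?mulr1//.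
  by rewrite (negPf lk) andbF mulr0.
by rewrite !ev /evec -!rowE !mxE => ->.
Qed.

(** The tangent space is Lagrangian: symmetry of [supS 1] says that [resN 1 *m (resM 1)^T] is
    symmetric, and in its antisymmetric part [B0 *m A0^T - A0 *m B0^T] is left with coefficient
    [1 - K * K + K * K = 1]. *)
Lemma tangent_sym : A0 *m B0^T = B0 *m A0^T.
Proof.
have s0 : (0 : R) < 1 by [].
have h : resN 1 *m (resM 1)^T = resM 1 *m (resN 1)^T.
  have -> : resN 1 = resM 1 *m supS 1 by rewrite mulmxA mulmxV ?mul1mx ?resM_unit.
  by rewrite (trmx_mul (resM 1)) supS_sym// -mulmxA.
have MT : (resM 1)^T = (1 + K) *: A0^T - B0^T.
  by apply/matrixP => i j; rewrite !mxE !mul1r.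
have NT : (resN 1)^T = B0^T + K *: (K *: A0^T - B0^T).
  by apply/matrixP => i j; rewrite !mxE !mulr1.
move: h; rewrite MT NT /resN /resM mul1r mulr1 scale1r => h.
apply/matrixP => i j; have := congr1 (fun M : 'M[R]_m => M i j) h.
have -> : B0 + K *: (K *: A0 - B0) = (1 - K) *: B0 + (K * K) *: A0.
  by apply/matrixP => i' j'; rewrite !mxE; ring.
have -> : B0^T + K *: (K *: A0^T - B0^T) = (1 - K) *: B0^T + (K * K) *: A0^T.
  by apply/matrixP => i' j'; rewrite !mxE; ring.
have E (a b c d : R) (M N P Q : 'M[R]_m) :
    ((a *: M + b *: N) *m (c *: P + d *: Q)) i j =
    a * c * (M *m P) i j + a * d * (M *m Q) i j + b * c * (N *m P) i j + b * d * (N *m Q) i j.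
  rewrite mulmxDl !mulmxDr -!scalemxAl -!scalemxAr.
  by move: (M *m P) (M *m Q) (N *m P) (N *m Q) => ? ? ? ?; rewrite !mxE; ring.
have -> : (1 + K) *: A0^T - B0^T = (1 + K) *: A0^T + (-1) *: B0^T by rewrite scaleN1r.
have -> : (1 + K) *: A0 - B0 = (1 + K) *: A0 + (-1) *: B0 by rewrite scaleN1r.
rewrite !E; move: ((A0 *m A0^T) i j) ((B0 *m B0^T) i j) ((A0 *m B0^T) i j) ((B0 *m A0^T) i j).
move=> a b c d; have -> : (1 - K) * (1 + K) = 1 - K * K by ring.
have -> : (1 + K) * (1 - K) = 1 - K * K by ring.
by rewrite !(mulrBl, mulrDl, mulrDr, mulrBr, mulrN1, mulN1r, mul1r, mulr1); lra.
Qed.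

(** Nondegeneracy as a factorisation: a vector killed by the form [A0 *m B0^T] is killed by [A0]. *)
Hypothesis nondeg : exists Z, A0 = A0 *m B0^T *m Z.
Ltac section_facts ::= assert (rho0 := I); assert (K0 := I); assert (neF := I); assert (cF := I);
  assert (sg0 := I); assert (tang := I); assert (nondeg := I); assert (cball := I).

(** By nondegeneracy the tangent space determines [u] linearly from [q]. If the combination
    vanished, so would nearly [mu *: q + la *: q'], with [q'] the supergradient at the proximal
    point [p]; hence [mu *: u + la *: p] would be small compared with [u], although [p] is close to
    [u] for small [s]. *)
Lemma no_opposite : exists s0 al d : R, [/\ 0 < s0, 0 < al, 0 < d <= rho / 2 &
  forall s u q e e' (mu la : R), 0 < s <= s0 -> 0 < enorm u <= d -> sg u q ->
    enorm e <= al * enorm u -> enorm e' <= al * enorm u ->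
    0 <= mu -> 0 <= la -> mu + la = 1 ->
    mu *: (q + e') + la *: (sgs s u + e) != 0].
Proof.
have [Z hZ] := nondeg.
(* Symmetry turns the factorisation into [B0 *m W = A0]: on the tangent space [u] is [q *m W]. *)
pose W := A0^T *m Z; have [C C0 hC] := mulmx_bound W; have [D D0 hD] := mulmx_bound Z.
have [CA CA0 hCA] := mulmx_bound A0^T.
have AW : B0 *m W = A0 by rewrite /W mulmxA -tangent_sym -hZ.
(* Relative to [enorm u], [C1] will bound [q'] and [C2] will bound [mu *: q]. *)
pose C1 := 3 * K + 2; pose C2 := C1 + 2 * (K + 1) + 1.
have C20 : 0 < C2 by rewrite /C2 /C1; slra.
pose tau := (4 * (1 + C) * (2 + C1 + C2))^-1.
have C10 : 0 < C1 by rewrite /C1; slra.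
have tau0 : 0 < tau by rewrite invr_gt0 !mulr_gt0//; slra.
have [eta /andP[eta0 er] he] := tangent_uniform tau0.
have tan u q : enorm u <= eta -> sg u q ->
    enorm (u - q *m W) <= tau * (1 + C) * (enorm u + enorm q).
  move=> ue /he[//|x hx].
  have -> : u - q *m W = (u - x *m A0) - (q - x *m B0) *m W.
    by rewrite mulmxBl -mulmxA AW opprB addrA subrK.
  rewrite (le_trans (enormBD _ _))//.
  have := hC (q - x *m B0).
  have := enorm_ge0 (u - x *m A0); have := enorm_ge0 (q - x *m B0) => p1 p2 p3.
  have p4 : 0 <= C * enorm (u - x *m A0) by rewrite mulr_ge0 ?(ltW C0).
  have C1' : 0 <= 1 + C by lra_with C0.
  have := ler_wpM2l C1' hx; rewrite mulrDl mul1r mulrDr => p5.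
  by rewrite -mulrA mulrCA mulrDl mul1r; lra_with p1 p3 p4 p5.
pose al := Num.min 1 (8 * C)^-1.
have al0 : 0 < al by rewrite lt_min ltr01 invr_gt0 mulr_gt0.
have al1 : al <= 1 by rewrite ge_min lexx.
have alC : C * al <= 1 / 8.
  have : al <= (8 * C)^-1 by rewrite ge_min lexx orbT.
  move=> /(ler_wpM2l (ltW C0)); rewrite (_ : C * (8 * C)^-1 = 1 / 8)//.
  by field; rewrite gt_eqF.
pose s0 := (16 * (K + 1) * (1 + C * K))^-1.
have CK : 0 <= C * K by rewrite mulr_ge0// ltW.
have s00 : 0 < s0 by rewrite invr_gt0 !mulr_gt0//; lra_with K0 CK.
exists s0, al, eta; split => //; first by rewrite eta0.
move=> s u q e e' mu la /andP[sp ss0] /andP[u0 ue] sq he1 he2 mu0 la0 mula.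
apply/eqP => E.
have sK : s * (16 * (K + 1) * (1 + C * K)) <= 1.
  by rewrite -ler_pdivlMr ?mul1r//; rewrite !mulr_gt0//; lra_with K0 CK.
have sK1 : 0 <= s * K by rewrite mulr_ge0// ltW.
have sCK : 0 <= s * (C * K) by rewrite mulr_ge0// ltW.
have sCKK : 0 <= s * (C * K * K) by rewrite !mulr_ge0// ltW.
have {}sK : 16 * (s * K) + 16 * s + 16 * (s * (C * K * K)) + 16 * (s * (C * K)) <= 1.
  by have -> : 16 * (s * K) + 16 * s + 16 * (s * (C * K * K)) + 16 * (s * (C * K)) =
    s * (16 * (K + 1) * (1 + C * K)) by ring.
have ur : enorm u <= rho by lra_with er u0 ue.
have pu := enorm_prox_le rho0 K0 neF cF sg0 u sp.
have sgp := sgrad_prox rho0 K0 neF cF u sp.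
have mono := sgrad_mono ur (enorm_prox K rho0 cF s u) sq sgp.
have uE := prox_resid F K rho u sp; rewrite supgrad.unlock in E.
rewrite uE in mono.
move: (px s u) (rs s u) pu sgp mono uE E => p z pu sgp mono uE E.
set q' := K *: p - z in sgp mono.
(* the resolvent displacement is controlled by monotonicity alone *)
have zb : enorm z <= 2 * (K + 1) * enorm u.
  have mono1 : dotp (q - q') z <= K * s * dotp z z.
    rewrite -(ler_pM2l sp); move: mono; rewrite !(dotpZr, dotpZl).
    by have -> : s * (K * s * dotp z z) = K * (s * (s * dotp z z)) by ring.
  have E1 : mu *: (q - q') = z - K *: p - (mu *: e' + la *: e) - (la * K * s) *: z.
    have -> : mu *: (q - q') = (mu *: (q + e') + la *: (K *: u - z + e)) - (mu *: e' + la *: e) - (mu + la) *: q' - (la * K * s) *: z + la *: (q' + (K * s) *: z - (K *: u - z)).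
      by rowring.
    rewrite E mula; have -> : u = p + s *: z by rewrite -uE addrC subrK.
    by rewrite /q'; rowring.
  have := ler_wpM2l mu0 mono1; rewrite -[mu * dotp (q - q') z]dotpZl E1.
  rewrite (dotpBl _ ((la * K * s) *: z)) (dotpBl _ (mu *: e' + _)) (dotpBl z) dotpDl !dotpZl => h.
  have c1 := dotp_le_enorm p z.
  have c2 : mu * dotp e' z <= mu * (al * enorm u * enorm z).
    by rewrite ler_wpM2l// (le_trans (dotp_le_enorm _ _))// ler_wpM2r.
  have c3 : la * dotp e z <= la * (al * enorm u * enorm z).
    by rewrite ler_wpM2l// (le_trans (dotp_le_enorm _ _))// ler_wpM2r.
  have c4 := ler_wpM2l K0 c1.
  have c5 : K * (enorm p * enorm z) <= K * (enorm u * enorm z).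
    by rewrite ler_wpM2l// ler_wpM2r.
  have c6 : mu * (al * enorm u * enorm z) + la * (al * enorm u * enorm z) <= enorm u * enorm z.
    by rewrite -mulrDl mula mul1r -mulrA ler_piMl// mulr_ge0.
  have c7 : mu * (K * s * dotp z z) + la * K * s * dotp z z = s * K * dotp z z.
    have -> : s * K * dotp z z = (mu + la) * (s * K * dotp z z) by rewrite mula mul1r.
    ring.
  have c8 : s * K * dotp z z <= 1 / 2 * dotp z z by rewrite ler_wpM2r ?dotp_ge0//; lra_with sp sCK sCKK sK.
  have c9 : dotp z z <= 2 * (K + 1) * enorm u * enorm z by rewrite -!mulrA mulrDl; lra_with h c2 c3 c4 c5 c6 c7 c8.
  have [->|z0] := eqVneq z 0.
    by rewrite enorm0 !mulr_ge0//; lra_with K0.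
  by move: c9; rewrite -enorm_sqr expr2 ler_pM2r ?enorm_gt0.
have q'b : enorm q' <= C1 * enorm u.
  rewrite (le_trans (enormBD _ _))// enormZ ger0_norm//.
  have := ler_wpM2l K0 pu; rewrite /C1 !mulrDl in zb *; lra_with zb.
have Ez : mu *: q + la *: q' = - (mu *: e' + la *: e + (la * (K * s)) *: z).
  apply/eqP; rewrite -subr_eq0 opprK; apply/eqP; rewrite -[RHS]E.
  have -> : u = p + s *: z by rewrite -uE addrC subrK.
  by rewrite /q'; rowring.
have la1 : la <= 1 by lra_with mu0 mula.
have mu1 : mu <= 1 by lra_with la0 mula.
have ez : enorm (mu *: e' + la *: e + (la * (K * s)) *: z) <= al * enorm u + s * K * (2 * (K + 1) * enorm u).
  have x1 : enorm (mu *: e') <= mu * (al * enorm u) by rewrite enormZ ger0_norm// ler_wpM2l.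
  have x2 : enorm (la *: e) <= la * (al * enorm u) by rewrite enormZ ger0_norm// ler_wpM2l.
  have x3 : enorm ((la * (K * s)) *: z) <= s * K * (2 * (K + 1) * enorm u).
    rewrite enormZ ger0_norm; last by rewrite !mulr_ge0// ltW.
    rewrite ler_pM//; first by rewrite !mulr_ge0// ltW.
    by rewrite (mulrC K) ler_piMl.
  have x4 : mu * (al * enorm u) + la * (al * enorm u) = al * enorm u by rewrite -mulrDl mula mul1r.
  have := enormD (mu *: e' + la *: e) ((la * (K * s)) *: z).
  by have := enormD (mu *: e') (la *: e); lra_with x1 x2 x3 x4.
have sKb : s * K * (2 * (K + 1) * enorm u) <= (K + 1) * enorm u.
  have -> : s * K * (2 * (K + 1) * enorm u) = (s * K * 2) * ((K + 1) * enorm u) by ring.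
  rewrite ler_piMl//; [by rewrite mulr_ge0//; lra_with K0|by lra_with sp sCK sCKK sK].
have mq : mu * enorm q <= C2 * enorm u.
  have -> : mu * enorm q = enorm ((mu *: q + la *: q') - la *: q').
    by rewrite addrK enormZ ger0_norm.
  rewrite (le_trans (enormBD _ _))// Ez enormN (le_trans (lerD ez (lexx _)))//.
  have : enorm (la *: q') <= C1 * enorm u.
    by rewrite enormZ ger0_norm// (le_trans _ q'b)// ler_piMl.
  have : al * enorm u <= enorm u by rewrite ler_piMl.
  by rewrite /C2 !mulrDl in sKb *; have := mulr_ge0 K0 (enorm_ge0 u); lra_with u0 sKb.
have t1 := tan _ _ ue sq.
have t2 := tan _ _ (le_trans pu ue) sgp.
have main : mu *: u + la *: p = mu *: (u - q *m W) + la *: (p - q' *m W) +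
    (mu *: q + la *: q') *m W.
  clearbody q'; rewrite mulmxDl -(scalemxAl mu) -(scalemxAl la).
  by move: (q *m W) (q' *m W) => a b; rowring.
have lhs : mu *: u + la *: p = u - (la * s) *: z.
  have -> : p = u - s *: z by rewrite -uE opprB addrC subrK.
  rewrite scalerBr scalerA addrA -scalerDl mula scale1r//.
have tC : tau * (1 + C) = (4 * (2 + C1 + C2))^-1.
  rewrite /tau; field; rewrite !gt_eqF//; rewrite /C1; lra_with C0 K0 C20.
have C120 : 0 < 2 + C1 + C2 by rewrite /C1; lra_with K0 C20.
have b1 : enorm (mu *: (u - q *m W)) <= tau * (1 + C) * ((1 + C2) * enorm u).
  rewrite enormZ ger0_norm// (le_trans (ler_wpM2l mu0 t1))// mulrCA ler_wpM2l//.
    by rewrite tC invr_ge0 mulr_ge0// ltW.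
  by rewrite mulrDr (mulrDl 1) mul1r lerD// ler_piMl.
have b2 : enorm (la *: (p - q' *m W)) <= tau * (1 + C) * ((1 + C1) * enorm u).
  rewrite enormZ ger0_norm// (le_trans (ler_piMl _ la1))// (le_trans t2)// ler_wpM2l//.
    by rewrite tC invr_ge0 mulr_ge0// ltW.
  by rewrite mulrDl mul1r lerD.
have b3 : enorm ((mu *: q + la *: q') *m W) <= C * (al * enorm u + s * K * (2 * (K + 1) * enorm u)).
  by rewrite (le_trans (hC _))// Ez enormN ler_wpM2l// ltW.
have b4 : enorm ((la * s) *: z) <= s * (2 * (K + 1) * enorm u).
  rewrite enormZ ger0_norm ?mulr_ge0 ?(ltW sp)//.
  by rewrite ler_pM ?mulr_ge0 ?(ltW sp)// ler_piMl// ltW.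
have b12 : tau * (1 + C) * ((1 + C2) * enorm u) + tau * (1 + C) * ((1 + C1) * enorm u) =
  1 / 4 * enorm u.
  by rewrite tC; field; rewrite gt_eqF.
have b5 := ler_wpM2r (enorm_ge0 u) alC.
have b6 := ler_wpM2r (enorm_ge0 u) sK.
have b7 : enorm u <= enorm (mu *: u + la *: p) + enorm ((la * s) *: z).
  by rewrite lhs; have := enormD (u - (la * s) *: z) ((la * s) *: z); rewrite subrK.
have b8 : enorm (mu *: u + la *: p) <= enorm (mu *: (u - q *m W)) + enorm (la *: (p - q' *m W)) + enorm ((mu *: q + la *: q') *m W).
  by rewrite main (le_trans (enormD _ _))// lerD2r enormD.
lra_with u0 b1 b2 b3 b4 b12 b5 b6 b7 b8.
Qed.

End TangentAnalysis.

(** * Signature and index *)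

Section Signature.
Variables (R : realType).

Lemma mx11_dotp m (u v : 'rV[R]_m) : u *m v^T = (dotp u v)%:M.
Proof. by rewrite dotpE [LHS]mx11_scalar. Qed.

Lemma dotp_delta m (u : 'rV[R]_m) i : dotp u (delta_mx 0 i) = u 0 i.
Proof.
rewrite /dotp (bigD1 i)//= big1 ?addr0 => [|l lk]; rewrite mxE eqxx ?eqxx ?mulr1//.
by rewrite (negPf lk) andbF mulr0.
Qed.

Lemma mulmx_inj_leq a b (T : 'M[R]_(a, b)) :
  (forall y : 'rV_a, y *m T = 0 -> y = 0) -> (a <= b)%N.
Proof.
move=> h; suff : row_free T by rewrite /row_free => /eqP <-; exact: rank_leq_col.
rewrite -kermx_eq0; apply/eqP/row_matrixP => i; rewrite row0; apply: h.
by apply/sub_kermxP; rewrite row_sub.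
Qed.

(** The rows of [P] and [Q] form a Sylvester system: orthogonal for [W], with squares [-1] and
    [1]. *)
Definition signature m (W : 'M[R]_m) a b (P : 'M[R]_(a, m)) (Q : 'M[R]_(b, m)) :=
  [/\ P *m W *m P^T = - 1%:M, Q *m W *m Q^T = 1%:M & P *m W *m Q^T = 0].

Lemma signature_col m (W : 'M[R]_m) a b (P : 'M[R]_(a, m)) (Q : 'M[R]_(b, m)) :
  W^T = W -> signature W P Q ->
  col_mx P Q *m (W *m row_mx (- P^T) Q^T) = 1%:M.
Proof.
move=> sW [hP hQ hPQ]; have hQP : Q *m W *m P^T = 0.
  by apply: trmx_inj; rewrite !trmx_mul sW trmxK mulmxA hPQ trmx0.
rewrite mulmxA mul_col_mx mul_col_row !mulmxN hP hPQ hQP hQ opprK oppr0.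
by rewrite -scalar_mx_block.
Qed.

Lemma signature_leq m (W : 'M[R]_m) a b (P : 'M[R]_(a, m)) (Q : 'M[R]_(b, m)) :
  W^T = W -> signature W P Q -> (a + b <= m)%N.
Proof. by move=> sW /(signature_col sW)/mulmx1_min. Qed.

(* A signature pair of maximal size cannot be extended by a vector of its
   orthogonal complement, on which the form then vanishes. *)
Lemma signature_max m (W : 'M[R]_m) : W^T = W ->
  exists a b (P : 'M[R]_(a, m)) (Q : 'M[R]_(b, m)), signature W P Q /\
    forall x : 'rV_m, x *m W *m P^T = 0 -> x *m W *m Q^T = 0 -> x *m W = 0.
Proof.
move=> sW.
pose pr n := `[< exists a b (P : 'M[R]_(a, m)) (Q : 'M[R]_(b, m)),
  signature W P Q /\ (a + b)%N = n >].
have ex : exists n, pr n.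
  exists 0; apply/asboolP; exists 0, 0, 0, 0; split => //.
  by split; apply/matrixP => -[].
have bd n : pr n -> (n <= m)%N.
  by move=> /asboolP[a [b [P [Q [s <-]]]]]; exact: signature_leq s.
case: (ex_maxnP ex bd) => n /asboolP[a [b [P [Q [sg abn]]]]] nmax.
exists a, b, P, Q; split => //; have [hP hQ hPQ] := sg.
have hQP : Q *m W *m P^T = 0.
  by apply: trmx_inj; rewrite !trmx_mul sW trmxK mulmxA hPQ trmx0.
have tr0 c (N : 'M[R]_(c, m)) (x : 'rV_m) : x *m W *m N^T = 0 -> N *m W *m x^T = 0.
  by move=> h; apply: trmx_inj; rewrite !trmx_mul sW trmxK mulmxA h trmx0.
have iso x : x *m W *m P^T = 0 -> x *m W *m Q^T = 0 -> dotp (x *m W) x = 0.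
  move=> xP xQ; apply/eqP/negPn/negP => c0.
  set c := dotp (x *m W) x in c0.
  have sc : 0 < Num.sqrt `|c| by rewrite sqrtr_gt0 normr_gt0.
  pose y := (Num.sqrt `|c|)^-1 *: x.
  have yP : y *m W *m P^T = 0 by rewrite /y -!scalemxAl xP scaler0.
  have yQ : y *m W *m Q^T = 0 by rewrite /y -!scalemxAl xQ scaler0.
  have yy : y *m W *m y^T = (c / `|c|)%:M.
    rewrite mx11_dotp /y -scalemxAl dotpZl dotpZr -/c mulrA -invfM -expr2.
    by rewrite sqr_sqrtr// mulrC.
  have : pr n.+1 -> False by move=> /nmax; rewrite ltnn.
  apply; apply/asboolP; have [cp|cn|c00] := ltgtP c 0; last by rewrite c00 eqxx in c0.
    exists (a + 1)%N, b, (col_mx P y), Q; split; last by rewrite addn1 addSn abn.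
    split => //.
      rewrite mul_col_mx tr_col_mx mul_col_row hP yP tr0// yy ltr0_norm// invrN mulrN divff ?lt_eqF//.
      by rewrite (raddfN scalar_mx) (scalar_mx_block a 1) opp_block_mx !oppr0.
    by rewrite mul_col_mx mul_col_mx hPQ yQ col_mx0.
  exists a, (b + 1)%N, P, (col_mx Q y); split; last by rewrite addn1 addnS abn.
  split => //.
    rewrite mul_col_mx tr_col_mx mul_col_row hQ yQ tr0// yy gtr0_norm// divff ?gt_eqF//.
    by rewrite -scalar_mx_block.
  by rewrite tr_col_mx mul_mx_row hPQ tr0// row_mx0.
have iso2 x y : x *m W *m P^T = 0 -> x *m W *m Q^T = 0 ->
    y *m W *m P^T = 0 -> y *m W *m Q^T = 0 -> dotp (x *m W) y = 0.
  move=> xP xQ yP yQ; have := iso (x + y).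
  rewrite !mulmxDl xP xQ yP yQ !addr0 => /(_ erefl erefl).
  rewrite !dotpDl !dotpDr (iso x)// (iso y)//.
  have -> : dotp (y *m W) x = dotp (x *m W) y by rewrite [LHS]dotp_mulmxl sW dotpC.
  lra.
move=> x xP xQ; apply/rowP => i; rewrite -dotp_delta mxE.
set z := delta_mx 0 i.
have E1 c c' (N : 'M[R]_(c, m)) (T : 'M[R]_(c', m)) :
    z *m W *m N^T *m N *m W *m T^T = z *m W *m N^T *m (N *m W *m T^T) by rewrite !mulmxA.
pose z' := z + z *m W *m P^T *m P - z *m W *m Q^T *m Q.
have z'P : z' *m W *m P^T = 0.
  rewrite /z' !(mulmxBl, mulmxDl, mulNmx) !E1 hP hQP.
  by rewrite mulmx0 subr0 mulmxN mulmx1 subrr.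
have z'Q : z' *m W *m Q^T = 0.
  rewrite /z' !(mulmxBl, mulmxDl, mulNmx) !E1 hPQ hQ.
  by rewrite mulmx0 addr0 mulmx1 subrr.
have := iso2 _ _ xP xQ z'P z'Q.
rewrite /z' dotpBr dotpDr !(dotp_mulmxr (_ *m _^T)) xP xQ !dotp0l addr0 subr0//.
Qed.

(** What remains of a vector after removal of its components along a maximal system is killed by
    [W], hence is 0. *)
Lemma signature_unit m (W : 'M[R]_m) : W^T = W -> W \in unitmx ->
  exists a b (P : 'M[R]_(a, m)) (Q : 'M[R]_(b, m)), signature W P Q /\
    1%:M = W *m Q^T *m Q - W *m P^T *m P.
Proof.
move=> sW uW; have [a [b [P [Q [sg h]]]]] := signature_max sW.
exists a, b, P, Q; split => //; have [hP hQ hPQ] := sg.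
have hQP : Q *m W *m P^T = 0.
  by apply: trmx_inj; rewrite !trmx_mul sW trmxK mulmxA hPQ trmx0.
have E1 c c' (N : 'M[R]_(c, m)) (T : 'M[R]_(c', m)) :
    W *m N^T *m N *m W *m T^T = W *m N^T *m (N *m W *m T^T) by rewrite !mulmxA.
apply/eqP; rewrite -subr_eq0 opprB addrA; apply/eqP/row_matrixP => i; rewrite row0.
set z : 'rV_m := row i _; have zE : z *m W = 0.
  apply: h; rewrite /z -!row_mul; set N := (X in row i X); rewrite (_ : N = 0) ?row0// /N.
    rewrite !(mulmxBl, mulmxDl, mulNmx) mul1mx !E1 hP hQP.
    by rewrite mulmx0 subr0 mulmxN mulmx1 subrr.
  rewrite !(mulmxBl, mulmxDl, mulNmx) mul1mx !E1 hPQ hQ.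
  by rewrite mulmx0 addr0 mulmx1 subrr.
by rewrite -[z]mulmx1 -(mulmxV uW) mulmxA zE mul0mx.
Qed.

Lemma signature_form m (W : 'M[R]_m) a b (P : 'M[R]_(a, m)) (Q : 'M[R]_(b, m)) u :
  W^T = W -> 1%:M = W *m Q^T *m Q - W *m P^T *m P ->
  dotp (u *m W) u = dotp (u *m (W *m Q^T)) (u *m (W *m Q^T)) -
    dotp (u *m (W *m P^T)) (u *m (W *m P^T)).
Proof.
move=> sW h; rewrite -{1}[u]mulmx1 h mulmxBr mulmxBl dotpBl.
have E c (N : 'M[R]_(c, m)) : dotp (u *m (W *m N^T *m N) *m W) u =
    dotp (u *m (W *m N^T)) (u *m (W *m N^T)).
  rewrite mulmxA -[_ *m N *m W]mulmxA [LHS]dotp_mulmxl trmx_mul sW.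
  by [].
by rewrite !E.
Qed.

Lemma sqdotp_coercive a m (U V : 'M[R]_(a, m)) :
  (forall y, y != 0 -> dotp (y *m U) (y *m V) < 0) ->
  exists2 c : R, 0 < c & forall y, dotp (y *m U) (y *m V) <= - c * dotp y y.
Proof.
move=> h; have [CU CU0 hU] := mulmx_bound U; have [CV CV0 hV] := mulmx_bound V.
(* In dimension 0 the unit sphere over which the form is maximised is empty. *)
have [y1|noy] := pselect (exists y1 : 'rV[R]_a, y1 != 0); last first.
  exists 1 => // y; have -> : y = 0 by apply/eqP/negPn/negP => y0; apply: noy; exists y.
  by rewrite mul0mx !dotp0l mulr0.
pose Sp := [set y : 'rV[R]_a | enorm y = 1].
have cS : compact Sp.
  have -> : Sp = [set z | enorm (z - 0) <= 1] `&` (@enorm R a @^-1` [set 1]).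
    apply/seteqP; split => [z z1|z [_ //]].
    by split => //; rewrite /= subr0 z1.
  apply: compact_closedI_enorm; first exact: compact_enorm_le.
  by apply: closed_comp => [z _|]; [exact: enorm_continuous|exact: closed_eq].
have S0 : Sp !=set0 by case: y1 => y1 /enorm_unit; exists ((enorm y1)^-1 *: y1).
have cg : rcontinuous_on Sp (fun y => dotp (y *m U) (y *m V)).
  apply: (@lipschitz_rcontinuous_on _ _ _ _ (2 * (CU * CV))) => y z y1' z1'.
  have -> : dotp (z *m U) (z *m V) - dotp (y *m U) (y *m V) =
    dotp ((z - y) *m U) (z *m V) + dotp (y *m U) ((z - y) *m V).
    by rewrite !mulmxBl dotpBl dotpBr; ring.
  rewrite (le_trans (ler_normD _ _))// -mulrA mulr_natl mulr2n lerD//.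
    rewrite (le_trans (normr_dotp _ _))//.
    have -> : CU * CV * enorm (z - y) = (CU * enorm (z - y)) * (CV * enorm z).
      by rewrite z1'; ring.
    by rewrite ler_pM.
  rewrite (le_trans (normr_dotp _ _))//.
  have -> : CU * CV * enorm (z - y) = (CU * enorm y) * (CV * enorm (z - y)).
    by rewrite y1'; ring.
  by rewrite ler_pM.
have [ym ym1 hm] := compact_max cS S0 cg.
exists (- dotp (ym *m U) (ym *m V)).
  rewrite oppr_gt0; apply: h; apply/eqP => y0; move: ym1.
  by rewrite y0 /Sp /= enorm0 => /eqP; rewrite eq_sym oner_eq0.
move=> y; rewrite opprK; have [->|y0] := eqVneq y 0.
  by rewrite mul0mx !dotp0l mulr0.
have := hm _ (enorm_unit y0); rewrite -!scalemxAl dotpZl dotpZr mulrA -enorm_sqr.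
by rewrite -invfM -expr2 mulrC ler_pdivrMr// exprn_gt0// enorm_gt0.
Qed.

End Signature.

(** * Index of the regularised Hessian *)

Section Index.
Variables (R : realType) (m : nat) (K : R) (A0 B0 : 'M[R]_m).
Hypothesis K0 : 0 <= K.
Hypothesis symAB : A0 *m B0^T = B0 *m A0^T.
Hypothesis nondeg : exists Z, A0 = A0 *m B0^T *m Z.
Local Notation M := (resM K A0 B0).
Local Notation N := (resN K A0 B0).

Lemma resolvent_form s (x : 'rV_m) : dotp (x *m N s) (x *m M s) =
  dotp (x *m B0) (x *m A0) - s * dotp (x *m B0) (x *m B0) +
  K ^+ 2 * s * dotp (x *m A0) (x *m A0) +
  K * s ^+ 2 * dotp (K *: (x *m A0) - x *m B0) (K *: (x *m A0) - x *m B0).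
Proof.
rewrite /resN /resM mulmxDr mulmxBr -!scalemxAr mulmxBr -!scalemxAr.
move: (x *m A0) (x *m B0) => a b.
have := dotpC a b.
rewrite !(dotpBl, dotpBr, dotpDl, dotpDr, dotpZl, dotpZr). move=> ->; ring.
Qed.

Variable (ind : nat) (L : 'M[R]_(ind, m)).
Hypothesis negL : forall y : 'rV_ind, y != 0 -> dotp (y *m L *m A0) (y *m L *m B0) < 0.
Hypothesis maxL : forall j (L' : 'M[R]_(j, m)),
  (forall y : 'rV_j, y != 0 -> dotp (y *m L' *m A0) (y *m L' *m B0) < 0) -> (j <= ind)%N.
Ltac section_facts ::= assert (K0 := I); assert (symAB := I); assert (nondeg := I);
  assert (negL := I); assert (maxL := I).

(* The regularized form is negative on span L + ker A0, where it is at most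
   -c|y|^2/2 - s|x B0|^2/2, and positive on the positive part of A0 B0^T. *)
Lemma index_resolvent : exists2 s1 : R, 0 < s1 &
  forall s, 0 < s <= s1 -> M s \in unitmx ->
  forall (W : 'M[R]_m) a b (P : 'M[R]_(a, m)) (Q : 'M[R]_(b, m)),
    W^T = W -> M s *m W = 2^-1 *: N s -> signature W P Q ->
    1%:M = W *m Q^T *m Q - W *m P^T *m P ->
    a = (ind + (m - \rank A0))%N.
Proof.
have [c c0 hc] : exists2 c : R, 0 < c &
    forall y, dotp (y *m (L *m A0)) (y *m (L *m B0)) <= - c * dotp y y.
  by apply: sqdotp_coercive => y /negL; rewrite !mulmxA.
have [C C0 hC] := mulmx_bound (L *m A0).
have sO : (A0 *m B0^T)^T = A0 *m B0^T by rewrite trmx_mul trmxK -symAB.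
have [a' [b' [P' [Q' [sg' hker]]]]] := signature_max sO.
have [hP' hQ' _] := sg'.
have [D D0 hD] := mulmx_bound (Q' *m B0).
have OE (x : 'rV_m) : dotp (x *m A0) (x *m B0) = dotp (x *m (A0 *m B0^T)) x.
  by rewrite mulmxA [RHS]dotp_mulmxl trmxK.
have sub c' (T : 'M[R]_(c', m)) (y : 'rV_c') : dotp (y *m T *m A0) (y *m T *m B0) =
    dotp (y *m (T *m (A0 *m B0^T) *m T^T)) y.
  by rewrite OE !mulmxA [RHS]dotp_mulmxl trmxK.
have a'ind : (a' <= ind)%N.
  apply: (maxL (L' := P')) => y y0; rewrite sub hP' mulmxN mulmx1 dotpNl oppr_lt0.
  by rewrite lt_def dotp_eq0 y0 dotp_ge0.
(* Nondegeneracy identifies the rank of [A0] with that of the form [A0 *m B0^T], and a maximal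
   signature pair exhausts the latter. *)
have rkb : (\rank A0 <= ind + b')%N.
  have [Z hZ] := nondeg.
  apply: (@leq_trans (a' + b')); last by rewrite leq_add2r.
  apply: (@leq_trans (\rank (A0 *m B0^T))).
    by rewrite {1}hZ mxrankM_maxl.
  set O := A0 *m B0^T; pose T := O *m row_mx P'^T Q'^T.
  apply: (@leq_trans (\rank T)); last exact: rank_leq_col.
  have : (\rank (kermx T) <= \rank (kermx O))%N.
    apply/mxrankS/sub_kermxP/row_matrixP => i; rewrite row_mul row0.
    have : row i (kermx T) *m T = 0 by apply/sub_kermxP; rewrite row_sub.
    rewrite /T mulmxA mul_mx_row => /eqP; rewrite -[0]row_mx0 => /eqP/eq_row_mx[h1 h2].
    exact: hker.
  rewrite !mxrank_ker; move: (rank_leq_row T) (rank_leq_row O); move: (\rank T) (\rank O) => rT rO.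
  by clear; lia.
(* One bound for the three smallness conditions [sK4], [sKC] and [sD] on [s]. *)
pose big := 1 + 4 * K + 2 / c * (K ^+ 2 * C ^+ 2 + 2 * K ^+ 3 * C ^+ 2) + 2 * D ^+ 2.
have K2 : 0 <= K ^+ 2 by rewrite sqr_ge0.
have C2 : 0 <= C ^+ 2 by rewrite sqr_ge0.
have D2 : 0 <= D ^+ 2 by rewrite sqr_ge0.
have K3 : 0 <= K ^+ 3 by rewrite exprn_ge0.
have KC : 0 <= K ^+ 2 * C ^+ 2 + 2 * K ^+ 3 * C ^+ 2 by exact: addr_ge0 (mulr_ge0 K2 C2) (mulr_ge0 (mulr_ge0 (ler0n _ 2) K3) C2).
have KCc : 0 <= 2 / c * (K ^+ 2 * C ^+ 2 + 2 * K ^+ 3 * C ^+ 2).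
  by rewrite mulr_ge0// divr_ge0// ltW.
have big1 : 1 <= big by rewrite /big; have := K0; lra.
have big0 : 0 < big by lra.
exists big^-1; first by rewrite invr_gt0.
move=> s /andP[s0 sb] uM W a b P Q sW MW sg id1.
have {}sb : s * big <= 1 by rewrite -ler_pdivlMr ?mul1r.
have s00 := ltW s0.
have s1 : s <= 1 by rewrite (le_trans _ sb)// ler_peMr.
have sK4 : s * K * 4 <= 1.
  apply: le_trans sb; rewrite -mulrA ler_wpM2l// /big mulrC; lra_with D2 KCc.
have sD : s * D ^+ 2 <= 1 / 2.
  have : s * (2 * D ^+ 2) <= s * big by rewrite ler_wpM2l// /big; have := K0; lra_with K0 KCc.
  by rewrite mulrCA; lra_with sb.
have sKC : s * (K ^+ 2 * C ^+ 2 + 2 * K ^+ 3 * C ^+ 2) <= c / 2.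
  have : s * (2 / c * (K ^+ 2 * C ^+ 2 + 2 * K ^+ 3 * C ^+ 2)) <= s * big.
    by rewrite ler_wpM2l// /big; have := K0; lra_with K0 D2.
  move=> /le_trans/(_ sb); move: (_ + _ * C ^+ 2) => Y Y1.
  have -> : s * Y = s * (2 / c * Y) * (c / 2) by field; rewrite gt_eqF.
  by rewrite ler_piMl// divr_ge0// ltW.
have form (x : 'rV_m) : dotp (x *m M s *m W) (x *m M s) = 2^-1 * dotp (x *m N s) (x *m M s).
  by rewrite -mulmxA MW -scalemxAr dotpZl.
have ab1 : (a + b <= m)%N by exact: signature_leq sg.
have ab2 : (m <= a + b)%N.
  apply: (@mulmx1_min _ _ _ (row_mx (- (W *m P^T)) (W *m Q^T)) (col_mx P Q)).
  by rewrite mul_row_col mulNmx addrC -id1.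
have neg : (ind + (m - \rank A0) <= a)%N.
  rewrite -mxrank_ker; set Kb := row_base (kermx A0).
  apply: (@mulmx_inj_leq _ _ _ (col_mx L Kb *m M s *m (W *m P^T))) => y.
  rewrite -[y]hsubmxK; set y1 := lsubmx y; set y2 := rsubmx y.
  rewrite !mulmxA mul_row_col -!mulmxA; set x := y1 *m L + y2 *m Kb => hy.
  have KbA : y2 *m Kb *m A0 = 0.
    by apply/sub_kermxP; rewrite (submx_trans (submxMl _ _))// eq_row_base.
  have : 0 <= dotp (x *m N s) (x *m M s).
    have := form x; rewrite (signature_form _ sW id1) (_ : x *m M s *m (W *m P^T) = 0); last by rewrite -mulmxA.
    by rewrite !dotp0l subr0 => h; have := dotp_ge0 (x *m M s *m (W *m Q^T)); lra_with h.
  rewrite resolvent_form.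
  have xA : x *m A0 = y1 *m (L *m A0) by rewrite mulmxDl KbA addr0 mulmxA.
  have qa : dotp (x *m B0) (x *m A0) = dotp (y1 *m (L *m A0)) (y1 *m (L *m B0)).
    rewrite dotpC OE dotp_mulmxl sO dotpC /x mulmxDl dotpDl.
    have -> : y2 *m Kb *m (A0 *m B0^T) = 0 by rewrite mulmxA KbA mul0mx.
    rewrite dotp0l addr0 dotpC -{1}sO -dotp_mulmxl mulmxDl.
    have -> : y2 *m Kb *m (A0 *m B0^T) = 0 by rewrite mulmxA KbA mul0mx.
    by rewrite addr0 -OE !mulmxA.
  rewrite qa; have := hc y1; have := hC y1; rewrite -xA.
  set q := x *m B0; set al := x *m A0 => alb.
  have al2 : dotp al al <= C ^+ 2 * dotp y1 y1.
    by rewrite -!enorm_sqr -exprMn ler_pXn2r// nnegrE// mulr_ge0// ltW.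
  have res : dotp (K *: al - q) (K *: al - q) <= 2 * K ^+ 2 * dotp al al + 2 * dotp q q.
    have := dotp_ge0 (K *: al + q); rewrite dotp_addsq dotp_subsq dotpZl !dotpZr dotpZl; lra_with.
  have y1y1 := dotp_ge0 y1; have qq := dotp_ge0 q; have aa := dotp_ge0 al.
  move: res; set re := dotp (K *: al - q) (K *: al - q).
  set f := dotp al (y1 *m (L *m B0)) => res fb h.
  have b1 : K ^+ 2 * s * dotp al al <= s * (K ^+ 2 * C ^+ 2) * dotp y1 y1.
    have -> : s * (K ^+ 2 * C ^+ 2) * dotp y1 y1 = (K ^+ 2 * s) * (C ^+ 2 * dotp y1 y1) by ring.
    exact: ler_wpM2l (mulr_ge0 K2 s00) _ _ al2.
  have b2 : K * s ^+ 2 * re <= s * (2 * K ^+ 3 * C ^+ 2) * dotp y1 y1 + s / 2 * dotp q q.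
    apply: (@le_trans _ _ (K * s ^+ 2 * (2 * K ^+ 2 * dotp al al + 2 * dotp q q))).
      by rewrite ler_wpM2l// mulr_ge0// sqr_ge0.
    have -> : K * s ^+ 2 * (2 * K ^+ 2 * dotp al al + 2 * dotp q q) =
      s * (2 * K ^+ 3 * (s * dotp al al)) + (s * K * 4) * (s / 2 * dotp q q) by field.
    rewrite lerD//.
      have -> : s * (2 * K ^+ 3 * C ^+ 2) * dotp y1 y1 =
        s * (2 * K ^+ 3) * (C ^+ 2 * dotp y1 y1) by ring.
      rewrite mulrA ler_wpM2l ?(mulr_ge0 s00)// ?(mulr_ge0 (ler0n _ 2) K3)//.
      by apply: le_trans al2; rewrite ler_piMl.
    by rewrite ler_piMl// mulr_ge0// divr_ge0.
  have b3 := ler_wpM2r y1y1 sKC; rewrite mulrDr mulrDl in b3.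
  have y10 : dotp y1 y1 = 0.
    have : c / 2 * dotp y1 y1 <= 0.
      have sq : 0 <= s / 2 * dotp q q by rewrite mulr_ge0// divr_ge0.
      have : - c * dotp y1 y1 = - (c * dotp y1 y1) by rewrite mulNr.
      by lra_with fb h b1 b2 b3 sq.
    by rewrite pmulr_rle0 ?divr_gt0// => y1n; apply/eqP; rewrite eq_le y1n.
  have q0 : q = 0.
    have : s / 2 * dotp q q <= 0 by move: fb b1 b2; rewrite y10 !mulr0; lra_with h.
    rewrite pmulr_rle0 ?divr_gt0// => qn.
    by apply/eqP; rewrite -dotp_eq0 eq_le qn.
  have al0 : al = 0.
    by apply/eqP; rewrite -dotp_eq0 eq_le aa andbT (le_trans al2)// y10 mulr0.
  have x0 : x = 0.
    rewrite -[x]mulmx1 -(mulmxV uM) mulmxA /resM mulmxBr -!scalemxAr -/q -/al q0 al0.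
    by rewrite !scaler0 subr0 mul0mx.
  have y1z : y1 = 0 by apply/eqP; rewrite -dotp_eq0 y10.
  have y2z : y2 = 0.
    apply: (row_free_inj (row_base_free (kermx A0))).
    by rewrite /= mul0mx; move: x0; rewrite /x y1z mul0mx add0r.
  by rewrite y1z y2z row_mx0.
have pos : (b' <= b)%N.
  apply: (@mulmx_inj_leq _ _ _ (Q' *m M s *m (W *m Q^T))) => y.
  rewrite !mulmxA -(mulmxA _ W) => hy; set x := y *m Q' in hy.
  have : dotp (x *m N s) (x *m M s) <= 0.
    have := form x; rewrite (signature_form _ sW id1) hy dotp0l sub0r => h.
    by have := dotp_ge0 (x *m M s *m (W *m P^T)); lra_with h.
  rewrite resolvent_form dotpC sub hQ' mulmx1 => h.
  have h1 : 0 <= K ^+ 2 * s * dotp (x *m A0) (x *m A0) by rewrite !mulr_ge0// dotp_ge0.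
  have h2 : 0 <= K * s ^+ 2 * dotp (K *: (x *m A0) - x *m B0) (K *: (x *m A0) - x *m B0).
    by rewrite !mulr_ge0// ?dotp_ge0// sqr_ge0.
  have h3 : s * dotp (x *m B0) (x *m B0) <= s * (D ^+ 2 * dotp y y).
    rewrite ler_wpM2l// -!enorm_sqr -exprMn ler_pXn2r// ?nnegrE ?mulr_ge0 ?(ltW D0)//.
    by rewrite /x -mulmxA.
  have := ler_wpM2r (dotp_ge0 y) sD; rewrite -mulrA => h4.
  have : dotp y y <= 0 by lra_with h h1 h2 h3 h4.
  by move=> y0; apply/eqP; rewrite -dotp_eq0 eq_le y0 dotp_ge0.
(* The two lower bounds on [a] and [b] already add up to at least [m = a + b], so both are
   attained. *)
move: (rank_leq_row A0) neg pos rkb ab1 ab2; move: (\rank A0) => rk; clear; lia.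
Qed.

End Index.

Lemma ord_unif (R : realType) k (P : 'I_k -> R -> Prop) :
  (forall i r r', P i r -> 0 < r' <= r -> P i r') ->
  (forall i, exists2 r : R, 0 < r & P i r) -> exists2 r : R, 0 < r & forall i, P i r.
Proof.
move=> Pd h; have /choice[rho hr] : forall i, exists r, 0 < r /\ P i r.
  move=> i.
  by have [r r0 Pr] := h i; exists r.
have ri i : 0 < (rho i)^-1 by rewrite invr_gt0; have [] := hr i.
have S0 : 0 <= \sum_i (rho i)^-1 by apply: sumr_ge0 => i _; exact: ltW.
(* A positive lower bound for finitely many radii; the summand 1 covers the empty family. *)
exists (1 + \sum_i (rho i)^-1)^-1; first by rewrite invr_gt0; lra.
move=> i; apply: (Pd i (rho i)); first exact: (hr i).2.
rewrite invr_gt0 ltr_pwDl//= -[leRHS]invrK lef_pV2 ?posrE ?ltr_pwDl//.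
by rewrite (bigD1 i)//= addrCA lerDl addr_ge0// sumr_ge0// => j _; exact: ltW.
Qed.

(** * Smooth functions and push fields *)

Section Calculus.
Variables (R : realType) (m : nat).
Implicit Types (f g : 'rV[R]_m -> R) (y z v h : 'rV[R]_m).

Lemma line_MVT_ge0 g z v (T : R) : 0 <= T ->
  (forall t : R, derivable g (z + t *: v) v) ->
  exists2 c : R, 0 <= c <= T & g (z + T *: v) - g z = T * 'D_v g (z + c *: v).
Proof.
move=> T0 dg; pose phi (t : R) : R := g (z + t *: v).
have E (t : R) : (fun h : R => h^-1 *: ((phi \o shift t) (h *: (1 : R)) - phi t)) =
  (fun h : R => h^-1 *: ((g \o shift (z + t *: v)) (h *: v) - g (z + t *: v))).
  apply/funext => h /=; rewrite /phi; congr (_ *: (g _ - _)).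
  by rewrite [h *: 1]mulr1 scalerDl addrCA.
have dphi (t : R) : is_derive t (1 : R) phi ('D_v g (z + t *: v)).
  apply: DeriveDef; first by rewrite /derivable E; exact: dg.
  by rewrite /derive E.
have [|c] := @MVT_segment R phi (fun t => 'D_v g (z + t *: v)) 0 T T0 (fun x _ => dphi x).
  by apply: derivable_within_continuous => x _; have [] := dphi x.
rewrite in_itv /= => c0T; rewrite /phi scale0r addr0 subr0 mulrC => ?.
by exists c.
Qed.

Lemma line_MVT g z v (T : R) : (forall t : R, derivable g (z + t *: v) v) ->
  exists2 c : R, `|c| <= `|T| & g (z + T *: v) - g z = T * 'D_v g (z + c *: v).
Proof.
move=> dg; have [T0|T0] := leP 0 T.
  have [c /andP[c0 cT] e] := line_MVT_ge0 T0 dg.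
  by exists c => //; rewrite !ger0_norm.
have [||c /andP[c0 cT] e] := @line_MVT_ge0 g (z + T *: v) v (- T).
- by lra.
- by move=> t; rewrite -addrA -scalerDl; exact: dg.
exists (T + c); first by rewrite ler0_norm ?(ltr0_norm T0)//; lra.
move: e; rewrite scaleNr addrK -addrA -scalerDl => e.
by rewrite -[LHS]opprB e mulNr opprK.
Qed.

Lemma enorm_le_coord (u v : 'rV[R]_m) : (forall i, `|u 0 i| <= `|v 0 i|) -> enorm u <= enorm v.
Proof.
move=> h; rewrite ler_enorm// enorm_sqr /dotp ler_sum// => i _.
by rewrite -!expr2 -[u 0 i ^+ 2]real_normK ?num_real// -[v 0 i ^+ 2]real_normK ?num_real// ler_pXn2r.
Qed.

Lemma C1_grad_continuous f : C1 f -> forall y (e : R), 0 < e ->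
  exists2 r : R, 0 < r & forall z, enorm (z - y) < r -> enorm (grad f z - grad f y) <= e.
Proof.
move=> [_ cf] y e e0; pose e' := e / m.+1%:R.
have e'0 : 0 < e' by rewrite divr_gt0.
have [i r r' h /andP[_ rr'] z zr|i|r r0 h] := @ord_unif R m
    (fun i r => forall z, enorm (z - y) < r -> `|pderiv i f z - pderiv i f y| < e').
- by apply: h; exact: lt_le_trans rr'.
- have /nbhs_enormP[r r0 h] := cf i y _ (nbhsx_ballx (pderiv i f y) e' e'0).
  by exists r => // z /h; rewrite /= -ball_normE /= distrC.
exists r => // z zr; have hz i := h i z zr.
rewrite (le_trans (enorm_le_sum _))//.
apply: (@le_trans _ _ (\sum_(i < m) e')).
  by apply: ler_sum => i _; rewrite !mxE ltW.
rewrite sumr_const card_ord -mulr_natr /e' mulrAC ler_pdivrMr// ler_wpM2l ?(ltW e0)//.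
by rewrite ler_nat.
Qed.

(** Since [C1] speaks of partial derivatives only, the increment is split into legs parallel to the
    axes, with the mean value theorem on each; [pt k] keeps the first [k] coordinates of [h]. *)
Lemma C1_expand f y : C1 f -> forall e : R, 0 < e -> exists2 r : R, 0 < r &
  forall h, enorm h < r -> `|f (y + h) - f y - dotp (grad f y) h| <= e * enorm h.
Proof.
move=> cf e e0; pose e' := e / m.+1%:R.
have e'0 : 0 < e' by rewrite divr_gt0.
have [r r0 hr] := C1_grad_continuous cf y e'0; exists r => // h hh.
pose pt k : 'rV[R]_m := \row_j (if (j < k)%N then h 0 j else 0).
have step k : (k <= m)%N ->
    `|f (y + pt k) - f y - dotp (grad f y) (pt k)| <= k%:R * (e' * enorm h).
  elim: k => [|k IH] km.
    have -> : pt 0 = 0 by apply/rowP => j; rewrite !mxE.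
    by rewrite addr0 subrr dotp0r subr0 normr0 mul0r.
  pose i := Ordinal km.
  have ptS : pt k.+1 = pt k + h 0 i *: evec R i.
    apply/rowP => j; rewrite !mxE eqxx /= ltnS leq_eqVlt.
    have [ji|ji] := eqVneq j i; first by rewrite ji /= eqxx ltnn mulr1 add0r.
    by rewrite -val_eqE /= in ji; rewrite (negPf ji) /= mulr0 addr0.
  have [c ch e1] : exists2 c : R, `|c| <= `|h 0 i| & f (y + pt k + h 0 i *: evec R i) - f (y + pt k) =
      h 0 i * 'D_(evec R i) f (y + pt k + c *: evec R i).
    by apply: line_MVT => t; exact: cf.1.
  set z := y + pt k + c *: evec R i in e1.
  have zy : enorm (z - y) < r.
    apply: le_lt_trans hh; have -> : z - y = pt k + c *: evec R i by rewrite /z; move: (pt k) => w; rowring.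
    apply: enorm_le_coord => j; rewrite !mxE eqxx /=.
    have [->|ji] := eqVneq j i; first by rewrite ltnn add0r mulr1.
    by rewrite mulr0 addr0; case: ifP => // _; rewrite normr0.
  have := IH (ltnW km); rewrite ptS addrA dotpDr dotpZr.
  have -> : dotp (grad f y) (evec R i) = grad f y 0 i by exact: dotp_delta.
  have -> : f (y + pt k + h 0 i *: evec R i) - f y - (dotp (grad f y) (pt k) + h 0 i * grad f y 0 i) =
      (f (y + pt k) - f y - dotp (grad f y) (pt k)) + h 0 i * ((grad f z - grad f y) 0 i).
    have -> : f (y + pt k + h 0 i *: evec R i) = f (y + pt k) + h 0 i * 'D_(evec R i) f z.
      by rewrite -e1 [RHS]addrC subrK.
    by rewrite !mxE /pderiv; ring.
  move=> hk; rewrite (le_trans (ler_normD _ _))// -natr1 mulrDl mul1r lerD//.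
  rewrite normrM mulrC ler_pM ?normr_coord//.
  by rewrite (le_trans (normr_coord _ _))// hr.
have := step m (leqnn _).
have -> : pt m = h by apply/rowP => j; rewrite !mxE ltn_ord.
move=> /le_trans; apply; rewrite mulrA ler_wpM2r// /e' mulrCA ler_piMr ?(ltW e0)//.
by rewrite ler_pdivrMr// mul1r ler_nat.
Qed.

Lemma C1_MVT f y h : C1 f ->
  exists2 s : R, 0 <= s <= 1 & f (y + h) - f y = dotp (grad f (y + s *: h)) h.
Proof.
move=> cf; have df z : differentiable f z.
  by have [] := differentiable_grad (C1_expand z cf).
have [|s s01 e] := @line_MVT_ge0 f y h 1 ler01.
  by move=> t; exact: diff_derivable.
exists s => //; move: e; rewrite scale1r mul1r => ->.
set z := y + s *: h; rewrite deriveE//.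
have {1}-> : h = \sum_i h 0 i *: evec R i.
  by rewrite {1}[h]row_sum_delta.
rewrite linear_sum /dotp; apply: eq_bigr => i _.
by rewrite linearZ /= !mxE /pderiv deriveE// [LHS]mulrC.
Qed.

Lemma C1_continuous f : C1 f -> continuous f.
Proof.
move=> cf y; have [df _] := differentiable_grad (C1_expand y cf).
exact: differentiable_continuous.
Qed.

(* A common modulus of continuity on a ball, from a local Lipschitz bound on
   each partial derivative and convexity of the ball. *)
Lemma C2_grad_lip f (B : R) : C2 f -> exists2 C : R, 0 < C &
  forall y z, enorm y <= B -> enorm z <= B ->
    enorm (grad f z - grad f y) <= C * enorm (z - y).
Proof.
move=> [_ cf].
have key i : exists2 C : R, 0 < C & forall y, enorm y <= B ->
    enorm (grad (pderiv i f) y) <= C.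
  pose K := [set y : 'rV[R]_m | enorm (y - 0) <= B].
  have [|y r r' h /andP[r'0 rr'] |y Ky|r r0 hr] := @compact_unif _ _ K
     (fun y r => enorm (grad (pderiv i f) y) <= r^-1).
  - exact: compact_enorm_le.
  - by rewrite (le_trans h)// lef_pV2// posrE//; exact: lt_le_trans rr'.
  - have [r r0 hr] := C1_grad_continuous (cf i) y ltr01.
    pose M := enorm (grad (pderiv i f) y) + 1.
    have M0 : 0 < M by rewrite ltr_wpDl.
    exists (Num.min r M^-1); first by rewrite lt_min r0 invr_gt0.
    move=> z Kz; rewrite lt_min => /andP[/hr zy _].
    apply: (@le_trans _ _ M).
      move: zy; rewrite /M; move: (grad (pderiv i f) z) (grad (pderiv i f) y) => a b ab.
      by have := enorm_triangle a b 0; rewrite !subr0; lra.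
    rewrite -{1}[M]invrK lef_pV2 ?posrE ?lt_min ?r0 ?invr_gt0//.
    by rewrite ge_min lexx orbT.
  by exists r^-1; rewrite ?invr_gt0// => y yB; apply: hr; rewrite /K /= subr0.
have /choice[C hC] : forall i, exists C : R, 0 < C /\ forall y, enorm y <= B ->
    enorm (grad (pderiv i f) y) <= C.
  move=> i.
  by have [C C0 h] := key i; exists C.
have C0 : 0 <= \sum_i C i by apply: sumr_ge0 => i _; rewrite ltW//; have [] := hC i.
exists (1 + \sum_i C i); first by lra.
move=> y z yB zB; rewrite (le_trans (enorm_le_sum _))// mulrDl mul1r ler_wpDl// mulr_suml.
apply: ler_sum => i _; rewrite !mxE.
have [s s01] := C1_MVT y (z - y) (cf i); rewrite [y + (z - y)]addrC subrK => ->.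
rewrite (le_trans (normr_dotp _ _))// ler_wpM2r//.
apply: (hC i).2.
have -> : y + s *: (z - y) = (1 - s) *: y + s *: z by rowring.
have /andP[s0 s1] := s01.
rewrite (le_trans (enormD _ _))// !enormZ !ger0_norm ?subr_ge0//.
have : s * enorm z <= s * B by rewrite ler_wpM2l.
have : (1 - s) * enorm y <= (1 - s) * B by rewrite ler_wpM2l// subr_ge0.
by lra.
Qed.

Lemma C2_taylor f (B : R) : C2 f -> exists2 C : R, 0 < C &
  forall y z, enorm y <= B -> enorm z <= B ->
    `|f z - f y - dotp (grad f y) (z - y)| <= C * dotp (z - y) (z - y).
Proof.
move=> cf; have [C C0 hC] := C2_grad_lip B cf; exists C => // y z yB zB.
have [s s01] := C1_MVT y (z - y) cf.1; rewrite [y + (z - y)]addrC subrK => ->.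
rewrite -dotpBl (le_trans (normr_dotp _ _))// -enorm_sqr expr2 mulrA ler_wpM2r//.
have /andP[s0 s1] := s01.
have zsB : enorm (y + s *: (z - y)) <= B.
  have -> : y + s *: (z - y) = (1 - s) *: y + s *: z by rowring.
  rewrite (le_trans (enormD _ _))// !enormZ !ger0_norm ?subr_ge0//.
  have : s * enorm z <= s * B by rewrite ler_wpM2l.
  have : (1 - s) * enorm y <= (1 - s) * B by rewrite ler_wpM2l// subr_ge0.
  by lra.
rewrite (le_trans (hC _ _ yB zsB))// ler_wpM2l ?(ltW C0)//.
by rewrite addrAC subrr add0r enormZ ger0_norm// ler_piMl.
Qed.

(** Indexed so that [h *m hessmx f y] is the derivative of the gradient along [h]. *)
Definition hessmx f y : 'M[R]_m := \matrix_(j, i) pderiv j (pderiv i f) y.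

Lemma hessianE f y u v : hessian f y u v = dotp u (v *m hessmx f y).
Proof.
rewrite /hessian /dotp; apply: eq_bigr => i _; rewrite mxE mulr_sumr.
by apply: eq_bigr => j _; rewrite !mxE mulrA.
Qed.

Lemma C2_grad_expand f y : C2 f -> forall e : R, 0 < e -> exists2 r : R, 0 < r &
  forall h, enorm h < r ->
    enorm (grad f (y + h) - grad f y - h *m hessmx f y) <= e * enorm h.
Proof.
move=> [_ cf] e e0; pose e' := e / m.+1%:R.
have e'0 : 0 < e' by rewrite divr_gt0.
have [i r r' h /andP[_ rr'] z zr|i|r r0 hr] := @ord_unif R m (fun i r => forall h, enorm h < r ->
    `|pderiv i f (y + h) - pderiv i f y - dotp (grad (pderiv i f) y) h| <= e' * enorm h).
- by apply: h; exact: lt_le_trans rr'.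
- exact: C1_expand.
exists r => // h hhr; have hh i := hr i h hhr.
rewrite (le_trans (enorm_le_sum _))//.
apply: (@le_trans _ _ (\sum_(i < m) e' * enorm h)).
  apply: ler_sum => i _; apply: le_trans (hh i); rewrite !mxE.
  have -> // : dotp (grad (pderiv i f) y) h = \sum_j h 0 j * hessmx f y j i.
  by apply: eq_bigr => j _; rewrite !mxE mulrC.
rewrite sumr_const card_ord -mulr_natr mulrAC ler_wpM2r//.
rewrite /e' mulrAC ler_pdivrMr// ler_wpM2l ?(ltW e0)//.
by rewrite ler_nat.
Qed.

End Calculus.

Lemma lipschitz_continuous (R : realType) m (g : 'rV[R]_m -> R) (C : R) :
  (forall y z, `|g z - g y| <= C * enorm (z - y)) -> continuous g.
Proof.
move=> h y A /= /nbhs_ballP[e /= e0 eA]; apply/nbhs_enormP.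
exists (e / (1 + `|C|)); first by rewrite divr_gt0// ltr_pwDl.
move=> z; rewrite ltr_pdivlMr ?ltr_pwDl// => zy; apply: eA.
rewrite -ball_normE /= distrC (le_lt_trans (h _ _))// (le_lt_trans _ zy)//.
by rewrite mulrC ler_wpM2l// (le_trans (ler_norm C))// lerDr.
Qed.

Lemma open_enorm_lt (R : realType) m (z : 'rV[R]_m) (r : R) :
  open [set y | enorm (y - z) < r].
Proof.
rewrite openE => y /= yz; apply/nbhs_enormP; exists (r - enorm (y - z)).
  by rewrite subr_gt0.
by move=> y' y'y /=; have := enorm_triangle y' y z; lra.
Qed.

Section ContinuousFunctions.
Variables (R : realType) (T : topologicalType) (W : normedModType R).

Lemma continuous_addv (f g : T -> W) :
  continuous f -> continuous g -> continuous (fun y => f y + g y).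
Proof. by move=> cf cg y; apply: (@cvgD _ _ _ (nbhs y)); [exact: cf|exact: cg]. Qed.

Lemma continuous_subv (f g : T -> W) :
  continuous f -> continuous g -> continuous (fun y => f y - g y).
Proof. by move=> cf cg y; apply: (@cvgB _ _ _ (nbhs y)); [exact: cf|exact: cg]. Qed.

Lemma continuous_scalev (s : T -> R) (g : T -> W) :
  continuous s -> continuous g -> continuous (fun y => s y *: g y).
Proof. by move=> cs cg y; apply: (@cvgZ _ _ _ (nbhs y)); [exact: cs|exact: cg]. Qed.

Lemma continuous_mulr (s t : T -> R) :
  continuous s -> continuous t -> continuous (fun y => s y * t y).
Proof. by move=> cs ct y; apply: (@cvgM _ _ (nbhs y)); [exact: cs|exact: ct]. Qed.

Lemma continuous_const (a : W) : continuous (fun _ : T => a).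
Proof. by move=> ?; exact: cst_continuous. Qed.

End ContinuousFunctions.

(** * Gluing local directions into a continuous field *)

Section PushField.
Variables (R : realType) (m : nat).
Local Notation V := 'rV[R]_m.
Variable (Good : V -> V -> R -> Prop).
Hypothesis Good0 : forall y, Good y 0 0.
Hypothesis GoodD : forall y w e w' e', Good y w e -> Good y w' e' -> Good y (w + w') (e + e').
Hypothesis GoodZ : forall y w e (a : R), 0 <= a -> Good y w e -> Good y (a *: w) (a * e).

Let bump (r : R) (z y : V) : R := Num.max 0 (r - enorm (y - z)).

Let bump_continuous r z : continuous (bump r z).
Proof.
apply: (@lipschitz_continuous _ _ _ 1) => y y'; rewrite mul1r /bump.
have := enorm_triangle y' y z; have := enorm_triangle y y' z; rewrite (enormB y y').
have := enorm_ge0 (y' - y).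
move: (enorm _) (enorm _) (enorm _) => d a b d0 h1 h2.
rewrite ler_norml.
by rewrite !maxEle; case: ifPn; rewrite -?ltNge => ?; case: ifPn; rewrite -?ltNge => ?; apply/andP; split; lra.
Qed.

(** Good pairs form a convex cone, so bump functions glue finitely many local ones. The bound of [w]
    by [th] makes the quadratic error of a step a small multiple of its linear gain, also where the
    field fades out. *)
Lemma push_field (K : set V) : compact K ->
  (forall y, K y -> exists rho w e, [/\ 0 < rho, 0 < e &
     forall y', enorm (y' - y) < rho -> Good y' w e]) ->
  exists (w : V -> V) (th : V -> R) (C th0 rho0 : R),
    [/\ continuous w, [/\ 0 < C, 0 < th0 & 0 < rho0],
      forall y, [/\ 0 <= th y, th y <= 1 & enorm (w y) <= C * th y],
      forall y y', enorm (y' - y) <= rho0 -> Good y' (w y) (th y) &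
      forall y, K y -> th0 <= th y].
Proof.
move=> cK loc.
have /choice[D hD] : forall y, exists D : R * V * R, K y ->
    [/\ 0 < D.1.1, 0 < D.2 & forall y', enorm (y' - y) < D.1.1 -> Good y' D.1.2 D.2].
  move=> y; have [/loc[rho [w [e [r0 e0 h]]]]|nK] := pselect (K y); last by exists (0, 0, 0).
  by exists (rho, w, e).
have fin (s : seq V) : (forall z, z \in s -> K z) ->
  exists (w : V -> V) (th : V -> R) (C T rho0 : R),
    [/\ continuous w, continuous th, [/\ 0 < C, 0 < T & 0 < rho0],
      forall y, [/\ 0 <= th y, th y <= T & enorm (w y) <= C * th y] &
      (forall y y', enorm (y' - y) <= rho0 -> Good y' (w y) (th y)) /\
      forall y z, z \in s -> enorm (y - z) < (D z).1.1 / 2 -> 0 < th y].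
  elim: s => [|z s IH] sK.
    exists (fun=> 0), (fun=> 0), 1, 1, 1; split => //.
    - by move=> ?; exact: cst_continuous.
    - by move=> ?; exact: cst_continuous.
    - by move=> y; rewrite enorm0 mulr0.
  have [|w [th [C [T [rho0 [cw cth [C0 T0 r0] hb [hg hp]]]]]]] := IH.
    by move=> z' z's; apply: sK; rewrite inE z's orbT.
  have := hD z (sK z (mem_head _ _)).
  set rho := (D z).1.1; set wz := (D z).1.2; set e := (D z).2 => -[rz0 e0 hz].
  (* Half the radius: the direction stays good at all points within [rho / 2] of the support of the
     bump. *)
  pose b := bump (rho / 2) z.
  have b0 y : 0 <= b y by rewrite /b /bump le_max lexx.
  have br y : b y <= rho / 2.
    by rewrite /b /bump ge_max; have := enorm_ge0 (y - z) => ?; apply/andP; split; lra.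
  exists (fun y => w y + b y *: wz), (fun y => th y + b y * e).
  exists (C + enorm wz / e), (T + rho / 2 * e), (Num.min rho0 (rho / 2)).
  have we0 : 0 <= enorm wz / e by rewrite divr_ge0// ltW.
  split.
  - apply: (continuous_addv cw); apply: continuous_scalev; first exact: bump_continuous.
    exact: continuous_const.
  - apply: (@continuous_addv _ _ R^o th (fun y => b y * e) cth).
    apply: continuous_mulr; first exact: bump_continuous.
    exact: (@continuous_const _ _ R^o).
  - split; first by rewrite ltr_wpDr.
      by rewrite addr_gt0// mulr_gt0//; lra.
    by rewrite lt_min r0; lra.
  - move=> y; have [h1 h2 h3] := hb y; have be : 0 <= b y * e by rewrite mulr_ge0// ltW.
    split; first by lra.
      by rewrite lerD// ler_wpM2r// ltW.
    rewrite (le_trans (enormD _ _))// enormZ ger0_norm// mulrDr !mulrDl.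
    have -> : enorm wz / e * (b y * e) = b y * enorm wz by field; rewrite gt_eqF.
    have : 0 <= C * (b y * e) by rewrite mulr_ge0// ltW.
    have : 0 <= enorm wz / e * th y by rewrite mulr_ge0.
    by lra.
  split.
    move=> y y'; rewrite le_min => /andP[y1 y2]; apply: GoodD; first exact: hg.
    have [yz|yz] := ltP (enorm (y - z)) (rho / 2).
      by apply: GoodZ => //; apply: hz; have := enorm_triangle y' y z; lra.
    have -> : b y = 0 by rewrite /b /bump; apply: max_l; lra.
    by rewrite scale0r mul0r; exact: Good0.
  move=> y z'; have [h1 _ _] := hb y; rewrite inE => /orP[/eqP ->|z's] yz.
    have bp : 0 < b y by rewrite /b /bump lt_max subr_gt0 yz orbT.
    by rewrite ltr_wpDl// mulr_gt0.
  have := hp y z' z's yz; have be : 0 <= b y * e by rewrite mulr_ge0// ltW.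
  by lra.
have cov : exists2 s : seq V, (forall z, z \in s -> K z) &
    forall y, K y -> exists2 z, z \in s & enorm (y - z) < (D z).1.1 / 2.
  move: cK; rewrite compact_cover => /(_ _ K (fun z => [set y | enorm (y - z) < (D z).1.1 / 2])).
  case.
  - by move=> z Kz; exact: open_enorm_lt.
  - move=> y Ky; exists y => //=; rewrite subrr enorm0.
    by have [r0 _ _] := hD y Ky; rewrite divr_gt0.
  move=> S SK hS; exists (finmap.enum_fset S); first by move=> z zS; apply/set_mem/SK.
  by move=> y /hS[z zS yz]; exists z.
have [s sK hs] := cov.
have [w [th [C [T [rho0 [cw cth [C0 T0 r0] hb [hg hp]]]]]]] := fin s sK.
have Ti : 0 < T^-1 by rewrite invr_gt0.
have [th0 th00 hth] : exists2 th0 : R, 0 < th0 & forall y, K y -> th0 <= th y.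
  have [K0|/set0P K0] := eqVneq K set0; first by exists 1 => // y; rewrite K0.
  have [y Ky hy] := compact_min cK K0 (continuous_rcontinuous_on (K := K) cth).
  exists (th y) => //; have [z zs yz] := hs y Ky.
  exact: hp zs yz.
exists (fun y => T^-1 *: w y), (fun y => T^-1 * th y), C, (T^-1 * th0), rho0; split.
- by apply: continuous_scalev => //; exact: (@continuous_const _ _ R^o).
- by split => //; rewrite mulr_gt0.
- move=> y; have [h1 h2 h3] := hb y; split; first by rewrite mulr_ge0// ltW.
    by rewrite mulrC ler_pdivrMr// mul1r.
  by rewrite enormZ gtr0_norm// mulrCA ler_wpM2l// ltW.
- by move=> y y' /hg; apply: GoodZ; exact: ltW.
- by move=> y /hth; rewrite ler_pM2l.
Qed.

End PushField.

(** * Separating three compact convex sets *)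

Section Separation.
Variables (R : realType) (m : nat).
Local Notation V := 'rV[R]_m.

Definition segment_closed (C : set V) :=
  forall x y (s : R), C x -> C y -> 0 <= s <= 1 -> C (x + s *: (y - x)).

(* The point of minimal norm of the convex hull of C1, C2 and -C3 separates. *)
Lemma separate3 (C1 C2 C3 : set V) : compact C1 -> compact C2 -> compact C3 ->
  segment_closed C1 -> segment_closed C2 -> segment_closed C3 ->
  C1 !=set0 -> C2 !=set0 -> C3 !=set0 ->
  (forall (a b c : R) x y z, 0 <= a -> 0 <= b -> 0 <= c -> a + b + c = 1 ->
     C1 x -> C2 y -> C3 z -> a *: x + b *: y - c *: z != 0) ->
  exists w (e : R), [/\ 0 < e, forall x, C1 x -> dotp x w <= - e,
    forall y, C2 y -> dotp y w <= - e & forall z, C3 z -> e <= dotp z w].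
Proof.
move=> k1 k2 k3 v1 v2 v3 [x0 x0P] [y0 y0P] [z0 z0P] ne0.
pose T := [set t : R * R * R | [/\ 0 <= t.1.1 <= 1, 0 <= t.1.2 <= 1, 0 <= t.2 <= 1 &
  t.1.1 + t.1.2 + t.2 = 1]].
pose G (p : (R * R * R) * (V * V * V)) : V :=
  p.1.1.1 *: p.2.1.1 + p.1.1.2 *: p.2.1.2 - p.1.2 *: p.2.2.
pose D := G @` (T `*` (C1 `*` C2 `*` C3)).
have cT : compact T.
  apply: (@subclosed_compact _ _ (`[(0 : R), 1]%classic `*` `[(0 : R), 1]%classic `*` `[(0 : R), 1]%classic)).
  - have -> : T = (`[(0 : R), 1]%classic `*` `[(0 : R), 1]%classic `*` `[(0 : R), 1]%classic) `&`
       (fun t : R * R * R => t.1.1 + t.1.2 + t.2) @^-1` [set 1].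
      apply/seteqP; split => -[[a b] c] /=; rewrite !in_itv /=.
        by case.
      by case=> -[[]].
    apply: closedI; last first.
      apply: closed_comp; last exact: closed_eq.
      move=> p _; apply: cvgD; last exact: cvg_snd.
      apply: cvgD.
        by apply: (@continuous_comp _ _ _ fst fst); [exact: cvg_fst|exact: cvg_fst].
      by apply: (@continuous_comp _ _ _ fst snd); [exact: cvg_fst|exact: cvg_snd].
    apply: compact_closed; first exact: norm_hausdorff.
    by do 2 (apply: compact_setX; last exact: segment_compact); exact: segment_compact.
  - by do 2 (apply: compact_setX; last exact: segment_compact); exact: segment_compact.
  - by move=> -[[a b] c] [] /= *; rewrite !in_itv.
have cD : compact D.
  apply: continuous_compact; last by repeat apply: compact_setX.
  apply: continuous_subspaceT => p; rewrite /G.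
  have c11 (A B C : topologicalType) : continuous (fun t : A * B * C => t.1.1).
    by apply: (@continuous_comp_fst _ _ _ fst) => ?; exact: cvg_fst.
  have c12 (A B C : topologicalType) : continuous (fun t : A * B * C => t.1.2).
    by apply: (@continuous_comp_fst _ _ _ snd) => ?; exact: cvg_snd.
  have c2 (A B C : topologicalType) : continuous (fun t : A * B * C => t.2).
    by move=> ?; exact: cvg_snd.
  move: p; apply: continuous_subv; [apply: continuous_addv|]; apply: continuous_scalev.
  - exact: (continuous_comp_fst (@c11 R R R)).
  - exact: (continuous_comp_snd (@c11 V V V)).
  - exact: (continuous_comp_fst (@c12 R R R)).
  - exact: (continuous_comp_snd (@c12 V V V)).
  - exact: (continuous_comp_fst (@c2 R R R)).
  - exact: (continuous_comp_snd (@c2 V V V)).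
have Dne : D !=set0.
  exists (G (1, 0, 0, (x0, y0, z0))), (1, 0, 0, (x0, y0, z0)) => //.
  by split=> //; split; rewrite /= ?lexx ?ler01// ?addr0.
have cn : rcontinuous_on D (@enorm R m).
  by apply: continuous_rcontinuous_on; exact: enorm_continuous.
have [d0 [[[[al be] ga] [[x y] z]] [[/= al01 be01 ga01 s1] [[/= x1 y2] z3] dE]] hd] := compact_min cD Dne cn.
move: al01 be01 ga01 => /andP[al0 _] /andP[be0 _] /andP[ga0 _].
rewrite /G /= in dE.
have d00 : d0 != 0 by rewrite -dE; exact: ne0.
have dp : 0 < dotp d0 d0 by rewrite lt_def dotp_eq0 d00 dotp_ge0.
have key q : (forall s, 0 < s <= 1 -> D (d0 + s *: (q - d0))) -> dotp d0 d0 <= dotp q d0.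
  move=> h; rewrite -subr_ge0 -dotpBl.
  apply: (@ler_small_slope _ _ _ (dotp (q - d0) (q - d0) / 2)).
    by rewrite divr_ge0// dotp_ge0.
  move=> s /andP[s0 s1']; have := hd _ (h s (introT andP (conj s0 s1'))).
  rewrite ler_enorm// enorm_sqr dotp_addsq dotpZl !dotpZr (dotpC d0) => k.
  rewrite -(ler_pM2l s0) mulr0; lra.
have cvx (C : set V) u u1 (c s : R) : segment_closed C -> C u -> C u1 -> 0 <= c -> 0 < s <= 1 ->
    exists2 u', C u' & ((1 - s) * c) *: u + s *: u1 = ((1 - s) * c + s) *: u'.
  move=> vC Cu Cu1 c0 /andP[s0 s1']; have w0 : 0 < (1 - s) * c + s.
    by rewrite ltr_wpDl// mulr_ge0// subr_ge0.
  exists (u + (s / ((1 - s) * c + s)) *: (u1 - u)).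
    apply: vC => //; rewrite divr_ge0 ?(ltW s0) ?(ltW w0)// ler_pdivrMr// mul1r lerDr mulr_ge0//.
    by rewrite subr_ge0.
  rewrite scalerDr scalerA mulrCA mulfV ?gt_eqF// mulr1; rowring.
have sum1 s : 0 < s <= 1 -> [/\ 0 <= (1 - s) * al, 0 <= (1 - s) * be, 0 <= (1 - s) * ga &
    (1 - s) * al + (1 - s) * be + (1 - s) * ga = 1 - s].
  move=> /andP[s0 s1']; have s1s : 0 <= 1 - s by rewrite subr_ge0.
  by split; rewrite ?mulr_ge0// -!mulrDr s1 mulr1.
exists (- d0), (dotp d0 d0); split => //.
- move=> q Cq; rewrite dotpNr lerN2; apply: key => s s01.
  have [u Cu uE] := cvx C1 x q al s v1 x1 Cq al0 s01.
  have [h1 h2 h3 h4] := sum1 s s01; have /andP[s0 s1'] := s01.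
  exists ((1 - s) * al + s, (1 - s) * be, (1 - s) * ga, (u, y, z)).
    by split=> //; split=> /=; lra_with s0 h1 h2 h3 h4.
  by rewrite /G /= -uE -dE; rowring.
- move=> q Cq; rewrite dotpNr lerN2; apply: key => s s01.
  have [u Cu uE] := cvx C2 y q be s v2 y2 Cq be0 s01.
  have [h1 h2 h3 h4] := sum1 s s01; have /andP[s0 s1'] := s01.
  exists ((1 - s) * al, (1 - s) * be + s, (1 - s) * ga, (x, u, z)).
    by split=> //; split=> /=; lra_with s0 h1 h2 h3 h4.
  by rewrite /G /= -uE -dE; rowring.
- move=> q Cq; rewrite dotpNr -dotpNl; apply: key => s s01.
  have [u Cu uE] := cvx C3 z q ga s v3 z3 Cq ga0 s01.
  have [h1 h2 h3 h4] := sum1 s s01; have /andP[s0 s1'] := s01.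
  exists ((1 - s) * al, (1 - s) * be, (1 - s) * ga + s, (x, y, u)).
    by split=> //; split=> /=; lra_with s0 h1 h2 h3 h4.
  by rewrite /G /= -uE -dE; rowring.
Qed.

End Separation.

(** * The local epigraph *)

Section TangentCones.
Variables (R : realType) (m : nat).
Implicit Types (A : set 'rV[R]_m) (p n u : 'rV[R]_m).

(** If the endpoint were in the complement, [y] would be at distance at most [s * enorm w] from it,
    on the normal of a nearby boundary point. The ball of radius [r] tangent there contains the
    endpoint, because [w] has component at least [eta] along that normal. *)
Lemma push_notin (Rr r rho0 eta s : R) (X : set 'rV[R]_m) y w :
  closure (interior X) = X -> compl_set X !=set0 -> unique_proj Rr (compl_set X) ->
  0 < r < Rr -> X y -> 0 < s -> 0 < eta -> s * enorm w <= r / 2 -> s * enorm w <= rho0 ->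
  s * dotp w w < r * eta ->
  (forall a n, compl_set X a -> enorm (a - y) <= rho0 -> enorm n = 1 ->
     proxnor r (compl_set X) a n -> eta <= dotp n w) ->
  ~ compl_set X (y + s *: w).
Proof.
move=> cX A0 uA /andP[r0 rR] Xy s0 eta0 sr srho sw hn Az.
pose d := dist_set (compl_set X) y.
have d0 : 0 <= d by exact: dist_set_ge0.
have dw : d <= s * enorm w.
  rewrite (le_trans (dist_set_le y Az))// opprD addrA subrr add0r enormN.
  by rewrite enormZ gtr0_norm.
have [||n [n1 Aa pn]] := @inner_proxnor _ _ Rr r X y cX A0 uA _ Xy.
- by rewrite r0.
- by rewrite -/d; lra.
rewrite -/d in Aa pn; have ay : y - d *: n - y = - (d *: n) by rowring.
have := hn _ n Aa; rewrite ay enormN enormZ n1 mulr1 ger0_norm// => /(_ (le_trans dw srho) erefl pn) hw.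
have := pn _ Az.
have -> : y + s *: w - (y - d *: n) = d *: n + s *: w by rowring.
rewrite dotp_addsq dotpDr !(dotpZl, dotpZr) unit_dotp//.
move: (dotp n w) hw (dotp w w) sw => t te ww sw h.
have st : 0 < s * t by rewrite mulr_gt0// (lt_le_trans eta0).
have h1 : r * (s * t) <= s * (s * ww).
  have k1 : 0 <= (r / 2 - d) * (s * t) by rewrite mulr_ge0// ?(ltW st)//; lra.
  have k2 : 0 <= d * (r - d) by rewrite mulr_ge0//; lra.
  have k3 : 0 <= d * r by rewrite mulr_ge0// ltW.
  move: k1 k2 h; rewrite !(mulrBl, mulrBr, mulrDr) => k1 k2 h; lra.
have h2 : r * t <= s * ww by rewrite -(ler_pM2l s0) mulrCA.
have : r * eta <= r * t by rewrite ler_pM2l.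
lra.
Qed.

Lemma cvg_enorm (xs : nat -> 'rV[R]_m) p :
  (forall e : R, 0 < e -> \forall k \near \oo, enorm (xs k - p) < e) <-> xs @ \oo --> p.
Proof.
split=> [h B /nbhs_enormP[e e0 eB]|cx e e0].
  by have := h e e0; apply: filterS => k; exact: eB.
by apply: (cx [set z | enorm (z - p) < e]); apply/nbhs_enormP; exists e.
Qed.

Lemma not_tan_dirs A p u : ~ tan_dirs A p u -> exists2 r : R, 0 < r &
  forall b, A b -> b != p -> enorm (b - p) < r ->
    r <= enorm ((enorm (b - p))^-1 *: (b - p) - u).
Proof.
move=> h; apply: contrapT => nr; apply: h.
have /choice[xs hxs] : forall k : nat, exists b, [/\ A b, b != p, enorm (b - p) < k.+1%:R^-1 &
    enorm ((enorm (b - p))^-1 *: (b - p) - u) < k.+1%:R^-1].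
  move=> k; apply: contrapT => nb; apply: nr; exists k.+1%:R^-1; first by rewrite invr_gt0.
  move=> b Ab bp bk; rewrite leNgt; apply/negP => bu; apply: nb.
  by exists b.
have small e : 0 < e -> \forall k \near \oo, (k.+1%:R^-1 : R) < e.
  by move=> e0; exact: (near_infty_natSinv_lt (PosNum e0)).
exists xs; split; first by move=> k; have [] := hxs k.
split; apply/cvg_enorm => e /small; apply: filterS => k; apply: lt_trans.
  by have [] := hxs k.
by have [] := hxs k.
Qed.

Lemma Tan_near A p (e : R) : 0 < e -> exists2 r : R, 0 < r &
  forall b, A b -> enorm (b - p) < r ->
    exists2 v, Tan A p v & enorm (b - p - v) <= e * enorm (b - p).
Proof.
move=> e0; pose Q u r := forall b, A b -> enorm (b - p) < r -> b != p ->
  enorm ((enorm (b - p))^-1 *: (b - p) - u) < r ->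
  exists2 v, Tan A p v & enorm (b - p - v) <= e * enorm (b - p).
have [|u r r' h /andP[_ rr'] b Ab bp bp' bu|u _|r r0 hr] :=
  @compact_unif _ _ [set z : 'rV[R]_m | enorm (z - 0) <= 1] Q.
- exact: compact_enorm_le.
- by apply: h => //; exact: lt_le_trans rr'.
- have [tu|/not_tan_dirs[r r0 h]] := pselect (tan_dirs A p u); last first.
    exists (r / 2); first by lra.
    move=> u' _ u'u b Ab bp bp' bu'.
    have := h b Ab bp'; have := enorm_triangle ((enorm (b - p))^-1 *: (b - p)) u' u.
    move: (enorm (_ - u)) (enorm (_ - u')) bu' => x y bu' h1 h2.
    by have := h2 (ltac:(lra)); lra.
  exists (e / 2); first by lra.
  move=> u' _ u'u b Ab bp bp' bu'.
  have nb : 0 < enorm (b - p) by rewrite enorm_gt0 subr_eq0.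
  exists (enorm (b - p) *: u); first by right; exists (enorm (b - p)), u.
  have -> : b - p - enorm (b - p) *: u = enorm (b - p) *: ((enorm (b - p))^-1 *: (b - p) - u).
    by rewrite scalerBr scalerA mulfV ?gt_eqF// scale1r.
  rewrite enormZ ger0_norm// mulrC ler_wpM2r//.
  by have := enorm_triangle ((enorm (b - p))^-1 *: (b - p)) u' u; lra.
exists r => // b Ab bp; have [->|bp'] := eqVneq b p.
  by exists 0; [left|rewrite subrr subr0 enorm0 mulr0].
apply: (hr ((enorm (b - p))^-1 *: (b - p))) => //.
  by rewrite /= subr0 enorm_unit// subr_eq0.
by rewrite subrr enorm0.
Qed.

Lemma Nor_pr_le A p n (e : R) : Nor_pr A p n -> 0 < e -> exists2 r : R, 0 < r &
  forall b, A b -> enorm (b - p) < r -> dotp n (b - p) <= e * enorm (b - p).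
Proof.
move=> hn e0; have n0 : 0 < 1 + enorm n by rewrite ltr_pwDl.
have [r r0 hr] := Tan_near A p (divr_gt0 e0 n0); exists r => // b Ab bp.
have [v /hn vn hv] := hr b Ab bp.
have -> : dotp n (b - p) = dotp n (b - p - v) + dotp n v by rewrite -dotpDr subrK.
have := dotp_le_enorm n (b - p - v).
have : enorm n * enorm (b - p - v) <= (1 + enorm n) * (e / (1 + enorm n) * enorm (b - p)).
  by rewrite ler_pM// lerDr.
have -> : (1 + enorm n) * (e / (1 + enorm n) * enorm (b - p)) = e * enorm (b - p).
  by field; rewrite gt_eqF.
lra.
Qed.

Lemma Nor_pr_proximal A p n (C r : R) : 0 < r ->
  (forall b, A b -> enorm (b - p) < r -> dotp n (b - p) <= C * dotp (b - p) (b - p)) ->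
  Nor_pr A p n.
Proof.
move=> r0 h b [->|[t [u [t0 [[xs [xsA [xsp xsu]]] ->]]]]]; first by rewrite dotp0r.
rewrite dotpZr mulr_ge0_le0//; apply/ler_addgt0Pr => e e0; rewrite add0r.
have C0 : 0 < 1 + `|C| by rewrite ltr_pwDl.
have n0 : 0 < 1 + enorm n by rewrite ltr_pwDl.
have e2 : 0 < e / 2 by lra.
have [k [[k1 k2] k3]] := filter_ex (filterI (filterI ((cvg_enorm xs p).2 xsp r r0)
  ((cvg_enorm xs p).2 xsp _ (divr_gt0 e2 C0))) ((cvg_enorm _ u).2 xsu _ (divr_gt0 e2 n0))).
have [Ak kp] := xsA k; set D := xs k - p in k1 k2 k3.
have D0 : 0 < enorm D by rewrite enorm_gt0 subr_eq0.
have := h _ Ak k1; rewrite -/D -enorm_sqr expr2 mulrA => hk.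
have h1 : dotp n ((enorm D)^-1 *: D) <= e / 2.
  rewrite dotpZr mulrC ler_pdivrMr// (le_trans hk)// ler_wpM2r//.
  rewrite (le_trans (ler_wpM2r (enorm_ge0 D) (ler_norm C)))//.
  rewrite ltr_pdivlMr// in k2; apply: le_trans (ltW k2).
  by rewrite mulrC ler_wpM2l// lerDr.
have h2 : dotp n u <= dotp n ((enorm D)^-1 *: D) + e / 2.
  rewrite -lerBlDl -dotpBr (le_trans (dotp_le_enorm _ _))// enormB.
  rewrite ltr_pdivlMr// in k3; apply: le_trans (ltW k3).
  by rewrite mulrC ler_wpM2l// lerDr.
lra.
Qed.

End TangentCones.

Section ProximalStability.
Variables (R : realType) (m : nat) (A : set 'rV[R]_m) (r : R).
Hypothesis cA : closed A.
Hypothesis r0 : 0 < r.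

(** Upper semicontinuity of the normals, from compactness of the sphere and closedness of
    [proxnor]. *)
Lemma proxnor_stable y w (eta : R) : 0 < eta ->
  (A y -> forall n, enorm n = 1 -> proxnor r A y n -> eta <= dotp n w) ->
  exists2 rho : R, 0 < rho & forall a n, A a -> enorm (a - y) < rho -> enorm n = 1 ->
    proxnor r A a n -> eta / 2 <= dotp n w.
Proof.
move=> eta0 h; have [Ay|nAy] := pselect (A y); last first.
  have [rho rho0 hr] : exists2 rho : R, 0 < rho & forall a, enorm (a - y) < rho -> ~ A a.
    apply: contrapT => nr; apply: nAy; apply/(closedP_enorm A).1 => // e e0.
    apply: contrapT => na; apply: nr; exists e => // a ae Aa; apply: na.
    by exists a.
  by exists rho => // a n Aa /hr.
pose Q n rho := forall a, A a -> enorm (a - y) < rho -> enorm n = 1 ->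
  proxnor r A a n -> eta / 2 <= dotp n w.
have [|n rho rho' hQ /andP[_ rr'] a Aa ay|n _|rho rho0 hr] :=
  @compact_unif _ _ [set z : 'rV[R]_m | enorm (z - 0) <= 1] Q.
- exact: compact_enorm_le.
- by apply: hQ => //; exact: lt_le_trans rr'.
- have [[n1 pn]|nn] := pselect (enorm n = 1 /\ proxnor r A y n); last first.
    have [n1|n1] := eqVneq (enorm n) 1.
      have [|s s0 hs] := @not_proxnor_near _ _ r A y n r0; first by move=> pn; apply: nn.
      by exists s => // n' _ n'n a Aa ay _ pn; case: (hs a n' ay n'n pn).
    exists `|enorm n - 1|; first by rewrite normr_gt0 subr_eq0.
    move=> n' _ n'n a Aa ay n'1 _; exfalso; move: n'n; rewrite ltNge => /negP; apply.
    by rewrite distrC -n'1 enorm_lip.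
  have w0 : 0 < 1 + enorm w by rewrite ltr_pwDl.
  have e2 : 0 < eta / 2 by lra.
  exists (eta / 2 / (1 + enorm w)); first by rewrite divr_gt0.
  move=> n' _; rewrite ltr_pdivlMr// => n'n a _ _ _ _.
  have := h Ay n n1 pn; have := dotp_ge_enorm (n' - n) w; rewrite dotpBl.
  have : 0 <= enorm (n' - n) by []. 
  by rewrite mulrDr mulr1 in n'n; lra.
exists rho => // a n Aa ay n1; apply: (hr n) => //.
by rewrite /= subr0 n1.
Qed.

End ProximalStability.

Section Chart.
Variables (R : realType) (m : nat).
Local Notation V := 'rV[R]_m.+1.

(* y - p = u N + t v with u = (y - p) Ku and t = <y - p, kt>; the rows of N
   span the hyperplane orthogonal to g. *)
Record chart (g v : V) (N : 'M[R]_(m, m.+1)) (Ku : 'M[R]_(m.+1, m)) (kt : V) : Prop := Chart {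
  chart_NKu : N *m Ku = 1%:M;
  chart_vKu : v *m Ku = 0;
  chart_Nkt : forall u : 'rV_m, dotp (u *m N) kt = 0;
  chart_vkt : dotp v kt = 1;
  chart_id : forall x : V, x = x *m Ku *m N + dotp x kt *: v;
  chart_gN : g *m N^T = 0 }.

Lemma chart_exists (g v : V) : 0 < dotp g v -> exists N Ku kt, chart g v N Ku kt.
Proof.
move=> gv; have g0 : g != 0.
  by apply: contraTneq gv => ->; rewrite dotp0l ltxx.
have rk : \rank (kermx g^T) = m.
  by rewrite mxrank_ker mxrank_tr rank_rV g0 subn1.
have [N [Nf NE]] : exists N : 'M[R]_(m, m.+1), row_free N /\ (N :=: kermx g^T)%MS.
  move: (row_base_free (kermx g^T)) (eq_row_base (kermx g^T)).
  move: (row_base _); rewrite rk => N Nf NE; by exists N.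
have Ng : N *m g^T = 0 by apply/sub_kermxP; rewrite NE.
pose kt := (dotp g v)^-1 *: g.
have Nk (u : 'rV_m) : dotp (u *m N) kt = 0.
  by rewrite /kt dotpZr [dotp (u *m N) g]dotpE -mulmxA Ng mulmx0 mxE mulr0.
have vk : dotp v kt = 1 by rewrite /kt dotpZr (dotpC v g) mulVf// gt_eqF.
have key (x : V) : x *m (kt^T *m v) = dotp x kt *: v.
  by rewrite mulmxA mx11_dotp mul_scalar_mx.
exists N, ((1%:M - kt^T *m v) *m pinvmx N), kt; split => //.
- rewrite mulmxA mulmxBr mulmx1 (_ : N *m (kt^T *m v) = 0) ?subr0 ?mulmxVp//.
  by rewrite mulmxA /kt linearZ /= -scalemxAr Ng scaler0 mul0mx.
- by rewrite mulmxA mulmxBr mulmx1 key vk scale1r subrr mul0mx.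
- move=> x; rewrite mulmxA mulmxKpV ?mulmxBr ?mulmx1 ?key ?subrK//.
  rewrite NE; apply/sub_kermxP; rewrite mulmxBl -scalemxAl.
  rewrite !mx11_dotp scale_scalar_mx /kt dotpZr (dotpC v g) mulrAC mulVf ?gt_eqF// mul1r.
  by rewrite subrr.
- by apply: trmx_inj; rewrite trmx_mul trmxK Ng trmx0.
Qed.

End Chart.

(** * The boundary as a Lipschitz graph *)

Section LocalGraph.
Variables (R : realType) (m : nat).
Local Notation V := 'rV[R]_m.+1.
Variables (X : set V) (Rr r : R) (p v : V) (kap rho : R) (N : 'M[R]_(m, m.+1)).
Local Notation A := (compl_set X).
Hypothesis clX : closed X.
Hypothesis cX : closure (interior X) = X.
Hypothesis uA : unique_proj Rr A.
Hypothesis r0 : 0 < r < Rr.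
Hypothesis Xp : X p.
Hypothesis Ap : A p.
Hypothesis kap0 : 0 < kap.
Hypothesis rho0 : 0 < rho.
Hypothesis cone : forall a n, A a -> enorm (a - p) < rho -> enorm n = 1 ->
  proxnor r A a n -> kap <= dotp n v.
Ltac section_facts ::= assert (clX := I); assert (cX := I); assert (uA := I); assert (r0 := I);
  assert (Xp := I); assert (Ap := I); assert (kap0 := I); assert (rho0 := I); assert (cone := I).

(** The uniform interior cone property: a tilt of [v] by at most [kap / 2] costs at most half of the
    bound [kap] on unit normals. *)
Lemma cone_notin : exists2 s1 : R, 0 < s1 & forall y v' s, X y -> enorm (y - p) < rho / 2 ->
  enorm (v' - v) <= kap / 2 -> 0 < s <= s1 -> ~ A (y + s *: v').
Proof.
have /andP[rp rR] := r0.
pose M := enorm v + kap.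
have M0 : 0 < M by rewrite /M; have := kap0; have := enorm_ge0 v; lra.
pose s1 := Num.min (Num.min (r / (2 * M)) (rho / (2 * M))) (r * kap / (4 * M ^+ 2)).
exists s1; first by rewrite !lt_min !divr_gt0// ?mulr_gt0// exprn_gt0.
move=> y v' s Xy yp v'v /andP[s0]; rewrite !le_min => /andP[/andP[sr srho] sM].
have v'M : enorm v' <= M.
  by have := enorm_triangle v' v 0; rewrite !subr0 /M; have := kap0; lra.
rewrite ler_pdivlMr ?mulr_gt0// in sr; rewrite ler_pdivlMr ?mulr_gt0// in srho.
rewrite ler_pdivlMr ?mulr_gt0// ?exprn_gt0// in sM.
have sv : s * enorm v' <= s * M by rewrite ler_wpM2l// ltW.
apply: (@push_notin _ _ Rr r (rho / 2) (kap / 2) s X y v') => //.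
- by exists p.
- by have := kap0; lra.
- by lra.
- by lra.
- rewrite -enorm_sqr; have h : s * enorm v' ^+ 2 <= s * M ^+ 2.
    by rewrite ler_wpM2l ?(ltW s0)// ler_pXn2r// nnegrE// ltW.
  have : 0 < r * kap by rewrite mulr_gt0.
  lra.
move=> a n Aa ay n1 pn; have := cone Aa _ n1 pn.
have := enorm_triangle a y p => /le_lt_trans h /(_ (h _ _)) -/(_ ltac:(lra)).
have := dotp_ge_enorm n (v' - v); rewrite n1 mul1r dotpBr.
by lra.
Qed.

(** Backward steps from a point of the complement stay in it, since forward steps from [X] leave it.
    So every normal pairs nonnegatively with each admissible tilt of [v], here the one furthest
    against [n]. *)
Lemma Nor_pr_cone y n : A y -> enorm (y - p) < rho / 4 -> Nor_pr A y n ->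
  kap / 2 * enorm n <= dotp n v.
Proof.
move=> Ay yp Nn; have [->|n0] := eqVneq n 0; first by rewrite enorm0 mulr0 dotp0l.
have np : 0 < enorm n by rewrite enorm_gt0.
have [s1 s10 hc] := cone_notin.
pose v' := v - (kap / 2 / enorm n) *: n.
have v'v : enorm (v' - v) <= kap / 2.
  rewrite /v' addrAC subrr add0r enormN enormZ ger0_norm ?divfK ?gt_eqF//.
  by rewrite divr_ge0//; have := kap0; lra.
have nv' : dotp n v' = dotp n v - kap / 2 * enorm n.
  by rewrite /v' dotpBr dotpZr -enorm_sqr; field; rewrite gt_eqF.
have v'0 : 0 < 1 + enorm v' by rewrite ltr_pwDl.
suff : 0 <= dotp n v' by rewrite nv'; lra.
apply/ler_addgt0Pr => e e0.
have [d d0 hd] := Nor_pr_le Nn (divr_gt0 e0 v'0).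
pose s := Num.min s1 (Num.min d (rho / 4) / (2 * (1 + enorm v'))).
have m0 : 0 < Num.min d (rho / 4) by rewrite lt_min d0 divr_gt0.
have s0 : 0 < s by rewrite lt_min s10 divr_gt0// mulr_gt0.
have ss : s <= s1 by rewrite ge_min lexx.
have sv : s * (2 * (1 + enorm v')) <= Num.min d (rho / 4).
  by rewrite -ler_pdivlMr ?mulr_gt0// ge_min lexx orbT.
move: sv; rewrite le_min => /andP[sd srho].
clearbody s; have sv0 : 0 <= s * enorm v' by rewrite mulr_ge0// ltW.
have zy : y - s *: v' - y = - (s *: v') by rowring.
have nzy : enorm (y - s *: v' - y) = s * enorm v' by rewrite zy enormN enormZ gtr0_norm.
rewrite mulrDr mulr1 mulrDr mulrCA in sd; rewrite mulrDr mulr1 mulrDr mulrCA in srho.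
have Az : A (y - s *: v').
  apply: subset_closure => Xz; apply: (hc (y - s *: v') v' s Xz) => //.
  - have := enorm_triangle (y - s *: v') y p; rewrite nzy; lra.
  - by rewrite s0.
  - by rewrite subrK.
have := hd _ Az; rewrite nzy zy dotpNr dotpZr => /(_ ltac:(lra)) h.
have h2 : - dotp n v' <= e / (1 + enorm v') * enorm v'.
  by rewrite -(ler_pM2l s0) mulrN mulrCA.
have : e / (1 + enorm v') * enorm v' <= e / (1 + enorm v') * (1 + enorm v').
  by rewrite ler_wpM2l ?lerDr// divr_ge0 ?(ltW e0) ?(ltW v'0).
rewrite divfK ?gt_eqF//; lra_with h2.
Qed.

Definition chart_pt (u : 'rV[R]_m) (t : R) : V := p + u *m N + t *: v.

(** [h u] is the lowest height at which the line through [u] parallel to [v] meets [X]. The cone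
    property gives that [X] is closed upwards on such lines and that [h] is Lipschitz. *)
Lemma local_graph : exists (h : 'rV[R]_m -> R) (ru tau L : R),
  [/\ 0 < ru, 0 < tau & 0 < L] /\
  [/\ h 0 = 0,
    forall u, enorm u <= ru -> `|h u| <= tau / 2,
    forall u u', enorm u <= ru -> enorm u' <= ru -> `|h u' - h u| <= L * enorm (u' - u),
    forall u t, enorm u <= ru -> `|t| <= tau -> (X (chart_pt u t) <-> h u <= t) &
    forall u t, enorm u <= ru -> `|t| <= tau -> (A (chart_pt u t) <-> t <= h u)] /\
  forall u t, enorm u <= ru -> `|t| <= tau -> enorm (chart_pt u t - p) < rho / 4.
Proof.
have [s1 s10 hc] := cone_notin; have [C C0 hC] := mulmx_bound N.
(* Above this slope, a displacement along the graph is a tilt of [v] by at most [kap / 2]. *)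
pose L := 2 * C / kap; have L0 : 0 < L by rewrite divr_gt0// mulr_gt0.
have LE : C = kap / 2 * L by rewrite /L; field; rewrite gt_eqF.
clearbody L.
have v0 : 0 < 1 + enorm v by rewrite ltr_pwDl.
pose tau := Num.min (s1 / 2) (rho / (16 * (1 + enorm v))).
have tau0 : 0 < tau by rewrite lt_min !divr_gt0// mulr_gt0.
have ts : tau <= s1 / 2 by rewrite ge_min lexx.
have tv : tau * enorm v <= rho / 16.
  have : tau <= rho / (16 * (1 + enorm v)) by rewrite ge_min lexx orbT.
  by rewrite ler_pdivlMr ?mulr_gt0// mulrDr !mulrDr; have := tau0; lra.
pose ru := Num.min (tau / (2 * L)) (rho / (16 * C)).
have ru0 : 0 < ru by rewrite lt_min !divr_gt0// mulr_gt0.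
have rL (u : 'rV[R]_m) : enorm u <= ru -> L * enorm u <= tau / 2.
  move=> ur; have : ru <= tau / (2 * L) by rewrite ge_min lexx.
  rewrite ler_pdivlMr ?mulr_gt0// => h; have : L * enorm u <= L * ru by rewrite ler_pM2l.
  lra.
have near_p u t : enorm u <= ru -> `|t| <= tau -> enorm (chart_pt u t - p) < rho / 4.
  move=> ur tr; have -> : chart_pt u t - p = u *m N + t *: v by rewrite /chart_pt; move: (u *m N) => w; rowring.
  have : ru <= rho / (16 * C) by rewrite ge_min lexx orbT.
  rewrite ler_pdivlMr ?mulr_gt0// => h; have := hC u.
  have : C * enorm u <= C * ru by rewrite ler_pM2l.
  have : `|t| * enorm v <= tau * enorm v by rewrite ler_wpM2r.
  by have := enormD (u *m N) (t *: v); rewrite enormZ; have := rho0; lra.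
have up u t u' t' : enorm u <= ru -> `|t| <= tau -> `|t'| <= tau ->
    t < t' -> L * enorm (u' - u) <= t' - t -> X (chart_pt u t) -> ~ A (chart_pt u' t').
  move=> ur tr tr' tt' Lu Xu.
  have dt : 0 < t' - t by rewrite subr_gt0.
  have -> : chart_pt u' t' = chart_pt u t + (t' - t) *: (v + (t' - t)^-1 *: ((u' - u) *m N)).
    rewrite scalerDr scalerA mulfV ?gt_eqF// scale1r /chart_pt mulmxBl.
    by move: (u *m N) (u' *m N) => a b; rowring.
  apply: hc => //; first by have := near_p u t ur tr; have := rho0; lra.
    rewrite addrAC subrr add0r enormZ gtr0_norm ?invr_gt0// mulrC ler_pdivrMr//.
    rewrite (le_trans (hC _))//.
    rewrite {1}LE -mulrA.
    by rewrite ler_wpM2l//; have := kap0; lra.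
  by rewrite dt; move: tr tr'; rewrite !ler_norml; lra.
have pt0 : chart_pt 0 0 = p by rewrite /chart_pt mul0mx scale0r !addr0.
have n0 : enorm (0 : 'rV[R]_m) <= ru by rewrite enorm0 ltW.
have t2 : `|tau / 2| <= tau by rewrite ger0_norm; lra.
have t2' : `|- (tau / 2)| <= tau by rewrite normrN.
have t0 : `|0 : R| <= tau by rewrite normr0 ltW.
have Xtop u : enorm u <= ru -> X (chart_pt u (tau / 2)).
  move=> ur; apply: notin_compl_set; apply: (up 0 0 u (tau / 2) n0 t0 t2).
  - by lra.
  - by rewrite !subr0; exact: rL.
  - by rewrite pt0.
have Xbot u : enorm u <= ru -> ~ X (chart_pt u (- (tau / 2))).
  move=> ur Xu; apply: (up u (- (tau / 2)) 0 0 ur t2' t0 _ _ Xu).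
  - by lra.
  - by rewrite sub0r enormN sub0r opprK; exact: rL.
  - by rewrite pt0.
have upX u t t' : enorm u <= ru -> `|t| <= tau -> `|t'| <= tau -> t < t' -> X (chart_pt u t) -> ~ A (chart_pt u t').
  by move=> ur tr tr' tt'; apply: up => //; rewrite subrr enorm0 mulr0 subr_ge0 ltW.
pose S u := [set t : R | `|t| <= tau /\ X (chart_pt u t)].
have Sne u : enorm u <= ru -> S u !=set0 by move=> ur; exists (tau / 2); split => //; exact: Xtop.
have Slb u t : enorm u <= ru -> S u t -> - (tau / 2) < t.
  move=> ur [tr Xt]; rewrite ltNge; apply/negP => tt; apply: (Xbot u ur).
  move: tt; rewrite le_eqVlt => /orP[/eqP <-//|tt].
  by apply: notin_compl_set; exact: (upX u t _ ur tr t2' tt Xt).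
pose h u := inf (S u).
have hlb u : enorm u <= ru -> has_lbound (S u).
  by move=> ur; exists (- (tau / 2)) => t /(Slb u t ur)/ltW.
have h_le u t : enorm u <= ru -> S u t -> h u <= t.
  by move=> ur St; apply: ge_inf => //; exact: hlb.
have h_ge u : enorm u <= ru -> - (tau / 2) <= h u.
  by move=> ur; apply: lb_le_inf; [exact: Sne|move=> t /(Slb u t ur)/ltW].
have h_top u : enorm u <= ru -> h u <= tau / 2.
  by move=> ur; apply: h_le => //; split => //; exact: Xtop.
have h_tau u : enorm u <= ru -> `|h u| <= tau / 2.
  by move=> ur; rewrite ler_norml h_ge// h_top.
have h_tau' u : enorm u <= ru -> `|h u| <= tau by move=> /h_tau; lra_with tau0.
have ptt u t t' : enorm (chart_pt u t - chart_pt u t') = `|t - t'| * enorm v.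
  by rewrite -enormZ; congr enorm; rewrite /chart_pt; move: (u *m N) => w; rowring.
have Xh u : enorm u <= ru -> X (chart_pt u (h u)).
  move=> ur; apply/(closedP_enorm X).1 => // e e0.
  have [t [tr Xt] th] := inf_adherent (divr_gt0 e0 v0) (conj (Sne u ur) (hlb u ur)).
  exists (chart_pt u t) => //; rewrite ptt.
  have th0 : h u <= t by exact: h_le.
  rewrite ger0_norm ?subr_ge0//.
  have : t - h u < e / (1 + enorm v) by rewrite /h; lra_with th.
  rewrite ltr_pdivlMr// mulrDr mulr1; have : 0 <= t - h u by lra_with th0.
  lra_with.
have G1 u t : enorm u <= ru -> `|t| <= tau -> (X (chart_pt u t) <-> h u <= t).
  move=> ur tr; split => [Xt|]; first exact: h_le.
  rewrite le_eqVlt => /orP[/eqP <-|ht]; first exact: Xh.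
  by apply: notin_compl_set; exact: (upX u (h u) _ ur (h_tau' _ ur) tr ht (Xh _ ur)).
have Alow u t : enorm u <= ru -> `|t| <= tau -> t < h u -> A (chart_pt u t).
  move=> ur tr th; apply: subset_closure => /G1 - /(_ ur tr); lra_with th.
have G2 u t : enorm u <= ru -> `|t| <= tau -> (A (chart_pt u t) <-> t <= h u).
  move=> ur tr; split => [At|].
    rewrite leNgt; apply/negP => ht; apply: (upX u (h u) t ur _ tr ht _ At).
      exact: h_tau'.
    exact: Xh.
  rewrite le_eqVlt => /orP[/eqP ->|]; last exact: Alow.
  apply/(closedP_enorm A).1 => [|e e0]; first exact: closed_compl_set.
  pose s := Num.min (tau / 2) (e / (1 + enorm v)) / 2.
  have s0 : 0 < s by rewrite divr_gt0// lt_min !divr_gt0.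
  have s2 : s <= tau / 4.
    have : Num.min (tau / 2) (e / (1 + enorm v)) <= tau / 2 by rewrite ge_min lexx.
    by rewrite /s; lra_with.
  have s3 : 2 * s <= e / (1 + enorm v) by rewrite /s mulrC divfK// ge_min lexx orbT.
  exists (chart_pt u (h u - s)).
    apply: Alow => //; last by lra_with s0.
    by have := h_tau u ur; rewrite !ler_norml; lra_with s0 s2.
  rewrite ptt addrAC subrr add0r normrN gtr0_norm//.
  rewrite ler_pdivlMr// mulrDr mulr1 in s3.
  have := mulr_ge0 (ltW s0) (enorm_ge0 v); lra_with e0 s0 s3.
have G3 u u' : enorm u <= ru -> enorm u' <= ru -> h u' <= h u + L * enorm (u' - u).
  move=> ur ur'; rewrite leNgt; apply/negP => hh.
  have Lu : 0 <= L * enorm (u' - u) by rewrite mulr_ge0// ltW.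
  have htr' : `|h u'| <= tau by exact: h_tau'.
  apply: (up u (h u) u' (h u') ur (h_tau' u ur) htr').
  - by lra_with hh Lu.
  - by lra_with hh.
  - exact: Xh.
  - by apply/G2.
exists h, ru, tau, L; split => //; split => //; split => //.
- apply/eqP; rewrite eq_le; apply/andP; split.
    by apply: h_le => //; split => //; rewrite pt0.
  by apply/G2 => //; rewrite pt0.
- move=> u u' ur ur'; rewrite ler_norml.
  by have := G3 u u' ur ur'; have := G3 u' u ur' ur; rewrite (enormB u u'); lra_with.
Qed.

End LocalGraph.

Section FirstOrder.
Variables (R : realType) (m : nat) (F : 'rV[R]_m -> R) (K rho : R).
Hypothesis K0 : 0 <= K.
Hypothesis neF : forall u, enorm u <= rho -> exists q, sgrad F K rho u q.

Lemma sgrad_concave u v s : enorm u <= rho -> enorm v <= rho -> 0 <= s <= 1 ->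
  (1 - s) * F u + s * F v <=
  F (u + s *: (v - u)) + K / 2 * (s * (1 - s)) * dotp (v - u) (v - u).
Proof.
move=> uB vB s01; have /andP[s0 s1] := s01.
have [q hq] := neF (enorm_segment uB vB s01).
have := hq _ uB; have := hq _ vB.
have -> : v - (u + s *: (v - u)) = (1 - s) *: (v - u).
  by rewrite scalerBl scale1r opprD addrA.
have -> : u - (u + s *: (v - u)) = (- s) *: (v - u) by rewrite opprD addrA subrr add0r scaleNr.
rewrite !(dotpZl (1 - s)) !(dotpZr (1 - s)) !(dotpZl (- s)) !(dotpZr (- s)).
set D := dotp (v - u) _; set a := dotp q _; set Fs := F (u + _) => h1 h2.
have e1 : s * F v <= s * (Fs + (1 - s) * a + K / 2 * ((1 - s) * ((1 - s) * D))).
  by rewrite ler_wpM2l.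
have e2 : (1 - s) * F u <= (1 - s) * (Fs + - s * a + K / 2 * (- s * (- s * D))).
  by rewrite ler_wpM2l// subr_ge0.
apply: (le_trans (lerD e2 e1)); rewrite le_eqVlt; apply/orP; left; apply/eqP; ring.
Qed.

(** Concavity along segments turns a first order inequality near [u] into a quadratic one on the
    whole ball. *)
Lemma sgrad_first_order u q : enorm u <= rho ->
  (forall e : R, 0 < e -> exists2 r : R, 0 < r & forall u1, enorm u1 <= rho ->
     enorm (u1 - u) < r -> F u1 <= F u + dotp q (u1 - u) + e * enorm (u1 - u)) ->
  sgrad F K rho u q.
Proof.
move=> uB hw v vB; have [->|vu] := eqVneq v u.
  by rewrite subrr dotp0r dotp0l mulr0 !addr0.
have d0 : 0 < enorm (v - u) by rewrite enorm_gt0 subr_eq0.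
set D := dotp (v - u) _; apply/ler_addgt0Pr => e e0.
have [r r0 hr] := hw (e / enorm (v - u)) ltac:(by rewrite divr_gt0).
pose s := Num.min (1 / 2) (r / (2 * enorm (v - u))).
have s0 : 0 < s by rewrite lt_min !divr_gt0// mulr_gt0.
have s1 : s <= 1 / 2 by rewrite ge_min lexx.
have sr : s * enorm (v - u) < r.
  have : s <= r / (2 * enorm (v - u)) by rewrite ge_min lexx orbT.
  by rewrite ler_pdivlMr ?mulr_gt0// => h; have := mulr_gt0 s0 d0; lra.
clearbody s; have s01 : 0 <= s <= 1 by apply/andP; split; lra.
have := hr _ (enorm_segment uB vB s01); rewrite addrAC subrr add0r enormZ gtr0_norm// dotpZr.
move=> /(_ sr); have -> : e / enorm (v - u) * (s * enorm (v - u)) = s * e.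
  by field; rewrite gt_eqF.
have := sgrad_concave uB vB s01; rewrite -/D; set Fs := F (u + _) => h1 h2.
have KD : 0 <= K / 2 * D by rewrite mulr_ge0 ?dotp_ge0// divr_ge0.
have sKD : s * (s * (K / 2 * D)) >= 0.
  by apply: mulr_ge0; [exact: ltW | apply: mulr_ge0 => //; exact: ltW].
rewrite -(ler_pM2l s0).
move: h1 h2.
have -> : K / 2 * (s * (1 - s)) * D = s * (K / 2 * D) - s * (s * (K / 2 * D)) by ring.
rewrite !mulrDr mulrBl mul1r; lra.
Qed.

End FirstOrder.

(* Near a boundary point p the set X is the epigraph {t >= h u} in coordinates
   adapted to f, and its complement is the hypograph. *)
Record local_model (R : realType) (m : nat) (X : set 'rV[R]_m.+1) (f : 'rV[R]_m.+1 -> R)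
    (Rr r : R) (p v : 'rV[R]_m.+1) (kap rho kv : R) (N : 'M[R]_(m, m.+1))
    (Ku : 'M[R]_(m.+1, m)) (kt : 'rV[R]_m.+1) (h : 'rV[R]_m -> R) (ru tau L : R) :
    Prop := LocalModel {
  lm_fC2 : C2 f;
  lm_clX : closed X;
  lm_cX : closure (interior X) = X;
  lm_uA : unique_proj Rr (compl_set X);
  lm_r0 : 0 < r < Rr;
  lm_kap0 : 0 < kap;
  lm_rho0 : 0 < rho;
  lm_cone : forall a n, (compl_set X) a -> enorm (a - p) < rho -> enorm n = 1 ->
  proxnor r (compl_set X) a n -> kap <= dotp n v;
  lm_ch : chart (grad f p) v N Ku kt;
  lm_kv0 : 0 < kv;
  lm_gkv : forall y, enorm (y - p) < rho -> kv <= dotp (grad f y) v;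
  lm_ru0 : 0 < ru;
  lm_tau0 : 0 < tau;
  lm_L0 : 0 < L;
  lm_h0 : h 0 = 0;
  lm_htau : forall u, enorm u <= ru -> `|h u| <= tau / 2;
  lm_hL : forall u u', enorm u <= ru -> enorm u' <= ru ->
  `|h u' - h u| <= L * enorm (u' - u);
  lm_hX : forall u t, enorm u <= ru -> `|t| <= tau -> (X (chart_pt p v N u t) <-> h u <= t);
  lm_hA : forall u t, enorm u <= ru -> `|t| <= tau -> ((compl_set X) (chart_pt p v N u t) <-> t <= h u);
  lm_hp : forall u t, enorm u <= ru -> `|t| <= tau -> enorm (chart_pt p v N u t - p) < rho / 4 }.

(** * Supergradients of [F] and normals of [X] *)

Section Graph.
Variables (R : realType) (m : nat).
Local Notation V := 'rV[R]_m.+1.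
Variables (X : set V) (f : V -> R) (Rr r : R) (p v : V) (kap rho kv : R).
Variables (N : 'M[R]_(m, m.+1)) (Ku : 'M[R]_(m.+1, m)) (kt : V).
Variables (h : 'rV[R]_m -> R) (ru tau L : R).
Hypothesis M : local_model X f Rr r p v kap rho kv N Ku kt h ru tau L.
Local Notation A := (compl_set X).
Local Notation pt := (chart_pt p v N).
Local Notation Gr := (fun u : 'rV[R]_m => pt u (h u)).
Local Notation F := (fun u : 'rV[R]_m => f (pt u (h u))).
Local Notation fC2 := (lm_fC2 M).
Local Notation cX := (lm_cX M).
Local Notation uA := (lm_uA M).
Local Notation r0 := (lm_r0 M).
Local Notation kap0 := (lm_kap0 M).
Local Notation rho0 := (lm_rho0 M).
Local Notation cone := (lm_cone M).
Local Notation ch := (lm_ch M).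
Local Notation kv0 := (lm_kv0 M).
Local Notation gkv := (lm_gkv M).
Local Notation tau0 := (lm_tau0 M).
Local Notation L0 := (lm_L0 M).
Local Notation htau := (lm_htau M).
Local Notation hL := (lm_hL M).
Local Notation hX := (lm_hX M).
Local Notation hA := (lm_hA M).
Local Notation hp := (lm_hp M).

Lemma pt_Ku u t : (pt u t - p) *m Ku = u.
Proof.
rewrite (_ : pt u t - p = u *m N + t *: v); last by rewrite /chart_pt; rowring.
by rewrite mulmxDl -mulmxA (chart_NKu ch) mulmx1 -scalemxAl (chart_vKu ch) scaler0 addr0.
Qed.

Lemma pt_kt u t : dotp (pt u t - p) kt = t.
Proof.
rewrite (_ : pt u t - p = u *m N + t *: v); last by rewrite /chart_pt; rowring.
by rewrite dotpDl (chart_Nkt ch) add0r dotpZl (chart_vkt ch) mulr1.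
Qed.

Lemma pt_coords y : y = pt ((y - p) *m Ku) (dotp (y - p) kt).
Proof. by rewrite /chart_pt -addrA -(chart_id ch) addrC subrK. Qed.

Lemma pt_sub u t u' t' : pt u' t' - pt u t = (u' - u) *m N + (t' - t) *: v.
Proof. by rewrite /chart_pt mulmxBl scalerBl; rowring. Qed.

Lemma pt0 : pt 0 0 = p. Proof. by rewrite /chart_pt mul0mx scale0r !addr0. Qed.

Lemma chart_cov (w : V) : dotp w v = 0 -> w = w *m N^T *m Ku^T.
Proof.
move=> wv; apply/rowP => i; rewrite -!dotp_delta -mulmxA -trmx_mul dotp_mulmxl trmxK.
by rewrite [in LHS](chart_id ch (delta_mx 0 i)) dotpDr dotpZr wv mulr0 addr0 mulmxA.
Qed.

Lemma NKuT (q : 'rV[R]_m) : q *m Ku^T *m N^T = q.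
Proof. by rewrite -mulmxA -trmx_mul (chart_NKu ch) trmx1 mulmx1. Qed.

Lemma Ku_v (q : 'rV[R]_m) : dotp (q *m Ku^T) v = 0.
Proof. by rewrite dotp_mulmxl trmxK (chart_vKu ch) dotp0r. Qed.

Lemma graph_rho u : enorm u <= ru -> enorm (Gr u - p) < rho / 4.
Proof. by move=> uB; apply: hp => //; apply: (le_trans (htau uB)); have := tau0; lra. Qed.

Lemma graph_A u : enorm u <= ru -> A (Gr u).
Proof. by move=> uB; apply/hA => //; apply: (le_trans (htau uB)); have := tau0; lra. Qed.

Lemma graph_X u : enorm u <= ru -> X (Gr u).
Proof. by move=> uB; apply/hX => //; apply: (le_trans (htau uB)); have := tau0; lra. Qed.

Lemma graph_lip : exists2 C : R, 0 < C & forall u u', enorm u <= ru -> enorm u' <= ru ->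
  enorm (Gr u' - Gr u) <= C * enorm (u' - u).
Proof.
have [C C0 hC] := mulmx_bound N.
exists (C + L * enorm v); first by rewrite ltr_wpDr// mulr_ge0 ?enorm_ge0// (ltW L0).
move=> u u' uB u'B; rewrite pt_sub (le_trans (enormD _ _))// mulrDl lerD ?hC//.
by rewrite enormZ mulrAC ler_wpM2r ?enorm_ge0// hL.
Qed.

Lemma graph_taylor : exists2 C : R, 0 < C & forall y z, enorm (y - p) < rho ->
  enorm (z - p) < rho -> `|f z - f y - dotp (grad f y) (z - y)| <= C * dotp (z - y) (z - y).
Proof.
have [C C0 hC] := C2_taylor (rho + enorm p) fC2; exists C => // y z yp zp; apply: hC.
  by have := enorm_triangle y p 0; rewrite !subr0; lra.
by have := enorm_triangle z p 0; rewrite !subr0; lra.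
Qed.

(** A Lagrange multiplier rule: [mu *: n] is the part of the gradient of [f] absorbed by the
    constraint, and the tangent ball at [Gr u] bounds its action on other graph points
    quadratically. *)
Lemma sgrad_of_normal : exists2 C : R, 0 < C & forall u q n mu, enorm u <= ru -> 0 <= mu ->
  proxnor r A (Gr u) n -> grad f (Gr u) = q *m Ku^T + mu *: n ->
  forall u1, enorm u1 <= ru ->
    F u1 <= F u + dotp q (u1 - u) + C * (1 + mu) * dotp (u1 - u) (u1 - u).
Proof.
have /andP[rp _] := r0; have [C C0 hC] := graph_taylor; have [G G0 hG] := graph_lip.
exists ((C + (2 * r)^-1) * G ^+ 2); first by rewrite mulr_gt0 ?exprn_gt0// addr_gt0// invr_gt0 mulr_gt0.
move=> u q n mu uB mu0 hn gE u1 u1B.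
have yp := graph_rho uB; have bp := graph_rho u1B.
have := hC (Gr u) (Gr u1) ltac:(have := rho0; lra_with yp) ltac:(have := rho0; lra_with bp).
have := hn _ (graph_A u1B).
have := hG u u1 uB u1B.
have -> : dotp (grad f (Gr u)) (Gr u1 - Gr u) = dotp q (u1 - u) + mu * dotp n (Gr u1 - Gr u).
  rewrite gE dotpDl dotpZl dotp_mulmxl trmxK pt_sub mulmxDl -mulmxA (chart_NKu ch) mulmx1.
  by rewrite -scalemxAl (chart_vKu ch) scaler0 addr0.
rewrite ler_enorm ?mulr_ge0 ?enorm_ge0 ?(ltW G0)// exprMn enorm_sqr.
move: (Gr u) (Gr u1) => y b; set e := dotp (b - y) (b - y); set D := dotp (u1 - u) (u1 - u).
move=> eD; rewrite mulrC -ler_pdivlMr ?mulr_gt0// => nb; rewrite ler_norml => /andP[_ hf].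
have mn : mu * dotp n (b - y) <= mu * (e / (2 * r)) by rewrite ler_wpM2l// .
have ri : 0 <= (2 * r)^-1 by rewrite invr_ge0 mulr_ge0// ltW.
have t1 : (C + mu * (2 * r)^-1) * e <= (C + mu * (2 * r)^-1) * (G ^+ 2 * D).
  by rewrite ler_wpM2l// addr_ge0 ?(ltW C0)// mulr_ge0.
have D0 : 0 <= G ^+ 2 * D by rewrite mulr_ge0 ?dotp_ge0// exprn_ge0// ltW.
have t2 : 0 <= (C * mu + (2 * r)^-1) * (G ^+ 2 * D).
  by rewrite mulr_ge0// addr_ge0// mulr_ge0// ltW.
have -> : (C + (2 * r)^-1) * G ^+ 2 * (1 + mu) * D =
  (C + mu * (2 * r)^-1) * (G ^+ 2 * D) + (C * mu + (2 * r)^-1) * (G ^+ 2 * D) by ring.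
have e3 : (C + mu * (2 * r)^-1) * e = C * e + mu * (e / (2 * r)) by ring.
lra_with hf mn t1 t2.
Qed.

Lemma graph_normal u : enorm u <= ru -> exists2 n, enorm n = 1 & proxnor r A (Gr u) n.
Proof.
move=> uB; have /andP[rp rR] := r0; have Ay := graph_A uB.
have d0 : dist_set A (Gr u) = 0 by rewrite dist_set_mem.
have := @inner_proxnor R m.+1 Rr r X (Gr u) cX (ex_intro _ _ Ay) uA r0 (graph_X uB).
rewrite d0 => /(_ (ltW rp)) [n [n1 _]].
by rewrite scale0r subr0 => hn; exists n.
Qed.

Lemma grad_bound : exists2 Mg : R, 0 < Mg & forall y, enorm (y - p) < rho -> enorm (grad f y) <= Mg.
Proof.
have [C C0 hC] := C2_grad_lip (rho + enorm p) fC2.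
exists (enorm (grad f p) + C * rho); first by rewrite ltr_wpDl ?enorm_ge0// mulr_gt0 ?rho0.
move=> y yp; have pB : enorm p <= rho + enorm p by rewrite lerDr (ltW rho0).
have yB : enorm y <= rho + enorm p by have := enorm_triangle y p 0; rewrite !subr0; lra.
have := hC _ _ pB yB; have := enorm_triangle (grad f y) (grad f p) 0; rewrite !subr0.
have : C * enorm (y - p) <= C * rho by rewrite ler_wpM2l// ltW.
lra_with.
Qed.

(** The multiplier is chosen so that the gradient minus [mu *: n] kills [v], hence is a covector in
    [u]; the cone bound [kap] keeps it, and so [K], uniformly bounded. *)
Lemma graph_semiconcave : exists2 K : R, 0 <= K &
  forall u, enorm u <= ru -> exists q, sgrad F K ru u q.
Proof.
have [C C0 hC] := sgrad_of_normal; have [Mg Mg0 hM] := grad_bound.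
pose mm := Mg * enorm v / kap; have mm0 : 0 <= mm.
  by rewrite divr_ge0 ?mulr_ge0 ?enorm_ge0 ?(ltW Mg0)// (ltW kap0).
exists (2 * (C * (1 + mm))); first by rewrite !mulr_ge0 ?addr_ge0 ?(ltW C0).
move=> u uB; have [n n1 hn] := graph_normal uB.
have yp : enorm (Gr u - p) < rho by have := graph_rho uB; have := rho0; lra.
have nv := cone (graph_A uB) yp n1 hn.
have nv0 : 0 < dotp n v by have := kap0; lra.
pose mu := dotp (grad f (Gr u)) v / dotp n v.
have gv := gkv yp.
have mu0 : 0 <= mu by rewrite divr_ge0 ?(ltW nv0)//; have := kv0; lra.
have mule : mu <= mm.
  rewrite /mu /mm ler_pM ?invr_ge0 ?(ltW nv0)//; first by have := kv0; lra.
    by rewrite (le_trans (dotp_le_enorm _ _))// ler_wpM2r ?enorm_ge0// hM.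
  by rewrite lef_pV2 // posrE kap0.
pose w := grad f (Gr u) - mu *: n.
have wv : dotp w v = 0 by rewrite /w dotpBl dotpZl /mu divfK ?subrr// gt_eqF.
exists (w *m N^T) => u1 u1B.
apply: le_trans (hC u (w *m N^T) n mu uB mu0 hn _ u1 u1B) _.
  by rewrite -(chart_cov wv) /w subrK.
rewrite lerD2l ler_wpM2r ?dotp_ge0// mulrAC mulfV ?mul1r// ler_wpM2l ?(ltW C0)//.
by rewrite lerD2l.
Qed.

Lemma F_continuous : rcontinuous_on [set u | enorm u <= ru] F.
Proof.
have [C C0 hC] := graph_taylor; have [G G0 hG] := graph_lip; have [Mg Mg0 hM] := grad_bound.
apply: (@lipschitz_rcontinuous_on _ _ _ _ (G * (Mg + 2 * C * rho))) => u u' uB u'B.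
have yp := graph_rho uB; have bp := graph_rho u'B; have := rho0 => rp.
have := hC (Gr u) (Gr u') ltac:(lra) ltac:(lra); have := hG u u' uB u'B.
have := hM (Gr u) ltac:(lra); have := normr_dotp (grad f (Gr u)) (Gr u' - Gr u).
have : enorm (Gr u' - Gr u) <= 2 * rho.
  by have := enorm_triangle (Gr u') p (Gr u); rewrite (enormB p); lra.
rewrite -enorm_sqr; move: (grad f (Gr u)) (Gr u' - Gr u) (F u) (F u') => g e a b.
move=> e1 e2 e3 e4 e5.
have e0 := enorm_ge0 e; have u0 := enorm_ge0 (u' - u).
have g0 : enorm g * enorm e <= Mg * enorm e by rewrite ler_wpM2r.
have c0 : C * enorm e ^+ 2 <= C * (2 * rho * enorm e) by rewrite ler_wpM2l ?(ltW C0)// ler_wpM2r.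
have : (Mg + 2 * C * rho) * enorm e <= (Mg + 2 * C * rho) * (G * enorm (u' - u)).
  by rewrite ler_wpM2l// addr_ge0 ?mulr_ge0 ?(ltW Mg0) ?(ltW C0)// ltW.
have -> : b - a = (b - a - dotp g e) + dotp g e by ring.
have := ler_normD (b - a - dotp g e) (dotp g e).
rewrite -[G * _ * _]mulrA; nra.
Qed.

Lemma chart_lip : exists2 C : R, 0 < C & forall y z,
  enorm ((y - p) *m Ku - (z - p) *m Ku) <= C * enorm (y - z) /\
  `|dotp (y - p) kt - dotp (z - p) kt| <= C * enorm (y - z).
Proof.
have [C C0 hC] := mulmx_bound Ku; exists (C + enorm kt); first by rewrite ltr_wpDr ?enorm_ge0.
move=> y z; rewrite -mulmxBl -dotpBl (_ : y - p - (z - p) = y - z); last by rowring.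
split; first by rewrite (le_trans (hC _))// ler_wpM2r ?enorm_ge0// lerDl enorm_ge0.
by rewrite (le_trans (normr_dotp _ _))// mulrC ler_wpM2r ?enorm_ge0// lerDr ltW.
Qed.

Variable K : R.
Hypothesis K0 : 0 <= K.
Hypothesis neF : forall u, enorm u <= ru -> exists q, sgrad F K ru u q.
Ltac section_facts ::= assert (M := I); assert (K0 := I); assert (neF := I).

Lemma Nor_sgrad u q : enorm u <= ru -> Nor_pr A (Gr u) (grad f (Gr u) - q *m Ku^T) ->
  sgrad F K ru u q.
Proof.
move=> uB Nw; apply: (sgrad_first_order K0 neF uB) => e e0.
have [C C0 hC] := graph_taylor; have [G G0 hG] := graph_lip.
have [r1 r10 hr1] := Nor_pr_le Nw (divr_gt0 e0 (mulr_gt0 (ltr0Sn R 1) G0)).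
pose r2 := Num.min (r1 / G) (e / (2 * C * G ^+ 2)).
exists r2; first by rewrite lt_min !divr_gt0// ?mulr_gt0 ?exprn_gt0.
move=> u1 u1B; rewrite lt_min !ltr_pdivlMr ?mulr_gt0 ?exprn_gt0// => /andP[ur1 ue].
have yp := graph_rho uB; have bp := graph_rho u1B; have := rho0 => rp.
have := hC (Gr u) (Gr u1) ltac:(lra) ltac:(lra).
have := hG u u1 uB u1B; have := hr1 _ (graph_A u1B).
have kE : (Gr u1 - Gr u) *m Ku = u1 - u.
  rewrite pt_sub mulmxDl -mulmxA (chart_NKu ch) mulmx1 -scalemxAl (chart_vKu ch).
  by rewrite scaler0 addr0.
rewrite dotpBl dotp_mulmxl trmxK kE -enorm_sqr.
move: (grad f (Gr u)) (Gr u1 - Gr u) (F u) (F u1) => g b a a1 hb hGb.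
have bG : enorm b < r1 by rewrite (le_lt_trans hGb)// mulrC.
have := hb bG; rewrite ler_norml => h1 /andP[_ h2].
have b0 := enorm_ge0 b; have u0 := enorm_ge0 (u1 - u).
have t1 : e / (2 * G) * enorm b <= e / (2 * G) * (G * enorm (u1 - u)).
  by rewrite ler_wpM2l// divr_ge0 ?mulr_ge0 ?(ltW G0) ?(ltW e0).
have t1e : e / (2 * G) * (G * enorm (u1 - u)) = e / 2 * enorm (u1 - u).
  by field; rewrite gt_eqF.
have t2 : C * enorm b ^+ 2 <= C * (G * enorm (u1 - u)) ^+ 2.
  by rewrite ler_wpM2l ?(ltW C0)// lerXn2r// nnegrE// mulr_ge0// ltW.
have t3 : enorm (u1 - u) * (enorm (u1 - u) * (2 * C * G ^+ 2)) <= enorm (u1 - u) * e.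
  by rewrite ler_wpM2l// ltW.
have t4 : C * (G * enorm (u1 - u)) ^+ 2 =
  enorm (u1 - u) * (enorm (u1 - u) * (2 * C * G ^+ 2)) / 2 by field.
lra_with h1 h2 t1 t1e t2 t3.
Qed.

(** The converse of [Nor_sgrad]. A point of the complement is compared with the graph point above
    it; the vertical gap has the favourable sign because [f] increases along [v]. *)
Lemma sgrad_Nor u q : enorm u < ru -> sgrad F K ru u q ->
  Nor_pr A (Gr u) (grad f (Gr u) - q *m Ku^T).
Proof.
move=> uB hq; have uBl := ltW uB.
have [C C0 hC] := graph_taylor; have [G G0 hG] := graph_lip; have [D D0 hD] := chart_lip.
pose r1 := Num.min ((ru - enorm u) / D) (tau / 2 / D).
have r10 : 0 < r1 by rewrite lt_min !divr_gt0 ?subr_gt0 ?tau0.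
apply: (@Nor_pr_proximal _ _ _ _ _ ((K / 2 + C * G ^+ 2) * D ^+ 2) r1 r10) => b Ab.
rewrite lt_min !ltr_pdivlMr// => /andP[b1 b2].
set y := Gr u in b1 b2 *; set w := _ - _.
have [] := hD b y; rewrite pt_Ku pt_kt (pt_coords b).
set u1 := (b - p) *m Ku; set t1 := dotp (b - p) kt; rewrite -pt_coords => du dt.
have u1B : enorm u1 <= ru.
  by have := enorm_triangle u1 u 0; rewrite !subr0; move: du; rewrite mulrC; lra.
have t1B : `|t1| <= tau.
  have := ler_normD (t1 - h u) (h u); rewrite subrK; have := htau uBl.
  by move: dt; rewrite mulrC; lra.
have tl : t1 <= h u1 by apply/hA => //; rewrite -pt_coords.
have yp := graph_rho uBl; have bp := graph_rho u1B; have := rho0 => rp.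
have wv : dotp w v = dotp (grad f y) v by rewrite /w dotpBl Ku_v subr0.
have gv : kv <= dotp (grad f y) v by apply: gkv; rewrite /y; lra_with yp rp.
have -> : b - y = (Gr u1 - y) - (h u1 - t1) *: v.
  by rewrite [in LHS](pt_coords b) -/u1 -/t1 !pt_sub; rowring.
rewrite dotpBr dotpZr wv.
have hv : 0 <= (h u1 - t1) * dotp (grad f y) v.
  by rewrite mulr_ge0 ?subr_ge0//; have := kv0; lra_with gv.
have := hC y (Gr u1) ltac:(rewrite /y; lra) ltac:(lra); have := hG u u1 uBl u1B; rewrite -/y.
have := hq u1 u1B; have kE : (Gr u1 - y) *m Ku = u1 - u.
  rewrite pt_sub mulmxDl -mulmxA (chart_NKu ch) mulmx1 -scalemxAl (chart_vKu ch).
  by rewrite scaler0 addr0.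
have -> : dotp w (Gr u1 - y) = dotp (grad f y) (Gr u1 - y) - dotp q (u1 - u).
  by rewrite /w dotpBl dotp_mulmxl trmxK kE.
rewrite -!enorm_sqr -/y; set e := enorm (Gr u1 - y); set d := enorm (u1 - u).
set bb := enorm (_ - _) in du *; move=> s1 s2; rewrite ler_norml => /andP[s3 _].
have e0 : 0 <= e by exact: enorm_ge0.
have d0 : 0 <= d by exact: enorm_ge0.
have d2 : d ^+ 2 <= D ^+ 2 * bb ^+ 2.
  by rewrite -exprMn lerXn2r// nnegrE// mulr_ge0 ?enorm_ge0// ltW.
have e2 : e ^+ 2 <= G ^+ 2 * d ^+ 2.
  by rewrite -exprMn lerXn2r// nnegrE// mulr_ge0 ?enorm_ge0// ltW.
have CE : C * e ^+ 2 <= C * (G ^+ 2 * d ^+ 2) by rewrite ler_wpM2l// ltW.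
have KC0 : 0 <= K / 2 + C * G ^+ 2.
  by rewrite addr_ge0 ?divr_ge0// mulr_ge0 ?exprn_ge0// ltW.
have : (K / 2 + C * G ^+ 2) * d ^+ 2 <= (K / 2 + C * G ^+ 2) * (D ^+ 2 * bb ^+ 2).
  by rewrite ler_wpM2l.
have -> : (K / 2 + C * G ^+ 2) * d ^+ 2 = K / 2 * d ^+ 2 + C * (G ^+ 2 * d ^+ 2) by ring.
rewrite (_ : enorm _ = bb); last first.
  by rewrite /bb [in RHS](pt_coords b) -/u1 -/t1 pt_sub [in RHS]pt_sub; congr enorm; rowring.
rewrite -[_ * D ^+ 2 * _]mulrA; lra_with hv s1 s3 CE.
Qed.

Lemma bdry_of y : X y -> A y -> bdry X y.
Proof.
by move=> Xy Ay; split; [exact: subset_closure | move/interior_notin_compl_set].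
Qed.

Lemma sgrad_normal u q : enorm u < ru -> sgrad F K ru u q ->
  let w := grad f (Gr u) - q *m Ku^T in
  [/\ w != 0, Nor_pr A (Gr u) w & NorBundle X (row_mx (Gr u) (- ((enorm w)^-1 *: w)))].
Proof.
move=> uB hq w; have Nw := sgrad_Nor uB hq; have uBl := ltW uB.
have w0 : w != 0.
  apply: contraTneq (gkv (y := Gr u) ltac:(have := graph_rho uBl; have := rho0; lra)) => we.
  have -> : dotp (grad f (Gr u)) v = dotp w v by rewrite /w dotpBl Ku_v subr0.
  by rewrite we dotp0l -ltNge kv0.
have bd := bdry_of (graph_X uBl) (graph_A uBl).
split => //; exists (Gr u), (- ((enorm w)^-1 *: w)); split => //; split; last first.
  by rewrite enormN enorm_unit.
rewrite /NorX; case: asboolP => // _; exists ((enorm w)^-1 *: w) => // b Tb.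
by rewrite dotpZl mulr_ge0_le0 ?invr_ge0 ?enorm_ge0//; exact: Nw.
Qed.

End Graph.

Section RowBlocks.
Variables (R : realType) (a b : nat).

Lemma dotp_row_mx (x x' : 'rV[R]_a) (y y' : 'rV[R]_b) :
  dotp (row_mx x y) (row_mx x' y') = dotp x x' + dotp y y'.
Proof.
rewrite /dotp big_split_ord /=; congr (_ + _); apply: eq_bigr => i _.
  by rewrite !row_mxEl.
by rewrite !row_mxEr.
Qed.

Lemma enorm_row_mx (x : 'rV[R]_a) (y : 'rV[R]_b) : enorm (row_mx x y) <= enorm x + enorm y.
Proof.
rewrite ler_enorm ?addr_ge0 ?enorm_ge0// dotp_row_mx -!enorm_sqr sqrrD.
by have := mulr_ge0 (enorm_ge0 x) (enorm_ge0 y); rewrite mulr2n; lra.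
Qed.

Lemma enorm_lsubmx (z : 'rV[R]_(a + b)) : enorm (lsubmx z) <= enorm z.
Proof.
rewrite ler_enorm ?enorm_ge0// -[z in enorm z]hsubmxK enorm_sqr dotp_row_mx.
by rewrite lerDl dotp_ge0.
Qed.

Lemma enorm_rsubmx (z : 'rV[R]_(a + b)) : enorm (rsubmx z) <= enorm z.
Proof.
rewrite ler_enorm ?enorm_ge0// -[z in enorm z]hsubmxK enorm_sqr dotp_row_mx.
by rewrite lerDr dotp_ge0.
Qed.

End RowBlocks.

Lemma unit_lip (R : realType) m (w g : 'rV[R]_m) : w != 0 -> g != 0 ->
  enorm ((enorm w)^-1 *: w - (enorm g)^-1 *: g) <= 2 / enorm g * enorm (w - g).
Proof.
move=> w0 g0; have wp : 0 < enorm w by rewrite enorm_gt0.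
have gp : 0 < enorm g by rewrite enorm_gt0.
have -> : (enorm w)^-1 *: w - (enorm g)^-1 *: g =
  (enorm g)^-1 *: (w - g) + ((enorm w)^-1 - (enorm g)^-1) *: w.
  by rewrite scalerBr scalerBl; rowring.
apply: (le_trans (enormD _ _)); rewrite !enormZ gtr0_norm ?invr_gt0//.
have -> : `|(enorm w)^-1 - (enorm g)^-1| * enorm w = `|enorm g - enorm w| / enorm g.
  have -> : (enorm w)^-1 - (enorm g)^-1 = (enorm g - enorm w) / (enorm g * enorm w).
    by field; rewrite !gt_eqF.
  by rewrite normrM [`|_^-1|]gtr0_norm ?invr_gt0 ?mulr_gt0//; field; rewrite !gt_eqF.
have h := enorm_lip g w; rewrite (enormB g) in h.
have : `|enorm g - enorm w| / enorm g <= enorm (w - g) / enorm g.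
  by rewrite ler_wpM2r// invr_ge0 ltW.
lra.
Qed.

(** * From the tangent space of the normal bundle to that of the supergradients *)

Section TangentNormalBundle.
Variables (R : realType) (m : nat).
Local Notation V := 'rV[R]_m.+1.
Variables (X : set V) (f : V -> R) (Rr r : R) (p v : V) (kap rho kv : R).
Variables (N : 'M[R]_(m, m.+1)) (Ku : 'M[R]_(m.+1, m)) (kt : V).
Variables (h : 'rV[R]_m -> R) (ru tau L : R).
Hypothesis M : local_model X f Rr r p v kap rho kv N Ku kt h ru tau L.
Local Notation A := (compl_set X).
Local Notation pt := (chart_pt p v N).
Local Notation Gr := (fun u : 'rV[R]_m => pt u (h u)).
Local Notation F := (fun u : 'rV[R]_m => f (pt u (h u))).
Local Notation fC2 := (lm_fC2 M).
Local Notation clX := (lm_clX M).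
Local Notation rho0 := (lm_rho0 M).
Local Notation ch := (lm_ch M).
Local Notation kv0 := (lm_kv0 M).
Local Notation gkv := (lm_gkv M).
Local Notation ru0 := (lm_ru0 M).
Local Notation tau0 := (lm_tau0 M).
Local Notation h0 := (lm_h0 M).
Local Notation hX := (lm_hX M).
Local Notation hA := (lm_hA M).

Variable K : R.
Hypothesis K0 : 0 <= K.
Hypothesis neF : forall u, enorm u <= ru -> exists q, sgrad F K ru u q.
Hypothesis g0 : grad f p != 0.
Variable B : 'M[R]_(m, m.+1 + m.+1).
Hypothesis TB : TanNor X p (unit_normal f p) = [set w | (w <= B)%MS].
Hypothesis Np : Nor_pr A p (grad f p).
Ltac section_facts ::= assert (M := I); assert (K0 := I); assert (neF := I); assert (g0 := I);
  assert (TB := I); assert (Np := I).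

(** The differentials of [u] and [q] along the normal bundle. A supergradient satisfies
    [q = (grad f y + enorm w *: n) *m N^T]; the variation of [enorm w] disappears because
    [grad f p], hence the normal at [p], is killed by [N^T]. *)
Definition tanA : 'M[R]_m := lsubmx B *m Ku.
Definition tanB : 'M[R]_m :=
  (lsubmx B *m hessmx f p + enorm (grad f p) *: rsubmx B) *m N^T.

Lemma sgrad_tangent t0 : 0 < t0 -> exists2 eta : R, 0 < eta &
  forall u q, enorm u <= eta -> enorm q <= eta -> sgrad F K ru u q ->
    exists x, enorm (u - x *m tanA) + enorm (q - x *m tanB) <= t0 * (enorm u + enorm q).
Proof.
move=> t00; have gp : 0 < enorm (grad f p) by rewrite enorm_gt0.
set g := grad f p in gp *; set H := hessmx f p.
have [G G0 hG] := graph_lip M.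
have [k k0 hk] := mulmx_bound Ku^T; have [cu cu0 hcu] := mulmx_bound Ku.
have [CN CN0 hCN] := mulmx_bound N^T; have [CH CH0 hCH] := mulmx_bound H.
have [Cg Cg0 hCg] := C2_grad_lip (rho + enorm p) fC2.
pose Cw := Cg * G + k; have Cw0 : 0 < Cw by rewrite addr_gt0// mulr_gt0.
pose D := G + 2 / enorm g * Cw; have D0 : 0 < D by rewrite addr_gt0// !mulr_gt0 ?invr_gt0.
pose T := cu * D + CN * (G + CH * D + D + enorm g * D).
have T0 : 0 < T by repeat (first [exact: D0 | assumption | apply: addr_gt0 | apply: mulr_gt0]).
have [e e0 eT] : exists2 e : R, 0 < e & t0 = e * T.
  by exists (t0 / T); rewrite ?divr_gt0// divfK// gt_eqF.
have [r1 r10 hr1] := Tan_near (NorBundle X) (row_mx p (unit_normal f p)) e0.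
have [r2 r20 hr2] := C2_grad_expand p fC2 e0.
pose eta := Num.min (Num.min (r1 / (4 * D)) (r2 / (2 * G))) (Num.min (e / (2 * Cw)) (ru / 2)).
exists eta; first by rewrite !lt_min !divr_gt0 ?mulr_gt0 ?ru0.
move=> u q; rewrite !le_min !ler_pdivlMr ?mulr_gt0//.
move=> /andP[/andP[u1 u2] /andP[u3 u4]] /andP[/andP[q1 q2] /andP[q3 q4]] hq.
have uB : enorm u < ru by have := ru0; lra_with u4.
have uBl := ltW uB.
have [w0 Nw Bw] := sgrad_normal M K0 uB hq.
set y := pt u (h u) in w0 Nw Bw; set w := grad f y - q *m Ku^T in w0 Nw Bw.
set n := - _ in Bw.
have ru0' : enorm (0 : 'rV[R]_m) <= ru by rewrite enorm0 (ltW ru0).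
have yE : enorm (y - p) <= G * enorm u.
  by have := hG 0 u ru0' uBl; rewrite h0 pt0 subr0.
have yp : enorm (y - p) < rho by have := graph_rho M uBl; have := rho0; rewrite -/y; lra_with.
have gyE : enorm (grad f y - g) <= Cg * enorm (y - p).
  apply: hCg; first by rewrite lerDr (ltW rho0).
  by have := enorm_triangle y p 0; rewrite !subr0; lra_with yp.
have Cy : Cg * enorm (y - p) <= Cg * (G * enorm u) by rewrite ler_wpM2l// ltW.
have nu0 := enorm_ge0 u; have nq0 := enorm_ge0 q.
have wg : enorm (w - g) <= Cw * (enorm u + enorm q).
  have -> : w - g = (grad f y - g) - q *m Ku^T by rewrite /w addrAC.
  have := enormBD (grad f y - g) (q *m Ku^T); have := hk q.
  have := mulr_ge0 (ltW k0) nu0; have := mulr_ge0 (mulr_ge0 (ltW Cg0) (ltW G0)) nq0.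
  by rewrite /Cw mulrDl !mulrDr -!mulrA in Cy *; lra_with gyE Cy.
have nE : enorm (n - unit_normal f p) <= 2 / enorm g * (Cw * (enorm u + enorm q)).
  have -> : n - unit_normal f p = - ((enorm w)^-1 *: w - (enorm g)^-1 *: g).
    by rewrite /n /unit_normal -/g opprK opprB addrC.
  rewrite enormN; apply: (le_trans (unit_lip w0 g0)).
  by rewrite ler_wpM2l// divr_ge0// ltW.
have dE : enorm (row_mx y n - row_mx p (unit_normal f p)) <= D * (enorm u + enorm q).
  rewrite opp_row_mx add_row_mx (le_trans (enorm_row_mx _ _))//.
  apply: (le_trans (lerD yE nE)).
  have -> : D * (enorm u + enorm q) =
    G * (enorm u + enorm q) + 2 / enorm g * (Cw * (enorm u + enorm q)) by rewrite /D; ring.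
  by rewrite lerD2r ler_wpM2l ?(ltW G0)// lerDl.
have [z Tz hz] := hr1 _ Bw ltac:(apply: (le_lt_trans dE); rewrite mulrDr; lra_with r10 u1 q1).
move: Tz; rewrite -/(TanNor X p (unit_normal f p)) TB => /submxP[x zE]; rewrite {z}zE in hz.
exists x; set d1 := y - p in yE yp gyE Cy dE hz *.
set d2 := n - unit_normal f p in nE dE hz *.
have dE' : row_mx y n - row_mx p (unit_normal f p) = row_mx d1 d2.
  by rewrite opp_row_mx add_row_mx.
rewrite dE' in dE hz.
set a := x *m lsubmx B; set b := x *m rsubmx B.
have xB : x *m B = row_mx a b by rewrite -[in LHS](hsubmxK B) mul_mx_row.
rewrite xB opp_row_mx add_row_mx in hz.
set e1 := d1 - a in hz *; set e2 := d2 - b in hz *.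
have he : enorm (row_mx e1 e2) <= e * (D * (enorm u + enorm q)).
  by apply: (le_trans hz); rewrite ler_wpM2l// ltW.
have he1 : enorm e1 <= e * (D * (enorm u + enorm q)).
  by apply: le_trans he; have := enorm_lsubmx (row_mx e1 e2); rewrite row_mxKl.
have he2 : enorm e2 <= e * (D * (enorm u + enorm q)).
  by apply: le_trans he; have := enorm_rsubmx (row_mx e1 e2); rewrite row_mxKr.
have uE : u - x *m tanA = e1 *m Ku.
  by rewrite /tanA /e1 mulmxBl /d1 /y (pt_Ku M) mulmxA.
have gN : g *m N^T = 0 := chart_gN ch.
pose e3 := grad f y - g - d1 *m H.
have wd2 : enorm w *: n = - w.
  by rewrite /n scalerN scalerA mulfV ?scale1r// gt_eqF// enorm_gt0.
have wn : enorm g *: unit_normal f p = - g.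
  by rewrite /unit_normal -/g scalerN scalerA mulfV ?scale1r// gt_eqF.
have qE : q - x *m tanB =
  (e3 + e1 *m H + (enorm w - enorm g) *: d2 + enorm g *: e2) *m N^T.
  have -> : q - x *m tanB = (q *m Ku^T - (a *m H + enorm g *: b)) *m N^T.
    rewrite mulmxBl (NKuT M) /tanB mulmxA mulmxDr mulmxA -/a -/b -/g -/H.
    by rewrite -scalemxAr -/b.
  have -> : q *m Ku^T = grad f y - w by rewrite /w opprB addrCA subrr addr0.
  have -> : e3 + e1 *m H + (enorm w - enorm g) *: d2 + enorm g *: e2 =
    grad f y - w - (a *m H + enorm g *: b) - (g + enorm w *: unit_normal f p).
    rewrite /e3 /e1 /e2 (mulmxBl d1 a) scalerBl /d2 !scalerBr wd2 wn.
    by move: (d1 *m H) (a *m H) => dH aH; rowring.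
  have npN : unit_normal f p *m N^T = 0.
    by rewrite /unit_normal mulNmx -scalemxAl gN scaler0 oppr0.
  by rewrite [RHS]mulmxBl (mulmxDl g) gN add0r -scalemxAl npN scaler0 subr0.
have e3E : enorm e3 <= e * (G * enorm u).
  rewrite /e3 (_ : grad f y = grad f (p + d1)); last by rewrite /d1 addrC subrK.
  apply: (le_trans (hr2 _ _)); last by rewrite ler_wpM2l// ltW.
  by apply: (le_lt_trans yE); rewrite mulrC; lra_with r20 u2.
have wgl : `|enorm w - enorm g| * enorm d2 <= e * (D * (enorm u + enorm q)).
  have d2D : enorm d2 <= D * (enorm u + enorm q).
    apply: (le_trans nE).
    have -> : D * (enorm u + enorm q) =
      G * (enorm u + enorm q) + 2 / enorm g * (Cw * (enorm u + enorm q)) by rewrite /D; ring.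
    by rewrite lerDr mulr_ge0 ?(ltW G0) ?addr_ge0.
  rewrite ler_pM ?enorm_ge0// (le_trans (enorm_lip _ _))// (le_trans wg)//.
  by rewrite mulrDr; lra_with u3 q3.
rewrite uE qE; move: he1 he2 e3E wgl.
set E := e * (D * _) => he1 he2 e3E wgl.
have E0 : 0 <= E by exact: mulr_ge0 (ltW e0) (mulr_ge0 (ltW D0) (addr_ge0 nu0 nq0)).
have k1 : enorm (e1 *m Ku) <= cu * E by apply: (le_trans (hcu _)); rewrite ler_wpM2l// ltW.
have k2 : enorm (e1 *m H) <= CH * E by apply: (le_trans (hCH _)); rewrite ler_wpM2l// ltW.
have k3 : enorm (enorm g *: e2) <= enorm g * E.
  by rewrite enormZ gtr0_norm// ler_wpM2l// ltW.
have k4 : enorm ((enorm w - enorm g) *: d2) <= E by rewrite enormZ.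
have k5 : enorm (e3 + e1 *m H + (enorm w - enorm g) *: d2 + enorm g *: e2) <=
  e * (G * (enorm u + enorm q)) + CH * E + E + enorm g * E.
  apply: (le_trans (enormD _ _)); apply: lerD k3.
  apply: (le_trans (enormD _ _)); apply: lerD k4.
  apply: (le_trans (enormD _ _)); apply: lerD k2; apply: (le_trans e3E).
  by rewrite ler_wpM2l ?(ltW e0)// ler_wpM2l ?(ltW G0)// lerDl.
have k6 := le_trans (hCN _) (ler_wpM2l (ltW CN0) k5).
apply: (le_trans (lerD k1 k6)).
by rewrite eT /E /T le_eqVlt; apply/orP; left; apply/eqP; ring.
Qed.

(* First-order criticality on both sides: g is normal to the complement at p,
   while 0 is a supergradient of F at 0 and nearby ones are small. *)
Lemma normal_bundle_flat e : 0 < e -> exists2 rr : R, 0 < rr & forall y n,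
  NorBundle X (row_mx y n) -> enorm (y - p) < rr -> enorm (n - unit_normal f p) < rr ->
  `|dotp (grad f p) (y - p)| <= e * enorm (y - p).
Proof.
move=> e0; have gp : 0 < enorm (grad f p) by rewrite enorm_gt0.
have gvp : kv <= dotp (grad f p) v by apply: gkv; rewrite subrr enorm0 rho0.
have kvp := kv0; have rhop := rho0; have rup := ru0; have taup := tau0.
set g := grad f p in gp gvp *.
have [rn rn0 hrn] := Nor_pr_le Np e0.
have [C C0 hC] := graph_taylor M; have [D D0 hD] := chart_lip p Ku kt.
have [CN CN0 hCN] := mulmx_bound N^T.
have [Cg Cg0 hCg] := C2_grad_lip (rho + enorm p) fC2.
pose k1 := kv / (2 * enorm g); have k10 : 0 < k1 by rewrite divr_gt0// mulr_gt0.
pose Cm := (enorm g + Cg) * enorm v / k1; have Cm0 : 0 <= Cm.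
  by rewrite divr_ge0 ?(ltW k10)// mulr_ge0 ?enorm_ge0// addr_ge0// ltW.
pose Cq := CN * (Cg + enorm g + Cm); have Cq0 : 0 <= Cq.
  by rewrite mulr_ge0 ?(ltW CN0)// !addr_ge0// ltW.
pose T := Cq * D + K / 2 * D ^+ 2 + C.
have T0 : 0 < T.
  apply: ltr_wpDl => //; apply: addr_ge0; apply: mulr_ge0 => //; first exact: ltW.
    exact: divr_ge0.
  by rewrite exprn_ge0// ltW.
pose rr := Num.min (Num.min (e / T) (k1 / (1 + enorm v)))
  (Num.min (Num.min (ru / (2 * D)) (tau / D)) (Num.min rho rn)).
have v1 : 0 < 1 + enorm v by rewrite ltr_pwDl ?enorm_ge0.
exists rr; first by rewrite !lt_min !divr_gt0 ?mulr_gt0 ?rup ?taup ?rn0 ?rhop.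
have [s [s0 sT [sk [sru stau srho srn]]]] : exists s, [/\ s = rr, s * T <= e &
    s * (1 + enorm v) <= k1 /\ [/\ s * (2 * D) <= ru, s * D <= tau, s <= rho & s <= rn]].
  exists rr; split=> //; [|split; [|split]];
    by rewrite -?ler_pdivlMr ?mulr_gt0// /rr !ge_min lexx ?orbT.
rewrite -s0 => y n [y' [n' [bd [Nn [n1 /eq_row_mx[-> ->]]]]]]; clear s0 rr y n.
move: y' n' bd Nn n1 => y n bd Nn n1 yp nn.
have Xy : X y by apply: clX; case: bd.
have Ay : A y.
  apply: contrapT => nAy; case: bd => _; apply; apply/interiorP_enorm.
  apply: contrapT => nex; apply: nAy; apply/closureP_enorm => e1 e10.
  apply: contrapT => nz; apply: nex; exists e1 => // z zy; apply: contrapT => nXz.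
  by apply: nz; exists z.
have sp : 0 < s by apply: le_lt_trans yp; exact: enorm_ge0.
set u := (y - p) *m Ku; set t := dotp (y - p) kt.
have [uD tD] := hD y p; rewrite subrr mul0mx dotp0l !subr0 -/u -/t in uD tD.
have Dy : D * enorm (y - p) <= D * s by rewrite ler_wpM2l ?ltW.
have uB : enorm u <= ru by have := mulr_gt0 D0 sp; lra_with rup sru uD Dy.
have tB : `|t| <= tau by lra_with stau tD Dy.
have yE := pt_coords M y; rewrite -/u -/t in yE.
have th : t = h u.
  apply/eqP; rewrite eq_le; apply/andP; split; first by apply/(hA uB tB); rewrite -yE.
  by apply/(hX uB tB); rewrite -yE.
have {}yE : y = Gr u by rewrite yE th.
move: Nn; rewrite /NorX; case: asboolP => // _ [v1' Nv1 nE].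
set w1 := v1' in Nv1 nE *; have w11 : enorm w1 = 1 by rewrite -enormN nE.
set gh := (enorm g)^-1 *: g.
have wg : enorm (w1 - gh) <= s.
  by rewrite -enormN opprB addrC; apply: ltW; move: nn; rewrite -nE /unit_normal opprK addrC.
have gg : enorm g *: gh = g by rewrite /gh scalerA mulfV ?scale1r// gt_eqF.
have ghv : 2 * k1 <= dotp gh v.
  have -> : 2 * k1 = (enorm g)^-1 * kv by rewrite /k1; field; rewrite gt_eqF.
  by rewrite /gh dotpZl ler_wpM2l// invr_ge0 ltW.
have wgv : `|dotp (w1 - gh) v| <= s * enorm v.
  by rewrite (le_trans (normr_dotp _ _))// ler_wpM2r ?enorm_ge0.
have wv : k1 <= dotp w1 v.
  have -> : dotp w1 v = dotp gh v + dotp (w1 - gh) v by rewrite dotpBl; lra_with.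
  by move: wgv; rewrite ler_norml => /andP[a1 _]; lra_with sk sp ghv a1.
have wv0 : 0 < dotp w1 v by lra_with k10 wv.
have gyE : enorm (grad f y - g) <= Cg * s.
  apply: (le_trans (hCg p y _ _)); first by rewrite lerDr ltW.
    by have := enorm_triangle y p 0; rewrite !subr0; lra_with srho yp.
  by rewrite ler_wpM2l ?ltW.
pose mu := dotp (grad f y) v / dotp w1 v.
have gyv : kv <= dotp (grad f y) v by apply: gkv; lra_with srho yp.
have mu0 : 0 <= mu by rewrite divr_ge0 ?(ltW wv0)//; lra_with kvp gyv.
have mug : `|enorm g - mu| <= Cm * s.
  have -> : enorm g - mu =
    (enorm g * dotp (w1 - gh) v - dotp (grad f y - g) v) / dotp w1 v.
    have e1 : enorm g * dotp (w1 - gh) v = enorm g * dotp w1 v - dotp g v.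
      by rewrite dotpBl mulrBr -[_ * dotp gh v]dotpZl gg.
    by rewrite e1 /mu dotpBl; field; rewrite gt_eqF.
  rewrite normrM [`|_^-1|]gtr0_norm ?invr_gt0// ler_pdivrMr//.
  have -> : Cm * s * dotp w1 v = (enorm g + Cg) * enorm v * s * (dotp w1 v / k1).
    by rewrite /Cm; field; rewrite gt_eqF.
  apply: le_trans (_ : (enorm g + Cg) * enorm v * s <= _); last first.
    rewrite ler_peMr ?ler_pdivlMr ?mul1r// mulr_ge0 ?(ltW sp)// mulr_ge0 ?enorm_ge0//.
    by rewrite addr_ge0 ?enorm_ge0// ltW.
  apply: (le_trans (ler_normB _ _)); rewrite normrM ger0_norm ?enorm_ge0//.
  have := normr_dotp (grad f y - g) v.
  have : enorm (grad f y - g) * enorm v <= Cg * s * enorm v by rewrite ler_wpM2r ?enorm_ge0.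
  have : enorm g * `|dotp (w1 - gh) v| <= enorm g * (s * enorm v) by rewrite ler_wpM2l ?enorm_ge0.
  lra_with.
pose q := (grad f y - mu *: w1) *m N^T.
have qE : grad f y - mu *: w1 = q *m Ku^T.
  by apply: (chart_cov M); rewrite dotpBl dotpZl /mu divfK ?subrr// gt_eqF.
have hq : sgrad F K ru u q.
  apply: (Nor_sgrad M K0 neF uB); rewrite -yE -qE opprB addrCA subrr addr0 => b Tb.
  by rewrite dotpZl mulr_ge0_le0//; exact: Nv1.
have qs : enorm q <= Cq * s.
  rewrite /q (le_trans (hCN _))// /Cq -mulrA ler_wpM2l ?(ltW CN0)//.
  have -> : grad f y - mu *: w1 = (grad f y - g) + (enorm g *: (gh - w1) + (enorm g - mu) *: w1).
    by rewrite scalerBr scalerBl gg; rowring.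
  apply: (le_trans (enormD _ _)); have := enormD (enorm g *: (gh - w1)) ((enorm g - mu) *: w1).
  rewrite !enormZ w11 mulr1 ger0_norm ?enorm_ge0// (enormB gh).
  have : enorm g * enorm (w1 - gh) <= enorm g * s by rewrite ler_wpM2l ?enorm_ge0.
  by rewrite !mulrDl; lra_with gyE mug.
have ru0' : enorm (0 : 'rV[R]_m) <= ru by rewrite enorm0 ltW.
have := hq 0 ru0'; rewrite h0 pt0 sub0r dotpNr dotpNl dotpNr opprK -yE => hF.
have := hC p y ltac:(rewrite subrr enorm0; lra_with srho sp) ltac:(lra_with srho yp).
have up := hrn _ Ay ltac:(lra_with srn yp).
rewrite ler_norml => /andP[_ hf]; rewrite ler_norml; apply/andP; split; last exact: up.
have := normr_dotp q u; rewrite ler_norml => /andP[qu _].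
have d0 := enorm_ge0 (y - p).
have i1 : enorm q * enorm u <= Cq * s * (D * enorm (y - p)) by rewrite ler_pM ?enorm_ge0.
have i2 : K / 2 * dotp u u <= K / 2 * (D ^+ 2 * (s * enorm (y - p))).
  rewrite ler_wpM2l ?divr_ge0// -enorm_sqr; apply: (@le_trans _ _ ((D * enorm (y - p)) ^+ 2)).
    by rewrite lerXn2r// nnegrE ?enorm_ge0// mulr_ge0// ltW.
  by rewrite exprMn ler_wpM2l ?exprn_ge0 ?(ltW D0)// expr2 ler_wpM2r// ltW.
have i3 : C * dotp (y - p) (y - p) <= C * (s * enorm (y - p)).
  by rewrite ler_wpM2l ?(ltW C0)// -enorm_sqr expr2 ler_wpM2r// ltW.
have i4 : s * T * enorm (y - p) <= e * enorm (y - p) by rewrite ler_wpM2r.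
have i5 : s * T * enorm (y - p) = Cq * s * (D * enorm (y - p)) +
  K / 2 * (D ^+ 2 * (s * enorm (y - p))) + C * (s * enorm (y - p)) by rewrite /T; ring.
rewrite -/g in hf; lra_with hF qu i1 i2 i3 i4 i5 hf.
Qed.

Lemma Tan_flat w : TanNor X p (unit_normal f p) w -> dotp (lsubmx w) (grad f p) = 0.
Proof.
case=> [->|[t [u [t0 [[xs [xsP [xsc xsu]]] ->]]]]]; first by rewrite linear0 dotp0l.
rewrite linearZ dotpZl; suff -> : dotp (lsubmx u) (grad f p) = 0 by rewrite mulr0.
apply/eqP; rewrite -normr_le0; apply/ler_addgt0Pr => e e0; rewrite add0r.
have e20 : 0 < e / 2 by rewrite divr_gt0.
have [rr rr0 hr] := normal_bundle_flat e20.
have eg : 0 < e / 2 / (1 + enorm (grad f p)) by rewrite divr_gt0// ltr_pwDl ?enorm_ge0.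
move: xsc xsu => /cvg_enorm /(_ _ rr0) xsc /cvg_enorm /(_ _ eg) xsu.
have [k /= [/[swap] b1]] : exists k, enorm (xs k - row_mx p (unit_normal f p)) < rr /\
  enorm ((enorm (xs k - row_mx p (unit_normal f p)))^-1 *:
    (xs k - row_mx p (unit_normal f p)) - u) < e / 2 / (1 + enorm (grad f p)).
  have /filter_ex[k kP] : \forall k \near \oo,
    enorm (xs k - row_mx p (unit_normal f p)) < rr /\
    enorm ((enorm (xs k - row_mx p (unit_normal f p)))^-1 *:
    (xs k - row_mx p (unit_normal f p)) - u) < e / 2 / (1 + enorm (grad f p)).
    by near=> k; split; [near: k; exact: xsc | near: k; exact: xsu].
  by exists k.
have [Bk nk] := xsP k; move: Bk nk b1.
rewrite -[xs k]hsubmxK; move: (lsubmx (xs k)) (rsubmx (xs k)) => y n Bk nk b1 b2.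
have dz : row_mx y n - row_mx p (unit_normal f p) = row_mx (y - p) (n - unit_normal f p).
  by rewrite opp_row_mx add_row_mx.
have z0 : 0 < enorm (row_mx y n - row_mx p (unit_normal f p)) by rewrite enorm_gt0 subr_eq0.
rewrite dz in b1 b2 z0; set z := row_mx _ _ in b1 b2 z0.
have ly : enorm (y - p) <= enorm z by have := enorm_lsubmx z; rewrite row_mxKl.
have rn : enorm (n - unit_normal f p) <= enorm z by have := enorm_rsubmx z; rewrite row_mxKr.
have := hr y n Bk ltac:(lra_with b2 ly) ltac:(lra_with b2 rn) => hy.
have -> : lsubmx u = (enorm z)^-1 *: (y - p) - lsubmx ((enorm z)^-1 *: z - u).
  by rewrite (linearB lsubmx) linearZ /= /z row_mxKl opprB addrC subrK.
rewrite dotpBl dotpZl (dotpC (y - p)).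
apply: (le_trans (ler_normB _ _)); rewrite normrM gtr0_norm ?invr_gt0//.
have c1 : (enorm z)^-1 * `|dotp (grad f p) (y - p)| <= e / 2.
  by rewrite mulrC ler_pdivrMr// (le_trans hy)// ler_wpM2l ?(ltW e20).
have := normr_dotp (lsubmx ((enorm z)^-1 *: z - u)) (grad f p).
have : enorm (lsubmx ((enorm z)^-1 *: z - u)) * enorm (grad f p) <= e / 2.
  have gp1 : 0 < 1 + enorm (grad f p) by rewrite ltr_pwDl ?enorm_ge0.
  move: b1; rewrite ltr_pdivlMr// => b1.
  apply: le_trans (ltW b1); rewrite ler_pM ?enorm_ge0 ?enorm_lsubmx//.
  by rewrite lerDr.
lra_with c1.
Unshelve. all: by end_near. Qed.

(** By [Tan_flat] tangent vectors are orthogonal to the gradient, so they have no component along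
    [v]. *)
Lemma tanA_N (x : 'rV[R]_m) : x *m lsubmx B = x *m tanA *m N.
Proof.
have fl : dotp (x *m lsubmx B) (grad f p) = 0.
  have := @Tan_flat (x *m B); rewrite -[in X in X -> _]/(TanNor X p (unit_normal f p) (x *m B)).
  rewrite TB /= submxMl => /(_ isT); rewrite -[in X in X -> _](hsubmxK B) mul_mx_row row_mxKl.
  by [].
have gv : 0 < dotp (grad f p) v.
  by have := gkv (y := p); rewrite subrr enorm0 => /(_ rho0); have := kv0; lra.
have := chart_id ch (x *m lsubmx B); rewrite /tanA mulmxA => xE.
suff kt0 : dotp (x *m lsubmx B) kt = 0 by rewrite kt0 scale0r addr0 in xE.
move: fl; rewrite {1}xE dotpDl dotp_mulmxl.
rewrite (chart_gN ch) dotp0r add0r dotpZl => /eqP; rewrite mulf_eq0 => /orP[/eqP//|].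
by rewrite dotpC gt_eqF.
Qed.

End TangentNormalBundle.

Lemma mulmx_continuous (R : realType) a b (M : 'M[R]_(a, b)) :
  continuous (fun u : 'rV[R]_a => u *m M).
Proof.
have [C C0 hC] := mulmx_bound M.
move=> u B /nbhs_enormP[e e0 he]; apply/nbhs_enormP; exists (e / C); first by rewrite divr_gt0.
move=> z; rewrite ltr_pdivlMr// => zu; apply: he; rewrite -mulmxBl.
by rewrite (le_lt_trans (hC _))// mulrC.
Qed.

(** * Descent directions *)

Section ConvexSets.
Variables (R : realType) (m : nat).
Local Notation V := 'rV[R]_m.

(** Separating the whole tube gives a direction of decrease that survives every small perturbation
    of the gradient. *)
Definition tube a (g : V) (M : 'M[R]_(a, m)) (b : R) : set V :=
  [set g + e *m M | e in [set e : 'rV_a | enorm e <= b]].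

Lemma compact_tube a g (M : 'M[R]_(a, m)) b : compact (tube g M b).
Proof.
apply: continuous_compact.
  apply: continuous_subspaceT; apply: continuous_addv; last exact: mulmx_continuous.
  exact: continuous_const.
have := @compact_enorm_le R a 0 b; congr compact; apply/funext => e /=.
by rewrite subr0.
Qed.

Lemma convex_tube a g (M : 'M[R]_(a, m)) b : segment_closed (tube g M b).
Proof.
move=> _ _ s [e eb <-] [e' eb' <-] s01; exists (e + s *: (e' - e)).
  exact: enorm_segment.
by rewrite mulmxDl -scalemxAl mulmxBl opprD addrACA subrr add0r addrA.
Qed.

Variables (A : set V) (r : R) (y v : V) (kap : R).

(** Norm at most 1 instead of 1 makes the set convex; the last condition keeps it away from 0 when
    [kap] is positive. *)
Definition normals := [set n : V | [/\ enorm n <= 1, proxnor r A y n & kap <= dotp n v]].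

Lemma compact_normals : 0 < r -> compact normals.
Proof.
move=> r0; apply: (@compact_enorm _ _ _ 1); last by move=> n [].
apply/closedP_enorm => n hn; split.
- apply/ler_addgt0Pr => e e0; have [n' [n1 _ _] nn] := hn _ e0.
  by have := enorm_triangle n n' 0; rewrite !subr0 (enormB n); lra.
- apply: contrapT => /(not_proxnor_near r0)[s s0 hs].
  have [n' [_ hn' _] nn] := hn _ s0.
  by apply: (hs y n') => //; rewrite subrr enorm0.
- apply/ler_addgt0Pr => e e0.
  have v0 : 0 < 1 + enorm v by rewrite ltr_pwDl ?enorm_ge0.
  have [n' [_ _ nk]] := hn _ (divr_gt0 e0 v0).
  rewrite ltr_pdivlMr// => nn; have := dotp_le_enorm (n' - n) v.
  have : enorm (n' - n) * enorm v <= enorm (n' - n) * (1 + enorm v).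
    by rewrite ler_wpM2l ?enorm_ge0// lerDr.
  by rewrite dotpBl; lra.
Qed.

Lemma convex_normals : segment_closed normals.
Proof.
move=> n n' s [n1 hn nk] [n1' hn' nk'] s01; have /andP[s0 s1] := s01; split.
- exact: enorm_segment.
- move=> b Ab; have := hn b Ab; have := hn' b Ab.
  rewrite (dotpDl n) (dotpZl s) (dotpBl n'); set x := dotp n _; set x' := dotp n' _; set D := dotp _ _.
  move=> h1 h2; have := ler_wpM2l s0 h1; have s10 : 0 <= 1 - s by rewrite subr_ge0.
  by have := ler_wpM2l s10 h2; lra.
- have s10 : 0 <= 1 - s by rewrite subr_ge0.
  rewrite (dotpDl n) (dotpZl s) (dotpBl n'); have := ler_wpM2l s0 nk'; have := ler_wpM2l s10 nk; lra.
Qed.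

End ConvexSets.

Section Availability.
Variables (R : realType) (m : nat).
Local Notation V := 'rV[R]_m.
Variables (X : set V) (f : V -> R) (Rr r : R).
Local Notation A := (compl_set X).
Hypothesis fC2 : C2 f.
Hypothesis clX : closed X.
Hypothesis cX : closure (interior X) = X.
Hypothesis uA : unique_proj Rr A.
Hypothesis r0 : 0 < r < Rr.
Hypothesis pointed : forall y, X y -> A y -> exists v (kap : R),
  0 < kap /\ forall n, enorm n = 1 -> proxnor r A y n -> kap <= dotp n v.

Definition inward y (w : V) (e : R) := A y -> forall n, enorm n = 1 ->
  proxnor r A y n -> e <= dotp n w.

Definition descent y (w : V) (e : R) := inward y w e /\ dotp (grad f y) w <= - e.

Definition locally_good (Good : V -> V -> R -> Prop) y := exists rho w (e : R),
  [/\ 0 < rho, 0 < e & forall y', enorm (y' - y) < rho -> Good y' w e].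

Lemma inward_near y w (e : R) : 0 < e ->
  (A y -> forall n, enorm n = 1 -> proxnor r A y n -> e <= dotp n w) ->
  exists2 rho : R, 0 < rho & forall y', enorm (y' - y) < rho -> inward y' w (e / 2).
Proof.
move=> e0 h; have /andP[rp _] := r0.
have [rho rho0 hr] := proxnor_stable (@closed_compl_set _ _ X) rp e0 h.
by exists rho => // y' y'y Ay' n n1 hn; exact: hr hn.
Qed.

Lemma grad_near y w (e : R) : 0 < e -> exists2 rho : R, 0 < rho &
  forall y', enorm (y' - y) < rho -> `|dotp (grad f y' - grad f y) w| <= e.
Proof.
move=> e0; have w0 : 0 < 1 + enorm w by rewrite ltr_pwDl ?enorm_ge0.
have [rho rho0 hr] := C1_grad_continuous (proj1 fC2) y (divr_gt0 e0 w0).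
exists rho => // y' /hr; rewrite ler_pdivlMr// => h.
apply: (le_trans (normr_dotp _ _)); apply: le_trans h.
by rewrite ler_wpM2l ?enorm_ge0// lerDr.
Qed.

Lemma normals_nonempty y v kap : X y -> A y ->
  (forall n, enorm n = 1 -> proxnor r A y n -> kap <= dotp n v) -> normals A r y v kap !=set0.
Proof.
move=> Xy Ay hv; have /andP[rp _] := r0.
have d0 : dist_set A y = 0 by rewrite dist_set_mem.
have := @inner_proxnor R m Rr r X y cX (ex_intro _ _ Ay) uA r0 Xy.
rewrite d0 => /(_ (ltW rp)) [n [n1 _]].
by rewrite scale0r subr0 => hn; exists n; split; [rewrite n1 | | exact: hv].
Qed.

(** Off the complement the opposite of the gradient works. On the boundary noncriticality says that
    the gradient is not a normal, so it can be separated from the compact convex set of normals. *)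
Lemma descent_noncritical y : X y -> ~ critical X f y -> locally_good descent y.
Proof.
move=> Xy ncr; have /andP[rp _] := r0; set g := grad f y.
have [Ay|nAy] := pselect (A y); last first.
  have g0 : g != 0.
    apply/eqP => g0; apply: ncr; split => //; exists 0; last by rewrite -/g g0 oppr0.
    rewrite /NorX; case: asboolP => // -[cl nint]; exfalso; apply: nAy.
    move=> B /nbhs_enormP[e e0 he]; apply: contrapT => nex; apply: nint.
    apply/interiorP_enorm; exists e => // z zy; apply: contrapT => nXz.
    by apply: nex; exists z; split => //; exact: he.
  have gg : 0 < dotp g g by rewrite lt_def dotp_eq0 g0 dotp_ge0.
  have g2 : 0 < dotp g g / 2 by rewrite divr_gt0.
  have [r1 r10 h1] := @inward_near y (- g) _ gg (fun Ay => False_ind _ (nAy Ay)).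
  have [r2 r20 h2] := grad_near y (- g) g2.
  exists (Num.min r1 r2), (- g), (dotp g g / 2); rewrite lt_min r10 r20 g2; split => // y'.
  rewrite lt_min => /andP[y1 y2]; split; first exact: h1.
  have := h2 _ y2; rewrite ler_norml dotpBl -/g [dotp g (- g)]dotpNr => /andP[_]; lra.
have [v [kap [kap0 hv]]] := pointed Xy Ay.
have nor0 := normals_nonempty Xy Ay hv.
have gN : ~ Nor_pr A y g.
  move=> Ng; apply: ncr; split=> //; exists (- g); last by rewrite opprK.
  rewrite /NorX; case: asboolP; first by exists g.
  move=> nb; exfalso; apply: nb; split; first exact: subset_closure.
  by move/interior_notin_compl_set.
(* The single point [g], passed twice to the separation of three sets. *)
pose C := tube g (0 : 'M[R]_(0, m)) 0.
have Cg : C g by exists 0; rewrite ?mul0mx ?addr0//= enorm0.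
have CE x : C x -> x = g by case=> e _ <-; rewrite mulmx0 addr0.
have [w [e [e0 h1 _ h3]]] : exists w (e : R), [/\ 0 < e, forall x, C x -> dotp x w <= - e,
    forall x, C x -> dotp x w <= - e & forall z, normals A r y v kap z -> e <= dotp z w].
  apply: separate3; rewrite ?/C; try exact: compact_tube; try exact: convex_tube;
    try exact: nor0; try exact: compact_normals; try exact: convex_normals;
    try (by exists g).
  move=> a b c x1 x2 n a0 b0 c0 abc /CE-> /CE-> [n1 hn nk]; apply/eqP => E.
  have {}E : (a + b) *: g = c *: n by apply/eqP; rewrite -subr_eq0 scalerDl E.
  have ab0 : 0 < a + b.
    rewrite lt_def addr_ge0// andbT; apply/eqP => ab; move: E; rewrite ab scale0r => /esym/eqP.
    rewrite scaler_eq0 => /orP[/eqP c1|/eqP n0]; first by move: abc; rewrite ab c1; lra.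
    by move: nk; rewrite n0 dotp0l; lra.
  apply: gN; have -> : g = (c / (a + b)) *: n.
    by rewrite mulrC -scalerA -E scalerA mulVf ?scale1r// gt_eqF.
  apply: (@Nor_pr_proximal _ _ _ _ _ (c / (a + b) / (2 * r)) 1) => // b' Ab' _.
  rewrite dotpZl -[X in _ <= X]mulrA ler_wpM2l ?divr_ge0 ?(ltW ab0)//.
  by rewrite ler_pdivlMl ?mulr_gt0//; exact: hn.
have e2 : 0 < e / 2 by rewrite divr_gt0.
have [r1 r10 hr1] : exists2 rho : R, 0 < rho & forall y', enorm (y' - y) < rho ->
    inward y' w (e / 2).
  apply: inward_near => // _ n n1 hn; apply: h3; split => //; [by rewrite n1 | exact: hv].
have [r2 r20 hr2] := grad_near y w e2.
exists (Num.min r1 r2), w, (e / 2); rewrite lt_min r10 r20 e2; split => // y'.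
rewrite lt_min => /andP[y1 y2]; split; first exact: hr1.
have := hr2 _ y2; have := h1 _ Cg; rewrite ler_norml dotpBl -/g => a1 /andP[_]; lra_with a1.
Qed.

End Availability.

(** * Common descent directions near the critical point *)

Section LocalAvailability.
Variables (R : realType) (m : nat).
Local Notation V := 'rV[R]_m.+1.
Variables (X : set V) (f : V -> R) (Rr r : R) (p v : V) (kap rho kv : R).
Variables (N : 'M[R]_(m, m.+1)) (Ku : 'M[R]_(m.+1, m)) (kt : V).
Variables (h : 'rV[R]_m -> R) (ru tau L : R).
Hypothesis M : local_model X f Rr r p v kap rho kv N Ku kt h ru tau L.
Local Notation A := (compl_set X).
Local Notation pt := (chart_pt p v N).
Local Notation Gr := (fun u : 'rV[R]_m => pt u (h u)).
Local Notation F := (fun u : 'rV[R]_m => f (pt u (h u))).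
Local Notation fC2 := (lm_fC2 M).
Local Notation r0 := (lm_r0 M).
Local Notation kap0 := (lm_kap0 M).
Local Notation rho0 := (lm_rho0 M).
Local Notation cone := (lm_cone M).
Local Notation ch := (lm_ch M).
Local Notation kv0 := (lm_kv0 M).
Local Notation gkv := (lm_gkv M).
Local Notation hX := (lm_hX M).
Local Notation hA := (lm_hA M).
Local Notation hp := (lm_hp M).

Variables (K : R) (G : 'rV[R]_m -> 'rV[R]_m) (CG al d : R).
Hypothesis K0 : 0 <= K.
Hypothesis neF : forall u, enorm u <= ru -> exists q, sgrad F K ru u q.
Hypothesis CG0 : 0 < CG.
Hypothesis GL : forall u u', enorm (G u - G u') <= CG * enorm (u - u').
Hypothesis al0 : 0 < al.
Hypothesis dru : d <= ru.
Hypothesis no_opp : forall u q e e' mu la, 0 < enorm u <= d -> sgrad F K ru u q ->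
  enorm e <= al * enorm u -> enorm e' <= al * enorm u -> 0 <= mu -> 0 <= la -> mu + la = 1 ->
  mu *: (q + e') + la *: (G u + e) != 0.
Ltac section_facts ::= assert (M := I); assert (K0 := I); assert (neF := I); assert (CG0 := I);
  assert (GL := I); assert (al0 := I); assert (dru := I); assert (no_opp := I).
Local Notation uc y := ((y - p) *m Ku).
Local Notation tc y := (dotp (y - p) kt).

(** [e'] stands for the gradient of a quadratic perturbation. The margin is [al / 2] because half of
    [al] is lost in passing from a point to its neighbourhood. *)
Definition graph_descent y (w : V) (e : R) :=
  forall e', enorm e' <= al / 2 * enorm (uc y) -> dotp (grad f y + e' *m Ku^T) w <= - e.

Definition model_descent y (w : V) (e : R) :=
  forall e', enorm e' <= al / 2 * enorm (uc y) -> dotp (G (uc y) + e') (w *m Ku) <= - e.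

Definition full_descent y w e :=
  [/\ descent X f r y w e, graph_descent y w e & model_descent y w e].

(** Otherwise [- G u] would be an admissible perturbation cancelling the gradient. *)
Lemma G_large u : 0 < enorm u <= d -> al * enorm u < enorm (G u).
Proof.
move=> ud; rewrite ltNge; apply/negP => Gl; have /andP[_ ul] := ud.
have [q hq] := neF (le_trans ul dru).
have e0 : enorm (0 : 'rV[R]_m) <= al * enorm u.
  by rewrite enorm0 mulr_ge0 ?enorm_ge0// ltW.
have := no_opp ud hq (_ : enorm (- G u) <= _) e0 (lexx 0) ler01 (add0r 1).
by rewrite enormN subrr scaler0 scale0r addr0 eqxx => /(_ Gl).
Qed.

(** If separation failed, the resulting relation between the gradient of [f], the vector [G u] and a
    normal would be a multiplier rule making [- (e1 + (b / a) *: (G u + e2))] a supergradient, which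
    [no_opp] forbids. *)
Lemma graph_full u : 0 < enorm u <= d ->
  exists w (e : R), [/\ 0 < e,
    forall n, enorm n = 1 -> proxnor r A (Gr u) n -> e <= dotp n w,
    forall e', enorm e' <= al * enorm u -> dotp (grad f (Gr u) + e' *m Ku^T) w <= - e &
    forall e', enorm e' <= al * enorm u -> dotp (G u + e') (w *m Ku) <= - e].
Proof.
move=> ud; have /andP[u0 ul] := ud; have uB := le_trans ul dru.
have /andP[rp _] := r0.
set y := Gr u; have yp : enorm (y - p) < rho.
  by have := graph_rho M uB; have := rho0; rewrite -/y; lra.
have hcone n : enorm n = 1 -> proxnor r A y n -> kap <= dotp n v.
  by move=> n1 hn; apply: (cone (graph_A M uB) yp n1 hn).
have gv := gkv yp; have kvp := kv0; have kapp := kap0.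
have aln : 0 <= al * enorm u by rewrite mulr_ge0// ltW.
have e00 : enorm (0 : 'rV[R]_m) <= al * enorm u by rewrite enorm0.
have ne1 : tube (grad f y) Ku^T (al * enorm u) !=set0 by exists (grad f y + 0 *m Ku^T); exists 0.
have ne2 : tube (G u *m Ku^T) Ku^T (al * enorm u) !=set0.
  by exists (G u *m Ku^T + 0 *m Ku^T); exists 0.
have ne3 : normals A r y v kap !=set0.
  have [n n1 hn] := graph_normal M uB; exists n; split => //; [by rewrite n1 | exact: hcone].
pose T1 := tube (grad f y) Ku^T (al * enorm u).
pose T2 := tube (G u *m Ku^T) Ku^T (al * enorm u).
have [w [e [e0 h1 h2 h3]]] : exists w (e : R), [/\ 0 < e, forall x, T1 x -> dotp x w <= - e,
    forall x, T2 x -> dotp x w <= - e & forall z, normals A r y v kap z -> e <= dotp z w].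
  apply: separate3; rewrite ?/T1 ?/T2; try exact: compact_tube; try exact: convex_tube;
    try exact: ne1; try exact: ne2; try exact: ne3;
    try exact: compact_normals; try exact: convex_normals.
  move=> a b c _ _ n a0 b0 c0 abc [e1 e1B <-] [e2 e2B <-] [n1 hn nk]; apply/eqP => E.
  have nv : 0 < dotp n v by lra.
  (* Pairing with [v] kills all covectors of the chart; in particular [a = 0] forces [c = 0]. *)
  have Ev : a * dotp (grad f y) v = c * dotp n v.
    have : dotp (a *: (grad f y + e1 *m Ku^T) + b *: (G u *m Ku^T + e2 *m Ku^T) - c *: n) v = 0.
      by rewrite E dotp0l.
    rewrite dotpBl dotpDl !dotpZl !dotpDl !(Ku_v M) !addr0 mulr0 addr0; lra_with.
  have [a00|ap] := eqVneq a 0.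
    have c00 : c = 0 by move: Ev; rewrite a00 mul0r => /esym/eqP; rewrite mulf_eq0 (gt_eqF nv) orbF => /eqP.
    have b1 : b = 1 by move: abc; rewrite a00 c00; lra_with.
    have /(congr1 (fun x => x *m N^T)) : G u *m Ku^T + e2 *m Ku^T = 0.
      by move: E; rewrite a00 c00 b1 !scale0r add0r scale1r subr0.
    rewrite mulmxDl !(NKuT M) mul0mx => Ge.
    have [q hq] := neF uB.
    by have := no_opp ud hq e2B e00 (lexx 0) ler01 (add0r 1); rewrite Ge scaler0 scale0r addr0 eqxx.
  have {}ap : 0 < a by rewrite lt_def ap.
  pose q := - (e1 + (b / a) *: (G u + e2)).
  have hg : grad f y = q *m Ku^T + (c / a) *: n.
    apply: (scalerI (lt0r_neq0 ap)); rewrite /q scalerDr scalerA mulrCA mulfV ?gt_eqF// mulr1.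
    rewrite mulNmx mulmxDl -scalemxAl scalerN scalerDr scalerA mulrCA mulfV ?gt_eqF// mulr1.
    apply/eqP; rewrite -subr_eq0; apply/eqP; rewrite -[RHS]E mulmxDl !scalerDr; rowring.
  have ca0 : 0 <= c / a by rewrite divr_ge0// ltW.
  have [C C0 hC] := sgrad_of_normal M.
  have hq : sgrad F K ru u q.
    apply: (sgrad_weak K0 neF _ uB (hC u q n (c / a) uB ca0 hn hg)).
    by rewrite mulr_ge0 ?(ltW C0)// addr_ge0.
  have ab : 0 < a + b by rewrite ltr_pwDl.
  have mu0 : 0 <= a / (a + b) by rewrite divr_ge0// ltW.
  have la0 : 0 <= b / (a + b) by rewrite divr_ge0// ltW.
  have := no_opp ud hq e2B e1B mu0 la0 (_ : _ = 1).
  rewrite -mulrDl mulfV ?gt_eqF// => /(_ erefl)/eqP; apply.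
  rewrite /q opprD addrAC addNr add0r scalerN scalerA.
  have -> : a / (a + b) * (b / a) = b / (a + b) by field; rewrite !gt_eqF.
  by rewrite addNr.
exists w, e; split => //.
- by move=> n n1 hn; apply: h3; split => //; [rewrite n1 | exact: hcone].
- by move=> e' e'B; apply: h1; exists e'.
- move=> e' e'B; rewrite [dotp _ (w *m Ku)]dotpC dotp_mulmxl dotpC mulmxDl.
  by apply: h2; exists e'.
Qed.

(** Without a normal constraint, [u] moves along [- G u] and a large multiple [MM] of [- v],
    invisible to [u], makes [f] decrease. *)
Lemma model_interior u y : 0 < enorm u <= d -> enorm (y - p) < rho ->
  exists w (e : R), [/\ 0 < e,
    forall e', enorm e' <= al * enorm u -> dotp (grad f y + e' *m Ku^T) w <= - e &
    forall e', enorm e' <= al * enorm u -> dotp (G u + e') (w *m Ku) <= - e].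
Proof.
move=> ud yp; have := G_large ud; have /andP[u0 ul] := ud => Gl.
have gv := gkv yp; have kvp := kv0.
pose D := al * enorm u; have D0 : 0 < D by rewrite mulr_gt0.
pose MM := (1 + enorm (grad f y) * enorm (G u *m N) + D * enorm (G u)) / kv.
pose e := Num.min 1 (enorm (G u) * (enorm (G u) - D)).
have G0 : 0 < enorm (G u) by apply: le_lt_trans Gl; exact: ltW.
exists (- (G u *m N) - MM *: v), e.
have wKu : (- (G u *m N) - MM *: v) *m Ku = - G u.
  by rewrite mulmxBl mulNmx -mulmxA (chart_NKu ch) mulmx1 -scalemxAl (chart_vKu ch) scaler0 subr0.
split; first by rewrite lt_min ltr01 mulr_gt0// subr_gt0.
- move=> e' e'B; rewrite dotpDl dotp_mulmxl trmxK wKu dotpBr dotpNr dotpZr dotpNr.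
  have h1 := dotp_ge_enorm (grad f y) (G u *m N); have h2 := dotp_ge_enorm e' (G u).
  have h3 : enorm e' * enorm (G u) <= D * enorm (G u) by rewrite ler_wpM2r ?enorm_ge0.
  have h4 : MM * kv <= MM * dotp (grad f y) v.
    rewrite ler_wpM2l// divr_ge0 ?(ltW kvp)//.
    by have := mulr_ge0 (enorm_ge0 (grad f y)) (enorm_ge0 (G u *m N));
      have := mulr_ge0 (ltW D0) (enorm_ge0 (G u)); lra.
  have h5 : MM * kv = 1 + enorm (grad f y) * enorm (G u *m N) + D * enorm (G u).
    by rewrite /MM divfK// gt_eqF.
  have : e <= 1 by rewrite ge_min lexx.
  clearbody MM; lra.
- move=> e' e'B; rewrite wKu dotpNr dotpDl -enorm_sqr.
  have h2 := dotp_ge_enorm e' (G u).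
  have h3 : enorm e' * enorm (G u) <= D * enorm (G u) by rewrite ler_wpM2r ?enorm_ge0.
  have : e <= enorm (G u) * (enorm (G u) - D) by rewrite ge_min lexx orbT.
  lra.
Qed.

Lemma full_descent_near y w (e : R) : 0 < e -> 0 < enorm (uc y) ->
  (A y -> forall n, enorm n = 1 -> proxnor r A y n -> e <= dotp n w) ->
  (forall e', enorm e' <= al * enorm (uc y) -> dotp (grad f y + e' *m Ku^T) w <= - e) ->
  (forall e', enorm e' <= al * enorm (uc y) -> dotp (G (uc y) + e') (w *m Ku) <= - e) ->
  locally_good full_descent y.
Proof.
move=> e0 u0 hn h1 h2; have e2 : 0 < e / 2 by rewrite divr_gt0.
have [r1 r10 hr1] := inward_near r0 e0 hn.
have [r2 r20 hr2] := grad_near fC2 y w e2.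
have [D D0 hD] := chart_lip p Ku kt.
have wp : 0 < 1 + enorm (w *m Ku) by rewrite ltr_pwDl ?enorm_ge0.
pose r3 := Num.min (enorm (uc y) / D) (e / 2 / (CG * D * (1 + enorm (w *m Ku)))).
have r30 : 0 < r3 by rewrite lt_min !divr_gt0 ?mulr_gt0.
exists (Num.min r3 (Num.min r1 r2)), w, (e / 2); split => //; first by rewrite lt_min r30 lt_min r10.
move=> y'; rewrite !lt_min !ltr_pdivlMr ?mulr_gt0// => /andP[/andP[y3 y4] /andP[y1 y2]].
have [uy _] := hD y' y; have Du : D * enorm (y' - y) < enorm (uc y) by rewrite mulrC.
have u2 : enorm (uc y') <= 2 * enorm (uc y).
  by have := enorm_triangle (uc y') (uc y) 0; rewrite !subr0; lra_with uy Du.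
have g2 := hr2 _ y2.
have ee (e' : 'rV[R]_m) : enorm e' <= al / 2 * enorm (uc y') -> enorm e' <= al * enorm (uc y).
  move=> h1e; apply: (le_trans h1e); rewrite -mulrA ler_wpM2l ?(ltW al0)//.
  by rewrite ler_pdivrMl// .
have gd : graph_descent y' w (e / 2).
  move=> e' /ee e'B; have := h1 e' e'B; move: g2; rewrite ler_norml => /andP[_].
  rewrite !dotpDl dotpNl; lra_with.
split => //.
- split; first exact: hr1.
  have := gd 0; rewrite mul0mx addr0; apply; rewrite enorm0 mulr_ge0 ?enorm_ge0//.
  by rewrite divr_ge0// ltW.
- move=> e' /ee e'B; have := h2 e' e'B.
  have -> : G (uc y') + e' = (G (uc y') - G (uc y)) + (G (uc y) + e') by rowring.
  rewrite [dotp (_ + (_ + _)) _]dotpDl.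
  have := dotp_le_enorm (G (uc y') - G (uc y)) (w *m Ku).
  have : enorm (G (uc y') - G (uc y)) * enorm (w *m Ku) <=
      (CG * (D * enorm (y' - y))) * (1 + enorm (w *m Ku)).
    rewrite ler_pM ?enorm_ge0 ?lerDr// (le_trans (GL _ _))//.
    by rewrite ler_wpM2l// ltW.
  lra_with y4.
Qed.

Lemma full_descent_zone y : X y -> 0 < enorm (uc y) <= d -> `|tc y| <= tau ->
  locally_good full_descent y.
Proof.
move=> Xy ud tB; have /andP[u0 ul] := ud; have uB := le_trans ul dru.
have yp : enorm (y - p) < rho.
  have := hp uB tB; rewrite -(pt_coords M y); have := rho0; lra.
have [Ay|nAy] := pselect (A y).
  have th : tc y = h (uc y).
    apply/eqP; rewrite eq_le; apply/andP; split.
      by apply/(hA uB tB); rewrite -(pt_coords M).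
    by apply/(hX uB tB); rewrite -(pt_coords M).
  have yE : y = Gr (uc y) by rewrite [LHS](pt_coords M) th.
  have [w [e [e0 h1 h2 h3]]] := graph_full ud.
  by rewrite -yE in h1 h2; apply: (full_descent_near (w := w) e0).
have [w [e [e0 h2 h3]]] := model_interior ud yp.
by apply: (full_descent_near (w := w) e0).
Qed.

End LocalAvailability.

Lemma continuous_compose (S T U : topologicalType) (f : S -> T) (g : T -> U) :
  continuous f -> continuous g -> continuous (fun y => g (f y)).
Proof. by move=> cf cg y; apply: continuous_comp; [exact: cf | exact: cg]. Qed.

Section ClosedSets.
Variables (R : realType) (T : topologicalType).
Implicit Types g h : T -> R.

Lemma closed_le_fun g h : continuous g -> continuous h -> closed [set y | g y <= h y].
Proof.
move=> cg ch; have -> : [set y | g y <= h y] = (fun y => h y - g y) @^-1` [set x | 0 <= x].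
  by apply/seteqP; split => y /=; rewrite subr_ge0.
apply: closed_comp; last exact: closed_ge.
by move=> y _; exact: (@continuous_subv R T R^o h g ch cg y).
Qed.

Lemma open_lt_fun g h : continuous g -> continuous h -> open [set y | g y < h y].
Proof.
move=> cg ch; rewrite (_ : [set y | _] = ~` [set y | h y <= g y]).
  by apply: closed_openC; exact: closed_le_fun.
by apply/seteqP; split => y /=; rewrite ltNge => /negP.
Qed.

End ClosedSets.

Section LinearCoordinates.
Variables (R : realType) (m a : nat) (p : 'rV[R]_m).

Lemma continuous_coords (M : 'M[R]_(m, a)) : continuous (fun y : 'rV[R]_m => (y - p) *m M).
Proof.
have cs : continuous (fun y : 'rV[R]_m => y - p).
  by apply: continuous_subv; [move=> ? | exact: continuous_const].
exact: (continuous_compose cs (@mulmx_continuous _ _ _ M)).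
Qed.

Lemma continuous_dotp (k : 'rV[R]_m) : continuous (fun y : 'rV[R]_m => dotp (y - p) k).
Proof.
apply: (@lipschitz_continuous _ _ _ (enorm k)) => y z.
rewrite -dotpBl (_ : z - p - (y - p) = z - y); last by rowring.
by rewrite (le_trans (normr_dotp _ _))// mulrC.
Qed.

End LinearCoordinates.

(** * The push field on the critical band *)

Section Push.
Variables (R : realType) (m : nat).
Local Notation V := 'rV[R]_m.+1.
Variables (X : set V) (f : V -> R) (Rr r : R) (p v : V) (kap rho kv : R).
Variables (N : 'M[R]_(m, m.+1)) (Ku : 'M[R]_(m.+1, m)) (kt : V).
Variables (h : 'rV[R]_m -> R) (ru tau L : R).
Hypothesis M : local_model X f Rr r p v kap rho kv N Ku kt h ru tau L.
Local Notation A := (compl_set X).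
Local Notation pt := (chart_pt p v N).
Local Notation Gr := (fun u : 'rV[R]_m => pt u (h u)).
Local Notation F := (fun u : 'rV[R]_m => f (pt u (h u))).
Local Notation fC2 := (lm_fC2 M).
Local Notation cX := (lm_cX M).
Local Notation uA := (lm_uA M).
Local Notation r0 := (lm_r0 M).
Local Notation rho0 := (lm_rho0 M).
Local Notation kv0 := (lm_kv0 M).
Local Notation gkv := (lm_gkv M).
Local Notation ru0 := (lm_ru0 M).
Local Notation tau0 := (lm_tau0 M).
Local Notation htau := (lm_htau M).
Local Notation hX := (lm_hX M).
Local Notation hA := (lm_hA M).
Local Notation hp := (lm_hp M).

Variables (K : R) (G : 'rV[R]_m -> 'rV[R]_m) (CG al d c : R).
Hypothesis K0 : 0 <= K.
Hypothesis neF : forall u, enorm u <= ru -> exists q, sgrad F K ru u q.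
Hypothesis CG0 : 0 < CG.
Hypothesis GL : forall u u', enorm (G u - G u') <= CG * enorm (u - u').
Hypothesis al0 : 0 < al.
Hypothesis d0 : 0 < d.
Hypothesis dru : d <= ru.
Hypothesis no_opp : forall u q e e' mu la, 0 < enorm u <= d -> sgrad F K ru u q ->
  enorm e <= al * enorm u -> enorm e' <= al * enorm u -> 0 <= mu -> 0 <= la -> mu + la = 1 ->
  mu *: (q + e') + la *: (G u + e) != 0.
Hypothesis coX : compact X.
Hypothesis pointed : forall y, X y -> A y -> exists v (kap : R),
  0 < kap /\ forall n, enorm n = 1 -> proxnor r A y n -> kap <= dotp n v.
Hypothesis crit : forall y, critical X f y -> f y = c -> y = p.
Local Notation uc y := ((y - p) *m Ku).
Local Notation tc y := (dotp (y - p) kt).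

Definition ozone (b : R) : set V := [set y | enorm (uc y) < b /\ `|tc y| < tau].
Definition czone (b : R) : set V := [set y | enorm (uc y) <= b /\ `|tc y| <= tau].

Lemma ozone_near b y : ozone b y -> exists2 rr : R, 0 < rr &
  forall y', enorm (y' - y) < rr -> ozone b y'.
Proof.
move=> [y1 y2]; have [D D0 hD] := chart_lip p Ku kt.
exists (Num.min ((b - enorm (uc y)) / D) ((tau - `|tc y|) / D)).
  by rewrite lt_min !divr_gt0 ?subr_gt0.
move=> y'; rewrite lt_min !ltr_pdivlMr// => /andP[h1 h2]; have [a1 a2] := hD y' y; split.
  by have := enorm_triangle (uc y') (uc y) 0; rewrite !subr0; lra.
by have := ler_normD (tc y' - tc y) (tc y); rewrite subrK; lra.
Qed.

Lemma not_czone_near b y : ~ czone b y -> exists2 rr : R, 0 < rr &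
  forall y', enorm (y' - y) < rr -> ~ czone b y'.
Proof.
move=> nz; have [D D0 hD] := chart_lip p Ku kt.
have [yb|yb] := leP (enorm (uc y)) b; last first.
  exists ((enorm (uc y) - b) / D); first by rewrite divr_gt0 ?subr_gt0.
  move=> y'; rewrite ltr_pdivlMr// => yy [y1 _]; have [a1 _] := hD y y'.
  by have := enorm_triangle (uc y) (uc y') 0; rewrite !subr0 (enormB y) in a1 *; lra.
have yt : tau < `|tc y| by rewrite ltNge; apply/negP => yt; apply: nz.
exists ((`|tc y| - tau) / D); first by rewrite divr_gt0 ?subr_gt0.
move=> y'; rewrite ltr_pdivlMr// => yy [_ y1]; have [_ a1] := hD y y'.
by have := ler_normD (tc y - tc y') (tc y'); rewrite subrK (enormB y) in a1 *; lra.
Qed.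

Lemma closed_not_ozone b : closed (~` ozone b).
Proof.
apply/closedP_enorm => y hy zy; have [rr rr0 hr] := ozone_near zy.
by have [z nz /hr] := hy _ rr0.
Qed.

Lemma locally_good_near (Good : V -> V -> R -> Prop) y : locally_good Good y ->
  exists2 rr : R, 0 < rr & forall y', enorm (y' - y) < rr -> locally_good Good y'.
Proof.
move=> [rr [w [e [rr0 e0 hg]]]]; exists rr => // y' y'y.
exists (rr - enorm (y' - y)), w, e; rewrite subr_gt0; split => // z zy; apply: hg.
by have := enorm_triangle z y' y; lra.
Qed.

(** Compactness of [X] outside the zone: on the level [c] there is no critical point left, and near
    other levels the premise fails for a small band. *)
Lemma level_descent : exists2 e1 : R, 0 < e1 & forall y, X y -> `|f y - c| <= e1 ->
  ~ ozone d y -> locally_good (descent X f r) y.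
Proof.
pose Q y (e : R) := `|f y - c| <= e -> locally_good (descent X f r) y.
have cK : compact (X `&` ~` ozone d).
  by apply: compact_closedI_enorm => //; exact: closed_not_ozone.
have [||e1 e10 he] := @compact_unif R m.+1 _ Q cK.
- by move=> y e e' hQ /andP[_ ee] ye; apply: hQ; exact: le_trans ee.
- move=> y [Xy nz]; have [fc|fc] := eqVneq (f y) c.
    have ncr : ~ critical X f y.
      move=> /crit/(_ fc) yp; apply: nz.
      by rewrite yp /ozone /= subrr mul0mx dotp0l enorm0 normr0 d0 tau0.
    have gy := @descent_noncritical R m.+1 X f Rr r fC2 cX uA r0 pointed y Xy ncr.
    have [rr rr0 hr] := locally_good_near gy.
    by exists rr => // y' _ /hr gy' _.
  have fy0 : 0 < `|f y - c| / 2 by rewrite divr_gt0// normr_gt0 subr_eq0.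
  have [rr rr0 hr] := continuous_rcontinuous_on (C1_continuous (proj1 fC2)) (I : setT y) fy0.
  exists (Num.min rr (`|f y - c| / 3)); first by rewrite lt_min rr0 divr_gt0// normr_gt0 subr_eq0.
  move=> y' _; rewrite lt_min => /andP[y'r _]; rewrite /Q.
  have := hr y' I y'r; rewrite distrC => h1; rewrite le_min => /andP[_ h2].
  by have := ler_normD (f y - f y') (f y' - c); rewrite addrA subrK; lra.
by exists e1 => // y Xy fy nz; apply: he.
Qed.

Variables (e1 del rho1 eps : R).
Hypothesis e1P : forall y, X y -> `|f y - c| <= e1 -> ~ ozone d y ->
  locally_good (descent X f r) y.
Hypothesis del0 : 0 < del <= d.
Hypothesis rho10 : 0 < rho1.
Hypothesis eps0 : 0 < eps.
Hypothesis rho1F : forall u, enorm u < rho1 -> F u < c + eps / 2.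
Ltac section_facts ::= assert (M := I); assert (K0 := I); assert (neF := I); assert (CG0 := I);
  assert (GL := I); assert (al0 := I); assert (d0 := I); assert (dru := I); assert (no_opp := I);
  assert (coX := I); assert (pointed := I); assert (crit := I); assert (e1P := I);
  assert (del0 := I); assert (rho10 := I); assert (eps0 := I); assert (rho1F := I).

(** The band minus a low neighbourhood of the critical point, where no common descent is
    available. *)
Definition active y := `|f y - c| <= e1 /\ ~ (ozone rho1 y /\ f y < c + eps / 2).

Definition Good y w e := [/\ descent X f r y w e,
  czone del y -> graph_descent f p Ku al y w e &
  czone del y -> rho1 <= enorm (uc y) -> model_descent p Ku G al y w e].

Lemma Good_active y : X y -> active y -> locally_good Good y.
Proof.
move=> Xy [fy ny]; have /andP[dl0 dld] := del0.
have Xpt := pt_coords M y.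
have [[uy ty]|nz] := pselect (czone d y).
  have uB := le_trans uy dru.
  have htl : h (uc y) <= tc y by apply/(hX uB ty); rewrite -Xpt.
  have [u1|u1] := leP rho1 (enorm (uc y)).
    have ud : 0 < enorm (uc y) <= d by rewrite uy (lt_le_trans rho10 u1).
    have [rr [w [e [rr0 e0 hg]]]] :=
      full_descent_zone M K0 neF CG0 GL al0 dru no_opp Xy ud ty.
    by exists rr, w, e; split => // y' /hg[h1 h2 h3].
  (* near the axis only f needs to decrease, and y is not on the graph *)
  have hlt : h (uc y) < tc y.
    rewrite lt_neqAle htl andbT; apply/eqP => E.
    have := htau uB; rewrite E => ty2; have taup := tau0; apply: ny; split.
      by split=> //=; lra.
    by have := rho1F u1; rewrite E -Xpt.
  have nAy : ~ A y by rewrite Xpt => /(hA uB ty); rewrite leNgt hlt.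
  have yp : enorm (y - p) < rho / 4 by have := hp uB ty; rewrite -Xpt.
  have [r1 r10 h1] := @inward_near R m.+1 X Rr r r0 y (- v) (2 * kv) ltac:(by rewrite mulr_gt0 ?kv0)
    (fun Ay => False_ind _ (nAy Ay)).
  have [D D0 hD] := chart_lip p Ku kt.
  exists (Num.min r1 (Num.min (rho / 4) ((rho1 - enorm (uc y)) / D))), (- v), kv.
  have rhop := rho0; rewrite !lt_min r10 !divr_gt0 ?subr_gt0 ?kv0 ?rho0//; split => // y'.
  rewrite !lt_min !ltr_pdivlMr// => /and3P[y1 y2 y3].
  have g1 : dotp (grad f y') (- v) <= - kv.
    rewrite dotpNr lerN2; apply: gkv.
    by have := enorm_triangle y' y p; lra_with yp rhop y2.
  split.
  - split => //; have := h1 _ y1; rewrite (_ : 2 * kv / 2 = kv)//; lra_with.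
  - by move=> _ e' _; rewrite dotpDl [dotp (_ *m _) _]dotpNr (Ku_v M) oppr0 addr0.
  - move=> _; rewrite leNgt => /negP; case; have [a1 _] := hD y' y.
    by have := enorm_triangle (uc y') (uc y) 0; rewrite !subr0; lra_with y3 a1.
have noz : ~ ozone d y by move=> [h1 h2]; apply: nz; split; exact: ltW.
have [r1 [w [e [r10 e0 h1]]]] := e1P Xy fy noz.
have [r2 r20 h2] := not_czone_near nz.
exists (Num.min r1 r2), w, e; rewrite lt_min r10 r20; split => // y'.
rewrite lt_min => /andP[/h1 y1 /h2 y2].
have y3 : ~ czone del y' by move=> [a1 a2]; apply: y2; split => //; exact: le_trans dld.
by split.
Qed.

Lemma compact_active : compact (X `&` [set y | active y]).
Proof.
apply: compact_closedI_enorm => //.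
have cf := C1_continuous (proj1 fC2).
have cfc : continuous (fun y => `|f y - c|).
  apply: (continuous_compose (f := fun y => f y - c)); last exact: norm_continuous.
  by apply: (@continuous_subv R _ R^o) => //; exact: continuous_const.
have oz : open (ozone rho1).
  apply: openI; apply: open_lt_fun; try exact: continuous_const.
    exact: (continuous_compose (@continuous_coords _ _ _ p Ku) (@enorm_continuous R m)).
  exact: (continuous_compose (@continuous_dotp _ _ p kt) (@norm_continuous _ R^o)).
have -> : [set y | active y] = [set y | `|f y - c| <= e1] `&`
    ~` (ozone rho1 `&` [set y | f y < c + eps / 2]) by [].
apply: closedI; first by apply: closed_le_fun => //; exact: continuous_const.
apply: open_closedC; apply: openI => //; apply: open_lt_fun => //; exact: continuous_const.
Qed.

(** [psi] runs over all functions with a quadratic upper expansion of constant [Cpsi], so that one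
    field serves the penalty, [Phi] and every tilted form. A step has linear gain [s * th y] and an
    error of order [s ^+ 2 * th y], absorbed for [s <= s1] by giving up half of the rate. *)
Lemma push_exists (Cpsi step0 : R) : 0 <= Cpsi -> 0 < step0 ->
  exists (w : V -> V) (th : V -> R) (s1 theta : R),
  [/\ continuous w, 0 < s1 & 0 < theta] /\
  [/\ forall y, 0 <= th y, forall y, X y -> active y -> theta <= th y &
  forall s y, 0 <= s <= s1 -> X y ->
    [/\ X (y + s *: w y), enorm (s *: w y) <= step0, f (y + s *: w y) <= f y - s * th y,
      czone del y -> forall (psi : 'rV_m -> R) e, enorm e <= al / 2 * enorm (uc y) ->
        (forall dd, psi (uc y + dd) <= psi (uc y) + dotp e dd + Cpsi * dotp dd dd) ->
        f (y + s *: w y) + psi (uc (y + s *: w y)) <= f y + psi (uc y) &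
      czone del y -> rho1 <= enorm (uc y) ->
        forall (psi : 'rV_m -> R) e, enorm e <= al / 2 * enorm (uc y) ->
        (forall dd, psi (uc y + dd) <= psi (uc y) + dotp (G (uc y) + e) dd + Cpsi * dotp dd dd) ->
        psi (uc (y + s *: w y)) <= psi (uc y) - s * th y]].
Proof.
move=> Cp0 st0.
have Good0 y : Good y 0 0.
  split; first split; rewrite ?dotp0r ?oppr0//.
  - by move=> _ n _ _; rewrite dotp0r.
  - by move=> _ e' _; rewrite dotp0r oppr0.
  - by move=> _ _ e' _; rewrite mul0mx dotp0r oppr0.
have GoodD y w e w' e' : Good y w e -> Good y w' e' -> Good y (w + w') (e + e').
  move=> [[a1 a2] a3 a4] [[b1 b2] b3 b4]; split; first split.
  - by move=> Ay n n1 hn; rewrite dotpDr lerD ?a1 ?b1.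
  - by rewrite dotpDr opprD lerD.
  - by move=> yz e2 e2B; rewrite dotpDr opprD lerD ?a3 ?b3.
  - by move=> yz yr e2 e2B; rewrite (mulmxDl w) dotpDr opprD lerD ?a4 ?b4.
have GoodZ y w e (b : R) : 0 <= b -> Good y w e -> Good y (b *: w) (b * e).
  move=> b0 [[a1 a2] a3 a4]; split; first split.
  - by move=> Ay n n1 hn; rewrite dotpZr ler_wpM2l ?a1.
  - by rewrite dotpZr -mulrN ler_wpM2l.
  - by move=> yz e2 e2B; rewrite dotpZr -mulrN ler_wpM2l ?a3.
  - by move=> yz yr e2 e2B; rewrite -scalemxAl dotpZr -mulrN ler_wpM2l ?a4.
have [|w [th [C [th0 [rr [cw [C0 th00 rr0] hth hG hK]]]]]] :=
  push_field Good0 GoodD GoodZ compact_active.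
  by move=> y [Xy ay]; exact: Good_active.
have /andP[rp _] := r0.
have [B B0 hB] := compact_enorm_bound coX.
have [CT CT0 hCT] := C2_taylor (B + 1) fC2.
have [D D0 hD] := mulmx_bound Ku.
pose Q := (CT + Cpsi * D ^+ 2) * C ^+ 2.
have Q0 : 0 < Q by rewrite mulr_gt0 ?exprn_gt0// ltr_wpDr// mulr_ge0 ?exprn_ge0// ltW.
have mn0 : 0 < Num.min (Num.min 1 step0) (Num.min (r / 2) rr).
  by rewrite !lt_min ltr01 st0 divr_gt0.
pose s1 := Num.min (Num.min (Num.min 1 step0) (Num.min (r / 2) rr) / C)
  (Num.min (1 / (2 * Q)) (r / (2 * C ^+ 2))).
have s10 : 0 < s1.
  have a1 : 0 < 1 / (2 * Q) by apply: divr_gt0 => //; exact: mulr_gt0.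
  have a2 : 0 < r / (2 * C ^+ 2) by apply: divr_gt0 => //; apply: mulr_gt0 => //; exact: exprn_gt0.
  by rewrite lt_min divr_gt0//= lt_min a1.
exists w, (fun y => th y / 2), s1, (th0 / 2); split; first by rewrite divr_gt0.
split; first by move=> y; have [t0 _ _] := hth y; rewrite divr_ge0.
  by move=> y Xy ay; rewrite ler_wpM2r ?invr_ge0//; exact: hK.
move=> s y /andP[s0 ss1] Xy.
have [ss3 [ss4 ss5]] : s * C <= Num.min (Num.min 1 step0) (Num.min (r / 2) rr) /\
    s * (2 * Q) <= 1 /\ s * (2 * C ^+ 2) <= r.
  have Q20 : 0 < 2 * Q by apply: mulr_gt0.
  have C20 : 0 < 2 * C ^+ 2 by apply: mulr_gt0 => //; exact: exprn_gt0.
  move: ss1; rewrite /s1 !(le_min s) => /andP[i1 /andP[i2 i3]].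
  by rewrite -(ler_pdivlMr _ _ C0) -(ler_pdivlMr _ _ Q20) -(ler_pdivlMr _ _ C20).
move: ss3; rewrite !le_min => /andP[/andP[sC1 sCst] /andP[sCr sCrr]].
have [t0 t1 wC] := hth y; have w0 := enorm_ge0 (w y).
have swC : enorm (s *: w y) <= s * C.
  rewrite enormZ ger0_norm// ler_wpM2l// (le_trans wC)//; exact: ler_piMr (ltW C0) t1.
have ww : dotp (w y) (w y) <= C ^+ 2 * th y.
  rewrite -enorm_sqr; apply: (@le_trans _ _ ((C * th y) ^+ 2)).
    by rewrite lerXn2r// nnegrE// mulr_ge0// ltW.
  by rewrite exprMn ler_wpM2l ?exprn_ge0 ?(ltW C0)// expr2 ler_piMr.
have Gy z : enorm (z - y) <= rr -> Good z (w y) (th y) := hG y z.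
have [[_ gy] cy my] := Gy y ltac:(by rewrite subrr enorm0 ltW).
have Xs : X (y + s *: w y).
  have [th0y|thn] := eqVneq (th y) 0; last first.
    have [->|sn] := eqVneq s 0; first by rewrite scale0r addr0.
    have sp : 0 < s by rewrite lt_def sn.
    have tp : 0 < th y by rewrite lt_def thn.
    have swn : s * enorm (w y) <= s * C by move: swC; rewrite enormZ ger0_norm.
    apply: notin_compl_set; apply: (@push_notin R m.+1 Rr r rr (th y) s X y (w y)) => //.
    + exact: cX.
    + by exists (Gr 0); apply: (graph_A M); rewrite enorm0 (ltW ru0).
    + exact: uA.
    + exact: r0.
    + exact: le_trans sCr.
    + exact: le_trans sCrr.
    + have := ler_wpM2l s0 ww; have := ler_wpM2r t0 ss5; have := mulr_gt0 rp tp; lra_with.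
    + by move=> a n Aa ay n1 hn; have [[ia _] _ _] := Gy a ay; exact: ia.
  have w00 : w y = 0.
    by apply/eqP; rewrite -enorm_eq0 eq_le w0 andbT (le_trans wC)// th0y mulr0.
  by rewrite w00 scaler0 addr0.
have yB := hB y Xy.
have ysB : enorm (y + s *: w y) <= B + 1.
  by apply: (le_trans (enormD _ _)); rewrite lerD// (le_trans swC).
have sst : 0 <= s * th y by rewrite mulr_ge0.
have sq : s * s * dotp (w y) (w y) * (2 * (CT + Cpsi * D ^+ 2)) <= s * th y.
  have QD : 0 <= CT + Cpsi * D ^+ 2 by rewrite addr_ge0 ?(ltW CT0)// mulr_ge0// exprn_ge0// ltW.
  apply: (@le_trans _ _ (s * s * (C ^+ 2 * th y) * (2 * (CT + Cpsi * D ^+ 2)))).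
    by rewrite ler_wpM2r ?mulr_ge0// ler_wpM2l ?mulr_ge0.
  have -> : s * s * (C ^+ 2 * th y) * (2 * (CT + Cpsi * D ^+ 2)) = s * th y * (s * (2 * Q)).
    by rewrite /Q; ring.
  by rewrite ler_piMr.
have wK : dotp (w y *m Ku) (w y *m Ku) <= D ^+ 2 * dotp (w y) (w y).
  rewrite -!enorm_sqr -exprMn lerXn2r// nnegrE ?enorm_ge0// mulr_ge0 ?enorm_ge0//.
  exact: ltW.
have dw0 := dotp_ge0 (w y); have ss0 : 0 <= s * s by rewrite mulr_ge0.
have t1f : f (y + s *: w y) <= f y + s * dotp (grad f y) (w y) + CT * (s * s * dotp (w y) (w y)).
  have := hCT y (y + s *: w y) ltac:(lra_with yB) ysB.
  rewrite (_ : y + s *: w y - y = s *: w y); last by rewrite addrAC subrr add0r.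
  rewrite (dotpZr s) (dotpZr s) (dotpZl s) ler_norml => /andP[_].
  by rewrite -[s * s * _]mulrA; lra_with.
have uE : uc (y + s *: w y) = uc y + s *: (w y *m Ku).
  by rewrite addrAC (mulmxDl (y - p)) -scalemxAl.
have Cw : 0 <= Cpsi * D ^+ 2 * (s * s * dotp (w y) (w y)).
  by rewrite !mulr_ge0// ltW.
have CTw : 0 <= CT * (s * s * dotp (w y) (w y)) by rewrite !mulr_ge0// ltW.
have Cwk : Cpsi * (s * (s * dotp (w y *m Ku) (w y *m Ku))) <= Cpsi * D ^+ 2 * (s * s * dotp (w y) (w y)).
  rewrite -mulrA ler_wpM2l// mulrA mulrCA ler_wpM2l//.
have sqE : s * s * dotp (w y) (w y) * (2 * (CT + Cpsi * D ^+ 2)) =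
  2 * (CT * (s * s * dotp (w y) (w y))) + 2 * (Cpsi * D ^+ 2 * (s * s * dotp (w y) (w y))) by ring.
split => //.
- by rewrite (le_trans swC).
- have := ler_wpM2l s0 gy; lra_with sq t1f Cw.
- move=> yz psi e eB hpsi; have := hpsi (s *: (w y *m Ku)); rewrite -uE.
  rewrite (dotpZr s) (dotpZr s) (dotpZl s).
  have := ler_wpM2l s0 (cy yz e eB); rewrite dotpDl dotp_mulmxl trmxK; lra_with sq t1f Cw CTw Cwk.
- move=> yz yr psi e eB hpsi; have := hpsi (s *: (w y *m Ku)); rewrite -uE.
  rewrite (dotpZr s) (dotpZr s) (dotpZl s).
  have := ler_wpM2l s0 (my yz yr e eB); lra_with sq CTw Cwk.
Qed.

End Push.

(** * Crossing the critical level *)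

(* Radial projection onto the ball of radius b; for b = 0 the division by zero is harmless. *)
Definition ball_proj (R : realType) m (b : R) (z : 'rV[R]_m) : 'rV[R]_m :=
  (b / Num.max b (enorm z)) *: z.

Section BallProjection.
Variables (R : realType) (m : nat).
Implicit Types (b : R) (z : 'rV[R]_m).

Lemma ball_proj_le b z : 0 <= b -> enorm (ball_proj b z) <= b.
Proof.
move=> b0; rewrite /ball_proj enormZ ger0_norm; last first.
  by rewrite divr_ge0// le_max b0.
have [mx0|mx0] := leP (Num.max b (enorm z)) 0.
  have z0 : enorm z = 0.
    by apply/eqP; rewrite eq_le enorm_ge0 andbT (le_trans _ mx0)// le_max lexx orbT.
  by rewrite z0 mulr0.
by rewrite mulrAC ler_pdivrMr// ler_wpM2l// le_max lexx orbT.
Qed.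

Lemma ball_proj_id b z : enorm z <= b -> ball_proj b z = z.
Proof.
move=> zb; rewrite /ball_proj max_l//; have [b0|b0] := eqVneq b 0; last first.
  by rewrite mulfV// scale1r.
have /eqP -> : z == 0 by rewrite -enorm_eq0 eq_le enorm_ge0 andbT -b0.
by rewrite scaler0.
Qed.

Lemma ball_proj0 z : ball_proj 0 z = 0.
Proof. by rewrite /ball_proj mul0r scale0r. Qed.

Lemma ball_proj_le_id b z : 0 <= b -> enorm (ball_proj b z) <= enorm z.
Proof.
move=> b0; rewrite /ball_proj enormZ ger0_norm; last first.
  by rewrite divr_ge0// le_max b0.
rewrite ler_piMl ?enorm_ge0//; have [mx0|mx0] := leP (Num.max b (enorm z)) 0.
  have b00 : b = 0 by apply/eqP; rewrite eq_le b0 andbT (le_trans _ mx0)// le_max lexx.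
  by rewrite b00 mul0r.
by rewrite ler_pdivrMr// mul1r le_max lexx.
Qed.

Lemma ball_proj_continuous (T : topologicalType) (g : T -> R) (k : T -> 'rV[R]_m) :
  (forall y, 0 <= g y) -> continuous g -> continuous k ->
  continuous (fun y => ball_proj (g y) (k y)).
Proof.
move=> g0 cg ck y; have cmx : continuous (fun y => Num.max (g y) (enorm (k y))).
  move=> z; apply: (@continuous_max R T g (fun y => enorm (k y))); first exact: cg.
  exact: (continuous_compose ck (@enorm_continuous R m)).
have [mx0|mx0] := leP (Num.max (g y) (enorm (k y))) 0; last first.
  apply: (@cvgZ _ _ T (nbhs y) _ (fun y => g y / Num.max (g y) (enorm (k y))) k); last exact: ck.
  by apply: (@cvgM R T (nbhs y)); [exact: cg | apply: cvgV; [rewrite gt_eqF | exact: cmx]].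
have gy : g y = 0 by apply/eqP; rewrite eq_le g0 andbT (le_trans _ mx0)// le_max lexx.
move=> B; rewrite gy ball_proj0 => /nbhs_enormP[e e0 he].
have : \forall z \near y, g z < e.
  by apply: (cvgr_lt (g y) (cg y)); rewrite gy.
by apply: filterS => z gz; apply: he; rewrite subr0; apply: le_lt_trans gz; exact: ball_proj_le.
Qed.

End BallProjection.

(** * Invariant sets, handle and cell *)

Section Arena.
Variables (R : realType) (m : nat).
Local Notation V := 'rV[R]_m.+1.
Variables (X : set V) (f : V -> R) (Rr r : R) (p v : V) (kap rho kv : R).
Variables (N : 'M[R]_(m, m.+1)) (Ku : 'M[R]_(m.+1, m)) (kt : V).
Variables (h : 'rV[R]_m -> R) (ru tau L : R).
Hypothesis M : local_model X f Rr r p v kap rho kv N Ku kt h ru tau L.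
Local Notation A := (compl_set X).
Local Notation pt := (chart_pt p v N).
Local Notation Gr := (fun u : 'rV[R]_m => pt u (h u)).
Local Notation F := (fun u : 'rV[R]_m => f (pt u (h u))).
Local Notation hp := (lm_hp M).

Variables (a b : nat) (P : 'M[R]_(a, m)) (Q : 'M[R]_(b, m)).
Variables (Zn : 'M[R]_(m, a)) (Zp : 'M[R]_(m, b)).
(** [aa] is the relative error between [Fs - c] and its quadratic form, [a1] the tilt that brings
    [Phi] below [F - c] on the rim, [D6] and [D3] the sizes of the handle and of the quadratic
    region, [kp] the slope of the penalty on the sides of the handle. *)
Variables (Fs : 'rV[R]_m -> R) (c aa a1 D3 D6 e1 del rho1 eps kp eta : R).
Local Notation uc y := ((y - p) *m Ku).
Local Notation tc y := (dotp (y - p) kt).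

Definition posq (u : 'rV[R]_m) : R := dotp (u *m Zp) (u *m Zp).
Definition negq (u : 'rV[R]_m) : R := dotp (u *m Zn) (u *m Zn).
Definition quad (be ga : R) (u : 'rV[R]_m) : R :=
  posq u - negq u + be * (posq u + negq u) - ga * dotp u u.
Local Notation n u := (posq u + negq u).
Local Notation Phi u := (Fs u - c - a1 * dotp u u).

Hypothesis hcont : continuous h.
Hypothesis cFs : continuous Fs.
Hypothesis PZn : P *m Zn = 1%:M.
Hypothesis QZn : Q *m Zn = 0.
Hypothesis PZp : P *m Zp = 0.
Hypothesis QZp : Q *m Zp = 1%:M.
Hypothesis ZPQ : Zp *m Q + Zn *m P = 1%:M.
Hypothesis aa0 : 0 < aa <= 1 / 4.
Hypothesis a10 : 0 < a1.
Hypothesis D60 : 0 < D6 < D3.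
Hypothesis del0 : 0 < del <= ru.
Hypothesis rho10 : 0 < rho1 <= del.
Hypothesis eps0 : 0 < eps.
Hypothesis kpD : kp * D6 = 2 * eps.
Hypothesis kp0 : 0 <= kp <= 1 / 2.
Hypothesis epsD : 2 * eps <= aa * D6.
Hypothesis epse : eps <= e1.
Hypothesis h_small : forall u, enorm u <= del -> `|h u| <= tau / 4.
Hypothesis t_small : forall y, X y -> czone p Ku kt tau del y -> f y <= c + eps -> `|tc y| <= tau / 2.
Hypothesis zone_high : forall y, X y -> ozone p Ku kt tau del y -> c - e1 < f y.
Hypothesis f_mono : forall u t t', enorm u <= del -> h u <= t' -> t' <= t -> t <= tau ->
  f (pt u t') <= f (pt u t).
Hypothesis rim : forall u, del / 2 <= enorm u <= del -> Phi u <= F u - c.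
Hypothesis F_Fs : forall u, enorm u <= del -> F u <= Fs u.
Hypothesis Fs_quad : forall u, n u <= 4 * D3 -> `|Fs u - c - (posq u - negq u)| <= aa * n u.
Hypothesis n_small : forall u, n u <= 4 * D3 -> enorm u < del / 2.
Hypothesis n_D6 : forall u, n u <= D6 -> 6 * aa * n u + 2 * a1 * dotp u u <= 4 * aa * D3.
Hypothesis axis2 : forall u, enorm u <= 2 * rho1 ->
  [/\ n u <= D6, quad (2 * aa) 0 u <= eps & kp * n u <= eps / 2].
Hypothesis axis1 : forall u, enorm u < rho1 -> - eps < Phi u /\ c - eps < F u.
Hypothesis eta_le : [/\ eta <= rho1, eta <= del / 2 & eta <= tau / 4].
Hypothesis n_step : forall u u', enorm (u' - u) <= eta ->
  (n u <= D3 -> n u' <= 4 * D3) /\ (n u <= D6 -> n u' <= D3).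

Variables (w : V -> V) (th : V -> R) (s1 theta : R).
Local Notation St s y := (y + s *: w y).
Hypothesis cw : continuous w.
Hypothesis s10 : 0 < s1.
Hypothesis theta0 : 0 < theta.
Hypothesis th0 : forall y, 0 <= th y.
Hypothesis th_active : forall y, X y -> active f p Ku kt tau c e1 rho1 eps y -> theta <= th y.
Hypothesis St_X : forall s y, 0 <= s <= s1 -> X y -> X (St s y).
Hypothesis St_near : forall s y, 0 <= s <= s1 -> X y ->
  enorm (uc (St s y) - uc y) <= eta /\ `|tc (St s y) - tc y| <= eta.
Hypothesis St_f : forall s y, 0 <= s <= s1 -> X y -> f (St s y) <= f y - s * th y.
Hypothesis St_fn : forall s y, 0 <= s <= s1 -> X y -> czone p Ku kt tau del y ->
  f (St s y) + kp * n (uc (St s y)) <= f y + kp * n (uc y).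
Hypothesis St_Phi : forall s y, 0 <= s <= s1 -> X y -> czone p Ku kt tau del y ->
  rho1 <= enorm (uc y) -> Phi (uc (St s y)) <= Phi (uc y).
Hypothesis St_quad : forall s y be ga, 0 <= s <= s1 -> X y -> czone p Ku kt tau del y ->
  rho1 <= enorm (uc y) -> n (uc y) <= 4 * D3 -> `|be| <= 5 * aa -> 0 <= ga <= 2 * a1 ->
  quad be ga (uc (St s y)) <= quad be ga (uc y).
Ltac section_facts ::= assert (M := I); assert (hcont := I); assert (cFs := I); assert (PZn := I);
  assert (QZn := I); assert (PZp := I); assert (QZp := I); assert (ZPQ := I); assert (aa0 := I);
  assert (a10 := I); assert (D60 := I); assert (del0 := I); assert (rho10 := I); assert (eps0 := I);
  assert (kpD := I); assert (kp0 := I); assert (epsD := I); assert (epse := I);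
  assert (h_small := I); assert (t_small := I); assert (zone_high := I); assert (f_mono := I);
  assert (rim := I); assert (F_Fs := I); assert (Fs_quad := I); assert (n_small := I);
  assert (n_D6 := I); assert (axis2 := I); assert (axis1 := I); assert (eta_le := I);
  assert (n_step := I); assert (cw := I); assert (s10 := I); assert (theta0 := I);
  assert (th0 := I); assert (th_active := I); assert (St_X := I); assert (St_near := I);
  assert (St_f := I); assert (St_fn := I); assert (St_Phi := I); assert (St_quad := I);
  assert (n0 := I); assert (taup := I); assert (cid := I); assert (cu := I); assert (ct := I);
  assert (cf := I); assert (sq1 := I).

Local Notation oz := (ozone p Ku kt tau del).
Local Notation cz := (czone p Ku kt tau del).
Local Notation Qa := (quad aa 0).
Local Notation Qb := (fun u => quad (- 5 * aa) (2 * a1) u + 4 * aa * D3).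
Local Notation Qh := (quad (2 * aa) 0).

(** [Phi] alone does not control the form inside the handle. [Qb] is a barrier: it is at most
    [- eps] as soon as [Phi] is, when [D3 <= n u <= 4 * D3], and it dominates [Qa] where
    [n u <= D6]. *)
Definition low_model u := Phi u <= - eps /\ (n u < D3 -> Qa u <= - eps \/ Qb u <= - eps).
Definition arenaY := sublevel X f (c + eps).
Definition arenaA := sublevel X f (c - eps).
(** A stable stand-in for the lower sublevel set, low for the model as well as for [f] inside the
    zone. *)
Definition arenaJ : set V := [set y | arenaA y /\ (oz y -> low_model (uc y))].
Definition handle : set V :=
  [set y | [/\ X y, `|tc y| <= tau / 2, n (uc y) <= D6, Qh (uc y) <= eps &
    f y + kp * n (uc y) <= c + eps]].
Definition arenaT := arenaJ `|` handle.
Local Notation Y := arenaY.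
Local Notation Lo := arenaA.
Local Notation J := arenaJ.
Local Notation Hh := handle.
Local Notation T := arenaT.

Let n0 u : 0 <= n u. Proof. by rewrite addr_ge0 ?dotp_ge0. Qed.
Let taup : 0 < tau. Proof. exact: (lm_tau0 M). Qed.

Lemma oz_cz y : oz y -> cz y.
Proof. by move=> [y1 y2]; split; exact: ltW. Qed.

Lemma F_le y : X y -> cz y -> F (uc y) <= f y.
Proof.
move=> Xy [uy ty]; have /andP[_ dr] := del0; have uB := le_trans uy dr.
have htl : h (uc y) <= tc y by apply/(lm_hX M uB ty); rewrite -(pt_coords M).
rewrite [in leRHS](pt_coords M y); apply: f_mono => //.
exact: le_trans (ler_norm _) ty.
Qed.

Lemma arena_AY : Lo `<=` Y.
Proof. by move=> y [Xy fy]; split => //=; rewrite /= in fy *; have := eps0; lra. Qed.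

Lemma arena_JA : J `<=` Lo. Proof. by move=> y []. Qed.

Lemma arena_HY : Hh `<=` Y.
Proof.
move=> y [Xy _ _ _ fy]; split => //=; have /andP[k0 _] := kp0.
by have := mulr_ge0 k0 (n0 (uc y)); lra.
Qed.

Lemma arena_TY : T `<=` Y.
Proof. by move=> y [/arena_JA/arena_AY|/arena_HY]. Qed.

Lemma handle_cz y : Hh y -> cz y /\ enorm (uc y) < del / 2.
Proof.
move=> [_ ty ny _ _]; have /andP[D6p D63] := D60.
have ud : enorm (uc y) < del / 2 by apply: n_small; lra.
by split=> //; split; have := taup; have /andP[dp _] := del0; lra.
Qed.

Lemma Fs_Qa u : n u <= 4 * D3 -> Fs u - c <= Qa u /\ posq u - negq u - aa * n u <= Fs u - c.
Proof.
by move=> /Fs_quad; rewrite ler_norml /quad mul0r subr0 => /andP[h1 h2]; split; lra.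
Qed.

Lemma St_low s y g : 0 <= s <= s1 -> X y -> f y <= g -> f (St s y) <= g.
Proof.
move=> ss Xy fy; have := St_f ss Xy; have /andP[sp _] := ss.
by have := mulr_ge0 sp (th0 y); lra.
Qed.

Lemma St_sublevel s y t : 0 <= s <= s1 -> sublevel X f t y -> sublevel X f t (St s y).
Proof. by move=> ss [Xy fy]; split; [exact: St_X | exact: St_low]. Qed.

Lemma Phi_Qb u : D3 <= n u -> n u <= 4 * D3 -> Phi u <= - eps -> Qb u <= - eps.
Proof.
move=> nD n4 hP; have [_ h1] := Fs_Qa n4; have /andP[ap _] := aa0.
have := mulr_ge0 (ltW a10) (dotp_ge0 u); have := ler_wpM2l (ltW ap) nD.
rewrite /quad; lra.
Qed.

(** Inside the zone every defining function decreases. A point entering it sideways lands on the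
    rim, where [Phi] lies below [f - c]; entering through the top or bottom is excluded by
    [t_small]. A point entering [n u < D3] satisfies the barrier [Qb]. *)
Lemma St_J s y : 0 <= s <= s1 -> J y -> J (St s y).
Proof.
move=> ss [Ly lowy]; have Ly' := St_sublevel ss Ly; split => // oz'.
have [Xy fy] := Ly; have [Xy' fy'] := Ly'; rewrite /= in fy fy'.
have [ne te] := St_near ss Xy; have [er ed et] := eta_le; have /andP[dp dr] := del0.
have nB u : n u < D3 -> enorm u < del / 2.
  by move=> nu; apply: n_small; have /andP[? ?] := D60; lra.
have [ozy|nozy] := pselect (oz y).
  have [hP hQ] := lowy ozy; have czy := oz_cz ozy.
  have ur : rho1 <= enorm (uc y).
    by rewrite leNgt; apply/negP => /axis1[h1 _]; rewrite ltNge hP in h1.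
  split; first by apply: le_trans hP; exact: St_Phi.
  move=> n3; have ne' : enorm (uc y - uc (St s y)) <= eta by rewrite enormB.
  have n4 : n (uc y) <= 4 * D3 by apply: (n_step ne').1; exact: ltW.
  have /andP[ap _] := aa0.
  have sa : Qa (uc (St s y)) <= Qa (uc y).
    by apply: St_quad => //; [rewrite ger0_norm; lra_with ap | have := a10; lra_with a10].
  have sb : Qb (uc (St s y)) <= Qb (uc y).
    rewrite lerD2r; apply: St_quad => //; last by have := a10; lra_with a10.
    by rewrite mulNr normrN ger0_norm; lra_with ap.
  have [n3y|n3y] := ltP (n (uc y)) D3.
    by case: (hQ n3y) => hq; [left; exact: le_trans sa hq | right; exact: le_trans sb hq].
  by right; apply: le_trans sb _; exact: Phi_Qb.
have czy' := oz_cz oz'; have /andP[rp rd] := rho10.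
have t2 := t_small Xy' czy' (ltac:(have := eps0; lra) : f (St s y) <= c + eps).
have u2 : del / 2 <= enorm (uc (St s y)).
  have ty : `|tc y| < tau.
    by have := ler_normB (tc (St s y)) (tc (St s y) - tc y); rewrite subKr; have := taup; lra.
  have uy : del <= enorm (uc y) by rewrite leNgt; apply/negP => uy; apply: nozy.
  by have := enorm_triangle (uc y) (uc (St s y)) 0; rewrite !subr0 (enormB (uc y)); lra_with ne ed uy.
split; last by move=> /nB; lra.
have [u'd _] := czy'; have := @rim (uc (St s y)) ltac:(by rewrite u2 u'd).
by have := F_le Xy' czy'; lra_with fy'.
Qed.

(* A point leaving the handle through n = D6 has f <= c - eps, as kp * D6 = 2 eps. *)
Lemma St_T s y : 0 <= s <= s1 -> T y -> T (St s y).
Proof.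
move=> ss [Jy|Hy]; first by left; exact: St_J.
have [czy ud] := handle_cz Hy; have [Xy ty ny Qy fy] := Hy.
have Xy' := St_X ss Xy; have [ne te] := St_near ss Xy; have [er ed et] := eta_le.
have /andP[k0 _] := kp0; have /andP[D6p D63] := D60; have /andP[ap a4] := aa0.
have fk := le_trans (St_fn ss Xy czy) fy.
have n3 : n (uc (St s y)) <= D3 by apply: (n_step ne).2.
have kn := mulr_ge0 k0 (n0 (uc (St s y))).
have cz' : cz (St s y).
  split; first by have := enorm_triangle (uc (St s y)) (uc y) 0; rewrite !subr0; lra_with ud ne ed.
  by have := ler_normD (tc (St s y) - tc y) (tc y); rewrite subrK; have := taup; lra_with ty te et.
have t' := t_small Xy' cz' ltac:(lra_with fk kn).
have Qh' : Qh (uc (St s y)) <= eps.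
  have [ur|ur] := ltP (enorm (uc y)) rho1.
    have u2 : enorm (uc (St s y)) <= 2 * rho1.
      by have := enorm_triangle (uc (St s y)) (uc y) 0; rewrite !subr0; lra_with ne er ur.
    by have [] := axis2 u2.
  apply: le_trans Qy; apply: St_quad => //; [lra_with ny D6p D63 | rewrite ger0_norm; lra_with ap |].
  by have := a10; lra_with a10.
have [n6|n6] := leP (n (uc (St s y))) D6; first by right.
have kn2 : 2 * eps <= kp * n (uc (St s y)) by rewrite -kpD ler_wpM2l// ltW.
left; split; first by split => //=; lra_with fk kn2.
have n4 : n (uc (St s y)) <= 4 * D3 by lra_with D6p n3 n6.
have an := ler_wpM2l (ltW ap) (ltW n6).
have Qa' : Qa (uc (St s y)) <= - eps.
  by move: Qh'; rewrite /quad mul0r subr0; have := epsD; lra_with an.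
move=> _; split; last by left.
have [h1 _] := Fs_Qa n4; have := mulr_ge0 (ltW a10) (dotp_ge0 (uc (St s y))); lra_with h1 Qa'.
Qed.

Lemma A_progress y : Lo y -> ~ J y -> c - e1 < f y /\ theta <= th y.
Proof.
move=> [Xy fy] nJ; rewrite /= in fy; have ozy : oz y.
  by apply: contrapT => noz; apply: nJ.
have fe := zone_high Xy ozy; split => //; apply: th_active => //; split.
  by rewrite ler_norml; have := eps0; lra.
move=> [[uy _] _]; have [_ h1] := axis1 uy; have := F_le Xy (oz_cz ozy); lra.
Qed.

(** The part of the band that is not active lies close to the axis, hence in the handle. *)
Lemma Y_progress y : Y y -> ~ T y -> c - e1 < f y /\ theta <= th y.
Proof.
move=> [Xy fy] nT; rewrite /= in fy; have [fl|fl] := leP (f y) (c - eps).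
  by apply: A_progress => // Jy; apply: nT; left.
split; first by have := epse; lra.
apply: th_active => //; split; first by rewrite ler_norml; have := epse; lra.
move=> [[uy ty] fy2]; apply: nT; right; have /andP[rp rd] := rho10.
have u2 : enorm (uc y) <= 2 * rho1 by lra.
have [n6 q6 kn] := axis2 u2; split => //; last by lra.
by apply: t_small => //; split; lra_with uy rd ty.
Qed.

(** The time parameter scales the length of each of the [k] steps. *)
Definition flow (k : nat) (q : R * V) : V := iter k (fun y => St (q.1 * s1) y) q.2.

Lemma flow_continuous k : continuous (flow k).
Proof.
elim: k => [|k IH]; first by move=> q; exact: cvg_snd.
apply: (@continuous_addv R _ V (flow k)) => //.
apply: (@continuous_scalev R _ V (fun q : R * V => q.1 * s1)).
  by apply: continuous_mulr; [move=> q; exact: cvg_fst | exact: continuous_const].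
exact: (continuous_compose IH cw).
Qed.

Lemma flow_inv (S : set V) k t y : 0 <= t <= 1 ->
  (forall s y, 0 <= s <= s1 -> S y -> S (St s y)) -> S y -> S (flow k (t, y)).
Proof.
move=> /andP[t0 t1] hS Sy; elim: k => //= k IH; apply: hS => //.
by rewrite mulr_ge0 ?(ltW s10)//= ler_piMl// ltW.
Qed.

(** Until [S'] is reached each step lowers [f] by [s1 * theta], while [f] must stay above [c - e1];
    [k] steps would use up the whole band. *)
Lemma flow_progress (S S' : set V) k y : (forall s y, 0 <= s <= s1 -> S y -> S (St s y)) ->
  (forall s y, 0 <= s <= s1 -> S' y -> S' (St s y)) -> S `<=` Y ->
  (forall y, S y -> ~ S' y -> c - e1 < f y /\ theta <= th y) ->
  S y -> e1 + eps <= k%:R * (s1 * theta) -> S' (flow k (1, y)).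
Proof.
move=> hS hS' SY pr Sy kl; apply: contrapT => nk.
have s11 : 0 <= s1 <= s1 by rewrite lexx ltW.
have all_not i : (i <= k)%N -> ~ S' (flow i (1, y)).
  move=> ik S'i; apply: nk; rewrite -(subnK ik) /flow iterD -/(flow i (1, y)).
  by elim: (k - i)%N => //= j; rewrite mul1r; exact: hS'.
have Si i : S (flow i (1, y)) by apply: flow_inv => //; rewrite ler01 lexx.
have dec i : (i <= k)%N -> f (flow i (1, y)) <= f y - i%:R * (s1 * theta).
  elim: i => [_|i IH ik]; first by rewrite mul0r subr0.
  have [_ tt] := pr _ (Si i) (all_not _ (ltnW ik)).
  have [Xi _] := SY _ (Si i); have := St_f s11 Xi; have := IH (ltnW ik).
  rewrite /= mul1r mulrSr mulrDl mul1r; have := ler_wpM2l (ltW s10) tt; lra.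
have [fe _] := pr _ (Si k) (all_not _ (leqnn k)).
have [_ fy] := SY _ Sy; rewrite /= in fy; have := dec _ (leqnn k); lra.
Qed.

Lemma flow_end : exists k,
  (forall y, Y y -> T (flow k (1, y))) /\ (forall y, Lo y -> J (flow k (1, y))).
Proof.
have st0 : 0 < s1 * theta by rewrite mulr_gt0.
exists (Num.trunc ((e1 + eps) / (s1 * theta))).+1.
have kl : e1 + eps <= (Num.trunc ((e1 + eps) / (s1 * theta))).+1%:R * (s1 * theta).
  by rewrite -ler_pdivrMr// ltW// truncnS_gt.
split=> y Sy.
  apply: (flow_progress _ _ _ Y_progress Sy kl) => //; first by move=> *; exact: St_sublevel.
  by move=> *; exact: St_T.
apply: (flow_progress _ _ _ A_progress Sy kl) => //; last exact: arena_AY.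
  by move=> *; exact: St_sublevel.
by move=> *; exact: St_J.
Qed.

Definition cutoff y : R :=
  clamp01 (2 - 2 / del * enorm (uc y)) * clamp01 (2 - 2 / tau * `|tc y|).

(** Slides points along [v] onto the graph. The cutoff is 1 where the handle lies and 0 outside the
    zone. *)
Definition collapse (q : R * V) : V :=
  q.2 - (q.1 * (cutoff q.2 * (tc q.2 - h (uc q.2)))) *: v.

Local Notation Co := collapse.

Lemma cutoff_in01 y : 0 <= cutoff y <= 1.
Proof.
have /andP[a1' a2] := clamp01P (2 - 2 / del * enorm (uc y)).
have /andP[b1 b2] := clamp01P (2 - 2 / tau * `|tc y|).
by rewrite mulr_ge0//= mulr_ile1.
Qed.

Lemma cutoff_support y : ~ oz y -> cutoff y = 0.
Proof.
move=> noz; have /andP[dp _] := del0; rewrite /cutoff.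
have [ud|ud] := leP del (enorm (uc y)).
  rewrite clamp01_le0 ?mul0r// subr_le0 mulrAC ler_pdivlMr// ler_wpM2l//.
have td : tau <= `|tc y| by rewrite leNgt; apply/negP => td; apply: noz.
rewrite [X in _ * X]clamp01_le0 ?mulr0// subr_le0 mulrAC ler_pdivlMr ?taup// ler_wpM2l//.
Qed.

Lemma cutoff1 y : enorm (uc y) <= del / 2 -> `|tc y| <= tau / 2 -> cutoff y = 1.
Proof.
move=> ud td; have /andP[dp _] := del0; have tp := taup; rewrite /cutoff !clamp01_ge1 ?mulr1//.
  have : 2 / tau * `|tc y| <= 2 / tau * (tau / 2) by rewrite ler_wpM2l// divr_ge0// ltW.
  by rewrite mulrA divfK ?gt_eqF// mulfV//; lra.
have : 2 / del * enorm (uc y) <= 2 / del * (del / 2) by rewrite ler_wpM2l// divr_ge0// ltW.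
by rewrite mulrA divfK ?gt_eqF// mulfV//; lra.
Qed.

Lemma collapse_uc q : uc (Co q) = uc q.2.
Proof.
rewrite /collapse addrAC mulmxBl -scalemxAl (chart_vKu (lm_ch M)) scaler0 subr0 //.
Qed.

Lemma collapse_tc q : tc (Co q) = tc q.2 - q.1 * (cutoff q.2 * (tc q.2 - h (uc q.2))).
Proof.
rewrite /collapse addrAC (dotpBl (q.2 - p)) dotpZl (chart_vkt (lm_ch M)) mulr1 //.
Qed.

Lemma collapse0 y : Co (0, y) = y.
Proof. by rewrite /collapse mul0r scale0r subr0. Qed.

Lemma collapse_out t y : ~ oz y -> Co (t, y) = y.
Proof. by move=> noz; rewrite /collapse cutoff_support// mul0r mulr0 scale0r subr0. Qed.

Lemma collapse_sublevel t g y : 0 <= t <= 1 -> sublevel X f g y -> sublevel X f g (Co (t, y)).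
Proof.
move=> /andP[t0 t1] [Xy fy]; have [ozy|noz] := pselect (oz y); last by rewrite collapse_out.
have [ud td] := oz_cz ozy; have /andP[dp dr] := del0; have uB := le_trans ud dr.
have htl : h (uc y) <= tc y by apply/(lm_hX M uB td); rewrite -(pt_coords M).
have /andP[c0 c1] := cutoff_in01 y.
have tc01 : 0 <= t * cutoff y <= 1 by rewrite mulr_ge0//= mulr_ile1.
have /andP[k0 k1] := tc01.
have t' : h (uc y) <= tc (Co (t, y)) <= tc y.
  rewrite collapse_tc /= mulrA; apply/andP; split.
    by have := ler_wpM2r (_ : 0 <= tc y - h (uc y)) k1; rewrite subr_ge0 => /(_ htl); lra.
  by rewrite gerBl mulr_ge0// subr_ge0.
have /andP[t1' t2'] := t'.
have hs := h_small ud; have tp := taup.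
have tB : `|tc (Co (t, y))| <= tau.
  move: hs td; rewrite !ler_norml => /andP[h1' h2'] /andP[d1 d2]; apply/andP; split; lra_with t1' tp t2' h1' h2' d1 d2.
have CE : Co (t, y) = pt (uc y) (tc (Co (t, y))).
  by rewrite [LHS](pt_coords M) collapse_uc.
split; first by rewrite CE; apply/(lm_hX M uB tB).
rewrite /= CE; apply: le_trans fy; rewrite [in leRHS](pt_coords M y).
by apply: f_mono => //; exact: le_trans (ler_norm _) td.
Qed.

Lemma collapse_handle y : Hh y -> Co (1, y) = Gr (uc y).
Proof.
move=> Hy; have [_ ud] := handle_cz Hy; have [_ td _ _ _] := Hy.
rewrite [LHS](pt_coords M) collapse_uc collapse_tc /= cutoff1 ?(ltW ud)// !mul1r.
by rewrite subKr.
Qed.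

Lemma collapse_graph t u : enorm u <= del -> Co (t, Gr u) = Gr u.
Proof.
by move=> ud; rewrite /collapse /= (pt_Ku M) (pt_kt M) subrr !mulr0 scale0r subr0.
Qed.

Lemma continuous_uc (S : topologicalType) (k : S -> V) : continuous k ->
  continuous (fun y => uc (k y)).
Proof. by move=> ck; exact: (continuous_compose ck (@continuous_coords _ _ _ p Ku)). Qed.

Lemma continuous_tc (S : topologicalType) (k : S -> V) : continuous k ->
  continuous (fun y => tc (k y) : R).
Proof. by move=> ck; exact: (continuous_compose ck (@continuous_dotp _ _ p kt)). Qed.

Lemma collapse_continuous : continuous Co.
Proof.
have c2 : continuous (fun q : R * V => q.2) by move=> q; exact: cvg_snd.
have c1 : continuous (fun q : R * V => q.1) by move=> q; exact: cvg_fst.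
have cu := continuous_uc c2; have ct := continuous_tc c2.
have chu := continuous_compose cu hcont.
have ccl (g : R * V -> R) (k : R) : continuous g ->
    continuous (fun q => clamp01 (2 - k * g q)).
  move=> cg; apply: (@continuous_compose _ _ _ (fun q => 2 - k * g q)); last exact: clamp01_continuous.
  apply: (@continuous_subv R _ R^o); first exact: continuous_const.
  by apply: continuous_mulr => //; exact: continuous_const.
apply: (@continuous_subv R _ V) => //.
apply: (@continuous_scalev R _ V); last exact: continuous_const.
apply: continuous_mulr => //; apply: continuous_mulr; last by apply: (@continuous_subv R _ R^o).
apply: continuous_mulr; apply: ccl.
  exact: (continuous_compose cu (@enorm_continuous R m)).
exact: (continuous_compose ct (@norm_continuous _ R^o)).
Qed.

Lemma graph_J u : n u <= D6 -> Qa u <= - eps -> J (Gr u).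
Proof.
move=> n6 q; have /andP[D6p D63] := D60; have n4 : n u <= 4 * D3 by lra.
have ud := n_small n4; have /andP[dp dr] := del0.
have ud' : enorm u <= del by lra.
have uB := le_trans ud' dr; have [h1 _] := Fs_Qa n4.
split; first split; first exact: (graph_X M).
  by rewrite /=; have := F_Fs ud'; lra.
rewrite (pt_Ku M) => _; split; last by left.
by have := mulr_ge0 (ltW a10) (dotp_ge0 u); lra.
Qed.

Lemma J_handle_Qa y : J y -> Hh y -> Qa (uc y) <= - eps.
Proof.
move=> [_ Jy] Hy; have [czy ud] := handle_cz Hy; have [_ ty n6 _ _] := Hy.
have /andP[D6p D63] := D60; have /andP[dp _] := del0.
have ozy : oz y by split; have := taup; lra.
have [_ hq] := Jy ozy; have [//|hb] := hq ltac:(lra).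
by have := n_D6 n6; move: hb; rewrite /quad; lra.
Qed.

(** The largest norm of the positive part compatible with [Qa u <= - eps]. The square root of a
    negative number is 0, so for a small negative part the projection sends the positive part to 0,
    that is, onto the cell. *)
Definition zrad (z : 'rV[R]_a) : R := Num.sqrt (((1 - aa) * dotp z z - eps) / (1 + aa)).

Definition squash (t : R) (u : 'rV[R]_m) : 'rV[R]_m :=
  u *m Zn *m P + ((1 - t) *: (u *m Zp) + t *: ball_proj (zrad (u *m Zn)) (u *m Zp)) *m Q.

Lemma zn_of (x : 'rV[R]_a) (z : 'rV[R]_b) : (x *m P + z *m Q) *m Zn = x.
Proof. by rewrite mulmxDl -!mulmxA PZn QZn mulmx1 mulmx0 addr0. Qed.

Lemma zp_of (x : 'rV[R]_a) (z : 'rV[R]_b) : (x *m P + z *m Q) *m Zp = z.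
Proof. by rewrite mulmxDl -!mulmxA PZp QZp mulmx1 mulmx0 add0r. Qed.

Lemma z_of (u : 'rV[R]_m) : u *m Zn *m P + u *m Zp *m Q = u.
Proof. by rewrite -!mulmxA -mulmxDr addrC ZPQ mulmx1. Qed.

Lemma squash_posq t u : 0 <= t <= 1 -> posq (squash t u) <= posq u.
Proof.
move=> /andP[t0 t1]; rewrite /posq zp_of -!enorm_sqr lerXn2r ?nnegrE ?enorm_ge0//.
apply: (le_trans (enormD _ _)); rewrite (enormZ (1 - t)) (enormZ t) !ger0_norm ?subr_ge0//.
have := ler_wpM2l t0 (ball_proj_le_id (u *m Zp) (sqrtr_ge0 _ : 0 <= zrad (u *m Zn))).
lra.
Qed.

Lemma squash_negq t u : negq (squash t u) = negq u.
Proof. by rewrite /negq zn_of. Qed.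

Definition retract (q : R * V) : V :=
  if `[< Hh q.2 >] then Gr (squash q.1 (uc q.2)) else Co (1, q.2).

Lemma retract_handle t y : Hh y -> retract (t, y) = Gr (squash t (uc y)).
Proof. by move=> Hy; rewrite /retract; case: asboolP. Qed.

Lemma zrad_J u : Qa u <= - eps -> enorm (u *m Zp) <= zrad (u *m Zn).
Proof.
have /andP[ap a4] := aa0; rewrite /quad /posq /negq mul0r subr0 => q.
rewrite /zrad ler_enorm ?sqrtr_ge0// sqr_sqrtr; first by rewrite ler_pdivlMr; lra.
by rewrite divr_ge0; have := dotp_ge0 (u *m Zp); nra.
Qed.

Lemma retract_J t y : 0 <= t <= 1 -> J y -> retract (t, y) = Co (1, y).
Proof.
move=> t01 Jy; rewrite /retract; case: asboolP => //= Hy.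
rewrite collapse_handle//; congr (pt _ (h _)).
all: rewrite /squash ball_proj_id; last exact/zrad_J/J_handle_Qa.
all: by rewrite -scalerDl subrK scale1r z_of.
Qed.

Lemma retract0 y : T y -> retract (0, y) = Co (1, y).
Proof.
move=> [Jy|Hy]; first by apply: retract_J => //; rewrite lexx ler01.
rewrite retract_handle// collapse_handle//; congr (pt _ (h _));
  by rewrite /squash scale0r addr0 subr0 scale1r z_of.
Qed.

(** On the graph [f] is at most [Fs], hence at most [c] plus [Qa]; squashing lowers only the
    positive part, so the bound on [Qh] in the handle is enough. *)
Lemma retract_Y t y : 0 <= t <= 1 -> T y -> Y (retract (t, y)).
Proof.
move=> t01 Ty; have [Jy|nJy] := pselect (J y).
  rewrite retract_J//; apply: collapse_sublevel; first by rewrite ler01 lexx.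
  by apply: arena_TY; left.
have Hy : Hh y by case: Ty.
rewrite retract_handle//; have [_ _ n6 qh _] := Hy; have /andP[D6p D63] := D60.
have sp := squash_posq (uc y) t01; have sn := squash_negq t (uc y).
set u := squash _ _ in sp sn *.
have n4 : n u <= 4 * D3 by rewrite sn; lra.
have ud := n_small n4; have /andP[dp dr] := del0; have ud' : enorm u <= del by lra.
split; first by apply: (graph_X M); lra.
rewrite /=; have := F_Fs ud'; have [h1 _] := Fs_Qa n4; have /andP[ap a4] := aa0.
have := ler_wpM2l (ltW ap) sp; have := mulr_ge0 (ltW ap) (n0 (uc y)).
by move: h1 qh; rewrite /quad !mul0r !subr0 sn; lra.
Qed.

(** The handle is cut where the argument of the root in [zrad] changes sign: one side retracts onto
    the cell, the other into [J]. *)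
Definition coreP : set V := [set y | Hh y /\ (1 - aa) * negq (uc y) <= eps].
Definition coreJ : set V := J `|` [set y | Hh y /\ eps <= (1 - aa) * negq (uc y)].

Lemma retract_coreJ y : coreJ y -> J (retract (1, y)).
Proof.
have t01 : 0 <= (1 : R) <= 1 by rewrite ler01 lexx.
move=> [Jy|[Hy ny]].
  rewrite retract_J//; have [Ly Jy'] := Jy; split; first exact: collapse_sublevel.
  have [/Jy' lm|noz] := pselect (oz y); first by rewrite collapse_uc.
  by rewrite collapse_out// => /noz.
rewrite retract_handle//; have [_ _ n6 _ _] := Hy.
have sp := squash_posq (uc y) t01; have sn := squash_negq 1 (uc y).
apply: graph_J; first by rewrite sn; lra.
have /andP[ap a4] := aa0.
have zr : posq (squash 1 (uc y)) <= ((1 - aa) * negq (uc y) - eps) / (1 + aa).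
  rewrite /posq zp_of subrr scale0r add0r scale1r -enorm_sqr.
  rewrite -[leRHS]sqr_sqrtr; last by rewrite divr_ge0; lra.
  by rewrite lerXn2r ?nnegrE ?enorm_ge0 ?sqrtr_ge0// ball_proj_le ?sqrtr_ge0.
have a1p : 0 < 1 + aa by lra.
rewrite (ler_pdivlMr _ _ a1p) in zr.
by rewrite /quad mul0r subr0 sn; lra.
Qed.

Lemma squash_continuous : continuous (fun q : R * 'rV[R]_m => squash q.1 q.2).
Proof.
have c2 : continuous (fun q : R * 'rV[R]_m => q.2) by move=> q; exact: cvg_snd.
have c1 : continuous (fun q : R * 'rV[R]_m => q.1) by move=> q; exact: cvg_fst.
have cm k l (D : 'M[R]_(k, l)) (g : R * 'rV[R]_m -> 'rV[R]_k) : continuous g ->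
    continuous (fun q => g q *m D).
  by move=> cg; exact: (continuous_compose cg (@mulmx_continuous _ _ _ D)).
have cn := cm _ _ Zn _ c2; have cp := cm _ _ Zp _ c2.
apply: (@continuous_addv R _ 'rV[R]_m); first exact: cm.
apply: cm; apply: (@continuous_addv R _ 'rV[R]_b).
  apply: (@continuous_scalev R _ 'rV[R]_b) => //.
  by apply: (@continuous_subv R _ R^o) => //; exact: continuous_const.
apply: (@continuous_scalev R _ 'rV[R]_b) => //.
apply: ball_proj_continuous => //; first by move=> q; exact: sqrtr_ge0.
have cd : continuous (fun q : R * 'rV[R]_m => enorm (q.2 *m Zn) * enorm (q.2 *m Zn)).
  by apply: continuous_mulr; exact: (continuous_compose cn (@enorm_continuous R a)).
apply: (@continuous_compose _ _ _ (fun q : R * 'rV[R]_m =>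
  ((1 - aa) * dotp (q.2 *m Zn) (q.2 *m Zn) - eps) / (1 + aa))); last exact: sqrt_continuous.
apply: continuous_mulr; last exact: continuous_const.
apply: (@continuous_subv R _ R^o); last exact: continuous_const.
apply: continuous_mulr; first exact: continuous_const.
by under eq_fun do rewrite -enorm_sqr expr2.
Qed.

Lemma graph_continuous (S : topologicalType) (g : S -> 'rV[R]_m) : continuous g ->
  continuous (fun y => Gr (g y)).
Proof.
move=> cg; apply: (@continuous_addv R _ V).
  apply: (@continuous_addv R _ V); first exact: continuous_const.
  exact: (continuous_compose cg (@mulmx_continuous _ _ _ N)).
apply: (@continuous_scalev R _ V); last exact: continuous_const.
exact: (continuous_compose cg hcont).
Qed.

Lemma continuous_form k (Z : 'M[R]_(m, k)) :
  continuous (fun u : 'rV[R]_m => dotp (u *m Z) (u *m Z) : R).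
Proof.
under eq_fun do rewrite -enorm_sqr expr2.
by apply: continuous_mulr;
  exact: (continuous_compose (@mulmx_continuous _ _ _ Z) (@enorm_continuous R k)).
Qed.

Lemma continuous_n : continuous (fun u => n u : R).
Proof. by apply: (@continuous_addv R _ R^o); exact: continuous_form. Qed.

Lemma continuous_sq : continuous (fun u : 'rV[R]_m => dotp u u : R).
Proof.
under eq_fun do rewrite -enorm_sqr expr2.
by apply: continuous_mulr; exact: enorm_continuous.
Qed.

Lemma continuous_quad be ga : continuous (quad be ga).
Proof.
apply: (@continuous_subv R _ R^o).
  apply: (@continuous_addv R _ R^o).
    by apply: (@continuous_subv R _ R^o); exact: continuous_form.
  by apply: continuous_mulr; [exact: continuous_const | exact: continuous_n].
by apply: continuous_mulr; [exact: continuous_const | exact: continuous_sq].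
Qed.

Let cid : continuous (fun y : V => y). Proof. by move=> y. Qed.
Let cu : continuous (fun y : V => uc y). Proof. exact: continuous_uc. Qed.
Let ct : continuous (fun y : V => `|tc y|).
Proof. exact: (continuous_compose (continuous_tc cid) (@norm_continuous _ R^o)). Qed.
Let cf : continuous f. Proof. exact: C1_continuous (proj1 (lm_fC2 M)). Qed.

Lemma closed_handle : closed Hh.
Proof.
have -> : Hh = X `&` ([set y | `|tc y| <= tau / 2] `&` ([set y | n (uc y) <= D6] `&`
    ([set y | Qh (uc y) <= eps] `&` [set y | f y + kp * n (uc y) <= c + eps]))).
  by apply/seteqP; split => y; [case=> ? ? ? ? ? | case=> ? [? [? [? ?]]]]; repeat split.
have cc (k : R) : continuous (fun _ : V => k) by exact: continuous_const.
apply: closedI; first exact: (lm_clX M).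
apply: closedI; first exact: closed_le_fun.
apply: closedI; first by apply: closed_le_fun => //; exact: (continuous_compose cu continuous_n).
apply: closedI.
  by apply: closed_le_fun => //; exact: (continuous_compose cu (@continuous_quad _ _)).
apply: closed_le_fun => //; apply: (@continuous_addv R _ R^o) => //.
by apply: continuous_mulr => //; exact: (continuous_compose cu continuous_n).
Qed.

Lemma closed_J : closed J.
Proof.
have cc (k : R) : continuous (fun _ : V => k) by exact: continuous_const.
have cq be ga : continuous (fun y : V => quad be ga (uc y)).
  exact: (continuous_compose cu (@continuous_quad _ _)).
have -> : J = (X `&` [set y | f y <= c - eps]) `&` (~` oz `|`
    ([set y | Phi (uc y) <= - eps] `&` ([set y | D3 <= n (uc y)] `|`
      ([set y | Qa (uc y) <= - eps] `|` [set y | Qb (uc y) <= - eps])))).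
  apply/seteqP; split => y; move=> [Ly Jy]; split => //.
    have [ozy|noz] := pselect (oz y); [right | by left].
    have [hP hQ] := Jy ozy; split => //.
    by have [n3|n3] := ltP (n (uc y)) D3; [right; exact: hQ | left].
  move=> ozy; case: Jy => [//|[hP hQ]]; split => // n3; case: hQ => //.
  by rewrite /= leNgt n3.
apply: closedI; first by apply: closedI; [exact: (lm_clX M) | exact: closed_le_fun].
apply: closedU; first exact: closed_not_ozone.
apply: closedI.
  apply: closed_le_fun => //; apply: (@continuous_compose _ _ _ (fun y : V => uc y)
    (fun u => Phi u)) => //.
  apply: (@continuous_subv R _ R^o).
    by apply: (@continuous_subv R _ R^o) => //; exact: continuous_const.
  by apply: continuous_mulr; [exact: continuous_const | exact: continuous_sq].
apply: closedU; first by apply: closed_le_fun => //; exact: (continuous_compose cu continuous_n).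
apply: closedU; first exact: closed_le_fun.
by apply: closed_le_fun => //; apply: (@continuous_addv R _ R^o).
Qed.

Lemma closed_I01X (S : set V) : closed S -> closed ([set t : R | 0 <= t <= 1] `*` S).
Proof.
move=> cS; have -> : [set t : R | 0 <= t <= 1] `*` S =
    ([set q : R * V | 0 <= q.1] `&` [set q | q.1 <= 1]) `&` (snd @^-1` S).
  by apply/seteqP; split => -[t y] /=; [case=> /andP[? ?] ?|case=> -[-> ->] ?]; split.
have c1 : continuous (fun q : R * V => q.1) by move=> q; exact: cvg_fst.
apply: closedI.
  by apply: closedI; apply: closed_le_fun => //; exact: continuous_const.
by apply: closed_comp => // q _; exact: cvg_snd.
Qed.

Lemma retract_continuous : {within [set t : R | 0 <= t <= 1] `*` T, continuous retract}.
Proof.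
have -> : [set t : R | 0 <= t <= 1] `*` T =
    ([set t : R | 0 <= t <= 1] `*` J) `|` ([set t : R | 0 <= t <= 1] `*` Hh).
  apply/seteqP; split => q /=; first by case=> q1 [q2|q2]; [left | right].
  by case=> -[q1 q2]; split => //; [left | right].
apply: withinU_continuous; try exact: closed_I01X closed_J; try exact: closed_I01X closed_handle.
  apply: (@eq_within _ _ _ (fun q => Co (1, q.2))).
    by move=> [t y] [t01 Jy]; rewrite retract_J.
  apply: continuous_subspaceT.
  have cp : continuous (fun q : R * V => (1 : R, q.2)).
    by apply: pair_continuous; [exact: continuous_const | move=> q; exact: cvg_snd].
  exact: (continuous_compose cp collapse_continuous).
apply: (@eq_within _ _ _ (fun q : R * V => Gr (squash q.1 (uc q.2)))).
  by move=> [t y] [t01 Hy]; rewrite retract_handle.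
apply: continuous_subspaceT; apply: graph_continuous.
have cp : continuous (fun q : R * V => (q.1, uc q.2)).
  apply: pair_continuous; first by move=> q; exact: cvg_fst.
  by apply: continuous_uc => q; exact: cvg_snd.
exact: (continuous_compose cp squash_continuous).
Qed.

Lemma closed_coreP : closed coreP.
Proof.
apply: closedI; first exact: closed_handle.
apply: closed_le_fun; last exact: continuous_const.
apply: continuous_mulr; first exact: continuous_const.
exact: (continuous_compose cu (@continuous_form _ Zn)).
Qed.

Lemma closed_coreJ : closed coreJ.
Proof.
apply: closedU; first exact: closed_J.
apply: closedI; first exact: closed_handle.
apply: closed_le_fun; first exact: continuous_const.
apply: continuous_mulr; first exact: continuous_const.
exact: (continuous_compose cu (@continuous_form _ Zn)).
Qed.

(** The radius is the one for which [Qa] equals [- eps] on the bounding sphere. *)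
Definition cell (x : 'rV[R]_a) : V := Gr (Num.sqrt (eps / (1 - aa)) *: x *m P).
Definition cell_coord (y : V) : 'rV[R]_a := Num.sqrt ((1 - aa) / eps) *: (uc y *m Zn).

Let sq1 : Num.sqrt (eps / (1 - aa)) * Num.sqrt ((1 - aa) / eps) = 1.
Proof.
have /andP[ap a4] := aa0; rewrite -sqrtrM ?divr_ge0 ?(ltW eps0)//; last by lra.
rewrite (_ : _ * _ = 1) ?sqrtr1//; field; rewrite gt_eqF//=; lra.
Qed.

Lemma cell_qforms (x : 'rV[R]_a) : let u := Num.sqrt (eps / (1 - aa)) *: x *m P in
  posq u = 0 /\ negq u = eps / (1 - aa) * dotp x x.
Proof.
have /andP[ap a4] := aa0; rewrite /posq /negq -!mulmxA PZp PZn mulmx0 mulmx1 dotp0l; split => //.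
rewrite dotpZl dotpZr mulrA -expr2 sqr_sqrtr// divr_ge0 ?(ltW eps0)//; lra.
Qed.

Lemma cell_small (x : 'rV[R]_a) : disk x -> let u := Num.sqrt (eps / (1 - aa)) *: x *m P in
  (1 - aa) * negq u <= eps /\ n u <= D6.
Proof.
rewrite /disk /= ler_enorm// expr1n => xx; have /andP[ap a4] := aa0.
have [-> ->] := cell_qforms x; have a1p : 0 < 1 - aa by lra.
have -> : (1 - aa) * (eps / (1 - aa) * dotp x x) = eps * dotp x x by field; rewrite gt_eqF.
have e1x : eps * dotp x x <= eps by rewrite ler_piMr// ltW.
split => //; rewrite add0r mulrAC ler_pdivrMr//.
have /andP[D6p _] := D60; have := epsD.
have : aa * D6 <= 1 / 4 * D6 by rewrite ler_wpM2r// ltW.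
lra.
Qed.

Lemma cell_handle (x : 'rV[R]_a) : disk x -> Hh (cell x).
Proof.
move=> dx; have [h1 h2] := cell_small dx; have [hp hn] := cell_qforms x.
rewrite /cell; set u := _ *m P in h1 h2 hp hn *.
have /andP[D6p D63] := D60; have n4 : n u <= 4 * D3 by lra.
have ud := n_small n4; have /andP[dp dr] := del0; have ud' : enorm u <= del by lra.
have := F_Fs ud'; have [h3 _] := Fs_Qa n4; have /andP[ap a4] := aa0; have /andP[k0 k1] := kp0.
have ng : 0 <= negq u by exact: dotp_ge0.
split; rewrite ?(pt_Ku M) ?(pt_kt M)//.
- by apply: (graph_X M); lra.
- by have := h_small ud'; have := taup; lra.
- by rewrite /quad hp; have := eps0; nra.
- move: h3; rewrite /quad hp; have := eps0.
  have := ler_wpM2r ng k1; have := ler_wpM2r ng a4; lra.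
Qed.

Theorem arena_cell_attached :
  cell_attached R (set_type Y) (set_type Lo) a.
Proof.
have [k [kT kJ]] := flow_end; have /andP[ap a4] := aa0.
have a1p : 0 < 1 - aa by lra.
have t01 : 0 <= (1 : R) <= 1 by rewrite ler01 lexx.
have tz : 0 <= (0 : R) <= 1 by rewrite ler01 lexx.
have cW S (g : R * V -> V) : continuous g -> {within S, continuous g}.
  exact: continuous_subspaceT.
have PZn0 (x : 'rV[R]_a) : (x *m P) *m Zn = x by rewrite -mulmxA PZn mulmx1.
apply: (@cell_attached_criterion R _ a Y Lo J T coreP coreJ (flow k) Co retract cell cell_coord).
- exact: arena_AY.
- exact: arena_JA.
- exact: arena_TY.
- by move=> y Jy; left.
- move=> y [Jy|Hy]; first by right; left.
  by have [h1|h1] := leP ((1 - aa) * negq (uc y)) eps; [left | right; right; split => //; exact: ltW].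
- exact/cW/flow_continuous.
- exact/cW/collapse_continuous.
- exact: retract_continuous.
- by move=> y _; elim: (k) => //= j IH; rewrite IH mul0r scale0r addr0.
- by move=> y _; exact: collapse0.
- by move=> y Ty; exact: retract0.
- by move=> t y tt Yy; apply: flow_inv => // *; exact: St_sublevel.
- by move=> t y tt Yy; apply: flow_inv => // *; exact: St_sublevel.
- by move=> t y tt Yy; apply: flow_inv => // *; exact: St_T.
- by move=> t y tt Yy; apply: flow_inv => // *; exact: St_J.
- exact: kT.
- exact: kJ.
- by move=> t y tt; exact: collapse_sublevel.
- by move=> t y tt; exact: collapse_sublevel.
- by move=> t y tt; exact: retract_Y.
- by move=> y Jy; exact: retract_J.
- exact: retract_coreJ.
- by move=> y [Jy|[Hy _]]; [left | right].
- exact: closed_coreP.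
- exact: closed_coreJ.
- apply: continuous_subspaceT; apply: (@continuous_scalev R _ 'rV[R]_a).
    exact: continuous_const.
  exact: (continuous_compose cu (@mulmx_continuous _ _ _ Zn)).
- move=> y [_ ny]; rewrite /disk /= ler_enorm// expr1n /cell_coord dotpZl dotpZr mulrA -expr2.
  rewrite sqr_sqrtr ?divr_ge0 ?(ltW eps0) ?(ltW a1p)// mulrAC ler_pdivrMr// mul1r.
  exact: ny.
- move=> y [Hy ny]; rewrite retract_handle// /cell /cell_coord.
  rewrite scalerA sq1 scale1r.
  have -> : squash 1 (uc y) = uc y *m Zn *m P.
    rewrite /squash subrr scale0r add0r scale1r.
    rewrite (_ : zrad _ = 0) ?ball_proj0 ?mul0mx ?addr0//.
    by apply/eqP; rewrite sqrtr_eq0 pmulr_lle0 ?invr_gt0 ?subr_le0//; lra.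
  by [].
- move=> y [Hy ny] JP.
  have ny' : eps <= (1 - aa) * negq (uc y).
    case: JP => [Jy|[]//]; have := J_handle_Qa Jy Hy; rewrite /quad mul0r subr0.
    have : 0 <= posq (uc y) by exact: dotp_ge0.
    by move=> pp; have := mulr_ge0 (ltW ap) pp; lra.
  have E : (1 - aa) * negq (uc y) = eps by apply/eqP; rewrite eq_le ny ny'.
  rewrite /sphere /= /cell_coord enormZ ger0_norm ?sqrtr_ge0//.
  have -> : enorm (uc y *m Zn) = Num.sqrt (eps / (1 - aa)).
    by rewrite /enorm -/(negq (uc y)) -E mulrAC mulfV ?mul1r// gt_eqF.
  by rewrite mulrC sq1.
- apply: continuous_subspaceT; apply: graph_continuous.
  have cs : continuous (fun x : 'rV[R]_a => Num.sqrt (eps / (1 - aa)) *: x).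
    by apply: (@continuous_scalev R _ 'rV[R]_a); [exact: continuous_const | move=> x].
  exact: (continuous_compose cs (@mulmx_continuous _ _ _ P)).
- by move=> x dx; right; exact: cell_handle.
- by move=> x dx; split; [exact: cell_handle | rewrite (pt_Ku M); have [] := cell_small dx].
- by move=> x dx; rewrite /cell_coord (pt_Ku M) PZn0 scalerA mulrC sq1 scale1r.
- move=> x sx; have dx : disk x by rewrite /disk /=; move: sx; rewrite /sphere /= => ->.
  have [h1 h2] := cell_small dx; have [hp hn] := cell_qforms x.
  apply: graph_J => //; rewrite /quad hp hn; move: sx; rewrite /sphere /= => sx.
  rewrite -enorm_sqr sx expr1n mulr1 mul0r subr0 !add0r le_eqVlt; apply/orP; left; apply/eqP.
  by field; rewrite gt_eqF.
- move=> t x tt sx; have dx : disk x by rewrite /disk /=; move: sx; rewrite /sphere /= => ->.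
  have [h1 h2] := cell_small dx; have /andP[D6p D63] := D60; have /andP[dp _] := del0.
  by apply: collapse_graph; have := n_small (ltac:(lra) : n _ <= 4 * D3); lra.
Qed.

End Arena.

Lemma form_add (R : realType) m (B : 'M[R]_m) u x : B^T = B ->
  dotp ((u + x) *m B) (u + x) = dotp (u *m B) u + dotp (2 *: (u *m B)) x + dotp (x *m B) x.
Proof.
move=> sB; rewrite mulmxDl (dotpDl (u *m B)) !(dotpDr u) dotpZl.
have -> : dotp (x *m B) u = dotp (u *m B) x by rewrite dotp_mulmxl sB dotpC.
ring.
Qed.

Lemma form_sq (R : realType) m k (Z : 'M[R]_(m, k)) u :
  dotp (u *m Z) (u *m Z) = dotp (u *m (Z *m Z^T)) u.
Proof. by rewrite mulmxA [RHS]dotp_mulmxl trmxK. Qed.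

(** * Constants depending on the level gap *)

Section LevelCrossing.
Variables (R : realType) (m : nat).
Local Notation V := 'rV[R]_m.+1.
Variables (X : set V) (f : V -> R) (Rr r : R) (p v : V) (kap rho kv : R).
Variables (N : 'M[R]_(m, m.+1)) (Ku : 'M[R]_(m.+1, m)) (kt : V).
Variables (h : 'rV[R]_m -> R) (ru tau L : R).
Hypothesis M : local_model X f Rr r p v kap rho kv N Ku kt h ru tau L.
Local Notation pt := (chart_pt p v N).
Local Notation F := (fun u : 'rV[R]_m => f (pt u (h u))).

Variables (K : R) (G : 'rV[R]_m -> 'rV[R]_m) (Fs : 'rV[R]_m -> R) (CG al d c : R).
Hypothesis K0 : 0 <= K.
Hypothesis neF : forall u, enorm u <= ru -> exists q, sgrad F K ru u q.
Hypothesis CG0 : 0 < CG.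
Hypothesis GL : forall u u', enorm (G u - G u') <= CG * enorm (u - u').
Hypothesis al0 : 0 < al.
Hypothesis dru : d <= ru.
Hypothesis no_opp : forall u q e e' mu la, 0 < enorm u <= d -> sgrad F K ru u q ->
  enorm e <= al * enorm u -> enorm e' <= al * enorm u -> 0 <= mu -> 0 <= la -> mu + la = 1 ->
  mu *: (q + e') + la *: (G u + e) != 0.
Hypothesis coX : compact X.
Variables (e1 del eps00 aa a1 D3 D6 Cu Cn Cg : R) (a b : nat).
Variables (W : 'M[R]_m) (P : 'M[R]_(a, m)) (Q : 'M[R]_(b, m)).
Local Notation Zp := (W *m Q^T).
Local Notation Zn := (- (W *m P^T)).
Local Notation n u := (posq Zp u + negq Zn u).
Local Notation uc y := ((y - p) *m Ku).
Local Notation tc y := (dotp (y - p) kt).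
Local Notation Nq := (Zp *m Zp^T + Zn *m Zn^T).
Local Notation Phi u := (Fs u - c - a1 * dotp u u).
Hypothesis e1P : forall y, X y -> `|f y - c| <= e1 -> ~ ozone p Ku kt tau d y ->
  locally_good (descent X f r) y.
Hypothesis hcont : continuous h.
Hypothesis cFs : continuous Fs.
Hypothesis FsG : forall u u', Fs u' <= Fs u + dotp (G u) (u' - u) + K / 2 * dotp (u' - u) (u' - u).
Hypothesis symW : W^T = W.
Hypothesis sigW : signature W P Q.
Hypothesis idW : 1%:M = W *m Q^T *m Q - W *m P^T *m P.
Hypothesis CnP : 0 < Cn /\ forall u, n u <= Cn * dotp u u.
Hypothesis CgP : 0 < Cg /\ forall u, enorm (2 *: (u *m Nq)) <= Cg * enorm u.
Hypothesis aa0 : 0 < aa <= 1 / 4.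
Hypothesis aaCg : 5 * aa * Cg <= al / 8.
Hypothesis a10 : 0 < a1.
Hypothesis a1al : 4 * a1 <= al / 8.
Hypothesis D60 : 0 < D6 /\ 4 * D6 <= D3.
Hypothesis del0 : 0 < del <= d.
Hypothesis h_small : forall u, enorm u <= del -> `|h u| <= tau / 4.
Hypothesis t_small : forall y, X y -> czone p Ku kt tau del y -> f y <= c + eps00 -> `|tc y| <= tau / 2.
Hypothesis zone_high : forall y, X y -> ozone p Ku kt tau del y -> c - e1 < f y.
Hypothesis f_mono : forall u t t', enorm u <= del -> h u <= t' -> t' <= t -> t <= tau ->
  f (pt u t') <= f (pt u t).
Hypothesis rim : forall u, del / 2 <= enorm u <= del -> Phi u <= F u - c.
Hypothesis F_Fs : forall u, enorm u <= del -> F u <= Fs u.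
Hypothesis Fs_quad : forall u, n u <= 4 * D3 -> `|Fs u - c - (posq Zp u - negq Zn u)| <= aa * n u.
Hypothesis GW : forall u, n u <= 4 * D3 -> enorm (G u - 2 *: (u *m W)) <= al / 8 * enorm u.
Hypothesis n_small : forall u, n u <= 4 * D3 -> enorm u < del / 2.
Hypothesis n_D6 : forall u, n u <= D6 -> 6 * aa * n u + 2 * a1 * dotp u u <= 4 * aa * D3.
Hypothesis F_cont0 : forall e : R, 0 < e -> exists2 rr : R, 0 < rr &
  forall u, enorm u < rr -> `|F u - c| < e.
Ltac section_facts ::= assert (M := I); assert (K0 := I); assert (neF := I); assert (CG0 := I);
  assert (GL := I); assert (al0 := I); assert (dru := I); assert (no_opp := I); assert (coX := I);
  assert (e1P := I); assert (hcont := I); assert (cFs := I); assert (FsG := I); assert (symW := I);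
  assert (sigW := I); assert (idW := I); assert (CnP := I); assert (CgP := I); assert (aa0 := I);
  assert (aaCg := I); assert (a10 := I); assert (a1al := I); assert (D60 := I); assert (del0 := I);
  assert (h_small := I); assert (t_small := I); assert (zone_high := I); assert (f_mono := I);
  assert (rim := I); assert (F_Fs := I); assert (Fs_quad := I); assert (GW := I);
  assert (n_small := I); assert (n_D6 := I); assert (F_cont0 := I).

Lemma n_form u : n u = dotp (u *m Nq) u.
Proof.
by rewrite /posq /negq !form_sq mulmxDr dotpDl.
Qed.

Lemma symNq : Nq^T = Nq.
Proof. by rewrite linearD /= [(Zp *m _)^T]trmx_mul [(Zn *m _)^T]trmx_mul !trmxK. Qed.

Lemma n_add u x : n (u + x) = n u + dotp (2 *: (u *m Nq)) x + n x.
Proof. by rewrite !n_form form_add // symNq. Qed.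

Lemma quad_form be ga u : quad Zn Zp be ga u = dotp (u *m W) u + be * n u - ga * dotp u u.
Proof.
rewrite /quad (signature_form u symW idW) /posq /negq.
by congr (_ - _ + _ - _); rewrite mulmxN dotpNl dotpNr opprK.
Qed.

Lemma quad_add be ga u x : quad Zn Zp be ga (u + x) = quad Zn Zp be ga u +
  dotp (2 *: (u *m W) + be *: (2 *: (u *m Nq)) - (2 * ga) *: u) x + quad Zn Zp be ga x.
Proof.
rewrite !quad_form n_add form_add// dotp_addsq.
rewrite (dotpBl (2 *: (u *m W) + _)) (dotpDl (2 *: (u *m W))).
rewrite (dotpZl be) (dotpZl (2 * ga)); ring.
Qed.

Lemma n_ge0 u : 0 <= n u. Proof. by rewrite addr_ge0 ?dotp_ge0. Qed.

Theorem level_crossing eps : 0 < eps -> 2 * eps <= aa * D6 -> eps <= e1 -> 4 * eps <= D6 ->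
  4 * eps * Cg <= al * D6 -> eps <= eps00 ->
  cell_attached R (set_type (sublevel X f (c + eps))) (set_type (sublevel X f (c - eps))) a.
Proof.
move=> eps0 epsD epse eps6 epsC eps00'.
have [Cn0 hCn] := CnP; have [Cg0 hCg] := CgP; have [D6p D63] := D60.
have /andP[ap a4] := aa0; have /andP[dp dld] := del0; have tp := lm_tau0 M.
pose kp := 2 * eps / D6.
have kpD : kp * D6 = 2 * eps by rewrite /kp divfK// gt_eqF.
have kp0 : 0 <= kp <= 1 / 2.
  by rewrite divr_ge0 ?(ltW D6p) ?mulr_ge0 ?(ltW eps0)//= ler_pdivrMr//; lra.
have kpC : kp * Cg <= al / 2.
  by rewrite /kp mulrAC ler_pdivrMr//; lra.
have e20 : 0 < eps / 2 by rewrite divr_gt0.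
have [rF rF0 hrF] := F_cont0 e20.
pose x2 := Num.min D6 (eps / 2) / (4 * Cn).
have x20 : 0 < x2 by rewrite divr_gt0 ?mulr_gt0// lt_min D6p.
pose x3 := eps / (2 * a1); have x30 : 0 < x3 by rewrite divr_gt0 ?mulr_gt0.
have [rho1 [rho10 [r1 r2] [r3 r4 r5]]] : exists rho1, [/\ 0 < rho1,
    rho1 <= 1 /\ rho1 <= del & [/\ rho1 <= rF, rho1 <= x2 & rho1 <= x3]].
  exists (Num.min (Num.min 1 del) (Num.min rF (Num.min x2 x3))).
  rewrite !lt_min !ge_min !lexx ?orbT ltr01 dp rF0 x20 x30; by repeat split.
have sqr1 (u : 'rV[R]_m) : enorm u <= 2 * rho1 -> dotp u u <= 4 * rho1.
  move=> ur; rewrite -enorm_sqr; apply: (@le_trans _ _ ((2 * rho1) ^+ 2)).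
    by rewrite lerXn2r// nnegrE ?enorm_ge0// mulr_ge0// ltW.
  rewrite exprMn expr2 (_ : 2 * 2 = 4 :> R); last by ring.
  by rewrite ler_wpM2l// expr2 ler_piMr// ltW.
have axis2 u : enorm u <= 2 * rho1 ->
    [/\ n u <= D6, quad Zn Zp (2 * aa) 0 u <= eps & kp * n u <= eps / 2].
  move=> /sqr1 uu; have nu : n u <= Num.min D6 (eps / 2).
    apply: (le_trans (hCn u)); move: r4; rewrite /x2 ler_pdivlMr ?mulr_gt0// => r4.
    by apply: le_trans r4; have := ler_wpM2l (ltW Cn0) uu; lra_with.
  move: nu; rewrite le_min => /andP[n6 ne]; have nu0 := n_ge0 u.
  have ng : 0 <= negq Zn u by exact: dotp_ge0.
  have /andP[k0 k1] := kp0; split => //.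
    by rewrite /quad mul0r subr0; have := ler_wpM2r nu0 a4; lra_with ng ne nu0 eps0.
  by have := ler_wpM2r nu0 k1; lra_with e20 ne.
have axis1 u : enorm u < rho1 -> - eps < Phi u /\ c - eps < F u.
  move=> ur; have := hrF u (lt_le_trans ur r3); rewrite ltr_norml => /andP[h1 h2].
  have ud : enorm u <= del by lra_with r2 ur.
  have uu : a1 * dotp u u <= eps / 2.
    have : dotp u u <= rho1.
      rewrite -enorm_sqr expr2; have := enorm_ge0 u => u0.
      apply: (@le_trans _ _ (enorm u * 1)); last by lra_with ur.
      by rewrite ler_wpM2l//; lra_with r1 ur.
    move=> uu; have := ler_wpM2l (ltW a10) (le_trans uu r5).
    by rewrite (_ : a1 * x3 = eps / 2)// /x3; field; rewrite gt_eqF.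
  by have FF := F_Fs ud; split; lra_with h1 h2 uu eps0 FF.
have [eta [eta0 [eta1 eta2 eta3] etaC]] : exists eta : R, [/\ 0 < eta,
    [/\ eta <= rho1, eta <= del / 2 & eta <= tau / 4] & Cn * eta ^+ 2 <= D6].
  pose x4 := D6 / Cn; have x40 : 0 < x4 by rewrite divr_gt0.
  exists (Num.min (Num.min rho1 (del / 2)) (Num.min (tau / 4) (Num.min 1 x4))).
  split; [by rewrite !lt_min rho10 x40 ltr01 !divr_gt0 | by split; rewrite !ge_min lexx ?orbT |].
  set ee := Num.min _ _; have e0 : 0 <= ee.
    by rewrite !le_min (ltW rho10) (ltW x40) ler01 !divr_ge0 ?ltW.
  have e1' : ee <= 1 by rewrite !ge_min lexx ?orbT.
  have e4 : ee <= x4 by rewrite !ge_min lexx ?orbT.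
  apply: (@le_trans _ _ (Cn * x4)).
    by rewrite ler_wpM2l ?(ltW Cn0)// (le_trans _ e4)// expr2 ler_piMr.
  by rewrite /x4 mulrC divfK// gt_eqF.
have n_step u u' : enorm (u' - u) <= eta ->
    (n u <= D3 -> n u' <= 4 * D3) /\ (n u <= D6 -> n u' <= D3).
  move=> uu; have nd : n (u' - u) <= D6.
    apply: (le_trans (hCn _)); apply: le_trans etaC; rewrite ler_wpM2l ?(ltW Cn0)//.
    by rewrite -enorm_sqr lerXn2r// nnegrE ?enorm_ge0// ltW.
  have : n u' <= 2 * n u + 2 * n (u' - u).
    have e1' : n u' = n u + dotp (2 *: (u *m Nq)) (u' - u) + n (u' - u).
      by rewrite -n_add (addrC u) subrK.
    have := n_add u (- (u' - u)); have := n_ge0 (u - (u' - u)).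
    have -> : n (- (u' - u)) = n (u' - u).
      by rewrite /posq /negq !mulNmx !dotpNl !dotpNr !opprK.
    by rewrite dotpNr e1' => h1 h2; move: h1; rewrite h2; lra_with.
  by move=> nu2; split => nu1; lra_with D6p D63 nd nu2 nu1.
have rho1F u : enorm u < rho1 -> F u < c + eps / 2.
  by move=> ur; have := hrF u (lt_le_trans ur r3); rewrite ltr_norml => /andP[_]; lra_with.
(* Covers the second order terms of [kp * n], of [Phi] and of all forms [quad be ga] with [be] at
   most [5 * aa] in absolute value. *)
pose Cpsi := 3 * Cn + K.
have Cpsi0 : 0 <= Cpsi by rewrite addr_ge0// mulr_ge0// ltW.
have [D D0 hD] := chart_lip p Ku kt.
have st0 : 0 < eta / D by rewrite divr_gt0.
have [w [th [s1 [theta [[cw s10 th0] [thp tha hstep]]]]]] :=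
  push_exists M K0 neF CG0 GL al0 dru no_opp coX e1P del0 rho10 rho1F Cpsi0 st0.
have al2 (x y : R) : 0 <= y -> x <= al / 4 * y -> x <= al / 2 * y.
  by move=> y0 xy; have := mulr_ge0 (ltW al0) y0; lra_with xy.
have wk (x y z : R) : 0 <= z -> x <= y - z -> x <= y.
  by move=> z0 xyz; apply: (le_trans xyz); rewrite gerBl.
have delru : 0 < del <= ru by rewrite dp (le_trans dld).
have rho1d : 0 < rho1 <= del by rewrite rho10.
have [s1a s1b s1c] := sigW.
have QWP : Q *m W *m P^T = 0.
  by apply: trmx_inj; rewrite trmx_mul trmx_mul trmxK symW mulmxA s1c trmx0.
have D6D3 : 0 < D6 < D3 by rewrite D6p; lra_with D6p D63.
apply: (@arena_cell_attached R m X f Rr r p v kap rho kv N Ku kt h ru tau L M a b P Q Zn Zp Fs c aa a1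
  D3 D6 e1 del rho1 eps kp eta hcont cFs _ _ _ _ _ aa0 a10 D6D3 delru rho1d eps0 kpD kp0 epsD
  epse h_small _ zone_high f_mono rim F_Fs Fs_quad n_small n_D6 axis2 axis1 _ n_step w th s1 theta).
- by rewrite mulmxN mulmxA s1a opprK.
- by rewrite mulmxN mulmxA QWP oppr0.
- by rewrite mulmxA s1c.
- by rewrite mulmxA s1b.
- by rewrite mulNmx -idW.
- by move=> y Xy yz fy; apply: t_small => //; lra_with eps00' fy.
- by split.
- exact: cw.
- exact: s10.
- exact: th0.
- exact: thp.
- exact: tha.
- by move=> s y ss Xy; have [] := hstep s y ss Xy.
- move=> s y ss Xy; have [_ sw _ _ _] := hstep s y ss Xy.
  have [h1 h2] := hD (y + s *: w y) y.
  have Dw : D * enorm (y + s *: w y - y) <= eta.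
    by rewrite addrAC subrr add0r mulrC -ler_pdivlMr.
  by split; [exact: le_trans h1 Dw | exact: le_trans h2 Dw].
- by move=> s y ss Xy; have [] := hstep s y ss Xy.
- move=> s y ss Xy yz; have [_ _ _ h1 _] := hstep s y ss Xy.
  apply: (h1 yz (fun u => kp * n u) (kp *: (2 *: (uc y *m Nq)))).
    rewrite enormZ ger0_norm; last by case/andP: kp0.
    have /andP[k0 _] := kp0; have := ler_wpM2l k0 (hCg (uc y)).
    by have := ler_wpM2r (enorm_ge0 (uc y)) kpC; lra_with.
  move=> x; rewrite n_add (dotpZl kp); set A1 := n (uc y); set A2 := dotp _ x.
  rewrite (mulrDr kp (A1 + A2)) (mulrDr kp A1) lerD2l.
  have /andP[k0 k1] := kp0; have := ler_wpM2r (n_ge0 x) k1; have := hCn x.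
  have := mulr_ge0 K0 (dotp_ge0 x); have := mulr_ge0 (ltW Cn0) (dotp_ge0 x).
  by rewrite /Cpsi mulrDl; lra_with.
- move=> s y ss Xy yz yr; have [_ _ _ _ h2] := hstep s y ss Xy.
  have /andP[s0 _] := ss; have sth := mulr_ge0 s0 (thp y).
  apply: (wk _ _ _ sth); apply: (h2 yz yr (fun u => Phi u) (- ((2 * a1) *: uc y))).
    rewrite enormN enormZ ger0_norm; last by have := a10; lra_with a10.
    apply: al2; first exact: enorm_ge0.
    by rewrite ler_wpM2r ?enorm_ge0//; have := a1al; have := a10; lra_with a10 a1al.
  move=> x; have := FsG (uc y) (uc y + x); rewrite (addrC _ x) addrK (addrC x).
  rewrite dotp_addsq dotpDl dotpNl dotpZl.
  have := mulr_ge0 K0 (dotp_ge0 x); have := mulr_ge0 (ltW a10) (dotp_ge0 x).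
  have := mulr_ge0 (ltW Cn0) (dotp_ge0 x); rewrite /Cpsi mulrDl; lra_with.
move=> s y be ga ss Xy yz yr n4 beB /andP[ga0 gaB]; have [_ _ _ _ h2] := hstep s y ss Xy.
have /andP[s0 _] := ss; have sth := mulr_ge0 s0 (thp y).
apply: (wk _ _ _ sth); apply: (h2 yz yr (quad Zn Zp be ga)
  (2 *: (uc y *m W) - G (uc y) + (be *: (2 *: (uc y *m Nq)) - (2 * ga) *: uc y))).
  set U := uc y in n4 *; have u0 := enorm_ge0 U.
  apply: (le_trans (enormD _ _)); rewrite (enormB (2 *: (U *m W))).
  have i1 := GW n4; have i2 := enormBD (be *: (2 *: (U *m Nq))) ((2 * ga) *: U).
  rewrite (enormZ be) (enormZ (2 * ga)) (ger0_norm (_ : 0 <= 2 * ga)) ?mulr_ge0// in i2.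
  have i3 : `|be| * enorm (2 *: (U *m Nq)) <= al / 8 * enorm U.
    apply: (@le_trans _ _ (5 * aa * (Cg * enorm U))); first by rewrite ler_pM ?enorm_ge0.
    by rewrite mulrA ler_wpM2r.
  have i4 : 2 * ga * enorm U <= al / 8 * enorm U by rewrite ler_wpM2r//; have := a1al; lra_with a1al gaB.
  by have := mulr_ge0 (ltW al0) u0; lra_with i1 i2 i3 i4.
move=> x; rewrite quad_add.
have -> : G (uc y) + (2 *: (uc y *m W) - G (uc y) + (be *: (2 *: (uc y *m Nq)) - (2 * ga) *: uc y)) =
  2 *: (uc y *m W) + be *: (2 *: (uc y *m Nq)) - (2 * ga) *: uc y by rowring.
rewrite lerD2l /quad; have := hCn x; have := dotp_ge0 x => x0.
have : be * n x <= 5 * aa * n x.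
  by rewrite ler_wpM2r ?n_ge0// (le_trans (ler_norm _)).
have := ler_wpM2r (n_ge0 x) a4; have : 0 <= negq Zn x by exact: dotp_ge0.
have := mulr_ge0 K0 x0; have := mulr_ge0 ga0 x0; have := mulr_ge0 (ltW Cn0) x0.
have := n_ge0 x; rewrite /Cpsi mulrDl; lra_with.
Qed.

End LevelCrossing.

Lemma form_le (R : realType) m k (Z : 'M[R]_(m, k)) : exists2 C : R, 0 < C &
  forall u, dotp (u *m Z) (u *m Z) <= C * dotp u u.
Proof.
have [C C0 hC] := mulmx_bound Z; exists (C ^+ 2); first by rewrite exprn_gt0.
move=> u; rewrite -!enorm_sqr -exprMn lerXn2r// nnegrE ?enorm_ge0// mulr_ge0 ?enorm_ge0//.
exact: ltW.
Qed.

Section SignatureCoordinates.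
Variables (R : realType) (m a b : nat) (W : 'M[R]_m) (P : 'M[R]_(a, m)) (Q : 'M[R]_(b, m)).
Local Notation Zp := (W *m Q^T).
Local Notation Zn := (- (W *m P^T)).
Local Notation n u := (posq Zp u + negq Zn u).

Lemma signature_norm_le : exists2 Cn : R, 0 < Cn & forall u, n u <= Cn * dotp u u.
Proof.
have [C C0 hC] := form_le Zp; have [C' C'0 hC'] := form_le Zn.
exists (C + C'); first exact: addr_gt0.
by move=> u; rewrite mulrDl lerD ?hC ?hC'.
Qed.

Lemma signature_norm_ge : 1%:M = W *m Q^T *m Q - W *m P^T *m P ->
  exists2 Cu : R, 0 < Cu & forall u, dotp u u <= Cu * n u.
Proof.
move=> idW; have [C C0 hC] := form_le P; have [C' C'0 hC'] := form_le Q.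
exists (2 * (C + C')); first by rewrite mulr_gt0// addr_gt0.
move=> u; have uE : u = u *m Zp *m Q + u *m Zn *m P.
  by rewrite -!(mulmxA u) -mulmxDr mulNmx -idW mulmx1.
rewrite [in leLHS]uE; set x := u *m Zp; set y := u *m Zn.
have h : dotp (x *m Q + y *m P) (x *m Q + y *m P) <=
    2 * dotp (x *m Q) (x *m Q) + 2 * dotp (y *m P) (y *m P).
  by have := dotp_ge0 (x *m Q - y *m P); rewrite dotp_subsq dotp_addsq; lra.
apply: (le_trans h); have := hC y; have := hC' x; rewrite /posq /negq -/x -/y.
have := mulr_ge0 (ltW C0) (dotp_ge0 x); have := mulr_ge0 (ltW C'0) (dotp_ge0 y).
lra.
Qed.

End SignatureCoordinates.

(** * Constants depending on the critical point *)

Section CriticalCrossing.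
Variables (R : realType) (m : nat).
Local Notation V := 'rV[R]_m.+1.
Variables (X : set V) (f : V -> R) (Rr r : R) (p v : V) (kap rho kv : R).
Variables (N : 'M[R]_(m, m.+1)) (Ku : 'M[R]_(m.+1, m)) (kt : V).
Variables (h : 'rV[R]_m -> R) (ru tau L : R).
Hypothesis M : local_model X f Rr r p v kap rho kv N Ku kt h ru tau L.
Local Notation A := (compl_set X).
Local Notation pt := (chart_pt p v N).
Local Notation F := (fun u : 'rV[R]_m => f (pt u (h u))).
Local Notation fC2 := (lm_fC2 M).
Local Notation rho0 := (lm_rho0 M).
Local Notation kv0 := (lm_kv0 M).
Local Notation gkv := (lm_gkv M).
Local Notation ru0 := (lm_ru0 M).
Local Notation tau0 := (lm_tau0 M).
Local Notation L0 := (lm_L0 M).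
Local Notation h0 := (lm_h0 M).
Local Notation htau := (lm_htau M).
Local Notation hL := (lm_hL M).
Local Notation hX := (lm_hX M).
Local Notation hp := (lm_hp M).

Lemma fiber_growth u t t' : enorm u <= ru -> h u <= t' -> t' <= t -> t <= tau ->
  kv * (t - t') <= f (pt u t) - f (pt u t').
Proof.
move=> uB ht' tt tB; have := htau uB; have tp := tau0; rewrite ler_norml => /andP[h1 h2].
have -> : pt u t = pt u t' + (t - t') *: v by rewrite -[LHS](subrK (pt u t')) pt_sub subrr mul0mx add0r addrC.
have [s /andP[s0 s1] ->] := C1_MVT (pt u t') ((t - t') *: v) (proj1 fC2).
rewrite dotpZr mulrC ler_wpM2l ?subr_ge0//; apply: gkv.
have -> : pt u t' + s *: ((t - t') *: v) = pt u (t' + s * (t - t')).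
  by rewrite /chart_pt scalerA scalerDl addrA.
have st0 : 0 <= s * (t - t') by rewrite mulr_ge0// subr_ge0.
have st1 : s * (t - t') <= t - t' by rewrite ler_piMl// subr_ge0.
have tB' : `|t' + s * (t - t')| <= tau by rewrite ler_norml; apply/andP; split; lra.
by have := hp uB tB'; have := rho0; lra.
Qed.

Variables (K c : R).
Hypothesis K0 : 0 <= K.
Hypothesis neF : forall u, enorm u <= ru -> exists q, sgrad F K ru u q.
Hypothesis coX : compact X.
Hypothesis pointed : forall y, X y -> A y -> exists v (kap : R),
  0 < kap /\ forall n, enorm n = 1 -> proxnor r A y n -> kap <= dotp n v.
Hypothesis crit : forall y, critical X f y -> f y = c -> y = p.
Hypothesis fp : f p = c.
Hypothesis hcont : continuous h.
Hypothesis sg0 : sgrad F K ru 0 0.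
Variables (A0 B0 : 'M[R]_m).
Hypothesis tang : forall t0 : R, 0 < t0 -> exists2 eta : R, 0 < eta &
  forall u q, enorm u <= eta -> enorm q <= eta -> sgrad F K ru u q ->
    exists x : 'rV[R]_m, enorm (u - x *m A0) + enorm (q - x *m B0) <= t0 * (enorm u + enorm q).
Hypothesis nondeg : exists Z, A0 = A0 *m B0^T *m Z.
Variables (ind : nat) (LI : 'M[R]_(ind, m)).
Hypothesis negL : forall y : 'rV_ind, y != 0 -> dotp (y *m LI *m A0) (y *m LI *m B0) < 0.
Hypothesis maxL : forall j (L' : 'M[R]_(j, m)),
  (forall y : 'rV_j, y != 0 -> dotp (y *m L' *m A0) (y *m L' *m B0) < 0) -> (j <= ind)%N.
Ltac section_facts ::= assert (M := I); assert (K0 := I); assert (neF := I); assert (coX := I);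
  assert (pointed := I); assert (crit := I); assert (fp := I); assert (hcont := I);
  assert (sg0 := I); assert (tang := I); assert (nondeg := I); assert (negL := I);
  assert (maxL := I).
Local Notation uc y := ((y - p) *m Ku).
Local Notation tc y := (dotp (y - p) kt).
Local Notation cF := (F_continuous M).

Lemma F_zero : F 0 = c. Proof. by rewrite /= h0 pt0. Qed.

Lemma F_cont0 (e : R) : 0 < e -> exists2 rr : R, 0 < rr &
  forall u, enorm u < rr -> `|F u - c| < e.
Proof.
move=> e0; have B0' : enorm (0 : 'rV[R]_m) <= ru by rewrite enorm0 (ltW ru0).
have [rr rr0 hr] := cF B0' e0; exists (Num.min rr ru); first by rewrite lt_min rr0 ru0.
move=> u; rewrite lt_min => /andP[ur uB]; have := hr u (ltW uB).
by rewrite subr0 F_zero; apply.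
Qed.

(** On the graph [f] is close to [c], and above it [f] grows at rate [kv]: a point higher than
    [tau / 2] has gained at least [kv * tau / 4]. *)
Lemma zone_choice (e1 d : R) : 0 < e1 -> 0 < d <= ru -> exists2 del : R, 0 < del <= d &
  [/\ forall u, enorm u <= del -> `|h u| <= tau / 4,
    forall y, X y -> czone p Ku kt tau del y -> f y <= c + kv * tau / 16 -> `|tc y| <= tau / 2 &
    forall y, X y -> ozone p Ku kt tau del y -> c - e1 < f y].
Proof.
move=> e10 /andP[d0 dru]; have kvp := kv0; have tp := tau0; have Lp := L0.
have kt0 : 0 < kv * tau / 16 by rewrite divr_gt0// mulr_gt0.
have mn0 : 0 < Num.min e1 (kv * tau / 16) by rewrite lt_min e10.
have [rr rr0 hr] := F_cont0 mn0.
pose del := Num.min d (Num.min (rr / 2) (tau / (4 * L))).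
have dl0 : 0 < del by rewrite !lt_min d0 !divr_gt0// mulr_gt0.
have dld : del <= d by rewrite ge_min lexx.
have dlr : del <= rr / 2 by rewrite !ge_min lexx orbT.
have dlL : del <= tau / (4 * L) by rewrite !ge_min lexx !orbT.
clearbody del; exists del; first by rewrite dl0.
have hsm u : enorm u <= del -> `|h u| <= tau / 4.
  move=> ud; have B0' : enorm (0 : 'rV[R]_m) <= ru by rewrite enorm0 (ltW ru0).
  have := hL B0' (le_trans (le_trans ud dld) dru); rewrite h0 !subr0 => hu.
  apply: (le_trans hu); have := le_trans ud dlL; rewrite ler_pdivlMr ?mulr_gt0//; lra.
have Fl u : enorm u <= del -> c - e1 < F u /\ c - kv * tau / 16 < F u.
  move=> ud; have := hr u ltac:(lra).
  by rewrite lt_min !ltr_norml => /andP[/andP[h1 _] /andP[h2 _]]; split; lra_with h1 h2.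
have Ff y : X y -> czone p Ku kt tau del y ->
    h (uc y) <= tc y /\ kv * (tc y - h (uc y)) <= f y - F (uc y).
  move=> Xy [uy ty]; have uB := le_trans (le_trans uy dld) dru.
  have htl : h (uc y) <= tc y by apply/(hX uB ty); rewrite -(pt_coords M).
  split => //; have := fiber_growth uB (lexx _) htl (le_trans (ler_norm _) ty).
  by rewrite -(pt_coords M).
split => //.
- move=> y Xy yz fy; have [htl hf] := Ff y Xy yz; have [uy ty] := yz.
  have [_ F1] := Fl _ uy; have := hsm _ uy; rewrite !ler_norml => /andP[h1 h2].
  apply/andP; split; first lra_with htl h1 h2.
  rewrite leNgt; apply/negP => tt.
  have : kv * (tau / 4) <= kv * (tc y - h (uc y)) by rewrite ler_wpM2l ?ltW//; lra_with h2 tt.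
  lra_with kt0 fy hf F1.
- move=> y Xy [uy ty]; have yz : czone p Ku kt tau del y by split; exact: ltW.
  have [htl hf] := Ff y Xy yz; have [F1 _] := Fl _ (ltW uy).
  have : 0 <= kv * (tc y - h (uc y)) by rewrite mulr_ge0 ?subr_ge0// ltW.
  lra_with hf F1.
Qed.

(** The gap between [Fs] and [F] is of order [s], whereas the tilt [a1 * dotp u u] is bounded below
    once [del / 2 <= enorm u]. *)
Lemma rim_choice (del a1 : R) : 0 < del <= ru / 2 -> 0 < a1 -> exists2 sg : R, 0 < sg &
  forall s, 0 < s <= sg -> forall u, del / 2 <= enorm u <= del ->
    supconv F K ru s u - c - a1 * dotp u u <= F u - c.
Proof.
move=> /andP[dl0 dlru] a10; have [Lq Lq0 hLq] := sgrad_bound ru0 K0 cF.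
have rup := ru0; pose B := Lq + K * ru.
have BB0 : 0 < B by rewrite ltr_wpDr// mulr_ge0// ltW.
exists (a1 * del ^+ 2 / (2 * B ^+ 2)); first by rewrite divr_gt0 ?mulr_gt0 ?exprn_gt0.
move=> s /andP[s0]; rewrite ler_pdivlMr ?mulr_gt0 ?exprn_gt0// => sB u /andP[u1 u2].
have uB : enorm u <= ru by lra.
have [q hq] := neF uB.
have qB : enorm (q - K *: u) <= B.
  apply: (le_trans (enormBD _ _)); rewrite lerD ?(hLq u)//; first lra.
  by rewrite enormZ ger0_norm// ler_wpM2l.
have h1 := supconv_le ru0 cF s0 hq.
have h2 : dotp (q - K *: u) (q - K *: u) <= B ^+ 2.
  by rewrite -enorm_sqr lerXn2r ?nnegrE ?enorm_ge0// ltW.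
have h3 : s / 2 * dotp (q - K *: u) (q - K *: u) <= s / 2 * B ^+ 2.
  by rewrite ler_wpM2l// divr_ge0// ltW.
have h4 : (del / 2) ^+ 2 <= dotp u u.
  by rewrite -enorm_sqr lerXn2r ?nnegrE ?enorm_ge0// divr_ge0// ltW.
have := ler_wpM2l (ltW a10) h4; rewrite expr_div_n => h5.
have : a1 * (del ^+ 2 / 2 ^+ 2) = a1 * del ^+ 2 / 4 by field.
lra.
Qed.

(** [W] is half the Hessian, so that [dotp (u *m W) u] is the quadratic part itself. Along a kernel
    vector of [W] the gradient would be smaller than its lower bound [al * enorm u]. *)
Lemma model_choice s : 0 < s -> forall d al, 0 < d <= ru -> 0 < al ->
  (forall u, 0 < enorm u <= d -> al * enorm u < enorm (supgrad F K ru s u)) ->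
  let W := 2^-1 *: supS K A0 B0 s in
  [/\ W^T = W, W \in unitmx, resM K A0 B0 s *m W = 2^-1 *: resN K A0 B0 s &
    forall t : R, 0 < t -> exists2 rr : R, 0 < rr & forall u, enorm u <= rr ->
      enorm (supgrad F K ru s u - 2 *: (u *m W)) <= t * enorm u /\
      `|supconv F K ru s u - c - dotp (u *m W) u| <= t * dotp u u].
Proof.
move=> s0 d al /andP[d0 dru] al0 Gl W.
have WE (u : 'rV[R]_m) : 2 *: (u *m W) = u *m supS K A0 B0 s.
  by rewrite /W -scalemxAr scalerA mulfV ?scale1r// pnatr_eq0.
have ex t : 0 < t -> exists2 rr : R, 0 < rr & forall u, enorm u <= rr ->
      enorm (supgrad F K ru s u - 2 *: (u *m W)) <= t * enorm u /\
      `|supconv F K ru s u - c - dotp (u *m W) u| <= t * dotp u u.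
  move=> t0; have [r1 r10 h1] := supgrad_expand ru0 K0 neF cF sg0 tang s0 t0.
  have [r2 r20 h2] := supconv_expand ru0 K0 neF cF sg0 tang s0 t0.
  exists (Num.min r1 r2); first by rewrite lt_min r10.
  move=> u; rewrite le_min => /andP[u1 u2]; split; first by rewrite WE //; exact: (h1 u u1).
  have := h2 u u2; rewrite F_zero -WE dotpZl [2 * _ / 2]mulrAC mulfV ?mul1r// pnatr_eq0//.
have symW : W^T = W by rewrite /W linearZ /= (supS_sym ru0 K0 neF cF sg0 tang s0).
split => //; last first.
  rewrite /W -scalemxAr /supS mulmxA mulmxV ?mul1mx//.
  exact: (resM_unit ru0 K0 neF cF sg0 tang s0).
rewrite -row_free_unit; apply/inj_row_free => u uW; apply/eqP; apply: contraT => un0.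
have u0 : 0 < enorm u by rewrite enorm_gt0.
have [rr rr0 hr] := ex al al0.
pose x := (Num.min rr d / enorm u) *: u.
have mn0 : 0 < Num.min rr d by rewrite lt_min rr0.
have xE : enorm x = Num.min rr d by rewrite /x enormZ gtr0_norm ?divr_gt0// divfK// gt_eqF.
have [h1 _] := hr x ltac:(by rewrite xE ge_min lexx).
have h2 := Gl x ltac:(by rewrite xE mn0 ge_min lexx orbT).
by move: h1; rewrite /x -scalemxAl uW !scaler0 subr0 leNgt -/x h2.
Qed.

Theorem critical_crossing : exists2 e0 : R, 0 < e0 & forall e, 0 < e < e0 ->
  cell_attached R (set_type (sublevel X f (c + e))) (set_type (sublevel X f (c - e)))
    (ind + (m - \rank A0)).
Proof.
have rup := ru0; have kvp := kv0; have tp := tau0.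
have [s0 [al [d [s00 al0 /andP[d0 dru2] nop]]]] :=
  no_opposite ru0 K0 neF cF sg0 tang nondeg.
have dru : d <= ru by lra.
have symAB := tangent_sym ru0 K0 neF cF sg0 tang.
have [si si0 hind] := index_resolvent K0 symAB nondeg negL maxL.
have [e1 e10 he1] := level_descent M d0 coX pointed crit.
have [del /andP[dl0 dld] [hsm tsm zhi]] := zone_choice e10 (ltac:(by rewrite d0) : 0 < d <= ru).
pose a1 := al / 32; have a10 : 0 < a1 by rewrite divr_gt0.
have dl2 : 0 < del <= ru / 2 by rewrite dl0; lra.
have [sr sr0 hrim] := rim_choice dl2 a10.
(* The regularisation parameter is fixed only now: [al], [d], [del] and [a1] do not depend on it,
   while [W] and the constants below do. *)
pose sg := Num.min s0 (Num.min si sr).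
have sg0' : 0 < sg by rewrite !lt_min s00 si0.
have sgs : sg <= s0 by rewrite ge_min lexx.
have sgi : 0 < sg <= si by rewrite sg0' !ge_min lexx orbT.
have sgr : 0 < sg <= sr by rewrite sg0' !ge_min lexx !orbT.
clearbody sg.
set G := supgrad F K ru sg; set Fs := supconv F K ru sg.
have nop' u q e e' mu la : 0 < enorm u <= d -> sgrad F K ru u q ->
    enorm e <= al * enorm u -> enorm e' <= al * enorm u -> 0 <= mu -> 0 <= la -> mu + la = 1 ->
    mu *: (q + e') + la *: (G u + e) != 0.
  by apply: nop; rewrite sg0'.
have Gl := G_large neF al0 dru nop'.
have [symW uW resW hW] := model_choice sg0' (ltac:(by rewrite d0) : 0 < d <= ru) al0 Gl.
set W := _ *: _ in symW uW resW hW.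
have [a [b [P [Q [sigW idW]]]]] := signature_unit symW uW.
have rU := resM_unit ru0 K0 neF cF sg0 tang sg0'.
have aE := hind sg sgi rU W a b P Q symW resW sigW idW.
rewrite -aE; clear aE hind.
have [Cn Cn0 hCn] := signature_norm_le W P Q.
have [Cu Cu0 hCu] := signature_norm_ge idW.
set Zp := W *m Q^T in hCn hCu; set Zn := - (W *m P^T) in hCn hCu.
have [Cg Cg0 hCg] := mulmx_bound (2 *: (Zp *m Zp^T + Zn *m Zn^T)).
(* A tilt of the form by [5 * aa] then moves its gradient by at most [al / 8 * enorm u]. *)
pose aa := Num.min (1 / 4) (al / (40 * Cg)).
have aap : 0 < aa by rewrite lt_min !divr_gt0// mulr_gt0.
have aa4 : aa <= 1 / 4 by rewrite ge_min lexx.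
have aaC : aa * (40 * Cg) <= al by rewrite -ler_pdivlMr ?mulr_gt0// ge_min lexx orbT.
clearbody aa.
have al80 : 0 < al / 8 by rewrite divr_gt0.
have aau0 : 0 < aa / Cu by rewrite divr_gt0.
have [r1 r10 h1] := hW _ al80; have [r2 r20 h2] := hW _ aau0.
pose rm := Num.min (del / 2) (Num.min r1 r2).
have rm0 : 0 < rm by rewrite !lt_min divr_gt0// r10.
have rmd : rm <= del / 2 by rewrite ge_min lexx.
have rm1 : rm <= r1 by rewrite !ge_min lexx orbT.
have rm2 : rm <= r2 by rewrite !ge_min lexx !orbT.
clearbody rm.
(* Chosen so that [n u <= 4 * D3] forces [enorm u < rm], where both expansions hold. *)
pose D3 := rm ^+ 2 / (8 * Cu).
have D30 : 0 < D3 by rewrite divr_gt0 ?exprn_gt0// mulr_gt0.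
have n_rm u : posq Zp u + negq Zn u <= 4 * D3 -> enorm u < rm.
  move=> nu; rewrite ltNge; apply/negP => ur.
  have i1 : rm ^+ 2 <= dotp u u by rewrite -enorm_sqr lerXn2r ?nnegrE ?enorm_ge0// ltW.
  have i2 := ler_wpM2l (ltW Cu0) nu.
  have i3 : Cu * (4 * D3) = rm ^+ 2 / 2 by rewrite /D3; field; rewrite gt_eqF.
  have i4 : 0 < rm ^+ 2 by rewrite exprn_gt0.
  by have := hCu u; lra_with i1 i2 i3 i4.
clearbody D3.
pose T6 := 6 * aa + 2 * a1 * Cu.
have T60 : 0 < T6 by rewrite addr_gt0 ?mulr_gt0.
pose D6 := Num.min (D3 / 4) (4 * aa * D3 / T6).
have D60 : 0 < D6 by rewrite lt_min !divr_gt0// !mulr_gt0.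
have D63 : 4 * D6 <= D3.
  have : D6 <= D3 / 4 by rewrite ge_min lexx.
  by lra_with.
have D6T : D6 * T6 <= 4 * aa * D3 by rewrite -ler_pdivlMr// ge_min lexx orbT.
clearbody D6.
have e00 : 0 < kv * tau / 16 by rewrite divr_gt0 ?mulr_gt0.
exists (Num.min (Num.min (aa * D6 / 2) (Num.min e1 (D6 / 4)))
  (Num.min (al * D6 / (4 * Cg)) (kv * tau / 16))).
  by rewrite !lt_min e10 e00 !divr_gt0 ?mulr_gt0.
move=> e; rewrite !lt_min => /andP[e0 /andP[/and3P[ea ee1 eD6] /andP[eC ekv]]].
have GL u u' : enorm (G u - G u') <= (K + 2 / sg) * enorm (u - u').
  exact: (supgrad_lip ru0 K0 neF cF u u' sg0').
have CG0 : 0 < K + 2 / sg by rewrite ltr_wpDl// divr_gt0.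
have cFs : continuous Fs := supconv_continuous ru0 K0 neF cF sg0'.
have FsG u u' : Fs u' <= Fs u + dotp (G u) (u' - u) + K / 2 * dotp (u' - u) (u' - u).
  exact: (supconv_sgrad ru0 K0 neF cF u u' sg0').
have h_mono u t t' : enorm u <= del -> h u <= t' -> t' <= t -> t <= tau ->
    f (pt u t') <= f (pt u t).
  move=> ud i1 i2 i3; have := fiber_growth (le_trans (le_trans ud dld) dru) i1 i2 i3.
  by have : 0 <= kv * (t - t') by [rewrite mulr_ge0 ?subr_ge0// ltW]; lra_with.
have F_Fs u : enorm u <= del -> F u <= Fs u.
  by move=> ud; apply: (supconv_ge K ru0 cF sg); exact: le_trans (le_trans ud dld) dru.
have qW u : posq Zp u - negq Zn u = dotp (u *m W) u.
  by rewrite (signature_form u symW idW) /posq /negq mulmxN dotpNl dotpNr opprK.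
have CgP : 0 < Cg /\ forall u : 'rV[R]_m,
    enorm (2 *: (u *m (Zp *m Zp^T + Zn *m Zn^T))) <= Cg * enorm u.
  by split => // u; rewrite scalemxAr; exact: hCg.
have aa0 : 0 < aa <= 1 / 4 by rewrite aap.
have aaCg : 5 * aa * Cg <= al / 8 by lra_with aaC.
have a1al : 4 * a1 <= al / 8 by rewrite /a1; lra_with.
have del0 : 0 < del <= d by rewrite dl0.
have rim := hrim sg sgr.
have Fsq u : posq Zp u + negq Zn u <= 4 * D3 ->
    `|Fs u - c - (posq Zp u - negq Zn u)| <= aa * (posq Zp u + negq Zn u).
  move=> n4; rewrite qW; have ur := ltW (n_rm u n4).
  have [_ i2] := h2 u (le_trans ur rm2); apply: (le_trans i2).
  by rewrite mulrAC ler_pdivrMr// -mulrA ler_wpM2l ?(ltW aap)// mulrC.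
have GW u : posq Zp u + negq Zn u <= 4 * D3 ->
    enorm (G u - 2 *: (u *m W)) <= al / 8 * enorm u.
  by move=> n4; have ur := ltW (n_rm u n4); have [i1 _] := h1 u (le_trans ur rm1).
have n_small u : posq Zp u + negq Zn u <= 4 * D3 -> enorm u < del / 2.
  by move=> n4; apply: lt_le_trans rmd; exact: n_rm.
have n_D6 u : posq Zp u + negq Zn u <= D6 ->
    6 * aa * (posq Zp u + negq Zn u) + 2 * a1 * dotp u u <= 4 * aa * D3.
  move=> n6; have i1 := ler_wpM2l (ltW a10) (hCu u).
  have i2 := ler_wpM2r (ltW T60) n6; move: i2; rewrite [X in X <= _]mulrDr.
  move: i1 D6T; set nn := posq _ _ + _ => i1 D6T i2; lra_with i1 D6T i2.
have ea2 : 2 * e <= aa * D6 by lra_with ea.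
have eD64 : 4 * e <= D6 by lra_with eD6.
have eCg : 4 * e * Cg <= al * D6.
  by have := ltW eC; rewrite ler_pdivlMr ?mulr_gt0//; lra_with.
exact: (@level_crossing R m X f Rr r p v kap rho kv N Ku kt h ru tau L M K G Fs
  (K + 2 / sg) al d c K0 neF CG0 GL al0 dru nop' coX e1 del (kv * tau / 16) aa a1 D3 D6 Cn Cg
  a b W P Q he1 hcont cFs FsG symW sigW idW (conj Cn0 hCn) CgP aa0 aaCg a10 a1al (conj D60 D63)
  del0 hsm tsm zhi h_mono rim F_Fs Fsq GW n_small n_D6 F_cont0 e e0 ea2 (ltW ee1) eD64 eCg (ltW ekv)).
Qed.

End CriticalCrossing.

Lemma compl_setP (R : realType) m (X : set 'rV[R]_m) y : ~ interior X y -> compl_set X y.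
Proof.
move=> nint B /nbhs_enormP[e e0 he]; apply: contrapT => nex; apply: nint.
apply/interiorP_enorm; exists e => // z zy; apply: contrapT => nXz.
by apply: nex; exists z; split => //; exact: he.
Qed.

Lemma reach_mu_Delta (R : realType) m (X : set 'rV[R]_m) (mu : R) : (0 < reach_mu mu X)%E ->
  exists2 s : R, 0 < s &
    forall x, 0 < dist_set X x <= s -> mu <= Delta (clarke_grad (dist_set X) x).
Proof.
by move=> /ereal_sup_gt[_ [t ht <-]]; rewrite lte_fin => tp; exists t.
Qed.

(** Composition with the radial projection extends the graph function continuously beyond its
    ball. *)
Lemma ball_proj_comp_continuous (R : realType) m (h : 'rV[R]_m -> R) (b C : R) : 0 <= b -> 0 < C ->
  (forall u u', enorm u <= b -> enorm u' <= b -> `|h u' - h u| <= C * enorm (u' - u)) ->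
  continuous (fun u => h (ball_proj b u)).
Proof.
move=> b0 C0 hL u A /= /nbhs_ballP[e /= e0 eA].
have cb : continuous (ball_proj b : 'rV[R]_m -> 'rV[R]_m).
  have ci : continuous (fun u : 'rV[R]_m => u) by move=> y.
  have cc : continuous (fun _ : 'rV[R]_m => b) by exact: (@continuous_const R _ R^o b).
  exact: (ball_proj_continuous (fun _ => b0) cc ci).
have eC : 0 < e / C by rewrite divr_gt0.
have nb : nbhs (ball_proj b u) [set z | enorm (z - ball_proj b u) < e / C].
  by apply/nbhs_enormP; exists (e / C).
apply: (@filterS _ (nbhs u) _ _ _ _ (cb u _ nb)) => z /=.
rewrite ltr_pdivlMr// mulrC => zu; apply: eA.
by rewrite -ball_normE /= distrC; apply: le_lt_trans zu; apply: hL; exact: ball_proj_le.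
Qed.

(** * The restricted Hessian in chart coordinates *)

Section NormalCoordinates.
Variables (R : realType) (m : nat).
Local Notation V := 'rV[R]_m.+1.
Variables (X : set V) (f : V -> R) (Rr r : R) (p v : V) (kap rho kv : R).
Variables (N : 'M[R]_(m, m.+1)) (Ku : 'M[R]_(m.+1, m)) (kt : V).
Variables (h : 'rV[R]_m -> R) (ru tau L : R).
Hypothesis M : local_model X f Rr r p v kap rho kv N Ku kt h ru tau L.
Local Notation A := (compl_set X).
Local Notation pt := (chart_pt p v N).
Local Notation F := (fun u : 'rV[R]_m => f (pt u (h u))).
Local Notation ru0 := (lm_ru0 M).
Local Notation h0 := (lm_h0 M).

Variable K : R.
Hypothesis K0 : 0 <= K.
Hypothesis neF : forall u, enorm u <= ru -> exists q, sgrad F K ru u q.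
Hypothesis g0 : grad f p != 0.
Variable B : 'M[R]_(m, m.+1 + m.+1).
Hypothesis TB : TanNor X p (unit_normal f p) = [set w | (w <= B)%MS].
Hypothesis Np : Nor_pr A p (grad f p).
Local Notation Ba := (lsubmx B).
Local Notation A0 := (tanA Ku B).
Local Notation B0 := (tanB f p N B).

Lemma sgrad00 : sgrad F K ru 0 0.
Proof.
have u0 : enorm (0 : 'rV[R]_m) <= ru by rewrite enorm0 (ltW ru0).
by apply: (Nor_sgrad M K0 neF u0); rewrite mul0mx subr0 h0 pt0.
Qed.

Lemma tanAB_tangent t0 : 0 < t0 -> exists2 eta : R, 0 < eta &
  forall u q, enorm u <= eta -> enorm q <= eta -> sgrad F K ru u q ->
    exists x, enorm (u - x *m A0) + enorm (q - x *m B0) <= t0 * (enorm u + enorm q).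
Proof. exact: (sgrad_tangent M K0 g0 TB). Qed.

Lemma tanAB_sym : A0 *m B0^T = B0 *m A0^T.
Proof. exact: (tangent_sym ru0 K0 neF (F_continuous M) sgrad00 tanAB_tangent). Qed.

Lemma lsubmx_mul (x : 'rV[R]_m) : lsubmx (x *m B) = x *m Ba.
Proof. by rewrite -[in LHS](hsubmxK B) mul_mx_row row_mxKl. Qed.

Lemma rsubmx_mul (x : 'rV[R]_m) : rsubmx (x *m B) = x *m rsubmx B.
Proof. by rewrite -[in LHS](hsubmxK B) mul_mx_row row_mxKr. Qed.

Lemma restr_domE : restr_dom X f p = [set u | (u <= Ba)%MS].
Proof.
apply/seteqP; split => u /=.
  case=> w; rewrite TB /= => /submxP[x ->] <-; apply/submxP; exists x.
  by rewrite /pi0 lsubmx_mul.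
case/submxP => x ->; exists (x *m B); first by rewrite TB /= submxMl.
by rewrite /pi0 lsubmx_mul.
Qed.

(* The second fundamental form is independent of the chosen lift because the
   tangent space is isotropic for (u, q), (u', q') |-> <u, q'> - <u', q>. *)
Lemma restr_hessianE x y : restr_hessian X f p (x *m Ba) (y *m Ba) = dotp (x *m A0) (y *m B0).
Proof.
rewrite /restr_hessian /second_ff; set S := [set w | _].
have [] : S (xget 0 S).
  apply: xgetPex; exists (y *m B); split; first by rewrite TB /= submxMl.
  by rewrite /pi0 lsubmx_mul.
rewrite TB /= => /submxP[z ->]; rewrite /pi0 lsubmx_mul rsubmx_mul => zy.
have -> : dotp (x *m A0) (y *m B0) = dotp (x *m A0) (z *m B0).
  apply/eqP; rewrite -subr_eq0 -dotpBr -mulmxBl dotp_mulmxr -mulmxA tanAB_sym mulmxA.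
  by rewrite -dotp_mulmxr mulmxBl /tanA !mulmxA zy subrr dotp0r.
have -> : z *m B0 = z *m (Ba *m hessmx f p + enorm (grad f p) *: rsubmx B) *m N^T.
  by rewrite -mulmxA.
rewrite hessianE -zy (dotp_mulmxr (z *m _) N^T) trmxK.
by rewrite -(tanA_N M K0 neF g0 TB Np) mulmxDr mulmxA -scalemxAr dotpDr dotpZr.
Qed.

Lemma rank_tanA : \rank A0 = \rank Ba.
Proof.
have BaE : Ba = A0 *m N.
  by apply/row_matrixP => i; rewrite !rowE (tanA_N M K0 neF g0 TB Np) mulmxA.
by apply/eqP; rewrite eqn_leq mxrankM_maxl /= {1}BaE mxrankM_maxl.
Qed.

(** In coordinates the restricted Hessian is [A0 *m B0^T]; an inclusion of kernels is a
    factorisation, obtained through the cokernel. *)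
Lemma nondeg_tan : nondeg_form (restr_hessian X f p) (restr_dom X f p) ->
  exists Z, A0 = A0 *m B0^T *m Z.
Proof.
rewrite restr_domE => nd; set C := A0 *m B0^T.
have ker (y : 'rV_m) : y *m C = 0 -> y *m A0 = 0.
  move=> yC; rewrite /tanA mulmxA (nd (y *m Ba)) ?mul0mx//=; first exact: submxMl.
  move=> _ /submxP[z ->]; rewrite restr_hessianE dotp_mulmxr -mulmxA -/C yC dotp0l //.
suff /submxP[Z /(congr1 trmx)] : (A0^T <= C^T)%MS.
  by rewrite trmxK trmx_mul trmxK => ->; exists Z^T.
rewrite submxE; apply/eqP/trmx_inj; rewrite trmx0 trmx_mul trmxK.
apply/row_matrixP => i; rewrite row0 rowE mulmxA; apply: ker.
have kC : (cokermx C^T)^T *m C = 0.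
  by apply: trmx_inj; rewrite trmx_mul trmxK mulmx_coker trmx0.
by rewrite -mulmxA kC mulmx0.
Qed.

Lemma index_tan ind : is_index (restr_hessian X f p) (restr_dom X f p) ind ->
  exists2 LI : 'M[R]_(ind, m),
    forall y : 'rV_ind, y != 0 -> dotp (y *m LI *m A0) (y *m LI *m B0) < 0 &
    forall j (L' : 'M[R]_(j, m)),
      (forall y : 'rV_j, y != 0 -> dotp (y *m L' *m A0) (y *m L' *m B0) < 0) -> (j <= ind)%N.
Proof.
rewrite restr_domE => -[[_ [[B' [B'f ->]] [sub neg]]] mx].
have /submxP[LI LE] : (B' <= Ba)%MS.
  by apply/row_subP => i; apply: sub; exact: row_sub.
exists LI.
  move=> y y0; rewrite -restr_hessianE -mulmxA -LE; apply: neg; first exact: submxMl.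
  by apply: contra_neq y0 => yB; apply: (row_free_inj B'f); rewrite yB mul0mx.
move=> j L' neg'; apply: mx; exists [set u | (u <= L' *m Ba)%MS]; split.
  exists (L' *m Ba); split => //; apply/inj_row_free => y yL; apply/eqP; apply: contraT => y0.
  have := neg' y y0; have -> : y *m L' *m A0 = 0; last by rewrite dotp0l ltxx.
  by rewrite /tanA mulmxA -(mulmxA y) yL mul0mx.
split=> u /=; first by move=> /submx_trans; apply; exact: submxMl.
case/submxP => y -> u0; rewrite mulmxA restr_hessianE; apply: neg'.
by apply: contra_neq u0 => ->; rewrite mul0mx.
Qed.

End NormalCoordinates.

Lemma local_model_exists (R : realType) (m : nat) (X : set 'rV[R]_m.+1) (f : 'rV[R]_m.+1 -> R)
    (Rr r : R) (p v : 'rV[R]_m.+1) (kap : R) :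
  C2 f -> closed X -> closure (interior X) = X -> unique_proj Rr (compl_set X) -> 0 < r < Rr ->
  X p -> compl_set X p -> 0 < kap ->
  (forall n, enorm n = 1 -> proxnor r (compl_set X) p n -> kap <= dotp n v) ->
  grad f p != 0 -> Nor_pr (compl_set X) p (grad f p) ->
  exists kap' rho kv N Ku kt h ru tau L,
    local_model X f Rr r p v kap' rho kv N Ku kt h ru tau L /\ continuous h.
Proof.
move=> fC2 clX cX uA r0 Xp Ap kap0 hv g0 Np; have /andP[rp rR] := r0.
have [rho1 rho10 hr1] := proxnor_stable (@closed_compl_set _ _ X) rp kap0 (fun _ => hv).
have kap20 : 0 < kap / 2 by rewrite divr_gt0.
have gp : 0 < enorm (grad f p) by rewrite enorm_gt0.
have gv : kap / 2 / 2 * enorm (grad f p) <= dotp (grad f p) v.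
  apply: (Nor_pr_cone cX uA r0 Ap kap20 rho10 hr1 Ap _ Np).
  by rewrite subrr enorm0 divr_gt0.
have gv0 : 0 < dotp (grad f p) v by apply: lt_le_trans gv; rewrite mulr_gt0// divr_gt0.
pose kv := dotp (grad f p) v / 2; have kv0 : 0 < kv by rewrite divr_gt0.
have [rho2 rho20 hr2] := grad_near fC2 p v kv0.
pose rho := Num.min rho1 rho2; have rho0 : 0 < rho by rewrite lt_min rho10.
have cone a n : compl_set X a -> enorm (a - p) < rho -> enorm n = 1 ->
    proxnor r (compl_set X) a n -> kap / 2 <= dotp n v.
  by move=> Aa; rewrite lt_min => /andP[ap _]; exact: hr1.
have gkv y : enorm (y - p) < rho -> kv <= dotp (grad f y) v.
  rewrite lt_min => /andP[_ /hr2]; rewrite ler_norml dotpBl => /andP[h _].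
  by move: h; rewrite /kv; lra_with.
have [N [Ku [kt ch]]] := chart_exists gv0.
have [h [ru [tau [L [[ru0 tau0 L0] [[h0 ht hL hX hA] hp]]]]]] :=
  local_graph N clX cX uA r0 Xp Ap kap20 rho0 cone.
have id_ball u : enorm u <= ru -> ball_proj ru u = u by exact: ball_proj_id.
exists (kap / 2), rho, kv, N, Ku, kt, (fun u => h (ball_proj ru u)), ru, tau, L; split.
  split => //.
  - by rewrite id_ball// enorm0 ltW.
  - by move=> u uB; rewrite id_ball//; exact: ht.
  - by move=> u u' uB u'B; rewrite !id_ball//; exact: hL.
  - by move=> u t uB tB; rewrite id_ball//; exact: hX.
  - by move=> u t uB tB; rewrite id_ball//; exact: hA.
exact: (ball_proj_comp_continuous (ltW ru0) L0 hL).
Qed.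

Theorem mainTheorem3 (R : realType) (d : nat) (X : set 'rV[R]_d)
  (f : 'rV[R]_d -> R) (c : R) (x : 'rV[R]_d) :
  complementary_regular X ->
  C2 f ->
  critical X f x -> f x = c ->
  (forall y, critical X f y -> f y = c -> y = x) ->
  nondegenerate_cp X f x ->
  forall (ind k : nat),
    is_index (restr_hessian X f x) (restr_dom X f x) ind ->
    subspace_dim (restr_dom X f x) k ->
    exists e0 : R, 0 < e0 /\
      forall e : R, 0 < e < e0 ->
        cell_attached R (set_type (sublevel X f (c + e)))
                        (set_type (sublevel X f (c - e)))
                        (ind + (d.-1 - k)).
Proof.
(* In dimension 0 the gradient vanishes, against nondegeneracy. *)
case: d X f x => [|m] X f p; first by move=> _ _ _ _ _ [/eqP g0]; case: g0; exact: thinmx0.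
move=> [coX [cX [[mu [mu01 rmu]] /reach_unique_proj[Rr Rr0 uA]]]] fC2 cp fp crit.
move=> [g0 [[_ [B [_ TB]]] nd]] ind k hind [Bk [Bkf BkE]].
have clX : closed X by exact: compact_closed_enorm.
have [s s0 hs] := reach_mu_Delta rmu; have /andP[mu0 mu1] := mu01.
(* Strictly below [Rr], so that projections stay unique in a neighbourhood of the points at distance
   [r]. *)
pose r := Rr / 2; have r0 : 0 < r < Rr.
  by rewrite divr_gt0//= ltr_pdivrMr//; lra.
have /andP[rp _] := r0; have mu80 : 0 < mu / 8 by rewrite divr_gt0.
have pointed y : X y -> compl_set X y -> exists v (kap : R), 0 < kap /\
    forall n, enorm n = 1 -> proxnor r (compl_set X) y n -> kap <= dotp n v.
  move=> Xy Ay; have [v [_ hv]] := pointed_proxnor clX Xy Ay s0 mu01 rp hs.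
  by exists v, (mu / 8); split => // n n1 hn; rewrite dotpC; exact: hv.
have [Xp Ap Np] : [/\ X p, compl_set X p & Nor_pr (compl_set X) p (grad f p)].
  case: cp => Xp [w Nw wg]; move: Nw; rewrite /NorX; case: asboolP => [[_ nint]|_] Nw.
    by case: Nw => w' Nw' ww; split => //; [exact: compl_setP | rewrite -wg -ww opprK].
  by move: g0; rewrite -wg Nw oppr0 eqxx.
have [v [kap [kap0 hv]]] := pointed p Xp Ap.
have [kap' [rho [kv [N [Ku [kt [h [ru [tau [L [M hcont]]]]]]]]]]] :=
  local_model_exists fC2 clX cX uA r0 Xp Ap kap0 hv g0 Np.
have [K K0 neF] := graph_semiconcave M.
have [LI negL maxL] := index_tan M K0 neF g0 TB Np hind.
have [e0 e00 he] := critical_crossing M K0 neF coX pointed crit fp hcont (sgrad00 M K0 neF Np)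
  (tanAB_tangent M K0 g0 TB) (nondeg_tan M K0 neF g0 TB Np nd) negL maxL.
(* The number of infinite curvatures is the corank of [tanA], since the domain of the restricted
   Hessian is the row space of [lsubmx B]. *)
exists e0; split => // e /he; have -> // : (m.+1.-1 - k)%N = (m - \rank (tanA Ku B))%N.
congr (_ - _)%N; rewrite (rank_tanA M K0 neF g0 TB Np).
have eqB : (Bk :=: lsubmx B)%MS.
  apply/eqmxP/andP; split.
    by apply/row_subP => i; have : restr_dom X f p (row i Bk) by [rewrite BkE /= row_sub];
      rewrite (restr_domE TB).
  by apply/row_subP => i; have : restr_dom X f p (row i (lsubmx B)) by
      [rewrite (restr_domE TB) /= row_sub]; rewrite BkE.
by rewrite -eqB; apply/esym/eqP.
Qed.
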